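(* Consider the two-person zero-sum risk-sensitive continuous-time stochastic game $\{S,(A,A(x)),(B,B(x)),r,q,g\}$ with horizon $T>0$ and risk parameter $\theta>0$ described in the context. Assume: (A1) There are a Borel measurable function $V_0:S\to[1,\infty)$ and positive constants $\rho_0,L_0,M_0$ such that (i) $\int_S V_0(y)\,q(dy|x,a,b)\le \rho_0V_0(x)$ for all $(x,a,b)\in K$; (ii) $q^*(x)\le L_0V_0(x)$ for all $x\in S$; (iii) $|r(x,a,b)|\le M_0+\frac{\sqrt2}{2}\sqrt{\ln V_0(x)}$ for all $(x,a,b)\in K$, and $|g(x)|\le M_0+\frac{\sqrt2}{2}\sqrt{\ln V_0(x)}$ for all $x\in S$. (A2) There are a Borel measurable function $V_1:S\to[1,\infty)$ and positive constants $\rho_1,b_1,M_1$ such that (i) $\int_S V_1^2(y)\,q(dy|x,a,b)\le\rho_1V_1^2(x)+b_1$ for all $(x,a,b)\in K$; (ii) $V_0^2(x)\le M_1V_1(x)$ for all $x\in S$. (A3) (i) For each $x\in S$, $A(x)$ and $B(x)$ are compact; (ii) for each $x\in S$ and $D\in\mathcal B(S)$, $q(D|x,a,b)$ is continuous in $(a,b)\in A(x)\times B(x)$; (iii) for each $x\in S$, $r(x,a,b)$ and $\int_SV_0(y)\,q(dy|x,a,b)$ are continuous in $(a,b)\in A(x)\times B(x)$. Then: (a) There exists a unique $\varphi\in\mathbb B^1_{V_0,V_1}([0,T]\times S)$ satisfying the Shapley equation $$\varphi'(t,x)+\sup_{\phi\in P(A(x))}\inf_{\psi\in P(B(x))}\Big[\theta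 r(x,\phi,\psi)\varphi(t,x)+\int_S\varphi(t,y)\,q(dy|x,\phi,\psi)\Big]=0,\qquad \varphi(T,x)=e^{\theta g(x)},$$ for each $x\in S$ and each $t\in E_{(\varphi,x)}$, where $E_{(\varphi,x)}\subseteq[0,T]$ is a Borel set whose complement in $[0,T]$ has Lebesgue measure $0$ (and $\varphi'=\partial\varphi/\partial t$). (b) There exists a pair of Markov policies $(\hat\pi_1,\hat\pi_2)\in\Pi_1^m\times\Pi_2^m$ such that, for $(t,x)\in[0,T]\times S$, $$\begin{aligned}-\varphi'(t,x)&=\theta r(x,\hat\pi_1^t,\hat\pi_2^t)\varphi(t,x)+\int_S\varphi(t,y)\,q(dy|x,\hat\pi_1^t,\hat\pi_2^t)\\&=\sup_{\phi\in P(A(x))}\Big[\theta r(x,\phi,\hat\pi_2^t)\varphi(t,x)+\int_S\varphi(t,y)\,q(dy|x,\phi,\hat\pi_2^t)\Big]\\&=\inf_{\psi\in P(B(x))}\Big[\theta r(x,\hat\pi_1^t,\psi)\varphi(t,x)+\int_S\varphi(t,y)\,q(dy|x,\hat\pi_1^t,\psi)\Big].\end{aligned}$$ (c) For $(t,x)\in[0,T]\times S$, $$\varphi(t,x)=\sup_{\pi_1\in\Pi_1^m}\inf_{\pi_2\in\Pi_2^m}J(\pi_1,\pi_2,t,x)=\inf_{\pi_2\in\Pi_2^m}\sup_{\pi_1\in\Pi_1^m}J(\pi_1,\pi_2,t,x)=J(\hat\pi_1,\hat\pi_2,t,x).$$ (d) The value function $\mathbb M(x)$ of the game (over all history-dependent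 policies) exists and equals $\varphi(0,x)$ for each $x\in S$, and $(\hat\pi_1,\hat\pi_2)$ is a Nash equilibrium.
   Context: **Game model.** $S$ (states), $A$, $B$ (actions of players 1, 2) are Borel spaces; for $x\in S$, $A(x)\in\mathcal B(A)$ and $B(x)\in\mathcal B(B)$ are the sets of available actions; $K:=\{(x,a,b):x\in S,a\in A(x),b\in B(x)\}$ is a Borel subset of $S\times A\times B$. The payoff rate $r:K\to\mathbb R$ and the terminal reward $g:S\to\mathbb R$ are Borel measurable (rewards for player 1, costs for player 2). The transition rate $q(dy|x,a,b)$ is a Borel signed kernel on $S$ given $K$ with $q(D|x,a,b)\ge0$ whenever $x\notin D$, $q(S|x,a,b)=0$, and $q^*(x):=\sup_{a\in A(x),b\in B(x)}q(x,a,b)<\infty$ for every $x$, where $q(x,a,b):=-q(\{x\}|x,a,b)$. Constants $\theta>0$, $T>0$ are fixed. **Paths.** A sample is $\omega=(x_0,\delta_1,x_1,\delta_2,x_2,\dots)$ with states $x_k\in S$ and sojourn times $\delta_k\in(0,\infty)$ (if only finitely many jumps occur, the remaining entries are $(\infty,\Delta)$ with $\Delta\notin S$ a cemetery point). $T_0=0$, $T_k=\delta_1+\dots+\delta_k$, $T_\infty=\lim T_k$; $x_t=x_k$ for $T_k\le t<T_{k+1}$ and $x_t=\Delta$ for $t\ge T_\infty$. At $\Delta$ there is a single dummy action for each player, and $q$, $r$ vanish. **Policies.** A (history-dependent) policy $\pi_1\in\Pi_1$ of player 1 is given by stochastic kernels $\pi_1^k(da|x_0,\delta_1,\dots,\delta_k,x_k,u)$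 on $A$, $k\ge0$, concentrated on $A(x_k)$, via $\pi_1(da|\omega,t)=\pi_1^k(da|x_0,\delta_1,\dots,\delta_k,x_k,t-T_k)$ for $T_k<t\le T_{k+1}$ (and $\pi_1^0(da|x_0,0)$ at $t=0$; dummy action for $t\ge T_\infty$). It is Markov ($\pi_1\in\Pi_1^m$) if the action distribution at time $t$ depends only on the current state and the time $t$; then it is written $\pi_1(da|x,t)$. $\Pi_2,\Pi_2^m$ are defined in the same way for player 2 with $B(x)$. **Probability.** For an initial state $x$ and $(\pi_1,\pi_2)\in\Pi_1\times\Pi_2$, $\mathbb P_x^{\pi_1,\pi_2}$ (expectation $\mathbb E_x^{\pi_1,\pi_2}$) is the Ionescu-Tulcea measure with $x_0=x$ under which, given $h_k=(x_0,\delta_1,\dots,x_k)$, the pair $(\delta_{k+1},x_{k+1})$ has law $m_k(dy|u)\,e^{-\int_0^u m_k(S|v)dv}du$ on $(0,\infty)\times S$, with $m_k(dy|u)=\int\int q(dy\setminus\{x_k\}|x_k,a,b)\,\pi_1^k(da|h_k,u)\,\pi_2^k(db|h_k,u)$, and remaining mass at $(\infty,\Delta)$. **Criterion.** $J(\pi_1,\pi_2,0,x):=\mathbb E_x^{\pi_1,\pi_2}\big[\exp\big(\theta\int_0^T\int_{A\times B}r(x_t,a,b)\pi_1(da|\omega,t)\pi_2(db|\omega,t)dt+\theta g(x_T)\big)\big]$. For Markov policies, $\{x_t\}$ is a Markov process and, for $t\in[0,T]$, $J(\pi_1,\pi_2,t,x)$ is the expectation of $\exp\big(\theta\int_t^T\int_{A\times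 B}r(x_s,a,b)\pi_1(da|x_s,s)\pi_2(db|x_s,s)ds+\theta g(x_T)\big)$ given $x_t=x$. **Value and equilibrium.** If $\sup_{\pi_1\in\Pi_1}\inf_{\pi_2\in\Pi_2}J(\pi_1,\pi_2,0,x)=\inf_{\pi_2\in\Pi_2}\sup_{\pi_1\in\Pi_1}J(\pi_1,\pi_2,0,x)$ for all $x\in S$, the common function is the value function $\mathbb M(x)$. Then $\pi_1^*\in\Pi_1$ is optimal for player 1 if $\inf_{\pi_2\in\Pi_2}J(\pi_1^*,\pi_2,0,x)=\mathbb M(x)$ for all $x$; $\pi_2^*\in\Pi_2$ is optimal for player 2 if $\sup_{\pi_1\in\Pi_1}J(\pi_1,\pi_2^*,0,x)=\mathbb M(x)$ for all $x$; a pair of optimal policies is a Nash equilibrium. **Notation.** $P(X)$ is the set of Borel probability measures on $X$. For $\phi\in P(A(x))$, $\psi\in P(B(x))$: $r(x,\phi,\psi)=\int\int r(x,a,b)\phi(da)\psi(db)$, and similarly $q(dy|x,\phi,\psi)$. For Markov policies, $\pi_i^t$ in the place of $\phi$ or $\psi$ at state $x$ means $\pi_i(\cdot|x,t)$. **Function space.** For $V:S\to[1,\infty)$, a function $u$ on $[0,T]\times S$ is $V$-bounded if $\sup_{t,x}|u(t,x)|/V(x)<\infty$. $\mathbb B^1_{V_0,V_1}([0,T]\times S)$ is the set of Borel measurable, $V_0$-bounded real functions $\varphi$ on $[0,T]\times S$ such that, for each $x\in S$, there is a Borel set $E_{(\varphi,x)}\subseteq[0,T]$, with complement of Lebesgue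 measure $0$, such that $\partial\varphi(t,x)/\partial t$ exists for every $t\in E_{(\varphi,x)}$, and such that $\partial\varphi/\partial t$ is $V_1$-bounded.
   Formalization: In (a), φ(·,x) is also required to be absolutely continuous on [0,T], for the solution and for its competitors, since uniqueness in B^1 alone fails (one can add a step function of t); in (b), the equation for -φ'(t,x) is stated for t in E_(φ,x), where φ' exists. *)

(* Defs.v *)
From HB Require Import structures.
From mathcomp Require Import all_boot all_order all_algebra.
From mathcomp Require Import all_classical all_reals all_analysis.
From mathcomp Require Import measurable_realfun.

Set Implicit Arguments.
Unset Strict Implicit.
Unset Printing Implicit Defensive.

Import Order.TTheory GRing.Theory Num.Theory.
Import numFieldNormedType.Exports.

Local Open Scope classical_set_scope.
Local Open Scope ring_scope.
Local Open Scope ereal_scope.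

(* A type synonym of [X] carrying the Borel sigma-algebra. *)
Notation borel X := (g_sigma_algebraType (@open X)).

(* [X] is homeomorphic to a Borel subset of a Polish space [Y]. *)
Definition borel_space (R : realType) (X : ptopologicalType) : Prop :=
  exists (Y : completePseudoMetricType R) (f : X -> Y),
    [/\ hausdorff_space Y,
        exists2 Q : set Y, countable Q & dense Q,
        injective f /\
          (forall U : set X, open U <-> exists2 V : set Y, open V & U = f @^-1` V)
      & <<s @open Y >> (range f)].

Definition prob_on (R : realType) (X : ptopologicalType) (D : set X) :
    set (probability (borel X) R) :=
  [set mu | mu (D : set (borel X)) = 1].

Arguments prob_on R {X} D.

(* The upper and lower variations of a signed measure [nu] are the two parts of
   its Jordan decomposition.  They make sense for every set function, so that
   no proof that [nu] is sigma-additive is needed to write the integral. *)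
Section signed_integral.
Context d (X : measurableType d) (R : realType).
Implicit Type nu : set X -> \bar R.

Definition upper_variation nu (D : set X) : \bar R :=
  ereal_sup [set nu E | E in [set E | measurable E /\ E `<=` D]].

Definition lower_variation nu (D : set X) : \bar R :=
  upper_variation (fun E => - nu E) D.

Definition signed_integral nu (f : X -> \bar R) : \bar R :=
  \int[upper_variation nu]_y f y - \int[lower_variation nu]_y f y.

End signed_integral.

(* [rate] and [payoff] are total functions, but only their values on the set
   [admissible] of the admissible triples are constrained and used. *)
Definition admissible (S A B : Type) (actA : S -> set A) (actB : S -> set B) :
    set (S * A * B) :=
  [set z | actA z.1.1 z.1.2 /\ actB z.1.1 z.2].

Record game (R : realType) (S A B : ptopologicalType) := Game {
  actA : S -> set A ;
  actB : S -> set B ;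
  rate : S -> A -> B -> {charge set (borel S) -> \bar R} ;
  payoff : S -> A -> B -> R ;
  terminal : S -> R ;
  theta : R ;
  horizon : R ;
  borelS : borel_space R S ;
  borelA : borel_space R A ;
  borelB : borel_space R B ;
  measurable_actA : forall x, measurable (actA x : set (borel A)) ;
  measurable_actB : forall x, measurable (actB x : set (borel B)) ;
  actA_neq0 : forall x, actA x !=set0 ;
  actB_neq0 : forall x, actB x !=set0 ;
  measurable_admissible :
    measurable (admissible actA actB : set (borel S * borel A * borel B)) ;
  measurable_payoff :
    measurable_fun (admissible actA actB : set (borel S * borel A * borel B))
      (fun z => payoff z.1.1 z.1.2 z.2) ;
  measurable_terminal : measurable_fun [set: borel S] terminal ;
  measurable_rate : forall D : set (borel S), measurable D ->
    measurable_fun (admissible actA actB : set (borel S * borel A * borel B))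
      (fun z => rate z.1.1 z.1.2 z.2 D) ;
  rate_ge0 : forall x a b (D : set (borel S)), actA x a -> actB x b ->
    measurable D -> ~ D x -> 0 <= rate x a b D ;
  rate_conservative : forall x a b, actA x a -> actB x b ->
    rate x a b [set: borel S] = 0 ;
  rate_stable : forall x, ereal_sup
    [set - rate x ab.1 ab.2 [set x] | ab in actA x `*` actB x] < +oo ;
  theta_gt0 : (0 < theta)%R ;
  horizon_gt0 : (0 < horizon)%R }.

Section model.
Context (R : realType) (S A B : ptopologicalType) (G : game R S A B).

(* q^*(x) *)
Definition max_rate (x : S) : \bar R :=
  ereal_sup [set - rate G x ab.1 ab.2 [set x] | ab in actA G x `*` actB G x].

(* r(x, phi, psi) *)
Definition payoff_mix (x : S) (phi : set (borel A) -> \bar R)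
    (psi : set (borel B) -> \bar R) : \bar R :=
  \int[phi]_(a in (actA G x : set (borel A)))
    \int[psi]_(b in (actB G x : set (borel B))) (payoff G x a b)%:E.

(* q(D | x, phi, psi) *)
Definition rate_mix (x : S) (phi : set (borel A) -> \bar R)
    (psi : set (borel B) -> \bar R) (D : set (borel S)) : \bar R :=
  \int[phi]_(a in (actA G x : set (borel A)))
    \int[psi]_(b in (actB G x : set (borel B))) rate G x a b D.

End model.

(* (x_0, (delta_1, x_1), ..., (delta_k, x_k)) *)
Notation hist R S k := (borel S * k.-tuple (R * borel S))%type.

Section histories.
Context (R : realType) (S : ptopologicalType).

Definition last_state k (h : hist R S k) : borel S := last h.1 (map snd h.2).

Definition hist_time k (h : hist R S k) : R := (\sum_(i < k) (tnth h.2 i).1)%R.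

Lemma measurable_hist_entry k (i : 'I_k) :
  measurable_fun [set: hist R S k] (fun h => tnth h.2 i).
Proof.
exact: (measurableT_comp (@measurable_tnth _ _ k i) (@measurable_snd _ _ _ _)).
Qed.

Lemma measurable_last_state k : measurable_fun [set: hist R S k] (@last_state k).
Proof.
case: k => [|k].
  rewrite (_ : @last_state 0 = fst); first exact: measurable_fst.
  by apply/funext => -[x t]; rewrite /last_state (tuple0 t).
rewrite (_ : @last_state k.+1 = fun h => (tnth h.2 ord_max).2).
  exact: (measurableT_comp (@measurable_snd _ _ _ _)
    (measurable_hist_entry ord_max)).
apply/funext => -[x t]; rewrite /last_state /= (last_nth x) size_map size_tuple.
by rewrite (tnth_nth (0%R, x)) /= (nth_map (0%R, x)) ?size_tuple.
Qed.

Lemma measurable_hist_time k : measurable_fun [set: hist R S k] (@hist_time k).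
Proof.
apply: measurable_sum => i.
exact: (measurableT_comp (@measurable_fst _ _ _ _) (measurable_hist_entry i)).
Qed.

End histories.

Section kernel_precomposition.
Context d1 d2 d3 (Z : measurableType d1) (X : measurableType d2)
  (Y : measurableType d3) (R : realType).
Variables (k : R.-pker X ~> Y) (f : Z -> X) (mf : measurable_fun setT f).

Definition kpre of measurable_fun setT f := fun z => k (f z).

Let measurable_kpre U : measurable U ->
  measurable_fun [set: Z] ((kpre mf) ^~ U).
Proof.
by move=> mU; exact: (measurableT_comp (measurable_kernel k U mU) mf).
Qed.

HB.instance Definition _ := isKernel.Build _ _ _ _ _ (kpre mf) measurable_kpre.

Let kpre_prob z : kpre mf z setT = 1.
Proof. exact: prob_kernel. Qed.

HB.instance Definition _ :=
  Kernel_isProbability.Build _ _ _ _ _ (kpre mf) kpre_prob.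

End kernel_precomposition.

(* Policies of a player whose set of available actions in state [x] is [adm x].
   The values of the kernels at nonpositive sojourn times or at negative times
   play no role. *)
Section policies.
Context (R : realType) (S X : ptopologicalType) (adm : S -> set X).

Record policy := Policy {
  policy_kernel : forall k, R.-pker (hist R S k * R)%type ~> borel X ;
  policy_adm : forall k (h : hist R S k) u,
    policy_kernel k (h, u) (adm (last_state h)) = 1 }.

Record markov_policy := MarkovPolicy {
  markov_kernel : R.-pker (borel S * R)%type ~> borel X ;
  markov_adm : forall x t, markov_kernel (x, t) (adm x) = 1 }.

Definition markov_arg (s : R) k (hu : hist R S k * R) : borel S * R :=
  (last_state hu.1, s + hist_time hu.1 + hu.2)%R.

Lemma measurable_markov_arg s k :
  measurable_fun [set: hist R S k * R] (@markov_arg s k).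
Proof.
apply/measurable_fun_pairP; split.
  exact: (measurableT_comp (@measurable_last_state _ _ k)
    (@measurable_fst _ _ _ _)).
apply: measurable_funD; last exact: measurable_snd.
apply: measurable_funD; first exact: measurable_cst.
exact: (measurableT_comp (@measurable_hist_time _ _ k)
  (@measurable_fst _ _ _ _)).
Qed.

(* The policy given by the Markov policy [p] when time is counted from [s]
   on.  For [s = 0], this is [p] as a history-dependent policy. *)
Definition markov_from (s : R) (p : markov_policy) : policy :=
  @Policy (fun k => kpre (markov_kernel p) (@measurable_markov_arg s k))
    (fun k h u => markov_adm p _ _).

End policies.

(* An entry (delta_k, x_k) of a path; [None] stands for (oo, Delta). *)
Notation step R S := (g_sigma_algebraType
  [set [set Some z | z in U] | U in @measurable _ (R * borel S)%type]).

Notation steps R S := (g_sigma_algebraType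
  [set C : set (nat -> step R S) |
    exists n, exists2 U : set (step R S), measurable U & C = [set w | U (w n)]]).

Notation path_space R S := (borel S * steps R S)%type.

Section paths.
Context (R : realType) (S : ptopologicalType).

Implicit Type w : path_space R S.

(* Entry [k] of a path is (delta_(k+1), x_(k+1)). *)
Definition entry w (k : nat) : option (R * borel S) := w.2 k.

Definition alive k w : Prop := forall i, (i < k)%N -> entry w i <> None.

(* h_k, meaningful when [alive k w] *)
Definition hist_of k w : hist R S k :=
  (w.1, [tuple odflt point (entry w i) | i < k]).

Definition sojourn w k : \bar R :=
  if entry w k is Some z then (z.1)%:E else +oo.

(* T_k *)
Definition jump_time w k : \bar R := \sum_(i < k) sojourn w i.

(* x_t; [None] stands for Delta *)
Definition state_at w (t : R) : option S :=
  let N := [set k | jump_time w k <= t%:E < jump_time w k.+1] in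
  if `[< N !=set0 >] then Some (last_state (hist_of (xget 0%N N) w)) else None.

(* pi(da | w, t), and [None] for the dummy action at Delta *)
Definition action_at (X : ptopologicalType) (adm : S -> set X)
    (p : policy R adm) w (t : R) : option (set (borel X) -> \bar R) :=
  let N := [set k | (jump_time w k < t%:E <= jump_time w k.+1) \/
                    (t = 0%R /\ k = 0%N)] in
  let k := xget 0%N N in
  if `[< N !=set0 >]
  then Some (policy_kernel p k
    (hist_of k w, t - hist_time (hist_of k w))%R : set (borel X) -> \bar R)
  else None.

End paths.

Section criterion.
Context (R : realType) (S A B : ptopologicalType) (G : game R S A B).

Definition policy1 := policy R (actA G).
Definition policy2 := policy R (actB G).
Definition markov_policy1 := markov_policy R (actA G).
Definition markov_policy2 := markov_policy R (actB G).

Section law.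
Variables (p1 : policy1) (p2 : policy2).

(* m_k(D | u) *)
Definition jump_rate k (h : hist R S k) (u : R) (D : set (borel S)) : \bar R :=
  rate_mix G (last_state h) (policy_kernel p1 k (h, u))
    (policy_kernel p2 k (h, u)) (D `\ last_state h).

Definition jump_law k (h : hist R S k) (D : set (step R S)) : \bar R :=
  \int[lebesgue_measure]_(u in `]0%R, +oo[)
    (jump_rate h u [set y | D (Some (u, y))] *
     expeR (- \int[lebesgue_measure]_(v in `[0%R, u]) jump_rate h v setT)).

(* The conditional law of (delta_(k+1), x_(k+1)) given h_k. *)
Definition next_law k (h : hist R S k) (D : set (step R S)) : \bar R :=
  jump_law h D + (1 - jump_law h setT) * \d_(None : step R S) D.

Definition is_path_law (x : S) (P : probability (path_space R S) R) : Prop :=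
  [/\ P [set w | w.1 = x] = 1,
      forall k (C : set (hist R S k)) (D : set (step R S)),
        measurable C -> measurable D ->
        P [set w | [/\ alive k w, C (hist_of k w) & D (w.2 k)]] =
        \int[P]_(w in [set w | alive k w /\ C (hist_of k w)])
          next_law (hist_of k w) D
    & forall k, P [set w | entry w k = None /\ entry w k.+1 <> None] = 0].

(* The Ionescu-Tulcea measure: the conditions in [is_path_law] have a unique
   solution, which is selected here. *)
Definition path_law (x : S) : probability (path_space R S) R :=
  xget (\d_point : probability (path_space R S) R) [set P | is_path_law x P].

Definition payoff_at (w : path_space R S) (t : R) : \bar R :=
  match state_at w t, action_at p1 w t, action_at p2 w t with
  | Some x, Some phi, Some psi => payoff_mix G x phi psi
  | _, _, _ => 0
  end.

Definition terminal_at (w : path_space R S) (t : R) : \bar R :=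
  if state_at w t is Some x then (terminal G x)%:E else 0.

(* The criterion over the time interval [0, t]. *)
Definition criterion_upto (t : R) (x : S) : \bar R :=
  \int[path_law x]_w
    expeR ((theta G)%:E * (\int[lebesgue_measure]_(s in `[0%R, t]) payoff_at w s)
           + (theta G)%:E * terminal_at w t).

(* J(p1, p2, 0, x) *)
Definition criterion (x : S) : \bar R := criterion_upto (horizon G) x.

End law.

(* J(p1, p2, t, x): by the Markov property, the process given x_t = x is the
   process started in [x] whose clock shows [t] at the start. *)
Definition markov_criterion (p1 : markov_policy1) (p2 : markov_policy2)
    (t : R) (x : S) : \bar R :=
  criterion_upto (markov_from t p1) (markov_from t p2) (horizon G - t) x.

Definition lower_value (x : S) : \bar R :=
  ereal_sup [set ereal_inf [set criterion p1 p2 x | p2 in [set: policy2]]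
            | p1 in [set: policy1]].

Definition upper_value (x : S) : \bar R :=
  ereal_inf [set ereal_sup [set criterion p1 p2 x | p1 in [set: policy1]]
            | p2 in [set: policy2]].

Definition is_value (M : S -> \bar R) : Prop :=
  forall x, lower_value x = M x /\ upper_value x = M x.

Definition optimal1 (M : S -> \bar R) (p1 : policy1) : Prop :=
  forall x, ereal_inf [set criterion p1 p2 x | p2 in [set: policy2]] = M x.

Definition optimal2 (M : S -> \bar R) (p2 : policy2) : Prop :=
  forall x, ereal_sup [set criterion p1 p2 x | p1 in [set: policy1]] = M x.

Definition nash_equilibrium (p1 : policy1) (p2 : policy2) : Prop :=
  exists M, [/\ is_value M, optimal1 M p1 & optimal2 M p2].

(* [theta r(x,phi,psi) f(x) + int f(y) q(dy|x,phi,psi)], with [f] standing for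
   the function [varphi(t, .)] *)
Definition hamiltonian (f : S -> R) (x : S) (phi : set (borel A) -> \bar R)
    (psi : set (borel B) -> \bar R) : \bar R :=
  (theta G)%:E * payoff_mix G x phi psi * (f x)%:E +
  signed_integral (rate_mix G x phi psi) (fun y => (f y)%:E).

Definition shapley_solution (f : R -> S -> R) (E : S -> set R) : Prop :=
  (forall x, f (horizon G) x = expR (theta G * terminal G x)) /\
  (forall x t, E x t ->
    (derive1 (fun s => f s x) t)%:E +
    ereal_sup [set ereal_inf [set hamiltonian (f t) x phi psi
                             | psi in prob_on R (actB G x)]
              | phi in prob_on R (actA G x)] = 0).

End criterion.

Definition weight_bounded (R : realType) (S : Type) (D : set (R * S))
    (V : S -> R) (u : R -> S -> R) : Prop :=
  ereal_sup [set (`|u z.1 z.2| / V z.2)%R%:E | z in D] < +oo.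

(* [f] belongs to B^1_(V0,V1)([0,T] x S), with E_(f,x) = [E x].  Functions on
   [0, T] x S are represented by functions on [R * S] whose values outside
   [0, T] are immaterial: the null set removed from [E x] may contain 0, T. *)
Definition in_B1 (R : realType) (S : ptopologicalType) (T : R) (V0 V1 : S -> R)
    (f : R -> S -> R) (E : S -> set R) : Prop :=
  [/\ measurable_fun (`[0%R, T] `*` [set: borel S] : set (R * borel S))
        (fun z => f z.1 z.2),
      weight_bounded (`[0%R, T] `*` [set: S]) V0 f,
      forall x, [/\ measurable (E x), E x `<=` `[0%R, T],
                    lebesgue_measure (`[0%R, T] `\` E x) = 0
                  & forall t, E x t -> derivable (fun s => f s x) t 1%R]
    & weight_bounded [set z | E z.2 z.1] V1
        (fun t x => derive1 (fun s => f s x) t)].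

(* Membership in B^1 controls a function only through its almost everywhere
   derivative: adding to [f] a step function of time or a Cantor function that
   vanishes at time [T] changes neither that derivative nor the membership.
   Hence a Shapley equation required almost everywhere pins down [f] only
   together with the absolute continuity of [f(., x)] on [0, T]. *)
Definition absolutely_continuous (R : realType) (a b : R) (f : R -> R) : Prop :=
  forall e, (0 < e)%R -> exists2 d, (0 < d)%R &
    forall n (l r : 'I_n -> R),
      (forall i, [/\ a <= l i, l i <= r i & r i <= b]%R) ->
      (forall i j, i != j -> r i <= l j \/ r j <= l i)%R ->
      (\sum_(i < n) (r i - l i) < d)%R ->
      (\sum_(i < n) `|f (r i) - f (l i)| < e)%R.

(* Main.v *)
(** Uniformization at rate [clock] (proportional to [V0]) turns the Shapley
    operator into a game of probability kernels; its value exists and measurable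
    saddle points can be selected because the compact action sets are images of
    the Cantor space.  Time reversed and multiplied by an exponential, the Shapley
    equation becomes a monotone fixed point equation, whose iterates from 0 stay
    below [barrier] and increase to a solution, Lipschitz in time.  For any
    solution [f], the process [exp (theta int r) f(t, x_t)] is compared with the
    criterion jump by jump, against an arbitrary history-dependent policy of the
    opponent of a saddle policy; [V1] controls the remainder.  This gives (c) and
    (d), and uniqueness, since the criterion of a saddle pair determines [f]. *)

(* Three obstacles shape the proof. The action sets vary with the state and only their joint graph
   is measurable; after coding by binary sequences, a choice (of a point, of a mixed strategy, of a
   limit of strategies) becomes a branch of a tree whose tests are countable conditions, hence
   depends measurably on the state. The payoff is unbounded, of order [sqrt (ln V0)]; the inequality
   [theta * s <= T * theta ^ 2 / 2 + s ^ 2 / (2 * T)] trades it for a power of [V0] whose exponent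
   grows by at most 1/2 over the horizon. The criterion integrates a path functional that is not
   known to be measurable; up to a null set it is split, by the number of jumps before the horizon,
   into pieces that are. Each piece reduces to a linear differential inequality on one sojourn,
   valid at almost every time only, which absolute continuity allows to integrate. Lower bounds
   require moreover that the weight of paths with many jumps vanishes; upper bounds require a
   nonnegative candidate, a sign that membership in the function space does not give and that is
   proved first. *)
Require Import Defs.
From HB Require Import structures.
From mathcomp Require Import all_boot all_order all_algebra.
From mathcomp Require Import all_classical all_reals all_analysis.
From mathcomp Require Import measurable_realfun.
From mathcomp Require Import zify ring lra.

Set Implicit Arguments.
Unset Strict Implicit.
Unset Printing Implicit Defensive.

Import Order.TTheory GRing.Theory Num.Theory.
Import numFieldNormedType.Exports.

Local Open Scope classical_set_scope.
Local Open Scope ring_scope.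
Local Open Scope ereal_scope.

(** * Trees of finite binary words *)

Notation cantor := (nat -> bool).

Definition agree (T : Type) n (d d' : nat -> T) :=
  forall i, (i < n)%N -> d i = d' i.

Lemma agree_refl (T : Type) n (d : nat -> T) : agree n d d. Proof. by []. Qed.

Lemma agree_le (T : Type) m n (d d' : nat -> T) :
  (m <= n)%N -> agree n d d' -> agree m d d'.
Proof. by move=> mn h i im; apply: h; apply: leq_trans mn. Qed.

Definition pre (d : cantor) n : seq bool := mkseq d n.

Lemma size_pre d n : size (pre d n) = n. Proof. exact: size_mkseq. Qed.

Lemma preS d n : pre d n.+1 = rcons (pre d n) (d n).
Proof. by rewrite /pre mkseqS. Qed.

Lemma pre_agree n d d' : pre d n = pre d' n <-> agree n d d'.
Proof.
split=> [h i ni|h]; last by apply: (@eq_from_nth _ false);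
  rewrite ?size_pre// => i ni; rewrite !nth_mkseq// h.
by have := congr1 (nth false ^~ i) h; rewrite !nth_mkseq.
Qed.

Definition word (s : seq bool) : cantor := nth false s.

Lemma pre_word s : pre (word s) (size s) = s.
Proof. exact: mkseq_nth. Qed.

Lemma pre_word_size s n : size s = n -> pre (word s) n = s.
Proof. by move=> <-; exact: pre_word. Qed.

Definition tpre n (d : cantor) : n.-tuple bool := tcast (size_pre d n) (in_tuple (pre d n)).

Lemma agree_tpre n d : agree n d (word (tpre n d)).
Proof. by apply/pre_agree; rewrite pre_word_size ?size_tuple// val_tcast. Qed.

Section follow.
Variable T : seq bool -> Prop.

Fixpoint node (c : cantor) n : seq bool :=
  if n is m.+1 then let s := node c m in
    rcons s (if `[< T (rcons s (c m)) >] then c m else ~~ c m)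
  else [::].

(* Follows [c] as long as it stays in the tree [T]. *)
Definition follow c : cantor := fun n => last false (node c n.+1).

Lemma pre_follow c n : pre (follow c) n = node c n.
Proof. by elim: n => // n ih; rewrite preS ih /follow /= last_rcons. Qed.

Lemma follow_in c n : T [::] ->
  (forall s, T s -> T (rcons s true) \/ T (rcons s false)) ->
  T (pre (follow c) n).
Proof.
move=> T0 TS; rewrite pre_follow; elim: n => //= n ih.
case: asboolP => // h; move/TS: ih h.
by case: (c n) => -[].
Qed.

Lemma follow_id c : (forall n, T (pre c n)) -> follow c = c.
Proof.
move=> h; have e n : pre (follow c) n = pre c n.
  rewrite pre_follow; elim: n => //= n ->; rewrite asboolT -preS //.
apply/funext => n; have /pre_agree := e n.+1; exact.
Qed.

(** Each bit of the result depends on the bits of [c] read so far and on no later one; this finite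
    dependence is what makes [param] continuous. *)
Lemma follow_agree n c c' : agree n c c' -> agree n (follow c) (follow c').
Proof.
move=> h; apply/pre_agree; rewrite !pre_follow.
elim: n h => //= n ih h; rewrite ih; last exact: agree_le h.
by rewrite h.
Qed.

End follow.

Lemma measurable_exists d (X : measurableType d) (I : countType)
    (P : I -> X -> Prop) : (forall i, measurable [set x | P i x]) ->
  measurable [set x | exists i, P i x].
Proof.
move=> h; rewrite (_ : [set x | _] = \bigcup_i [set x | P i x]).
  exact: countable_bigcupT_measurable.
by apply/seteqP; split=> x [i]; [exists i|exists i].
Qed.

Lemma measurable_forall d (X : measurableType d) (I : countType)
    (P : I -> X -> Prop) : (forall i, measurable [set x | P i x]) ->
  measurable [set x | forall i, P i x].
Proof.
move=> h; rewrite (_ : [set x | _] = ~` [set x | exists i, ~ P i x]).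
  by apply/measurableC/measurable_exists => i; apply: measurableC; exact: h.
by apply/seteqP; split=> x /= => [H [i]//|H i]; apply: contrapT => n; apply: H; exists i.
Qed.

Lemma measurable_imply d (X : measurableType d) (Q : Prop) (P : X -> Prop) :
  (Q -> measurable [set x | P x]) -> measurable [set x | Q -> P x].
Proof.
have [q|nq] := pselect Q => h.
  rewrite (_ : [set x | _] = [set x | P x]); first exact: h.
  by apply/seteqP; split=> x /= => [/(_ q)|].
rewrite (_ : [set x | _] = setT); first exact: measurableT.
by apply/seteqP; split=> x //= _ /nq.
Qed.

Lemma measurable_conj d (X : measurableType d) (Q : Prop) (P : X -> Prop) :
  (Q -> measurable [set x | P x]) -> measurable [set x | Q /\ P x].
Proof.
have [q|nq] := pselect Q => h.
  rewrite (_ : [set x | _] = [set x | P x]); first exact: h.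
  by apply/seteqP; split=> x // [].
by rewrite (_ : [set x | _] = set0) //; apply/seteqP; split=> x // [].
Qed.

Lemma measurable_preimageT d d' (X : measurableType d) (Z : measurableType d')
    (f : X -> Z) (Y : set Z) :
  measurable_fun setT f -> measurable Y -> measurable (f @^-1` Y).
Proof. by move=> mf mY; rewrite -[X in measurable X]setTI; exact: mf. Qed.

(* Koenig's lemma *)
Lemma bar (P : seq bool -> Prop) : (forall s t, P s -> P (s ++ t)) ->
  (forall d, exists n, P (pre d n)) -> exists k, forall s, size s = k -> P s.
Proof.
move=> Pcat Pbar; apply: contrapT => nP.
pose bad s := forall k, exists2 t, size t = k & ~ P (s ++ t).
have bad0 : bad [::].
  move=> k; apply: contrapT => h; apply: nP; exists k => s sk.
  by apply: contrapT => nPs; apply: h; exists s.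
have badS s : bad s -> bad (rcons s true) \/ bad (rcons s false).
  move=> bs; apply: contrapT => /not_orP[].
  move=> /existsNP[k1 h1] /existsNP[k2 h2].
  have [[|b t]// [tk] nPt] := bs (maxn k1 k2).+1.
  have main k : (k <= maxn k1 k2)%N -> ~ P (rcons s b ++ take k t).
    move=> kk /Pcat - /(_ (drop k t)).
    by rewrite -catA cat_take_drop cat_rcons.
  case: b main {nPt} => main.
    apply: h1; exists (take k1 t); last exact: main (leq_maxl _ _).
    by rewrite size_takel// tk leq_maxl.
  apply: h2; exists (take k2 t); last exact: main (leq_maxr _ _).
  by rewrite size_takel// tk leq_maxr.
have [n] := Pbar (follow bad (fun=> false)).
have /(_ 0%N)[t /size0nil -> ] := @follow_in bad (fun=> false) n bad0 badS.
by rewrite cats0.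
Qed.

(** Interleaving makes the Cantor space its own square: a subset of a product of two copies, and its
    projection, are handled inside a single copy. *)
Definition evens (T : Type) (d : nat -> T) : nat -> T := fun i => d i.*2.
Definition odds (T : Type) (d : nat -> T) : nat -> T := fun i => d i.*2.+1.
Definition mix (T : Type) (d0 d1 : nat -> T) : nat -> T :=
  fun i => if odd i then d1 i./2 else d0 i./2.

Lemma evens_mix T (d0 d1 : nat -> T) : evens (mix d0 d1) = d0.
Proof. by apply/funext => i; rewrite /evens /mix odd_double doubleK. Qed.

Lemma odds_mix T (d0 d1 : nat -> T) : odds (mix d0 d1) = d1.
Proof. by apply/funext => i; rewrite /odds /mix /= odd_double uphalf_double. Qed.

Lemma mix_evens_odds T (d : nat -> T) : mix (evens d) (odds d) = d.
Proof.
apply/funext => i; rewrite /mix /evens /odds; case: ifP => h.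
  by rewrite -[RHS]/(d i) -{2}(odd_double_half i) h.
by rewrite -{2}(odd_double_half i) h.
Qed.

Lemma agree_mix (T : Type) n (d d' e e' : nat -> T) :
  agree n d d' -> agree n e e' -> agree n (mix d e) (mix d' e').
Proof.
move=> h h' i ni; rewrite /mix; case: ifP => _; [apply: h'|apply: h];
  by apply: leq_ltn_trans ni; rewrite leq_half_double -addnn; lia.
Qed.

(** * Borel sets of the Cantor space *)

Definition bit i : set cantor := [set d | d i].

Notation cantorM := (g_sigma_algebraType (range bit)).

Lemma measurable_bit i : measurable (bit i : set cantorM).
Proof. by apply: sub_sigma_algebra; exists i. Qed.

Lemma measurable_bit_eq i b : measurable ([set d | d i = b] : set cantorM).
Proof.
case: b; first exact: measurable_bit.
rewrite (_ : [set d | _] = ~` bit i); first by apply: measurableC; exact: measurable_bit.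
by apply/seteqP; split=> d; rewrite /bit /=; case: (d i).
Qed.

Lemma measurable_agree n c : measurable ([set d | agree n d c] : set cantorM).
Proof.
rewrite (_ : [set d | _] =
    \bigcap_(i in [set i | (i < n)%N]) [set d | d i = c i]) //.
by apply: bigcap_measurableType => i _; exact: measurable_bit_eq.
Qed.

Lemma measurable_into_cantor d (X : measurableType d) (f : X -> cantor) :
  (forall i, measurable [set x | f x i]) ->
  measurable_fun setT (f : X -> cantorM).
Proof.
move=> h; apply: (@measurability _ _ X cantorM setT f (range bit)) => //.
by move=> _ [_ [i _ <-] <-]; rewrite setTI; exact: h.
Qed.

Lemma measurable_coord d (X : measurableType d) (f : X -> cantorM) i :
  measurable_fun setT f -> measurable [set x | f x i].
Proof. by move=> mf; exact: (measurable_preimageT mf (measurable_bit i)). Qed.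

Lemma measurable_evens : measurable_fun setT (@evens bool : cantorM -> cantorM).
Proof. by apply: measurable_into_cantor => i; exact: measurable_bit. Qed.

Lemma measurable_odds : measurable_fun setT (@odds bool : cantorM -> cantorM).
Proof. by apply: measurable_into_cantor => i; exact: measurable_bit. Qed.

Lemma measurable_mix d (X : measurableType d) (f g : X -> cantorM) :
  measurable_fun setT f -> measurable_fun setT g ->
  measurable_fun setT ((fun x => mix (f x) (g x)) : X -> cantorM).
Proof.
move=> mf mg; apply: measurable_into_cantor => i; rewrite /mix.
by case: odd; [exact: (measurable_coord _ mg)|exact: (measurable_coord _ mf)].
Qed.

(** A node takes countably many values, and the event that it equals a given word is a countable
    union over the previous node, the proposed bit and the verdict of the tree. The measurable
    choices made later go through this lemma. *)
Lemma measurable_follow d (W : measurableType d) (T : W -> seq bool -> Prop)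
    (c : W -> cantorM) :
  (forall s, measurable [set w | T w s]) -> measurable_fun setT c ->
  measurable_fun setT ((fun w => follow (T w) (c w)) : W -> cantorM).
Proof.
move=> mT mc.
have mbit b n : measurable [set w | c w n = b].
  exact: (measurable_preimageT mc (measurable_bit_eq n b)).
have mTb b s : measurable [set w | `[< T w s >] = b].
  case: b.
    rewrite (_ : [set w | _] = [set w | T w s])//.
    by apply/seteqP; split=> w /asboolP.
  rewrite (_ : [set w | _] = ~` [set w | T w s]); first by apply: measurableC; exact: mT.
  by apply/seteqP; split=> w /= => [/negbT/asboolPn|/asboolPn/negbTE].
have mnode n s : measurable [set w | node (T w) (c w) n = s].
  elim: n s => [|n ih] s /=.
    rewrite (_ : [set w | _] = [set w | [::] = s /\ True]).
      by apply: measurable_conj => _; exact: measurableT.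
    by apply/seteqP; split=> w // [].
  rewrite (_ : [set w | _] = [set w | exists p : seq bool * (bool * bool),
      rcons p.1 (if p.2.2 then p.2.1 else ~~ p.2.1) = s /\
      (node (T w) (c w) n = p.1 /\ (c w n = p.2.1 /\
        `[< T w (rcons p.1 p.2.1) >] = p.2.2))]).
    apply: measurable_exists => p; apply: measurable_conj => _.
    apply: measurableI; first exact: ih.
    by apply: measurableI; [exact: mbit|exact: mTb].
  apply/seteqP; split=> w /= => [<-|[[s' [b b']] /= [<- [-> [-> ->]]]]] //.
  by exists (node (T w) (c w) n, (c w n, `[< T w (rcons (node (T w) (c w) n) (c w n)) >])).
apply: measurable_into_cantor => i.
rewrite (_ : [set w | _] = [set w | exists s : seq bool, last false s = true /\
    node (T w) (c w) i.+1 = s]).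
  by apply: measurable_exists => s; apply: measurable_conj => _; exact: mnode.
apply/seteqP; split=> w /= => [h|[s [sl ns]]]; last by rewrite /follow /= ns sl.
by exists (node (T w) (c w) i.+1).
Qed.

(** * Analytic sets *)

Notation baire := (nat -> nat).

Definition closed_rel (F : cantor -> baire -> Prop) := forall d z,
  (forall k, exists d' z', [/\ agree k d' d, agree k z' z & F d' z']) -> F d z.

(** Suslin's representation as the projection of a closed set along the Baire space, closedness
    being expressed through agreement of finite prefixes. *)
Definition analytic (A : set cantor) :=
  exists2 F, closed_rel F & A = [set d | exists z, F d z].

(** Pullback along a continuous map, whose continuity is the existence of a modulus [K] for each
    output entry; finitely many entries need only the maximum of their moduli. *)
Lemma closed_rel_comp F (D : cantor -> baire -> cantor)
    (Z : cantor -> baire -> baire) : closed_rel F ->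
  (forall i, exists K, forall d z d' z', agree K d' d -> agree K z' z ->
    D d' z' i = D d z i /\ Z d' z' i = Z d z i) ->
  closed_rel (fun d z => F (D d z) (Z d z)).
Proof.
move=> cF /choice[K KP] d z h; apply: cF => k.
have [d' [z' [dd zz Fdz]]] := h (\max_(i < k) K i)%N.
have H i : (i < k)%N -> D d' z' i = D d z i /\ Z d' z' i = Z d z i.
  move=> ik; have le : (K i <= \max_(i < k) K i)%N.
    exact: (leq_bigmax (Ordinal ik)).
  by apply: KP; apply: agree_le le _.
by exists (D d' z'), (Z d' z'); split=> // i /H[].
Qed.

Definition pr (n k : nat) : nat := pickle (n, k).
Definition unpr (m : nat) : nat * nat := odflt (0, 0)%N (unpickle m).

Lemma prK n k : unpr (pr n k) = (n, k). Proof. by rewrite /unpr pickleK. Qed.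

Lemma analytic_preimage (A : set cantor) (r : nat -> nat) : analytic A ->
  analytic [set d : cantor | A (d \o r)].
Proof.
move=> [F cF ->]; exists (fun d z => F (d \o r) z) => //.
apply: (closed_rel_comp (D := fun d _ => d \o r) (Z := fun _ z => z)) => // i.
by exists (maxn i (r i)).+1 => d z d' z' dd zz; split; [apply: dd|apply: zz];
  rewrite ltnS ?leq_maxl ?leq_maxr.
Qed.

Lemma analytic_bit i b : analytic [set d | d i = b].
Proof.
exists (fun d _ => d i = b).
  by move=> d z /(_ i.+1)[d' [z' [dd _ <-]]]; rewrite dd.
by apply/seteqP; split=> [d di|d []//]; exists (fun=> 0%N).
Qed.

(** One sequence carries the witnesses for all [n], the [n]-th of them on the entries [pr n k]. *)
Lemma analytic_bigcap (A : nat -> set cantor) : (forall n, analytic (A n)) ->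
  analytic (\bigcap_n A n).
Proof.
move=> h; have /choice[F FP] n : exists F, closed_rel F /\
    A n = [set d | exists z, F d z] by have [F] := h n; exists F.
exists (fun d z => forall n, F n d (z \o pr n)).
  move=> d z H n; apply: (closed_rel_comp (F := F n) (D := fun d _ => d)
    (Z := fun _ z => z \o pr n)) => [|i|k].
  - by have [] := FP n.
  - exists (maxn i (pr n i)).+1 => {H}d z0 d' z' dd zz.
    by split; [apply: dd|apply: zz]; rewrite ltnS ?leq_maxl ?leq_maxr.
  - by have [d' [z' [dd zz H']]] := H k; exists d', z'; split.
apply/seteqP; split=> [d Ad|d [z Fz] n _]; last first.
  by rewrite (FP n).2; exists (z \o pr n).
have /choice[z Hz] n : exists z, F n d z by have := Ad n I; rewrite (FP n).2.
exists (fun m => z (unpr m).1 (unpr m).2) => n.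
by rewrite (_ : _ \o _ = z n)//; apply/funext => k /=; rewrite prK.
Qed.

(** The first entry of the witness names a member of the union, and the tail is a witness for that
    member. *)
Lemma analytic_bigcup (A : nat -> set cantor) : (forall n, analytic (A n)) ->
  analytic (\bigcup_n A n).
Proof.
move=> h; have /choice[F FP] n : exists F, closed_rel F /\
    A n = [set d | exists z, F d z] by have [F] := h n; exists F.
exists (fun d z => F (z 0%N) d (z \o S)).
  move=> d z H; apply: (proj1 (FP _)) => k.
  have [d' [z' [dd zz Fz]]] := H k.+1.
  exists d', (z' \o S); split; [exact: agree_le dd|by move=> i ik; apply: zz|].
  by rewrite -zz.
apply/seteqP; split=> [d [n _]|d [z Fz]].
  by rewrite (FP n).2 => -[z Fz]; exists (fun i => if i is j.+1 then z j else n).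
by exists (z 0%N) => //; rewrite (FP _).2; exists (z \o S).
Qed.

(** The binary sequence that is projected away moves into the witness, as the parities of its
    entries at even places. *)
Lemma analytic_proj (A : set cantor) : analytic A ->
  analytic [set d | exists d', A (mix d d')].
Proof.
move=> [F cF ->].
exists (fun d z => F (mix d (fun i => odd (z i.*2))) (odds z)).
  apply: (closed_rel_comp (D := fun d z => mix d (fun i => odd (z i.*2)))
    (Z := fun _ z => odds z)) => // i.
  exists i.*2.+2 => d z d' z' dd zz; split; last by apply: zz.
  rewrite /mix; case: ifP => _; last by rewrite dd// -addnn; lia.
  by rewrite zz// -!addnn; lia.
apply/seteqP; split=> [d [d' [z Fz]]|d [z Fz]]; last first.
  by exists (fun i => odd (z i.*2)), (odds z).
exists (mix (fun i => d' i : nat) z); rewrite odds_mix.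
congr (F _ _): Fz; congr mix; apply/funext => i.
by rewrite /mix odd_double doubleK; case: (d' i).
Qed.

Lemma analyticI A B : analytic A -> analytic B -> analytic (A `&` B).
Proof.
move=> aA aB; rewrite (_ : _ `&` _ = \bigcap_n (if n == 0%N then A else B)).
  by apply: analytic_bigcap; case.
by apply/seteqP; split=> [d [Ad Bd] [|]//|d h]; split; [exact: (h 0%N)|exact: (h 1%N)].
Qed.

Lemma analyticU A B : analytic A -> analytic B -> analytic (A `|` B).
Proof.
move=> aA aB; rewrite (_ : _ `|` _ = \bigcup_n (if n == 0%N then A else B)).
  by apply: analytic_bigcup; case.
by apply/seteqP; split=> [d [Ad|Bd]|d [[|n] _]]; [exists 0%N|exists 1%N|left|right].
Qed.

(** Analytic sets are not closed under complement, so the induction over the sigma-algebra carries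
    each set together with its complement. *)
Lemma borel_analytic (B : set cantorM) : measurable B -> analytic B.
Proof.
suff : (@measurable _ cantorM) `<=` [set B | analytic B /\ analytic (~` B)].
  by move=> h /h[].
have aF : analytic set0 by exists (fun _ _ => False) => [d z /(_ 0%N)[? [? []]]//|];
  apply/seteqP; split=> d // [].
apply: smallest_sub => [|_ [i _ <-]]; last first.
  split; first exact: (analytic_bit i true).
  rewrite (_ : ~` _ = [set d | d i = false]); first exact: analytic_bit.
  by apply/seteqP; split=> d; rewrite /bit /=; case: (d i).
split=> [|A [aA aC]|A hA].
- split=> //; rewrite (_ : ~` _ = [set d | d 0%N = true] `|` [set d | d 0%N = false]).
    by apply: analyticU; exact: analytic_bit.
  by rewrite setC0; apply/seteqP; split=> // d _ /=; case: (d 0%N); [left|right].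
- by rewrite setTD; split; rewrite ?setCK.
- split; first by apply: analytic_bigcup => n; have [] := hA n.
  by rewrite setC_bigcup; apply: analytic_bigcap => n; have [] := hA n.
Qed.

(** * Novikov's separation theorem *)

Section novikov.
Variable F : nat -> cantor -> baire -> Prop.
Hypothesis cF : forall n, closed_rel (F n).

Definition separable_family (A : nat -> set cantor) :=
  exists2 B : nat -> set cantorM, (forall n, measurable (B n) /\ A n `<=` B n) &
    \bigcap_n B n = set0.

(* The part of the [n]-th analytic set that is compatible with the first [k]
   entries of [d], and with those of the interleaving [z] of all witnesses. *)
Let part k (d : cantor) (z : baire) n : set cantor := [set d' | agree k d' d /\
  exists2 z' : baire, (forall j, (pr n j < k)%N -> z' j = z (pr n j)) & F n d' z'].

Let upd (T : Type) (f : nat -> T) k x := fun i => if i == k then x else f i.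

(** Contrapositive of a gluing argument. Entry [k] of the interleaved witness belongs to the set
    [n0] alone. Given separating hulls for all values of the next bit and of this entry, the hulls
    of [n0] are united over the entry and those of the other sets are intersected. A point common to
    all of them fixes one value of bit and entry, for which the hulls already have empty
    intersection. *)
Let part_refine k d z : ~ separable_family (part k d z) ->
  exists dz : cantor * baire, [/\ agree k dz.1 d, agree k dz.2 z
    & ~ separable_family (part k.+1 dz.1 dz.2)].
Proof.
move=> nsep; apply: contrapT => h; apply: nsep.
have /choice[B BP] (bj : bool * nat) :
    exists B : nat -> set cantorM, (forall n, measurable (B n) /\
      part k.+1 (upd d k bj.1) (upd z k bj.2) n `<=` B n) /\ \bigcap_n B n = set0.
  apply: contrapT => nB; apply: h; exists (upd d k bj.1, upd z k bj.2).
  split=> [i ik|i ik|[B B1 B2]]; rewrite /upd /= ?ltn_eqF//.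
  by apply: nB; exists B.
pose n0 := (unpr k).1.
exists (fun n => \bigcup_(b in setT) ([set d | d k = b] `&`
  if n == n0 then \bigcup_j B (b, j) n else \bigcap_j B (b, j) n)).
  move=> n; split.
    rewrite (_ : \bigcup_(b in _) _ = \bigcup_m ([set d | d k = odd m] `&`
      if n == n0 then \bigcup_j B (odd m, j) n else \bigcap_j B (odd m, j) n)).
      apply: bigcup_measurable => m _; apply: measurableI.
        exact: measurable_bit_eq.
      case: ifP => _; [apply: bigcup_measurable|apply: bigcap_measurableType];
        by move=> j _; have [/(_ n)[]] := BP (odd m, j).
    apply/seteqP; split=> [x [b _ h']|x [m _ h']]; last by exists (odd m).
    by exists (b : nat) => //; case: b h'.
  move=> x [xd [z' zz' Fx]]; exists (x k) => //; split=> //.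
  have ag b : x k = b -> agree k.+1 x (upd d k b).
    move=> xb i; rewrite ltnS leq_eqVlt /upd => /orP[/eqP->|ik].
      by rewrite eqxx.
    by rewrite ltn_eqF// xd.
  case: ifPn => [/eqP nn0|nn0].
    exists (z' (unpr k).2) => //; apply: ((BP (x k, _)).1 n).2.
    split; first exact: ag.
    exists z' => // j; rewrite ltnS leq_eqVlt /upd /= => /orP[/eqP e|jk].
      by rewrite e eqxx -e prK.
    by rewrite ltn_eqF// zz'.
  move=> j _; apply: ((BP (x k, j)).1 n).2; split; first exact: ag.
  exists z' => // i; rewrite ltnS leq_eqVlt /upd /= => /orP[/eqP e|ik].
    by case/negP: nn0; rewrite /n0 -e prK.
  by rewrite ltn_eqF// zz'.
rewrite -subset0 => x xB.
have [_ _ [/= <-]] := xB n0 I; rewrite eqxx => -[j _ xj].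
suff : set0 x by [].
rewrite -(BP (x k, j)).2 => n _; have [_ _ [/= <-]] := xB n I.
by case: ifPn => [/eqP->//|_ /(_ j I)].
Qed.

(** If there are no separating hulls, [part_refine] fixes the entries one after the other without
    ever reaching a separable stage; the limit point lies in every set because the relations are
    closed. *)
Lemma novikov : \bigcap_n [set d | exists z, F n d z] = set0 ->
  separable_family (fun n => [set d | exists z, F n d z]).
Proof.
move=> F0; apply: contrapT => nsep.
pose ok k (dz : cantor * baire) := ~ separable_family (part k dz.1 dz.2).
have ok0 : ok 0%N (fun=> false, fun=> 0%N).
  move=> [B B1 B2]; apply: nsep; exists B => // n; split; first exact: (B1 n).1.
  by move=> d [z Fz]; apply: (B1 n).2; split=> //; exists z.
have /choice[nx nxP] (kdz : nat * (cantor * baire)) : exists dz,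
    ok kdz.1 kdz.2 -> [/\ agree kdz.1 dz.1 kdz.2.1, agree kdz.1 dz.2 kdz.2.2
                      & ok kdz.1.+1 dz].
  have [h|h] := pselect (ok kdz.1 kdz.2); last by exists kdz.2.
  by have [dz] := part_refine h; exists dz.
pose st := fix st k := if k is j.+1 then nx (j, st j) else (fun=> false, fun=> 0%N).
have okst k : ok k (st k) by elim: k => // k ih; have [] := nxP (k, st k) ih.
have st_agree k m : (k <= m)%N ->
    agree k (st m).1 (st k).1 /\ agree k (st m).2 (st k).2.
  elim: m => [|m ih]; first by rewrite leqn0 => /eqP->.
  rewrite leq_eqVlt => /orP[/eqP->//|]; rewrite ltnS => km.
  have [h1 h2 _] := nxP (m, st m) (okst m); have [h3 h4] := ih km.
  by split=> i ik; [rewrite -h3|rewrite -h4] => //; [apply: h1|apply: h2];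
    apply: leq_trans km.
pose d : cantor := fun i => (st i.+1).1 i; pose z : baire := fun i => (st i.+1).2 i.
have dE k : agree k (st k).1 d by move=> i ik; have [h _] := st_agree _ _ ik; exact: h.
have zE k : agree k (st k).2 z by move=> i ik; have [_ h] := st_agree _ _ ik; exact: h.
suff : (\bigcap_n [set d | exists z, F n d z]) d by rewrite F0.
move=> n _; exists (z \o pr n); apply: cF => k.
(* The stage must fix the first [k] bits and also the entries coded by [pr n i] with [i < k], which
   hold the beginning of the witness for [n]. *)
pose m := (\max_(i < k) (pr n i).+1 + k)%N.
have [x [xd [z' zz Fx]]] : part m (st m).1 (st m).2 n !=set0.
  apply/set0P/eqP => p0; apply: (okst m).
  (* A stage with an empty part is trivially separable: the empty hull for that set, the whole space
     for the others. *)
  exists (fun j => if j == n then set0 else setT).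
    by move=> j; case: ifPn => [/eqP->|_]; split=> //; rewrite p0.
  by rewrite -subset0 => y /(_ n I); rewrite eqxx.
exists x, z'; split=> // i ik.
  by rewrite xd ?dE//; apply: leq_trans ik _; rewrite leq_addl.
have im : (pr n i < m)%N.
  by rewrite /m; apply: leq_trans (leq_addr _ _); exact: (leq_bigmax (Ordinal ik)).
by rewrite zz//= zE.
Qed.

End novikov.

(** Luzin's theorem. The second set is repeated for all positive indices, so that each of its points
    lies in every hull but the first and hence, the intersection being empty, outside the first. *)
Lemma analytic_separation A B : analytic A -> analytic B -> A `&` B = set0 ->
  exists2 D : set cantorM, measurable D & A `<=` D /\ D `&` B = set0.
Proof.
move=> [F cF AE] [F' cF' BE] AB.
have [||E E1 E2] := @novikov (fun n => if n == 0%N then F else F').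
- by move=> [|n].
- by rewrite -AB AE BE; apply/seteqP;
    split=> [d h|d [Ad Bd] [|]//]; split; [exact: (h 0%N)|exact: (h 1%N)].
exists (E 0%N); first exact: (E1 0%N).1.
split; first by rewrite AE; exact: (E1 0%N).2.
suff E0 n : B `<=` E n.+1.
  by rewrite -subset0 -E2 => d [Ed Bd] [|n] _ //; exact: E0.
by rewrite BE; exact: (E1 n.+1).2.
Qed.

(* Projections of Borel sets with compact sections are Borel.  By Novikov's
   theorem the complement is a union of countably many Borel rectangles
   [B t] x [words with prefix t], so that emptiness of a section is, by
   Koenig's lemma, a statement about finitely many [t]. *)
Lemma borel_proj (D : set cantorM) : measurable D ->
  (forall d d1, (forall k, exists2 d2, agree k d2 d1 & D (mix d d2)) -> D (mix d d1)) ->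
  measurable ([set d | exists d1, D (mix d d1)] : set cantorM).
Proof.
move=> mD cD.
pose pref (t : seq bool) : set cantor := [set d | agree (size t) d (word t)].
have aD : analytic D by exact: borel_analytic.
have apref t r : analytic [set d : cantor | pref t (d \o r)].
  apply: (analytic_preimage r); apply: borel_analytic; exact: measurable_agree.
pose P t : set cantor := [set d | exists d1, (D `&` (pref t \o @odds bool)) (mix d d1)].
have aP t : analytic (P t) by apply/analytic_proj/analyticI => //; exact: apref.
have [tt ttP] : exists tt : nat -> seq bool, forall t, exists m, tt m = t.
  by exists (fun m => odflt [::] (unpickle m)) => t; exists (pickle t); rewrite pickleK.
pose A n : set cantor := if n is m.+1 then
  [set d : cantor | P (tt m) (d \o double)] `|` ~` (pref (tt m) \o @odds bool) else ~` D.
have aA n : analytic (A n).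
  case: n => [|n] /=; first by apply: borel_analytic; exact: measurableC.
  apply: analyticU; first exact: (analytic_preimage double (aP _)).
  apply: borel_analytic; apply: measurableC.
  exact: (measurable_preimageT measurable_odds (measurable_agree _ _)).
have A0 : \bigcap_n A n = set0.
  rewrite -subset0 => d Ad; have nD := Ad 0%N I.
  have : ~ D (mix (evens d) (odds d)) by rewrite mix_evens_odds.
  apply; apply: cD => k; apply: contrapT => h.
  have [m tm] := ttP (pre (odds d) k).
  have := Ad m.+1 I; rewrite /= tm => -[[d1 [Dd1 pd]]|]; last first.
    by apply => i; rewrite size_pre /word /pre => ik; rewrite nth_mkseq.
  apply: h; exists d1 => // i ik; have := pd i; rewrite /= odds_mix size_pre => ->//.
  by rewrite /word /pre nth_mkseq.
have /choice[F FP] n : exists F, closed_rel F /\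
    A n = [set d | exists z, F d z] by have [F] := aA n; exists F.
have [|B BP B0] := @novikov F (fun n => (FP n).1).
  by rewrite -A0; apply: eq_bigcapr => n _; rewrite (FP n).2.
have mB n : measurable (B n) := (BP n).1.
have AB n : A n `<=` B n by rewrite (FP n).2; exact: (BP n).2.
have /choice[C CP] m : exists C : set cantorM, measurable C /\
    ([set d | exists d1, (~` B m.+1) (mix d d1)] `<=` C /\ C `&` P (tt m) = set0).
  have [||C ? ?] := @analytic_separation
      [set d | exists d1, (~` B m.+1) (mix d d1)] (P (tt m)) _ (aP (tt m)).
  - by apply/analytic_proj/borel_analytic; exact: measurableC.
  - rewrite -subset0 => d [[d1 nB] Pd]; apply: nB; apply: AB => /=.
    by left; rewrite -[_ \o _]/(evens _) evens_mix.
  - by exists C.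
have cover d d1 : ~ D (mix d d1) -> exists m, C m d /\ pref (tt m) d1.
  move=> nD; have : ~ (\bigcap_n B n) (mix d d1) by rewrite B0.
  move=> /existsNP[[|m]] /not_implyP[_ nB]; first by case: nB; exact: AB.
  exists m; split; first by apply: (CP m).2.1; exists d1.
  by apply: contrapT => h; apply: nB; apply: AB; right; rewrite /= odds_mix.
rewrite (_ : [set d | _] = ~` [set d | exists k, forall s : seq bool, size s = k ->
    exists m, ((size (tt m) <= k)%N /\ pref (tt m) (word s)) /\ C m d]).
  apply/measurableC/measurable_exists => k; apply: measurable_forall => s.
  apply: measurable_imply => _; apply: measurable_exists => m.
  by apply: measurable_conj => _; exact: (CP m).1.
have disj m d : C m d -> ~ P (tt m) d.
  by move=> Cd Pd; have := (CP m).2.2; rewrite -subset0; apply; split; [exact: Cd|].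
apply/seteqP; split=> d /=.
  move=> [d1 Dd] [k /(_ (pre d1 k) (size_pre _ _))[m [[sk pm] /disj]]]; apply.
  exists d1; split => //=; rewrite odds_mix => i im; rewrite -pm//.
  by rewrite /word /pre nth_mkseq//; exact: leq_trans sk.
move=> h; apply: contrapT => nD; apply: h.
have [s t [m [[ms pm] Cm]]|d1|k hk] := @bar (fun s => exists m,
    ((size (tt m) <= size s)%N /\ pref (tt m) (word s)) /\ C m d).
- exists m; rewrite size_cat; split => //; split; first exact: leq_trans (leq_addr _ _).
  by move=> i im; rewrite /word nth_cat (leq_trans im ms); exact: pm.
- have [m [Cm pm]] := cover d d1 (fun h => nD (ex_intro _ d1 h)).
  exists (size (tt m)), m; rewrite size_pre; split=> //; split=> // i im.
  by rewrite -pm// /word /pre nth_mkseq.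
- by exists k => s sk; have [m] := hk s sk; rewrite sk => h'; exists m.
Qed.

(** * Borel spaces coded by the Cantor space *)

(** Presented as a measurable retract of the Cantor space, a form that is stable under products and
    supplies a decoding defined everywhere. *)
Definition standard_borel d (Z : measurableType d) :=
  exists (e : Z -> cantorM) (g : cantorM -> Z),
    [/\ measurable_fun setT e, measurable_fun setT g & cancel e g].

Lemma standard_borel_prod d d' (Z : measurableType d) (Z' : measurableType d') :
  standard_borel Z -> standard_borel Z' -> standard_borel (Z * Z')%type.
Proof.
move=> [e [g [me mg eg]]] [e' [g' [me' mg' eg']]].
exists (fun z => mix (e z.1) (e' z.2)), (fun d => (g (evens d), g' (odds d))).
split; first exact: (measurable_mix (measurableT_comp me measurable_fst)
    (measurableT_comp me' measurable_snd)).
  by apply: measurable_fun_pair; [exact: (measurableT_comp mg measurable_evens)|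
    exact: (measurableT_comp mg' measurable_odds)].
by move=> [z z'] /=; rewrite evens_mix odds_mix eg eg'.
Qed.

Section coding.
Context (X : topologicalType).
Variables U C : nat -> set X.

(** In the gap between [U i] and [C i] both bits are allowed. Each requirement is therefore closed
    in [a], whichever the bit, so that in a compact set a code is realized as soon as its finite
    prefixes are. Exact membership bits would not give this. *)
Definition fits (d : cantor) i (a : X) := if d i then C i a else ~ U i a.
Definition codes (d : cantor) (a : X) := forall i, fits d i a.

Record coding := Coding {
  coding_open : forall i, open (U i) ;
  coding_closed : forall i, closed (C i) ;
  coding_sub : forall i, U i `<=` C i ;
  coding_base : forall a V, open V -> V a -> exists2 i, U i a & C i `<=` V ;
  coding_inj : forall d a a', codes d a -> codes d a' -> a = a' ;
  coding_dom : measurable ([set d | exists a, codes d a] : set cantorM) }.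

Hypothesis cod : coding.

Lemma codes_open d a V : codes d a -> open V ->
  V a <-> exists2 i, C i `<=` V & d i.
Proof.
move=> da oV; split=> [Va|[i iV di]]; last by apply: iV; move: (da i); rewrite /fits di.
have [i Ui CV] := coding_base cod oV Va; exists i => //.
by move: (da i); rewrite /fits; case: (d i).
Qed.

Lemma closed_fits d i : closed (fits d i).
Proof.
rewrite /fits; case: (d i); first exact: (coding_closed cod).
by apply: open_closedC; exact: (coding_open cod).
Qed.

Lemma coding_preimage (M : set X) : <<s @open X >> M ->
  measurable ([set d | exists2 a, codes d a & M a] : set cantorM).
Proof.
move: M; apply: smallest_sub => [|V oV] /=; last first.
  rewrite (_ : [set d | _] = [set d | exists a, codes d a] `&`
      [set d | exists i, C i `<=` V /\ bit i d]).
    apply: measurableI; first exact: (coding_dom cod).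
    by apply: measurable_exists => i; apply: measurable_conj => _; exact: measurable_bit.
  apply/seteqP; split=> d /= => [[a da /(codes_open da oV)[i iV di]]|[[a da] [i [iV di]]]].
    by split; [exists a|exists i].
  by exists a => //; apply/(codes_open da oV); exists i.
split=> /= [|M mM|M mM].
- by rewrite (_ : [set d | _] = set0)//; apply/seteqP; split=> d // [].
- rewrite (_ : [set d | _] = [set d | exists a, codes d a] `\`
      [set d | exists2 a, codes d a & M a]).
    by apply: measurableD => //; exact: (coding_dom cod).
  apply/seteqP; split=> d /= => [[a da [_ nMa]]|[[a da] nM]].
    by split; [exists a|move=> [a' /(coding_inj cod da) <-]].
  by exists a => //; split=> // Ma; apply: nM; exists a.
- rewrite (_ : [set d | _] = [set d | exists i, exists2 a, codes d a & M i a]).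
    exact: measurable_exists.
  by apply/seteqP; split=> d /= [a]; [move=> da [i _ Ma]; exists i, a|
    move=> [b db Mb]; exists b => //; exists a].
Qed.

End coding.

Lemma compact_closed_seq (X : topologicalType) (K : set X) (E : nat -> set X) :
  compact K -> (forall i, closed (E i)) ->
  (forall k, exists a, K a /\ forall i, (i < k)%N -> E i a) ->
  exists2 a, K a & forall i, E i a.
Proof.
move=> cK cE /choice[a_ Ha].
have [|a [Ka]] := cK (a_ @ \oo) _.
  by exists 0%N => // k _ /=; have [] := Ha k.
rewrite clusterE => cl; exists a => // i; rewrite (closure_id (E i)).1//.
by apply: cl; exists i.+1 => // k /= ik; have [_] := Ha k; exact.
Qed.

Section polish.
Context (R : realType) (Y : completePseudoMetricType R).
Hypothesis hY : hausdorff_space Y.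
Local Open Scope ring_scope.
Variables (Q : set Y) (cQ : countable Q) (dQ : dense Q).

(** [U i] and [C i] are the interiors and the closures of balls with centers in the countable dense
    set and radii inverse to positive integers. *)
Lemma polish_coding : exists U C : nat -> set Y, coding U C.
Proof.
have [q_ qP] : exists q_ : nat -> Y, forall q, Q q -> exists n, q_ n = q.
  have /countable_injP[k kinj] := cQ.
  exists (fun n => xget point [set q | Q q /\ k q = n]) => q Qq; exists (k q).
  by case: xgetP => [q' -> [Qq' /kinj]|/(_ q) []//]; apply; rewrite inE.
pose rad i : R := (unpr i).2.+1%:R^-1.
pose U i := interior (ball (q_ (unpr i).1) (rad i)).
pose C i := closure (ball (q_ (unpr i).1) (rad i)).
have oU i : open (U i) by exact: open_interior.
have cC i : closed (C i) by exact: closed_closure.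
have UC i : U i `<=` C i by move=> y /interior_subset; exact: subset_closure.
have base k (a : Y) V : open V -> V a ->
    exists2 i, (k <= (unpr i).2)%N & U i a /\ C i `<=` V.
  move=> oV Va; have /nbhs_ballP[e /= e0 eV] : nbhs a V by exact: open_nbhs_nbhs.
  (* With radius [r < e / 4], a point of the closed ball is at distance at most
     [r / 2 + r + e / 4 < e] from [a]. The bound [k] lets the radius be as small as desired. *)
  have [m km me] : exists2 m, (k <= m)%N & m.+1%:R^-1 < e / 4 :> R.
    have [N _ hN] := near_infty_natSinv_lt (PosNum (divr_gt0 e0 (ltr0n R 4))).
    by exists (maxn N k); [exact: leq_maxr|apply: hN; exact: leq_maxl].
  have r0 : 0 < m.+1%:R^-1 / 2 :> R by rewrite divr_gt0// invr_gt0.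
  have [q [aq /qP[n nq]]] : ball a (m.+1%:R^-1 / 2) `&` Q !=set0.
    have [||q [/interior_subset]] := dQ (O := (ball a (m.+1%:R^-1 / 2))^°).
    - by exists a; exact: nbhsx_ballx.
    - exact: open_interior.
    - by exists q.
  exists (pr n m); rewrite /U /C /rad prK //=; split.
    rewrite nq; apply/nbhs_ballP; exists (m.+1%:R^-1 / 2) => //= z az.
    rewrite (splitr m.+1%:R^-1).
    by apply: ball_triangle az; exact: ball_sym.
  rewrite nq => z zq; apply: eV.
  have [z' [qz' zz']] := zq _ (nbhsx_ballx z (e / 4) ltac:(by rewrite divr_gt0)).
  apply: (@le_ball _ _ _ (m.+1%:R^-1 / 2 + m.+1%:R^-1 + e / 4)); first by set t := m.+1%:R^-1 in me *; lra.
  apply: ball_triangle (ball_sym zz'); exact: ball_triangle aq qz'.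
have fitU (d : cantor) a i : codes U C d a -> U i a -> d i.
  by move=> /(_ i); rewrite /fits; case: (d i).
exists U, C; split=> //.
- by move=> a V oV /(base 0%N _ _ oV)[i _ []]; exists i.
- move=> d a a' da da'; apply: contrapT => naa'.
  have := hY; rewrite open_hausdorff.
  move=> /(_ a a' (introN eqP naa'))[[A B] /= [Aa Ba] [oA oB AB]].
  have [i _ [Ua CA]] := base 0%N a A oA ltac:(by rewrite inE in Aa).
  have /CA Aa' : C i a' by move: (da' i); rewrite /fits (fitU _ _ _ da Ua).
  have : (A `&` B) a' by split=> //; rewrite inE in Ba.
  by rewrite (eqP AB).
have Cball i : C i `<=` ball (q_ (unpr i).1) (rad i + rad i).
  move=> z zq; have r0 : (0 < rad i)%R by rewrite invr_gt0.
  have [z' [qz' zz']] := zq _ (nbhsx_ballx z (rad i) r0).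
  exact: ball_triangle qz' (ball_sym zz').
(* A sequence is a code exactly when its positive bits name arbitrarily small balls and each of its
   prefixes fits some point: points that fit longer and longer prefixes form a Cauchy sequence, and
   the limit meets every requirement since each is closed. Only countably many words and indices
   occur, so the condition is Borel. *)
rewrite (_ : [set d | _] = [set d : cantor | forall k, exists i, (k <= (unpr i).2)%N /\ bit i d] `&`
    [set d | forall m, exists s : seq bool, (size s = m /\
      exists a, forall i, (i < m)%N -> fits U C (word s) i a) /\ agree m d (word s)]).
  apply: measurableI; apply: measurable_forall => k; apply: measurable_exists => s;
    apply: measurable_conj => _; [exact: measurable_bit|exact: measurable_agree].
have fits_agree m (d d' : cantor) a : agree m d d' ->
    (forall i, (i < m)%N -> fits U C d' i a) -> forall i, (i < m)%N -> fits U C d i a.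
  by move=> dd h i im; rewrite /fits dd//; exact: h.
apply/seteqP; split=> d /=.
  move=> [a da]; split=> [k|m].
    have [i ki [Ua _]] := base k a setT openT I.
    by exists i; split=> //; exact: fitU da Ua.
  have ag : agree m (word (pre d m)) d by move=> i im; rewrite /word nth_mkseq.
  exists (pre d m); split; last by move=> i im; rewrite ag.
  by rewrite size_pre; split=> //; exists a; apply: fits_agree ag _ => i _.
move=> [small /choice[s sP]].
have /choice[a aP] m : exists a, forall i, (i < m)%N -> fits U C d i a.
  by have [[_ [a ha]] ag] := sP m; exists a; exact: fits_agree ag ha.
have cva : cvg (a @ \oo).
  apply: cauchy_cvg; apply: cauchy_exP => e e0.
  have [k ke] : exists k : nat, k.+1%:R^-1 < e / 2 :> R.
    have [N _ hN] := near_infty_natSinv_lt (PosNum (divr_gt0 e0 (ltr0n R 2))).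
    by exists N; apply: hN => /=.
  have [i [ki di]] := small k; exists (q_ (unpr i).1); exists i.+1 => // m im.
  have := aP m i im; rewrite /fits [d i]di => /Cball; apply: le_ball.
  have ri : rad i <= k.+1%:R^-1 by rewrite /rad lef_pV2 ?posrE// ler_nat.
  by rewrite (splitr e) lerD// (le_trans ri)// ltW.
exists (lim (a @ \oo)) => i; apply: (closed_cvg (fits U C d i) _ _ _ cva).
  by rewrite /fits; case: (d i) => //; exact: open_closedC.
by exists i.+1 => // m; exact: aP.
Qed.

End polish.

(** The coding of the ambient Polish space is pulled back along the embedding; its domain stays
    Borel because the range of the embedding is. *)
Lemma borel_space_coding (R : realType) (X : ptopologicalType) :
  borel_space R X -> exists U C : nat -> set X, coding U C.
Proof.
move=> [Y [f [hY [Q cQ dQ] [finj oX] mf]]].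
have [U [C cod]] := polish_coding hY cQ dQ.
have codesf (d : cantor) a :
    codes (fun i => f @^-1` U i) (fun i => f @^-1` C i) d a <-> codes U C d (f a).
  by split=> h i; move: (h i); rewrite /fits; case: (d i).
exists (fun i => f @^-1` U i), (fun i => f @^-1` C i); split.
- by move=> i; apply/oX; exists (U i) => //; exact: (coding_open cod).
- move=> i; rewrite -[_ @^-1` _]setCK; apply: open_closedC; apply/oX.
  by exists (~` C i) => //; apply: closed_openC; exact: (coding_closed cod).
- by move=> i a /(coding_sub cod).
- move=> a V /oX[V' oV' ->] V'a; have [i Ua CV] := coding_base cod oV' V'a.
  by exists i => // b /CV.
- by move=> d a a' /codesf da /codesf da'; apply: finj; exact: coding_inj da'.
- rewrite (_ : [set d | _] = [set d | exists2 y, codes U C d y & range f y]).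
    exact: coding_preimage.
  apply/seteqP; split=> d /= => [[a /codesf da]|[y dy [a _ fa]]].
    by exists (f a) => //; exists a.
  by exists a; apply/codesf; rewrite fa.
Qed.

Section decoding.
Context (X : ptopologicalType) (U C : nat -> set X).
Hypothesis cod : coding U C.

Lemma measurable_decoding : exists2 g : cantorM -> borel X,
  measurable_fun setT g & forall d a, codes U C d a -> g d = a.
Proof.
have gP d a : codes U C d a -> xget (point : X) [set a | codes U C d a] = a.
  by move=> da; case: xgetP => [_ -> /(coding_inj cod)|/(_ a)//]; exact.
exists (fun d => xget (point : X) [set a | codes U C d a]) => //.
apply: (@measurability _ _ _ (borel X) setT _ (@open X)) => //.
move=> _ [M oM <-]; rewrite setTI.
rewrite (_ : _ @^-1` M = [set d | exists2 a, codes U C d a & M a] `|`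
    [set d | M point /\ ~ exists a, codes U C d a]).
  apply: measurableU; first by apply: coding_preimage => //; exact: sub_sigma_algebra.
  by apply: measurable_conj => _; apply: measurableC; exact: (coding_dom cod).
apply/seteqP; split=> d /= => [|[[a /gP->]//|[Mp nd]]].
  case: xgetP => [a _ da Ma|h Mp]; first by left; exists a.
  by right; split=> // -[a /h].
by case: xgetP => // a _ da; case: nd; exists a.
Qed.

Lemma measurable_encoding :
  measurable_fun setT ((fun a i => `[< U i a >]) : borel X -> cantorM).
Proof.
apply: measurable_into_cantor => i.
rewrite (_ : [set x | _] = U i); first by apply: sub_sigma_algebra; exact: (coding_open cod).
by apply/seteqP; split=> a /asboolP.
Qed.

Lemma codes_encoding a : codes U C (fun i => `[< U i a >]) a.
Proof. by move=> i; rewrite /fits; case: asboolP => // /(coding_sub cod). Qed.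

End decoding.

(** Each point is encoded by its exact membership bits in the sets [U i]; they form an admissible
    code because [U i] lies in [C i]. *)
Lemma standard_borel_space (R : realType) (X : ptopologicalType) :
  borel_space R X -> standard_borel (borel X).
Proof.
move=> /borel_space_coding[U [C cod]]; have [g mg gP] := measurable_decoding cod.
exists (fun a i => `[< U i a >]), g; split=> //; first exact: (measurable_encoding cod).
by move=> a; apply: gP; exact: (codes_encoding cod).
Qed.

(** * Measurable parametrization of compact sections *)

Section sections.
Context d (Z : measurableType d) (X : ptopologicalType) (U C : nat -> set X).
Hypotheses (cod : coding U C) (sZ : standard_borel Z).
Variable D : set (Z * borel X).
Hypothesis mD : measurable D.
Hypothesis cD : forall z, compact ([set a | D (z, a)] : set X).

(** On codes this is a projection with closed sections: if all prefixes of a sequence are realized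
    by points of [F] in the compact section, the whole sequence is. Hence [borel_proj] applies. *)
Lemma measurable_meet (F : set X) : closed F ->
  measurable [set z : Z | exists2 a, D (z, a) & F a].
Proof.
move=> cF; have [e [gZ [me mgZ egZ]]] := sZ.
have [g mg gP] := measurable_decoding cod.
pose D' : set cantorM := [set d | exists2 a, codes U C (odds d) a &
  D (gZ (evens d), a) /\ F a].
have mD' : measurable D'.
  rewrite (_ : D' = (@odds bool @^-1` [set d | exists a, codes U C d a]) `&`
      ((fun d => (gZ (evens d), g (odds d))) @^-1` (D `&` (setT `*` F)))).
    apply: measurableI; rewrite -[X in measurable X]setTI.
      by apply: measurable_odds => //; exact: (coding_dom cod).
    have mf : measurable_fun setT ((fun d => (gZ (evens d), g (odds d))) : cantorM -> Z * borel X).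
      by apply: measurable_fun_pair; [exact: (measurableT_comp mgZ measurable_evens)|
        exact: (measurableT_comp mg measurable_odds)].
    apply: mf => //; apply: measurableI => //; apply: measurableX => //.
    rewrite -[F]setCK; apply: measurableC; apply: sub_sigma_algebra.
    exact: closed_openC.
  apply/seteqP; split=> x /= => [[a xa [Da Fa]]|[[a xa]]].
    by split; [exists a|rewrite (gP _ _ xa)].
  by rewrite (gP _ _ xa) => -[Da [_ Fa]]; exists a.
rewrite (_ : [set z | _] = e @^-1` [set d | exists d1, D' (mix d d1)]).
  apply: (measurable_preimageT me); apply: borel_proj => // x d1 h.
  have [|||a [Da Fa] xa] := @compact_closed_seq X
      ([set a | D (gZ x, a)] `&` F) (fits U C d1).
  - by apply: compact_closedI => //; exact: cD.
  - by move=> i; exact: (closed_fits cod).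
  - move=> k; have [d2 dd [a]] := h k; rewrite /= evens_mix odds_mix => da [Da Fa].
    by exists a; split=> // i ik; move: (da i); rewrite /fits dd.
  - by exists a; rewrite /= ?odds_mix// evens_mix.
apply/seteqP; split=> z /= => [[a Da Fa]|[d1 [a _]]]; last first.
  by rewrite evens_mix egZ => -[Da Fa]; exists a.
exists (fun i => `[< U i a >]), a; first by rewrite odds_mix; exact: (codes_encoding cod).
by rewrite evens_mix egZ.
Qed.

Hypothesis D0 : forall z, exists a, D (z, a).

Let tree z (s : seq bool) := exists2 a, D (z, a) &
  forall i, (i < size s)%N -> fits U C (word s) i a.

Let tree0 z : tree z [::].
Proof. by have [a Da] := D0 z; exists a. Qed.

Let treeS z s : tree z s -> tree z (rcons s true) \/ tree z (rcons s false).
Proof.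
move=> [a Da sa]; have [Ua|nUa] := pselect (U (size s) a); [left|right];
  exists a => // i; rewrite size_rcons ltnS leq_eqVlt => /orP[/eqP->|is_];
  rewrite /fits /word nth_rcons ?ltnn ?eqxx ?is_//; try exact: sa.
exact: (coding_sub cod).
Qed.

(** A finite word imposes a closed condition, and [measurable_meet] tells measurably whether the
    section meets it. *)
Let measurable_tree s : measurable [set z | tree z s].
Proof.
apply: (@measurable_meet (\bigcap_(i in [set i | (i < size s)%N]) fits U C (word s) i)).
by apply: closed_bigI => i _; exact: (closed_fits cod).
Qed.

(* A measurable family of continuous surjections from the Cantor space onto
   the sections of [D]. *)
Definition param z (c : cantor) : X :=
  xget point [set a | D (z, a) /\ codes U C (follow (tree z) c) a].

(** The followed branch never leaves the tree, so every finite part of the code is realized in the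
    section; compactness realizes the whole of it. *)
Lemma paramP z c : D (z, param z c) /\ codes U C (follow (tree z) c) (param z c).
Proof.
have [|||a Da ca] := @compact_closed_seq X [set a | D (z, a)]
    (fits U C (follow (tree z) c)).
- exact: cD.
- by move=> i; exact: (closed_fits cod).
- move=> k; have := @follow_in (tree z) c k (tree0 z) (@treeS z).
  move=> [a Da ha]; exists a; split=> // i ik; move: (ha i).
  by rewrite size_pre /fits /word nth_mkseq//; exact.
- by rewrite /param; case: xgetP => [_ -> []//|/(_ a) []].
Qed.

Lemma param_open z c V : open V ->
  V (param z c) <-> exists2 i, C i `<=` V & follow (tree z) c i.
Proof. by move=> oV; exact: (codes_open cod (paramP z c).2 oV). Qed.

Lemma param_cont z c V : open V -> V (param z c) ->
  exists n, forall c', agree n c' c -> V (param z c').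
Proof.
move=> oV /(param_open _ _ oV)[i CV ci]; exists i.+1 => c' cc.
by apply/param_open => //; exists i => //; rewrite (follow_agree _ cc).
Qed.

(** The exact membership bits of a point of the section stay in the tree, so [follow] returns them
    unchanged. *)
Lemma param_onto z a : D (z, a) -> exists c, param z c = a.
Proof.
move=> Da; pose c : cantor := fun i => `[< U i a >]; exists c.
have ca : codes U C c a by exact: (codes_encoding cod).
apply: (coding_inj cod (d := c)) => //; rewrite -[c in codes _ _ c](@follow_id (tree z)).
  exact: (paramP z c).2.
move=> n; exists a => // i; rewrite size_pre => ni.
by rewrite /fits /word nth_mkseq//; exact: ca.
Qed.

Lemma measurable_param :
  measurable_fun setT ((fun zc => param zc.1 zc.2) : Z * cantorM -> borel X).
Proof.
apply: (@measurability _ _ _ (borel X) setT _ (@open X)) => //.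
move=> _ [V oV <-]; rewrite setTI.
have mf : measurable_fun setT ((fun zc => follow (tree zc.1) zc.2) : Z * cantorM -> cantorM).
  apply: measurable_follow => [s|]; last exact: measurable_snd.
  exact: (measurable_preimageT measurable_fst (measurable_tree s)).
rewrite (_ : _ @^-1` _ = [set zc | exists i : nat, C i `<=` V /\
    bit i (follow (tree zc.1) zc.2)]).
  apply: measurable_exists => i; apply: measurable_conj => _.
  exact: (measurable_preimageT mf (measurable_bit i)).
apply/seteqP; split=> zc => [/(param_open _ _ oV)[i CV ci]|[i [CV ci]]]; first by exists i.
by apply/param_open => //; exists i.
Qed.

End sections.

(** * Probability kernels *)

Section mkker.
Context d d' (X : measurableType d) (Y : measurableType d') (R : realType).
Variable k : X -> {measure set Y -> \bar R}.
Hypothesis mk : forall U, measurable U -> measurable_fun setT (k ^~ U).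
Hypothesis k1 : forall x, k x setT = 1.

Definition mkker of (forall U, measurable U -> measurable_fun setT (k ^~ U)) &
  (forall x, k x setT = 1) := k.

HB.instance Definition _ := isKernel.Build _ _ _ _ _ (mkker mk k1) mk.
HB.instance Definition _ := Kernel_isProbability.Build _ _ _ _ _ (mkker mk k1) k1.

End mkker.

Lemma kernel_exists d d' (X : measurableType d) (Y : measurableType d')
    (R : realType) (k : X -> {measure set Y -> \bar R}) :
  (forall U, measurable U -> measurable_fun setT (k ^~ U)) ->
  (forall x, k x setT = 1) ->
  exists k' : R.-pker X ~> Y, forall x U, k' x U = k x U.
Proof. by move=> mk k1; exists (mkker mk k1). Qed.

Section kmap.
Context d d' d'' (W : measurableType d) (Y : measurableType d')
  (Z : measurableType d'') (R : realType).
Variables (k : R.-pker W ~> Y) (f : W * Y -> Z) (mf : measurable_fun setT f).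

Let mfw w : measurable_fun setT (fun y => f (w, y)).
Proof. exact: (measurableT_comp mf (measurable_pair1 w)). Qed.

Definition kmap_measure w : {measure set Z -> \bar R} :=
  measure_function_pushforward__canonical__measure_function_Measure (k w) (mfw w).

Let measurable_kmap U : measurable U -> measurable_fun setT (kmap_measure ^~ U).
Proof.
move=> mU; have mV : measurable (f @^-1` U) by exact: measurable_preimageT.
have -> : (fun w => kmap_measure w U) = (fun w => k w (xsection (f @^-1` U) w)).
  apply/funext => w; congr (k w _).
  by apply/seteqP; split=> y /=; rewrite /xsection /= inE.
by apply: measurable_fun_xsection_finite_kernel; rewrite inE.
Qed.

Let kmap1 w : kmap_measure w setT = 1.
Proof. exact: (@prob_kernel _ _ _ _ _ k w). Qed.

Definition kmap : R.-pker W ~> Z := mkker measurable_kmap kmap1.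

Lemma kmapE w U : kmap w U = k w [set y | U (f (w, y))]. Proof. by []. Qed.

Lemma integral_kmap w (g : Z -> \bar R) : measurable_fun setT g ->
  (k w).-integrable setT (fun y => g (f (w, y))) ->
  \int[kmap w]_z g z = \int[k w]_y g (f (w, y)).
Proof. by move=> mg ig; exact: (integral_pushforward (mfw w) mg (D := setT)). Qed.

Lemma ge0_integral_kmap w (g : Z -> \bar R) : measurable_fun setT g ->
  (forall z, 0 <= g z) -> \int[kmap w]_z g z = \int[k w]_y g (f (w, y)).
Proof. by move=> mg g0; exact: (ge0_integral_pushforward (mfw w)). Qed.

End kmap.

Lemma measurable_pred d (X : measurableType d) (b : X -> bool) :
  measurable_fun setT b -> measurable [set x | b x].
Proof. by move=> mb; apply: (measurable_preimageT mb (Y := [set true])). Qed.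

(* A consistent family [p] of masses of the basic clopen sets is the law of the
   word whose basic sets are obtained by successive subdivisions of [0, 1[. *)
Section tree_law.
Context d (W : measurableType d) (R : realType).
Local Open Scope ring_scope.
Variable p : W -> seq bool -> R.
Hypotheses (mp : forall t, measurable_fun setT (p ^~ t)) (p0 : forall w t, 0 <= p w t)
  (p1 : forall w, p w [::] = 1)
  (pD : forall w t, p w t = p w (rcons t false) + p w (rcons t true)).

(** Left end of the interval of length [p w t] that belongs to [t]: each bit 1 skips the mass of the
    sibling that ends in 0. *)
Let lo w t := \sum_(i < size t) (if nth false t i then p w (rcons (take i t) false) else 0).

Let lo_rcons w t b : lo w (rcons t b) = lo w t + (if b then p w (rcons t false) else 0).
Proof.
rewrite /lo size_rcons big_ord_recr/=; congr (_ + _).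
  apply: eq_bigr => i _; rewrite nth_rcons ltn_ord; case: nth => //.
  by rewrite -[in take _ _](cats1 t b) takel_cat// ltnW.
by rewrite nth_rcons ltnn eqxx -[in take _ _](cats1 t b) take_size_cat.
Qed.

Let sub w u t : Prop := lo w t <= u < lo w t + p w t.

Let sub_rcons w u t b : sub w u (rcons t b) -> sub w u t.
Proof.
rewrite /sub lo_rcons (pD w t); case: b; have := p0 w (rcons t false);
  have := p0 w (rcons t true); rewrite ?addr0 => ? ? /andP[? ?]; apply/andP; split; lra.
Qed.

Let lo_bounds w t : 0 <= lo w t /\ lo w t + p w t <= 1.
Proof.
elim/last_ind: t => [|t b]; first by rewrite /lo big_ord0 p1 add0r.
rewrite lo_rcons (pD w t); have := p0 w (rcons t false); have := p0 w (rcons t true).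
by case: b; rewrite ?addr0 => ? ? [? ?]; split; lra.
Qed.

Let sub_inj w u s t : size s = size t -> sub w u s -> sub w u t -> s = t.
Proof.
elim/last_ind: s t => [|s b ih] t; first by case: t.
elim/last_ind: t => [|t c _]; first by rewrite size_rcons.
rewrite !size_rcons => -[st] us ut; have e := ih _ st (sub_rcons us) (sub_rcons ut).
move: us ut; rewrite /sub e !lo_rcons {e st ih}; case: b; case: c; rewrite ?addr0 // => /andP[? ?] /andP[? ?].
  by exfalso; lra.
by exfalso; lra.
Qed.

Let subS w u t : sub w u t -> sub w u (rcons t true) \/ sub w u (rcons t false).
Proof.
rewrite /sub !lo_rcons addr0 (pD w t) => /andP[h1 h2].
have [h|h] := leP (lo w t + p w (rcons t false)) u; [left|right]; apply/andP; split; lra.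
Qed.

(** The word drawn by a uniform [u] in [[0, 1[]: at each length exactly one interval contains [u],
    and [follow] descends along these. *)
Let path (wu : W * measurableTypeR R) : cantorM := follow (sub wu.1 wu.2) (fun=> true).

Let mlo t : measurable_fun setT (lo ^~ t).
Proof. by apply: measurable_sum => i; case: nth. Qed.

Let mpath : measurable_fun setT path.
Proof.
apply: measurable_follow => [t|]; last exact: measurable_cst.
have mf (f : W -> R) : measurable_fun setT f -> measurable_fun setT (f \o fst : W * measurableTypeR R -> R).
  by move=> h; exact: measurableT_comp.
apply: measurable_pred; apply: measurable_and.
  by apply: measurable_fun_ler; [exact: (mf (lo ^~ t) (mlo t))|exact: measurable_snd].
by apply: measurable_fun_ltr; [exact: measurable_snd|
  exact: (mf _ (measurable_funD (mlo t) (mp t)))].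
Qed.

Let unif_itv (a b : R) : 0 <= a -> a <= b -> b <= 1 ->
  uniform_prob (@ltr01 R) `[a, b[ = (b - a)%:E.
Proof.
move=> a0 ab b1; rewrite /uniform_prob integral_uniform_pdf setIidl; last first.
  by move=> x /=; rewrite !in_itv/= => /andP[? ?]; apply/andP; split; lra.
rewrite (eq_integral (cst 1%E)); last first.
  move=> x; rewrite inE/= in_itv/= => /andP[? ?].
  by rewrite /uniform_pdf ifT ?subr0 ?invr1//; apply/andP; split; lra.
rewrite integral_cst//= mul1e lebesgue_measure_itv/= lte_fin.
by have := ab; rewrite le_eqVlt => /orP[/eqP->|->]; rewrite ?ltxx ?subrr.
Qed.

Lemma tree_law : exists mu : R.-pker W ~> cantorM,
  forall w t, mu w [set d | agree (size t) d (word t)] = (p w t)%:E.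
Proof.
have [|w|k kE] := @kernel_exists _ _ W (measurableTypeR R) R
    (fun=> uniform_prob (@ltr01 R)).
- by move=> U mU; exact: measurable_cst.
- exact: (probability_setT (uniform_prob (@ltr01 R))).
exists (kmap k mpath) => w t; rewrite kmapE.
have [l0 l1] := lo_bounds w t.
pose E := [set u | agree (size t) (path (w, u)) (word t)].
have mE : measurable E.
  have mw : measurable_fun setT (fun u => path (w, u)).
    exact: (measurableT_comp mpath (measurable_pair1 w)).
  exact: (measurable_preimageT mw (measurable_agree (size t) (word t))).
(* Outside [[0, 1[] the path has no meaning, but the uniform law does not charge that set. *)
transitivity (k w (E `&` `[0, 1[)).
  rewrite -[LHS]/(k w E) (@measureDI _ _ _ (k w) E `[0, 1[ mE (measurable_itv _)).
  rewrite [X in (X + _)%E](_ : _ = 0%E) ?add0e//.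
  apply/eqP; rewrite eq_le measure_ge0 andbT.
  apply: (@le_trans _ _ (k w (~` `[0, 1[))).
      apply: le_measure; last by move=> u [].
      by rewrite inE; apply: measurableD.
    by rewrite inE; apply: measurableC.
    by rewrite kE [leLHS](probability_setC (uniform_prob (@ltr01 R)))//
      [X in (_ - X)%E](unif_itv (lexx 0) ler01 (lexx 1)) subr0 subee.
rewrite (_ : _ `&` _ = `[lo w t, lo w t + p w t[%classic).
  by rewrite kE [LHS](unif_itv l0 _ l1) ?lerDl// addrAC subrr add0r.
apply/seteqP; split=> u /=; rewrite !in_itv/=.
  move=> [Eu u01]; have su0 : sub w u [::] by rewrite /sub /lo big_ord0 p1 add0r.
  have := @follow_in (sub w u) (fun=> true) (size t) su0 (@subS w u).
  by rewrite ((pre_agree (size t) _ (word t)).2 Eu) pre_word.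
move=> sut; have u01 : sub w u [::].
  by rewrite /sub /lo big_ord0 p1 add0r; move: sut => /andP[? ?]; apply/andP; split; lra.
split; last by move: u01; rewrite /sub /lo big_ord0 p1 add0r.
apply/pre_agree; rewrite pre_word; apply: (@sub_inj w u) => //; first by rewrite size_pre.
exact: (@follow_in (sub w u) (fun=> true) (size t) u01 (@subS w u)).
Qed.

End tree_law.

(** * Minimax on the Cantor space *)

Section minimax.
Context (R : realType).
Local Open Scope ring_scope.

Definition avg (T : Type) (l : seq T) (f : T -> R) := (\sum_(i <- l) f i) / (size l)%:R.

Lemma avg_le (T : Type) (l : seq T) (f g : T -> R) :
  (forall i, f i <= g i) -> avg l f <= avg l g.
Proof. by move=> fg; rewrite /avg ler_wpM2r ?invr_ge0// ler_sum. Qed.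

Lemma avg_cst (T : Type) (l : seq T) (c : R) : l <> [::] -> avg l (fun=> c) = c.
Proof.
move=> l0; rewrite /avg big_const_seq count_predT iter_addr_0 -[c *+ _]mulr_natr mulfK//.
by rewrite pnatr_eq0; case: (l) l0.
Qed.

Lemma avgD (T : Type) (l : seq T) (f g : T -> R) :
  avg l (fun i => f i + g i) = avg l f + avg l g.
Proof. by rewrite /avg big_split/= mulrDl. Qed.

(* Blackwell approachability: if every mixture of columns has an answer, then
   answering the positive part of the cumulated deficits keeps the sum of their
   squares at most linear in the number of rounds. *)
Lemma finite_minimax (I J : finType) (i0 : I) (H : I -> J -> R) (v : R) :
  (exists y : J -> R, [/\ forall j, 0 <= y j, \sum_j y j = 1 &
    forall i, \sum_j y j * H i j < v]) \/
  (forall e, 0 < e -> exists2 l : seq I, l <> [::] & forall j, v - e <= avg l (H ^~ j)).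
Proof.
have [h|h] := EM (exists y : J -> R, [/\ forall j, 0 <= y j, \sum_j y j = 1 &
    forall i, \sum_j y j * H i j < v]); [by left|right => e e0].
have /choice[pk pkP] (y : J -> R) : exists i, (forall j, 0 <= y j) ->
    0 <= \sum_j y j * (H i j - v).
  have [y0|] := pselect (forall j, 0 <= y j); last by exists i0.
  set s := \sum_j y j; have s0 : 0 <= s by exact: sumr_ge0.
  have [sz|snz] := eqVneq s 0.
    exists i0 => _; apply: sumr_ge0 => j _.
    move/psumr_eq0P : sz => /(_ (fun j _ => y0 j)) ->//.
    by rewrite mul0r.
  apply: contrapT => /forallNP nh; apply: h; exists (fun j => y j / s); split.
  - by move=> j; rewrite divr_ge0.
  - by rewrite -mulr_suml divff.
  - move=> i; have : \sum_j y j * (H i j - v) < 0.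
      by rewrite ltNge; apply/negP => hh; apply: (nh i).
    under eq_bigr do rewrite mulrBr; rewrite sumrB -mulr_suml -/s subr_lt0 => lt.
    under eq_bigr do rewrite mulrAC; rewrite -mulr_suml.
    by rewrite ltr_pdivrMr 1?mulrC// lt_def snz.
pose def l j : R := Num.max 0 (- \sum_(i <- l) (H i j - v)).
pose st := fix st k := if k is m.+1 then pk (def (st m)) :: st m else [::].
pose B := \sum_i \sum_j (H i j - v) ^+ 2.
have def0 l j : 0 <= def l j by rewrite le_max lexx.
have bnd k : \sum_j def (st k) j ^+ 2 <= k%:R * B.
  elim: k => [|k ih].
    rewrite mul0r big1// => j _.
    by rewrite /def big_nil oppr0 maxxx expr0n.
  set i := pk (def (st k)).
  have stepj j : def (st k.+1) j ^+ 2 <= def (st k) j ^+ 2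
      - 2 * (def (st k) j * (H i j - v)) + (H i j - v) ^+ 2.
    rewrite /def /= big_cons -/i; set z := \sum_(i <- st k) _; set t := H i j - v.
    rewrite /Num.max; case: ifPn => h1; case: ifPn => h2; rewrite -?leNgt in h1 h2; nra.
  apply: (le_trans (ler_sum _ (fun j _ => stepj j))).
  rewrite big_split sumrB /= -mulr_sumr -natr1 mulrDl mul1r.
  have := pkP _ (def0 (st k)); rewrite -/i => ?.
  have : \sum_j (H i j - v) ^+ 2 <= B.
    by rewrite /B (bigD1 i)//= lerDl sumr_ge0// => i' _; rewrite sumr_ge0// => j _; exact: sqr_ge0.
  by lra.
have [k k0 kB] : exists2 k : nat, (0 < k)%N & B <= e ^+ 2 * k%:R.
  exists (Num.truncn (B / e ^+ 2)).+1 => //.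
  rewrite -ler_pdivrMl ?exprn_gt0// mulrC ltW//.
  exact: truncnS_gt.
have sz m : size (st m) = m by elim: m => //= m ->.
exists (st k); first by move=> s0; move: (sz k); rewrite s0 => k00; rewrite -k00 in k0.
move=> j; rewrite /avg sz ler_pdivlMr ?ltr0n//.
have -> : \sum_(i <- st k) H i j = \sum_(i <- st k) (H i j - v) + k%:R * v.
  by rewrite sumrB big_const_seq count_predT iter_addr_0 sz -[v *+ _]mulr_natl subrK.
have : def (st k) j <= e * k%:R.
  rewrite -ler_sqr ?nnegrE//; last by rewrite mulr_ge0// ltW.
  apply: (@le_trans _ _ (\sum_j def (st k) j ^+ 2)).
    by rewrite (bigD1 j)//= lerDl sumr_ge0// => j' _; exact: sqr_ge0.
  apply: (le_trans (bnd k)); rewrite exprMn [X in _ <= X]mulrC -mulrA.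
  have : 0 <= k%:R :> R by []. nra.
by rewrite /def ge_max => /andP[_]; nra.
Qed.

End minimax.

Lemma sum_lt_mix (R : realType) (J : finType) (z f g : J -> R) :
  (forall j, (0 <= z j)%R) -> (\sum_j z j = 1)%R -> (forall j, (f j < g j)%R) ->
  (\sum_j z j * f j < \sum_j z j * g j)%R.
Proof.
move=> z0 z1 fg; rewrite -subr_gt0 -sumrB.
under eq_bigr do rewrite -mulrBr.
rewrite lt_def sumr_ge0 ?andbT; last first.
  by move=> j _; rewrite mulr_ge0// subr_ge0 ltW.
rewrite psumr_neq0; last by move=> j _; rewrite mulr_ge0// subr_ge0 ltW.
have : (\sum_j z j != 0)%R by rewrite z1 oner_neq0.
rewrite psumr_neq0// => /hasP[j ji /= zj]; apply/hasP; exists j => //=.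
by rewrite mulr_gt0// subr_gt0.
Qed.

Section cantor_game.
Context (R : realType).
Local Open Scope ring_scope.
Implicit Type h : cantor -> cantor -> R.

Definition unif_cont h := forall e, 0 < e -> exists N, forall c c' d d',
  agree N c d -> agree N c' d' -> `|h c c' - h d d'| < e.

(** Mixed strategies are finite lists with repetition, played uniformly, and are tested against
    finite words only. Both range over countable types, so that a guarantee is a measurable event
    when [h] depends on a parameter. *)
Definition guarantee h (r : R) (l : seq (seq bool)) := l <> [::] /\
  forall s : seq bool, r <= avg l (fun t => h (word t) (word s)).

Definition game_val h := sup [set r | exists l, guarantee h r l].

Lemma unif_cont_bounded h : unif_cont h -> exists M, forall c c', `|h c c'| <= M.
Proof.
move=> /(_ 1 ltr01)[N hN].
exists (\sum_(s : N.-tuple bool) \sum_(t : N.-tuple bool) `|h (word s) (word t)| + 1) => c c'.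
have /ltW := hN _ _ _ _ (@agree_tpre N c) (@agree_tpre N c').
rewrite (bigD1 (tpre N c))//= (bigD1 (tpre N c'))//=.
set x := h c c'; set y := h _ _; set a := \sum_(_ | _) _; set b := \sum_(_ | _) _ => xy.
have a0 : 0 <= a by exact: sumr_ge0.
have b0 : 0 <= b by apply: sumr_ge0 => i _; exact: sumr_ge0.
have := ler_normD (x - y) y; rewrite subrK; lra.
Qed.

Lemma guarantee_ubound h : unif_cont h -> has_sup [set r | exists l, guarantee h r l].
Proof.
move=> /unif_cont_bounded[M hM]; split.
  exists (- M), [:: [::]]; split=> // s; rewrite -(@avg_cst R _ [:: [::] : seq bool] (- M))//.
  by apply: avg_le => t; have := hM (word t) (word s); rewrite ler_norml => /andP[].
exists M => r [l [l0 hr]]; rewrite -(@avg_cst R _ l M)//.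
apply: (le_trans (hr [::])); apply: avg_le => t.
by have := hM (word t) (word [::]); rewrite ler_norml => /andP[].
Qed.

Lemma discretize h (e : R) N (I := N.-tuple bool) (l : seq I) (v : R) :
  (forall c c' d d', agree N c d -> agree N c' d' -> `|h c c' - h d d'| < e) ->
  l <> [::] -> (forall j : I, v <= avg l (fun i : I => h (word i) (word j))) ->
  guarantee h (v - e) (map val l).
Proof.
move=> hN l0 hv; split; first by case: (l) l0.
move=> s; have sj := @agree_tpre N (word s).
have -> : avg (map val l) (fun t => h (word t) (word s)) =
    avg l (fun i : I => h (word i) (word s)) by rewrite /avg big_map size_map.
rewrite lerBlDr -(@avg_cst _ _ l e)// -avgD; apply: (le_trans (hv (tpre N (word s)))); apply: avg_le => i.
have := hN _ _ _ _ (@agree_refl _ N (word i)) sj; rewrite ltr_norml => /andP[]; lra.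
Qed.

Lemma unif_contN h : unif_cont h -> unif_cont (fun c c' => - h c' c).
Proof.
move=> uh e /uh[N hN]; exists N => c c' d d' cd cd'; rewrite -opprD normrN.
exact: hN.
Qed.

Lemma guarantee_val h e : unif_cont h -> 0 < e -> exists l, guarantee h (game_val h - e) l.
Proof.
move=> uh e0; have [r [l hl] lt] := sup_adherent e0 (guarantee_ubound uh).
by exists l; split; [exact: hl.1|move=> s; apply: le_trans (hl.2 s); exact: ltW].
Qed.

(** Uniform continuity reduces both players to words of a common length [N] at the price [e / 4].
    The finite game at the level [v], set [e / 2] above [game_val], either gives the list sought for
    the minimizer or a mixture of rows that beats [v], which is excluded. *)
Lemma minimax h e : unif_cont h -> 0 < e ->
  exists l, guarantee (fun c c' => - h c' c) (- game_val h - e) l.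
Proof.
move=> uh e0; have e4 : 0 < e / 4 by lra.
have [N hN] := uh _ e4; pose I := N.-tuple bool.
have e8 : 0 < e / 8 by lra.
have i0 : I by exact: [tuple of nseq N false].
pose v := game_val h + e / 2.
have [[y [y0 y1 yv]]|] := @finite_minimax R I I i0 (fun j i => - h (word i) (word j)) (- v); last first.
  move=> /(_ _ e4)[l l0 lv]; exists (map val l).
  have [|g0 gs] := @discretize (fun c c' => - h c' c) (e / 4) N l (- v - e / 4) _ l0 lv.
    by move=> c c' d d' cd cd'; rewrite -opprD normrN; exact: hN.
  by split=> // s; apply: le_trans (gs s); rewrite /v; lra.
(* The mixture [y] has real weights, whereas [game_val] is about lists. A mixture of columns that
   keeps every row under [v] contradicts [y] after exchanging the sums; so some list of rows secures
   [v - e / 8] on the grid and [v - 3 * e / 8] everywhere, which exceeds [game_val]. *)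
exfalso; have [[z [z0 z1 zv]]|] := @finite_minimax R I I i0 (fun i j => h (word i) (word j)) v.
  have : \sum_i y i * \sum_j z j * h (word i) (word j) <= \sum_i y i * v.
    by apply: ler_sum => i _; rewrite ler_wpM2l// ltW.
  rewrite -mulr_suml y1 mul1r leNgt => /negP; apply.
  under eq_bigr do rewrite mulr_sumr.
  rewrite exchange_big /=; under eq_bigr do under eq_bigr do rewrite mulrCA.
  under eq_bigr do rewrite -mulr_sumr.
  have -> : v = \sum_j z j * v by rewrite -mulr_suml z1 mul1r.
  apply: sum_lt_mix => // j.
  have := yv j; under eq_bigr do rewrite mulrN; rewrite sumrN; lra.
move=> /(_ _ e8)[l l0 lv]; have g := discretize hN l0 lv.
have : v - e / 8 - e / 4 <= game_val h.
  by apply: ub_le_sup; [exact: (guarantee_ubound uh).2|exists (map val l)].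
by rewrite /v; lra.
Qed.

End cantor_game.

Lemma measurable_lt d (X : measurableType d) (R : realType) (f : X -> R) :
  (forall r, measurable [set x | (f x < r)%R]) -> measurable_fun setT f.
Proof.
move=> h; apply: (@measurability _ _ _ (measurableTypeR R) setT _ (@RGenInftyO.G R)).
  exact: RGenInftyO.measurableE.
move=> _ [_ [r ->] <-]; rewrite setTI.
rewrite (_ : f @^-1` _ = [set x | (f x < r)%R])//.
Qed.

Lemma measurable_gt d (X : measurableType d) (R : realType) (f : X -> R) :
  (forall r, measurable [set x | (r < f x)%R]) -> measurable_fun setT f.
Proof.
move=> h; rewrite (_ : f = (fun x => - - f x)%R); last by apply/funext => x; rewrite opprK.
apply: measurableT_comp => //; apply: measurable_lt => r.
rewrite (_ : [set x | _] = [set x | (- r < f x)%R])//.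
by apply/seteqP; split=> x /=; rewrite ltrNl.
Qed.

Lemma bounded_integrable d (X : measurableType d) (R : realType)
    (mu : {measure set X -> \bar R}) (f : X -> R) M :
  mu setT < +oo -> measurable_fun setT f -> (forall x, (`|f x| <= M)%R) ->
  mu.-integrable setT (EFin \o f).
Proof.
move=> mu1 mf fM; apply: measurable_bounded_integrable => //.
by exists M; split; [exact: num_real|move=> N MN x _; exact: le_trans (fM x) (ltW MN)].
Qed.

Lemma pker_lty d d' (X : measurableType d) (Y : measurableType d') (R : realType)
  (k : R.-pker X ~> Y) x : k x setT < +oo.
Proof. by rewrite prob_kernel ltry. Qed.

Lemma integral_pker_cst d d' (X : measurableType d) (Y : measurableType d')
  (R : realType) (k : R.-pker X ~> Y) x (r : R) : \int[k x]_y r%:E = r%:E.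
Proof. by rewrite integral_cst// prob_kernel mule1. Qed.

Lemma integrable_pker_cst d d' (X : measurableType d) (Y : measurableType d')
  (R : realType) (k : R.-pker X ~> Y) x (r : R) :
  (k x).-integrable setT (EFin \o (fun=> r)).
Proof. exact: (bounded_integrable (pker_lty k x) (measurable_cst _) (M := `|r|%R)). Qed.

(** * Measurable limits of almost optimal strategies *)

Section limit_kernel.
Context d (W : measurableType d) (R : realType).
Local Open Scope ring_scope.
Variable h : W -> cantor -> cantor -> R.
Hypothesis mh : forall c c', measurable_fun setT (fun w => h w c c').
Hypothesis uh : forall w, unif_cont (h w).
Variable v : W -> R.
Hypothesis mv : measurable_fun setT v.
Hypothesis hv : forall w e, 0 < e -> exists l, guarantee (h w) (v w - e) l.

Let freq (l : seq (seq bool)) (t : seq bool) : R :=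
  avg l (fun s => (pre (word s) (size t) == t)%:R).

Let cut n : seq bool * rat := odflt ([::], 0) (unpickle n).

Let cut_onto tq : exists n, cut n = tq.
Proof. by exists (pickle tq); rewrite /cut pickleK. Qed.

(** Bit [i] tells on which side of a rational the frequency of a prefix lies. A string is kept when,
    for every [n], some list that is optimal up to [1 / n.+1] has these bits. Following this tree
    selects a limit of almost optimal lists by countably many measurable decisions, in place of a
    weak compactness argument. *)
Let good w (s : seq bool) := forall n, exists l, guarantee (h w) (v w - n.+1%:R^-1) l /\
  forall i, (i < size s)%N -> (freq l (cut i).1 <= ratr (cut i).2) = word s i.

Let good0 w : good w [::].
Proof.
move=> n; have [|l hl] := @hv w n.+1%:R^-1; first by rewrite invr_gt0.
by exists l.
Qed.

Let goodS w s : good w s -> good w (rcons s true) \/ good w (rcons s false).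
Proof.
move=> gs; apply: contrapT => /not_orP[/existsNP[n1 h1] /existsNP[n2 h2]].
have [l [[l0 gl] sl]] := gs (maxn n1 n2).
have main b n : (n <= maxn n1 n2)%N -> (freq l (cut (size s)).1 <= ratr (cut (size s)).2) = b ->
    exists l, guarantee (h w) (v w - n.+1%:R^-1) l /\ forall i, (i < size (rcons s b))%N ->
      (freq l (cut i).1 <= ratr (cut i).2) = word (rcons s b) i.
  move=> nn e; exists l; split; first split=> // t.
    by apply: le_trans (gl t); rewrite lerD2l lerN2 lef_pV2 ?posrE// ler_nat.
  move=> i; rewrite size_rcons ltnS leq_eqVlt /word nth_rcons => /orP[/eqP->|is_].
    by rewrite ltnn eqxx.
  by rewrite is_ sl.
case e : (freq l (cut (size s)).1 <= ratr (cut (size s)).2).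
  by apply: h1; apply: main => //; exact: leq_maxl.
by apply: h2; apply: main => //; exact: leq_maxr.
Qed.

Let bits w : cantor := follow (good w) (fun=> true).

Let approx w k : exists l, guarantee (h w) (v w - k.+1%:R^-1) l /\
  forall i, (i < k)%N -> (freq l (cut i).1 <= ratr (cut i).2) = bits w i.
Proof.
have [l [gl sl]] := @follow_in (good w) (fun=> true) k (good0 w) (@goodS w) k.
exists l; split=> // i ik; rewrite sl ?size_pre// /word /pre nth_mkseq//.
Qed.

(** The number whose cut the bits record. It is the limit of the frequencies along lists that agree
    with longer and longer prefixes of [bits w]. *)
Let mass w t := inf [set x : R | exists i, [/\ (cut i).1 = t, bits w i & x = ratr (cut i).2]].

Let freq_ge0 l t : 0 <= freq l t.
Proof. by rewrite /freq /avg mulr_ge0 ?invr_ge0// sumr_ge0. Qed.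

Let freq_le1 l t : l <> [::] -> freq l t <= 1.
Proof. by move=> l0; rewrite -(@avg_cst R _ l 1)//; apply: avg_le => s; case: (_ == _). Qed.

Let mass_inf w t : has_inf [set x : R | exists i, [/\ (cut i).1 = t, bits w i & x = ratr (cut i).2]].
Proof.
split.
  have [i ci] := cut_onto (t, 1); exists 1, i; rewrite ci /= rmorph1; split=> //.
  have [l [[l0 _] <-]] := approx w i.+1; rewrite ?ltnS// ci /= rmorph1.
  exact: freq_le1.
exists 0 => _ [i [_ bi ->]]; have [l [_ /(_ i (ltnSn i))]] := approx w i.+1.
by rewrite bi => /(le_trans (freq_ge0 _ _)).
Qed.

Let cvg_freq w (l_ : nat -> seq (seq bool)) t :
  (forall k i, (i < k)%N -> (freq (l_ k) (cut i).1 <= ratr (cut i).2) = bits w i) ->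
  (fun k => freq (l_ k) t) @ \oo --> mass w t.
Proof.
move=> hl; apply/cvgrPdist_le => e e0.
have [_ [i [ci bi ->]] lt1] := inf_adherent e0 (mass_inf w t).
have [q] := @rat_in_itvoo _ (mass w t - e) (mass w t) ltac:(by rewrite ltrBlDr ltrDl).
rewrite in_itv/= => /andP[q1 q2]; have [j cj] := cut_onto (t, q).
have bj : bits w j = false.
  apply/negP => bj; move: q2; rewrite ltNge => /negP; apply.
  by apply: ge_inf; [exact: (mass_inf w t).2|exists j; rewrite cj].
exists (maxn i j).+1 => // k /=; rewrite gtn_max => /andP[ik jk].
have := hl k i ik; have := hl k j jk; rewrite bi bj ci cj /= => /negbT.
rewrite -ltNge -/(mass w t) in lt1 * => f1 f2.
rewrite ler_norml; apply/andP; split; first by rewrite lerBrDl; lra.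
by lra.
Qed.

Let mass_exists w : exists l_ : nat -> seq (seq bool),
  [/\ forall k, guarantee (h w) (v w - k.+1%:R^-1) (l_ k) &
      forall t, (fun k => freq (l_ k) t) @ \oo --> mass w t].
Proof.
have /choice[l_ hl] := approx w; exists l_; split=> [k|t]; first by have [] := hl k.
by apply: cvg_freq => k; have [] := hl k.
Qed.

Let mass_ge0 w t : 0 <= mass w t.
Proof.
have [l_ [_ /(_ t) cl]] := mass_exists w.
apply: ler_cvg_to (@cvg_cst _ (0 : R) _ \oo _) cl _; near=> k; exact: freq_ge0.
Unshelve. all: by end_near. Qed.

Let mass1 w : mass w [::] = 1.
Proof.
have [l_ [gl /(_ [::]) cl]] := mass_exists w.
rewrite -(cvg_lim (@Rhausdorff R) cl); apply: lim_near_cst => //; near=> k.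
by have [lk _] := gl k; rewrite -(@avg_cst R _ (l_ k) 1)//.
Unshelve. all: by end_near. Qed.

Let massD w t : mass w t = mass w (rcons t false) + mass w (rcons t true).
Proof.
have [l_ [gl cl]] := mass_exists w.
rewrite -(cvg_lim (@Rhausdorff R) (cl t)); apply/cvg_lim => //.
have -> : (fun k => freq (l_ k) t) =
    (fun k => freq (l_ k) (rcons t false)) \+ (fun k => freq (l_ k) (rcons t true)).
  apply/funext => k; rewrite /= /freq -avgD; congr (_ / _).
  apply: eq_bigr => s _; rewrite !size_rcons preS !eqseq_rcons.
  by case: (_ == t); case: (word s (size t)); rewrite ?addr0 ?add0r.
exact: cvgD (cl (rcons t false)) (cl (rcons t true)).
Qed.

Let measurable_guarantee r l : measurable [set w | guarantee (h w) (v w - r) l].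
Proof.
apply: measurable_conj => _; apply: measurable_forall => s; apply: measurable_pred.
apply: measurable_fun_ler; first exact: measurable_funB.
by apply: measurable_funM => //; apply: measurable_sum => t.
Qed.

Let measurable_bits : measurable_fun setT (bits : W -> cantorM).
Proof.
apply: measurable_follow => [s|]; last exact: measurable_cst.
apply: measurable_forall => n; apply: measurable_exists => l.
under eq_set do rewrite andC; apply: measurable_conj => _; exact: measurable_guarantee.
Qed.

Let measurable_mass t : measurable_fun setT (mass ^~ t).
Proof.
apply: measurable_lt => r.
rewrite (_ : [set x | _] = [set w | exists i, ((cut i).1 = t /\ ratr (cut i).2 < r) /\ bit i (bits w)]).
  apply: measurable_exists => i; apply: measurable_conj => _.
  exact: (measurable_preimageT measurable_bits (measurable_bit i)).
apply/seteqP; split=> w /=.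
  by move=> /(inf_lt (mass_inf w t).1)[_ [i [ci bi ->]] lt]; exists i.
move=> [i [[ci lt] bi]]; apply: le_lt_trans lt; apply: ge_inf; first exact: (mass_inf w t).2.
by exists i.
Qed.

(** The masses of clopen sets are limits of frequencies, and by uniform continuity the payoff is
    within [e / 2] of [G], a combination of finitely many clopen indicators. The guarantee of the
    lists thus passes to the limit, with one [e / 2] lost on the lists and one on the limit law. *)
Lemma limit_kernel : exists mu : R.-pker W ~> cantorM,
  forall w c', ((v w)%:E <= \int[mu w]_c (h w c c')%:E)%E.
Proof.
have [mu muE] := tree_law measurable_mass mass_ge0 mass1 massD.
exists mu => w c'; apply/lee_addgt0Pr => e e0.
have [N hN] := uh w (divr_gt0 e0 (ltr0n R 2)); pose I := N.-tuple bool.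
pose g c := h w c c'.
have mg : measurable_fun setT (g : cantorM -> R).
  apply: measurable_lt => r.
  rewrite (_ : [set x | _] = [set c | exists s : seq bool,
      (forall d, agree (size s) d (word s) -> g d < r) /\ agree (size s) c (word s)]).
    apply: measurable_exists => s; apply: measurable_conj => _; exact: measurable_agree.
  apply/seteqP; split=> c /=; last by move=> [s [hs] /hs].
  rewrite -subr_gt0 => /(uh w)[M hM]; exists (pre c M); rewrite size_pre.
  have cM : agree M c (word (pre c M)) by move=> i iM; rewrite /word nth_mkseq.
  split=> // d' dM; have := hM d' c' c c' _ (@agree_refl _ _ _).
  have dc : agree M d' c by move=> i iM; rewrite dM// cM.
  by move=> /(_ dc); rewrite ltr_norml => /andP[]; rewrite /g; lra.
pose G c := \sum_(t : I) h w (word t) c' * (pre c N == t)%:R.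
have GE c : G c = h w (word (tpre N c)) c'.
  rewrite /G (bigD1 (tpre N c))//= val_tcast eqxx mulr1 big1 ?addr0// => t tc.
  rewrite (_ : _ == _ = false) ?mulr0//; apply: contraNF tc => /eqP e'.
  by apply/eqP/val_inj; rewrite /= val_tcast.
have Gg c : `|g c - G c| < e / 2.
  by rewrite GE; apply: hN => //; exact: agree_tpre.
pose S := \sum_(t : I) h w (word t) c' * mass w t.
have vS : v w <= S + e / 2.
  have [l_ [gl cl]] := mass_exists w.
  have cS : (fun k => \sum_(t : I) h w (word t) c' * freq (l_ k) t) @ \oo --> S.
    by apply: cvg_big => [|t _]; [exact: add_continuous|apply: cvgMr; exact: cl].
  have cv : (fun k => v w - k.+1%:R^-1 - e / 2) @ \oo --> v w - 0 - e / 2.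
    by apply: cvgB; [apply: cvgB; [exact: cvg_cst|exact: cvg_harmonic]|exact: cvg_cst].
  suff : v w - 0 - e / 2 <= S by lra.
  apply: ler_cvg_to cv cS _; near=> k; have [l0 /(_ (tpre N c')) vk] := gl k.
  rewrite lerBlDr; apply: le_trans vk _.
  have -> : \sum_(t : I) h w (word t) c' * freq (l_ k) t = avg (l_ k) (fun s => G (word s)).
    rewrite /avg /G exchange_big mulr_suml; apply: eq_bigr => t _.
    by rewrite /freq /avg mulrA mulr_sumr size_tuple.
  rewrite -[X in _ <= _ + X](@avg_cst R _ (l_ k) (e / 2))// -avgD; apply: avg_le => s.
  rewrite GE -lerBlDl; apply: le_trans (ler_norm _) _; apply/ltW/hN.
    exact: agree_tpre.
  by move=> i iN; rewrite (@agree_tpre N c' i iN).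
have iI (t : I) : (mu w).-integrable setT (fun c => (\1_[set d | agree N d (word t)] c)%:E).
  apply: (bounded_integrable (pker_lty mu w) (M := 1)).
    by apply: measurable_indic; exact: measurable_agree.
  by move=> c; rewrite indicE normr_nat; case: (_ \in _).
have GI : (EFin \o G) = (fun c => \sum_(t : I) (h w (word t) c')%:E *
    (\1_[set d | agree N d (word t)] c)%:E)%E.
  apply/funext => c /=; rewrite -sumEFin; apply: eq_bigr => t _; congr (_ * _)%:E.
  rewrite indicE; congr (_%:R); congr nat_of_bool.
  apply/idP/idP => [/eqP e'|].
    by rewrite inE /=; apply/pre_agree; rewrite e' pre_word_size ?size_tuple.
  by rewrite inE /= => /pre_agree ->; rewrite pre_word_size ?size_tuple.
have intG : (mu w).-integrable setT (EFin \o G).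
  by rewrite GI; apply: integrable_sum => // t _; exact: integrableZl.
have SE : (\int[mu w]_c (G c)%:E = S%:E)%E.
  rewrite -[LHS]/(\int[mu w]_c (EFin \o G) c)%E GI integral_sum//; last by move=> t; exact: integrableZl.
  rewrite -sumEFin; apply: eq_bigr => t _; rewrite integralZl// integral_indic//.
    by rewrite setIT -{2}(size_tuple t) muE EFinM.
  exact: measurable_agree.
have [M hM] := unif_cont_bounded (uh w).
have intg : (mu w).-integrable setT (EFin \o g).
  by apply: (bounded_integrable (pker_lty mu w) mg (M := M)) => c; exact: hM.
apply: (@le_trans _ _ (\int[mu w]_c (G c)%:E + (e / 2)%:E)%E).
  by rewrite SE -EFinD lee_fin.
rewrite {2}(splitr e) EFinD addeA leeD2r//.
rewrite -(integral_pker_cst mu w (e / 2)) -integralD_EFin//; last first.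
  exact: integrable_pker_cst.
apply: le_integral => //.
  apply: (integrableD measurableT intg); exact: integrable_pker_cst.
move=> c _; rewrite /= -[h w c c']/(g c) lee_fin; have := Gg c; rewrite ltr_norml => /andP[]; lra.
Unshelve. all: by end_near. Qed.

End limit_kernel.

(** * Measurable saddle points *)

Lemma within_near (X : topologicalType) (R : realType) (D : set X) (f : X -> R) x e :
  {within D, continuous f} -> D x -> (0 < e)%R ->
  \forall y \near x, D y -> (`|f x - f y| < e)%R.
Proof.
by move=> /subspace_continuousP cf Dx e0; have /cvgrPdist_lt/(_ _ e0) := cf x Dx.
Qed.

Lemma integral_kmap_in d d' d'' (W : measurableType d) (Y : measurableType d')
    (X : measurableType d'') (R : realType) (k : R.-pker W ~> Y) (g : W * Y -> X)
    (mg : measurable_fun setT g) (D : set X) (f : X -> R) w M :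
  measurable D -> measurable_fun D f -> (forall c, D (g (w, c))) ->
  (forall c, (`|f (g (w, c))| <= M)%R) ->
  \int[kmap k mg w]_(a in D) (f a)%:E = \int[k w]_c (f (g (w, c)))%:E.
Proof.
move=> mD mf Dg fM.
have mfD : measurable_fun setT (f \_ D) by apply/(measurable_restrictT _ mD).
have e : (fun c => ((f \_ D) (g (w, c)))) = (fun c => f (g (w, c))).
  by apply/funext => c; rewrite patchE mem_set.
rewrite integral_mkcond restrict_EFin integral_kmap.
- by apply: eq_integral => c _; rewrite /= -[RHS]/(((fun c => f (g (w, c))) c)%:E) -e.
- exact/measurable_EFinP.
- apply: (bounded_integrable (f := fun c => (f \_ D) (g (w, c))) (pker_lty k w) (M := M)).
    exact: (measurableT_comp mfD (measurableT_comp mg (measurable_pair1 w))).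
  by move=> c; rewrite -[X in `|X|%R]/((fun c => (f \_ D) (g (w, c))) c) e.
Qed.

Section saddle.
Context d dZ (W : measurableType d) (Z : measurableType dZ) (R : realType)
  (A B : ptopologicalType).
Local Open Scope ring_scope.
Hypotheses (borelA : borel_space R A) (borelB : borel_space R B) (sZ : standard_borel Z).
Variables (KA : set (Z * borel A)) (KB : set (Z * borel B)).
Hypotheses (mKA : measurable KA) (mKB : measurable KB)
  (cKA : forall z, compact ([set a | KA (z, a)] : set A))
  (cKB : forall z, compact ([set b | KB (z, b)] : set B))
  (KA0 : forall z, exists a, KA (z, a)) (KB0 : forall z, exists b, KB (z, b)).
Variables (sg : W -> Z) (msg : measurable_fun setT sg).
Variable h : W -> A -> B -> R.
Hypothesis hc : forall w, {within [set ab | KA (sg w, ab.1) /\ KB (sg w, ab.2)],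
  continuous ((fun ab => h w ab.1 ab.2) : A * B -> R)}.
Hypothesis mh : forall (al : W -> borel A) (be : W -> borel B),
  measurable_fun setT al -> measurable_fun setT be ->
  (forall w, KA (sg w, al w)) -> (forall w, KB (sg w, be w)) ->
  measurable_fun setT (fun w => h w (al w) (be w)).
Hypothesis mhA : forall w b, KB (sg w, b) ->
  measurable_fun ([set a | KA (sg w, a)] : set (borel A)) (h w ^~ b).
Hypothesis mhB : forall w a, KA (sg w, a) ->
  measurable_fun ([set b | KB (sg w, b)] : set (borel B)) (h w a).

(* Pulls the game back to the Cantor space along [param]. *)
Lemma saddle_kernels : exists (v : W -> R) (phi : R.-pker W ~> borel A)
    (psi : R.-pker W ~> borel B),
  [/\ measurable_fun setT v,
      forall w, (phi w [set a | KA (sg w, a)] = 1)%E /\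
                (psi w [set b | KB (sg w, b)] = 1)%E,
      forall w b, KB (sg w, b) ->
        ((v w)%:E <= \int[phi w]_(a in [set a | KA (sg w, a)]) (h w a b)%:E)%E
    & forall w a, KA (sg w, a) ->
        (\int[psi w]_(b in [set b | KB (sg w, b)]) (h w a b)%:E <= (v w)%:E)%E].
Proof.
have [U [C cod]] := borel_space_coding borelA.
have [U' [C' cod']] := borel_space_coding borelB.
pose gA w := param U C KA (sg w); pose gB w := param U' C' KB (sg w).
have gAP w c : KA (sg w, gA w c) := (paramP cod cKA KA0 (sg w) c).1.
have gBP w c : KB (sg w, gB w c) := (paramP cod' cKB KB0 (sg w) c).1.
have msc : measurable_fun setT (fun wc : W * cantorM => (sg wc.1, wc.2)).
  by apply: measurable_fun_pair; [exact: measurableT_comp|exact: measurable_snd].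
have mgA : measurable_fun setT ((fun wc => gA wc.1 wc.2) : W * cantorM -> borel A).
  exact: (measurableT_comp (measurable_param cod sZ mKA cKA KA0) msc).
have mgB : measurable_fun setT ((fun wc => gB wc.1 wc.2) : W * cantorM -> borel B).
  exact: (measurableT_comp (measurable_param cod' sZ mKB cKB KB0) msc).
pose h' w c c' := h w (gA w c) (gB w c').
have uh w : unif_cont (h' w).
  (* Both arguments are merged into one binary sequence, and [bar] turns the local bounds that
     continuity gives into a common length of prefix. *)
  move=> e e0; pose H (m : cantor) := h' w (evens m) (odds m).
  have [s t Ps m m' ms ms'|m|N hN] := @bar (fun s => forall m m' : cantor,
      agree (size s) m (word s) -> agree (size s) m' (word s) -> `|H m - H m'| < e).
  - have le (x : cantor) : agree (size (s ++ t)) x (word (s ++ t)) -> agree (size s) x (word s).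
      move=> h1 i is_; rewrite h1 /word ?nth_cat ?is_// size_cat.
      by rewrite (leq_trans is_)// leq_addr.
    by apply: Ps; exact: le.
  - have Dm : [set ab : A * B | KA (sg w, ab.1) /\ KB (sg w, ab.2)] (gA w (evens m), gB w (odds m)).
      by split; [exact: gAP|exact: gBP].
    have [[V V'] [/= nV nV'] VP] := within_near (@hc w) Dm (divr_gt0 e0 (ltr0n R 2)).
    have [n nP] := param_cont cod cKA KA0 (open_interior V) (nbhs_singleton (nbhs_interior nV)).
    have [n' nP'] := param_cont cod' cKB KB0 (open_interior V') (nbhs_singleton (nbhs_interior nV')).
    exists (n + n').*2.+2; have close m1 : agree (n + n').*2.+2 m1 m -> `|H m - H m1| < e / 2.
      move=> ag; apply: (VP (gA w (evens m1), gB w (odds m1))); last by split; [exact: gAP|exact: gBP].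
      split; apply: interior_subset; [apply: nP|apply: nP'] => i ii; apply: ag;
        rewrite -!addnn; lia.
    rewrite size_pre => m1 m2 m1m m2m.
    have wm : agree (n + n').*2.+2 (word (pre m (n + n').*2.+2)) m.
      by move=> i ii; rewrite /word nth_mkseq.
    have := close m1 (fun i ii => etrans (m1m i ii) (wm i ii)).
    have := close m2 (fun i ii => etrans (m2m i ii) (wm i ii)).
    by rewrite !ltr_norml => /andP[? ?] /andP[? ?]; apply/andP; split; lra.
  - exists N => c c' x x' cx cx'.
    have wm : agree N (mix c c') (word (pre (mix c c') N)).
      by move=> i ii; rewrite /word nth_mkseq.
    have := hN (pre (mix c c') N) (size_pre _ _) (mix c c') (mix x x').
    rewrite /H !evens_mix !odds_mix size_pre; apply => // i iN.
    by rewrite -wm//; apply/esym/(agree_mix cx cx').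
have mh' c c' : measurable_fun setT (fun w => h' w c c').
  have mc (x : cantor) : measurable_fun setT ((fun w => (w, x)) : W -> W * cantorM).
    by apply: measurable_fun_pair; [exact: measurable_id|exact: measurable_cst].
  by apply: mh => //; [exact: (measurableT_comp mgA (mc c))|exact: (measurableT_comp mgB (mc c'))].
pose v w := game_val (h' w).
have mv : measurable_fun setT v.
  apply: measurable_gt => r.
  (* The value exceeds [r] exactly when some list guarantees more than [r] by a margin [1 / n.+1], a
     countable condition. *)
  rewrite (_ : [set x | _] = [set w | exists l, exists n : nat, guarantee (h' w) (r + n.+1%:R^-1) l]).
    apply: measurable_exists => l; apply: measurable_exists => n.
    apply: measurable_conj => _; apply: measurable_forall => s; apply: measurable_pred.
    apply: measurable_fun_ler; first exact: measurable_cst.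
    by apply: measurable_funM => //; apply: measurable_sum => t.
  apply/seteqP; split=> w /= => [rv|[l [n gl]]].
    have [r' [l gl] rr'] := sup_gt (guarantee_ubound (uh w)).1 rv.
    have [N _ hN] := near_infty_natSinv_lt (PosNum (ltac:(by rewrite subr_gt0) : 0 < r' - r)).
    exists l, N; split; first exact: gl.1.
    move=> s; apply: le_trans (gl.2 s); rewrite -lerBrDl; exact: ltW (hN N (leqnn N)).
  apply: (@lt_le_trans _ _ (r + n.+1%:R^-1)); first by rewrite ltrDl invr_gt0.
  by apply: ub_le_sup; [exact: (guarantee_ubound (uh w)).2|exists l].
have [|mu muP] := @limit_kernel _ W R h' mh' uh v mv.
  by move=> w e e0; exact: guarantee_val.
have [||||nu nuP] := @limit_kernel _ W R (fun w c c' => - h' w c' c) _ _ (fun w => - v w).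
- by move=> c c'; exact: measurableT_comp.
- by move=> w; exact: unif_contN.
- exact: measurableT_comp.
- by move=> w e e0; exact: minimax.
have bnd w : exists M, forall c c', `|h' w c c'| <= M by exact: unif_cont_bounded.
have mKAw w : measurable ([set a | KA (sg w, a)] : set (borel A)).
  by have := measurable_xsection (sg w) mKA; rewrite /xsection; under eq_set do rewrite in_setE.
have mKBw w : measurable ([set b | KB (sg w, b)] : set (borel B)).
  by have := measurable_xsection (sg w) mKB; rewrite /xsection; under eq_set do rewrite in_setE.
exists v, (kmap mu mgA), (kmap nu mgB); split=> //.
- move=> w; rewrite !kmapE; split.
    by rewrite (_ : [set y | _] = setT) ?prob_kernel//; apply/seteqP; split=> c //= _; exact: gAP.
  by rewrite (_ : [set y | _] = setT) ?prob_kernel//; apply/seteqP; split=> c //= _; exact: gBP.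
- move=> w b Kb; have [c' cb] := param_onto cod' cKB KB0 Kb.
  rewrite -cb -/(gB w c') {b Kb cb}; have [M hM] := bnd w.
  rewrite (@integral_kmap_in _ _ _ _ _ _ _ _ _ _ _ _ _ M)//; first exact: (muP w c').
  - by apply: mhA; exact: gBP.
  - by move=> c; exact: gAP.
  - by move=> c; exact: hM.
- move=> w a Ka; have [c ca] := param_onto cod cKA KA0 Ka.
  rewrite -ca -/(gA w c) {a Ka ca}; have [M hM] := bnd w.
  have mhw : measurable_fun ([set b | KB (sg w, b)] : set (borel B)) (h w (gA w c)).
    by apply: mhB; exact: gAP.
  rewrite (@integral_kmap_in _ _ _ _ _ _ _ _ _ _ _ _ _ M)//; last 2 first.
  - by move=> c'; exact: gBP.
  - by move=> c'; exact: hM.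
  have ih : (nu w).-integrable setT (fun c' => (h' w c c')%:E).
    apply: (bounded_integrable (pker_lty nu w) (M := M)) => //.
    have mc : measurable_fun setT (gB w : cantorM -> borel B).
      exact: (measurableT_comp mgB (measurable_pair1 w)).
    rewrite (_ : h' w c = ((h w (gA w c) \_ [set b | KB (sg w, b)]) \o gB w)).
      by apply: measurableT_comp mc; apply/(measurable_restrictT _ (mKBw w)).
    apply/funext => c' /=; rewrite patchE mem_set//; exact: gBP.
  have e : (\int[nu w]_c' (- h' w c c')%:E = - \int[nu w]_c' (h' w c c')%:E)%E.
    by rewrite -integralN//; exact: integrable_add_def.
  by have := nuP w c; rewrite e EFinN leeN2.
Qed.

End saddle.

(** * Integrals against signed measures with one negative atom *)

Section integral_eq_measurable.
Import HBNNSimple.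

(** The integral unfolds into suprema over simple functions, whose level sets are measurable. It may
    thus be computed for set functions that are not measures, such as the two variations. *)
Lemma integral_eq_measurable d (X : measurableType d) (R : realType)
    (m1 m2 : set X -> \bar R) (f : X -> \bar R) :
  (forall D, measurable D -> m1 D = m2 D) ->
  \int[m1]_x f x = \int[m2]_x f x.
Proof.
move=> m12; have e (h : {nnsfun X >-> R}) : sintegral m1 h = sintegral m2 h.
  by rewrite /sintegral; apply: eq_fsbigr => r _; rewrite m12.
by rewrite /integral; congr (ereal_sup _ - ereal_sup _);
  apply/seteqP; split=> _ [h hf <-]; exists h.
Qed.

End integral_eq_measurable.

Section one_atom.
Context d (X : measurableType d) (R : realType) (U : {measure set X -> \bar R}).
Hypothesis U1 : U setT = 1.
Variables (x0 : X) (c : R).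
Hypotheses (mx0 : measurable [set x0]) (c0 : (0 <= c)%R).
Variable nu : set X -> \bar R.
Hypothesis nuE : forall D, measurable D -> nu D = c%:E * (U D - \d_x0 D).

Let mC : measurable (~` [set x0]). Proof. exact: measurableC. Qed.
Let V : {measure set X -> \bar R} := mrestr U mC.
Let p : R := fine (U [set x0]).

Let U_le1 D : measurable D -> U D <= 1.
Proof. by move=> mD; rewrite -U1; apply: le_measure; rewrite ?inE. Qed.

Let p01 : (0 <= p <= 1)%R /\ U [set x0] = p%:E.
Proof.
have pE : U [set x0] = p%:E.
  by rewrite fineK// ge0_fin_numE// (le_lt_trans (U_le1 mx0)) ?ltry.
by rewrite -!lee_fin -pE measure_ge0/= U_le1.
Qed.

Let p0 : (0 <= p)%R. Proof. by have [/andP[]] := p01. Qed.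
Let q0 : (0 <= c * (1 - p))%R.
Proof. by have [/andP[? ?] _] := p01; rewrite mulr_ge0// subr_ge0. Qed.

Let VE D : measurable D -> exists2 v : R, (0 <= v)%R & V D = v%:E /\
  U D = (v + p * (x0 \in D)%:R)%:E.
Proof.
move=> mD; have Vf : V D \is a fin_num.
  rewrite ge0_fin_numE// (@le_lt_trans _ _ 1) ?ltry//.
  by apply: U_le1; exact: measurableI.
exists (fine (V D)); first by rewrite fine_ge0.
split; first by rewrite fineK.
rewrite (measureDI U mD mx0) EFinD fineK// /V/= /mrestr -setDE; congr (_ + _).
have [xD|xD] := boolP (x0 \in D).
  by rewrite setIC setIidl ?mulr1 ?p01.2// => y ->; exact: set_mem.
rewrite mulr0 (_ : _ `&` _ = set0) ?measure0//.
by rewrite -subset0 => y [Dy yx]; move: xD; rewrite -yx mem_set.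
Qed.

(** Jordan decomposition of a measure whose negative part sits at [x0]: the supremum is attained at
    [D] without [x0]. In [lowerE] it is attained at the singleton, with mass [c * (1 - p)]. *)
Let upperE D : measurable D -> upper_variation nu D = c%:E * V D.
Proof.
move=> mD; have mDx : measurable (D `\ x0) by exact: measurableD.
apply/eqP; rewrite eq_le; apply/andP; split; last first.
  apply: ereal_sup_ubound; exists (D `\ x0); first by split=> //; exact: subDsetl.
  by rewrite nuE// diracE memNset ?sube0// => -[_]; exact.
apply: ge_ereal_sup => _ [E [mE ED] <-]; rewrite nuE// lee_wpmul2l ?lee_fin//.
apply: (@le_trans _ _ (V E)); last by apply: le_measure; rewrite ?inE.
have [v v0 [-> ->]] := VE mE; rewrite diracE -EFinB lee_fin.
by have [/andP[? ?] _] := p01; case: (x0 \in E) => /=; lra.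
Qed.

Let lowerE D : measurable D -> lower_variation nu D = (c * (1 - p))%:E * \d_x0 D.
Proof.
move=> mD; have [/andP[_ p1] pE] := p01; apply/eqP; rewrite eq_le; apply/andP; split.
  apply: ge_ereal_sup => _ [E [mE ED] <-]; rewrite nuE//.
  have [v v0 [_ ->]] := VE mE; rewrite !diracE -EFinB -!EFinM -EFinN lee_fin -mulrN -mulrA.
  rewrite ler_wpM2l//; have [xE|xE] := boolP (x0 \in E).
    by rewrite (_ : x0 \in D) /=; [lra|exact/mem_set/ED/set_mem].
  by case: (x0 \in D) => /=; lra.
rewrite diracE; have [xD|xD] := boolP (x0 \in D); last first.
  rewrite mule0; apply: ereal_sup_ubound; exists set0.
    by split; [exact: measurable0|exact: sub0set].
  by rewrite nuE// diracE in_set0 measure0 sube0 mule0 oppe0.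
rewrite mule1; apply: ereal_sup_ubound; exists [set x0].
  by split=> // y ->; exact: set_mem.
by rewrite nuE// diracE mem_set// pE -EFinB -EFinM -EFinN -mulrN opprB.
Qed.

Lemma atom_integralE (f : X -> \bar R) : measurable_fun setT f ->
  (forall x, 0 <= f x) -> \int[U]_x f x = \int[V]_x f x + p%:E * f x0.
Proof.
move=> mf f0.
rewrite (@integral_eq_measurable _ _ _ _ (measure_add V (mscale (NngNum p0) (dirac x0)))).
  rewrite ge0_integral_measure_add// ge0_integral_mscale//= integral_dirac//.
  by rewrite diracT mul1e.
move=> D mD; have [v v0 [vE ->]] := VE mD.
rewrite measure_addE [X in X + _]vE EFinD EFinM /mscale/=; congr (_ + _ * _).
Qed.

Let upper_integralE (f : X -> \bar R) : measurable_fun setT f ->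
  \int[upper_variation nu]_x f x =
  c%:E * \int[V]_x f^\+ x - c%:E * \int[V]_x f^\- x.
Proof.
move=> mf; have mp := measurable_funepos mf; have mn := measurable_funeneg mf.
rewrite (@integral_eq_measurable _ _ _ _ (mscale (NngNum c0) V)).
  by rewrite [LHS]integralE !ge0_integral_mscale//=.
by move=> D mD; rewrite upperE.
Qed.

Let lower_integralE (f : X -> \bar R) : measurable_fun setT f ->
  \int[lower_variation nu]_x f x =
  (c * (1 - p))%:E * f^\+ x0 - (c * (1 - p))%:E * f^\- x0.
Proof.
move=> mf; have mp := measurable_funepos mf; have mn := measurable_funeneg mf.
rewrite (@integral_eq_measurable _ _ _ _ (mscale (NngNum q0) (dirac x0))).
  by rewrite integralE !ge0_integral_mscale//= !integral_dirac// diracT !mul1e.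
by move=> D mD; rewrite lowerE.
Qed.

Let fin_part (f : X -> R) : measurable_fun setT (EFin \o f) -> exists a b : R,
  [/\ (EFin \o f)^\+ x0 = a%:E, (EFin \o f)^\- x0 = b%:E, f x0 = (a - b)%R,
    \int[U]_x (EFin \o f)^\+ x = \int[V]_x (EFin \o f)^\+ x + p%:E * a%:E &
    \int[U]_x (EFin \o f)^\- x = \int[V]_x (EFin \o f)^\- x + p%:E * b%:E].
Proof.
move=> mf; have pE : (EFin \o f)^\+ x0 = (Num.max (f x0) 0)%:E by rewrite funeposE EFin_max.
have nE : (EFin \o f)^\- x0 = (Num.max (- f x0) 0)%:E by rewrite funenegE EFin_max.
exists (Num.max (f x0) 0)%R, (Num.max (- f x0) 0)%R; split=> //.
- by rewrite /Num.max; case: ifPn => ?; case: ifPn => ?; lra.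
- by rewrite -pE atom_integralE//; exact: measurable_funepos.
- by rewrite -nE atom_integralE//; exact: measurable_funeneg.
Qed.

Lemma signed_integralE (f : X -> R) : U.-integrable setT (EFin \o f) ->
  signed_integral nu (EFin \o f) = c%:E * (\int[U]_x (f x)%:E - (f x0)%:E).
Proof.
move=> /[dup] /integrableP[mf _] intf; have := integrable_pos_fin_num measurableT intf.
have := integrable_neg_fin_num measurableT intf.
rewrite /signed_integral upper_integralE// lower_integralE// [X in _ = _ * (X - _)]integralE.
have [a [b [-> -> fx -> ->]]] := fin_part mf.
have Vf (x y : \bar R) (r : R) : 0 <= x -> x + r%:E \is a fin_num -> exists z, x = z%:E.
  by case: x => // z; exists z.
have := integral_ge0 V (fun x _ => funeneg_ge0 (EFin \o f) x) (D := setT).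
have := integral_ge0 V (fun x _ => funepos_ge0 (EFin \o f) x) (D := setT).
rewrite -!EFinM => P0 N0 /(Vf _ 0 _ N0)[n ->] /(Vf _ 0 _ P0)[m ->].
by rewrite -!(EFinM, EFinB, EFinD) fx; congr (_%:E); lra.
Qed.

(** The negative part only charges [x0], where the integrand is finite, so an upper bound on the
    difference bounds the positive integral. In this way the drift conditions yield
    integrability. *)
Lemma signed_integral_integrable (f : X -> R) K : (0 < c)%R -> measurable_fun setT f ->
  (forall x, (0 <= f x)%R) -> signed_integral nu (EFin \o f) <= K%:E ->
  U.-integrable setT (EFin \o f).
Proof.
move=> c1 mf f0; have f0' x : 0 <= (EFin \o f) x by rewrite /= lee_fin.
have mf' : measurable_fun setT (EFin \o f) by exact/measurable_EFinP.
have fp : (EFin \o f)^\+ = EFin \o f by apply/funext => x; rewrite funeposE max_l.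
have fn : (EFin \o f)^\- = cst 0 by apply/funext => x; rewrite funenegE max_r// oppe_le0.
rewrite /signed_integral upper_integralE// lower_integralE// fp fn integral0 !mule0 !sube0.
move=> h; apply/integrableP; split=> //.
rewrite (eq_integral (EFin \o f)); last by move=> x _; rewrite /= ger0_norm.
rewrite atom_integralE//; have : c%:E * \int[V]_x (EFin \o f) x < +oo.
  by rewrite (@le_lt_trans _ _ (K%:E + (c * (1 - p) * f x0)%:E)) ?ltry// EFinM -leeBlDr.
have := integral_ge0 V (fun x _ => f0' x) (D := setT).
by case: (\int[V]_x _) => //= [r _ _|_]; rewrite ?ltry// gt0_muley// lte_fin.
Qed.

End one_atom.

(** * Uniformized transition kernel *)

(** The countably many sets [U i] of a coding separate points. *)
Lemma measurable_singleton (R : realType) (X : ptopologicalType) (x : X) :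
  borel_space R X -> measurable ([set x] : set (borel X)).
Proof.
move=> /borel_space_coding[U [C cod]].
have mU i : measurable (U i : set (borel X)).
  by apply: sub_sigma_algebra; exact: (coding_open cod).
rewrite (_ : [set x] = [set y : borel X | forall i, U i y <-> U i x]).
  apply: measurable_forall => i; have [Ux|nUx] := pselect (U i x).
    by rewrite (_ : [set y | _] = U i)//; apply/seteqP; split=> y; [case=> _; exact|].
  rewrite (_ : [set y | _] = ~` U i); first by apply: measurableC; exact: mU.
  by apply/seteqP; split=> y //= [h _] /h.
apply/seteqP; split=> y /= => [->//|h]; apply: (coding_inj cod _ (codes_encoding cod x)).
move=> i; rewrite /fits; case: asboolP => [/(h i).2 /(coding_sub cod)//|nU Uy].
by apply: nU; exact/h.
Qed.

Lemma measurable_inv d (X : measurableType d) (R : realType) (f : X -> R) :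
  (forall x, (0 < f x)%R) -> measurable_fun setT f ->
  measurable_fun setT (fun x => (f x)^-1%R).
Proof.
move=> f0 mf; apply: measurable_lt => r.
rewrite (_ : [set x | _] = [set x | (0 < r)%R /\ (r^-1 < f x)%R]).
  apply: measurable_conj => _; apply: measurable_pred.
  by apply: measurable_fun_ltr => //; exact: measurable_cst.
apply/seteqP; split=> x /= => [fr|[r0 rf]].
  have r0 : (0 < r)%R by rewrite (lt_trans _ fr)// invr_gt0.
  by split=> //; rewrite invf_plt ?posrE.
by rewrite invf_plt ?posrE.
Qed.

Section charge_measure.
Context d (X : measurableType d) (R : realType) (nu : {charge set X -> \bar R}).
Hypothesis nu0 : forall D, measurable D -> 0 <= nu D.

(** The maximum with 0 matters on nonmeasurable sets only, where the sign of a charge is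
    unconstrained. *)
Definition charge_pos of (forall D, measurable D -> 0 <= nu D) := fun D => maxe 0 (nu D).

Let charge_posE D : measurable D -> charge_pos nu0 D = nu D.
Proof. by move=> mD; rewrite /charge_pos max_r ?nu0. Qed.

Let charge_pos0 : charge_pos nu0 set0 = 0.
Proof. by rewrite charge_posE// charge0. Qed.

Let charge_pos_ge0 D : 0 <= charge_pos nu0 D.
Proof. by rewrite le_max lexx. Qed.

Let charge_pos_sigma_additive : semi_sigma_additive (charge_pos nu0).
Proof.
move=> F mF tF mUF; rewrite charge_posE//.
under eq_fun do under eq_bigr do rewrite charge_posE//.
exact: charge_semi_sigma_additive.
Qed.

HB.instance Definition _ := isMeasure.Build _ _ _ (charge_pos nu0)
  charge_pos0 charge_pos_ge0 charge_pos_sigma_additive.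

Lemma charge_measure : exists m : {measure set X -> \bar R},
  forall D, measurable D -> m D = nu D.
Proof. by exists (charge_pos nu0) => D mD; exact: charge_posE. Qed.

End charge_measure.

Record growth (R : realType) (S A B : ptopologicalType) (G : game R S A B)
    (V0 V1 : S -> R) (rho0 L0 M0 rho1 b1 M1 : R) : Prop := Growth {
  mV0 : measurable_fun [set: borel S] V0 ;
  V0_ge1 : forall x, (1 <= V0 x)%R ;
  rho0_gt0 : (0 < rho0)%R ;
  L0_gt0 : (0 < L0)%R ;
  M0_gt0 : (0 < M0)%R ;
  A1_drift : forall x a b, actA G x a -> actB G x b ->
    signed_integral (rate G x a b) (fun y => (V0 y)%:E) <= (rho0 * V0 x)%:E ;
  A1_rate : forall x, max_rate G x <= (L0 * V0 x)%:E ;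
  A1_payoff : forall x a b, actA G x a -> actB G x b ->
    (`|payoff G x a b| <= M0 + Num.sqrt 2 / 2 * Num.sqrt (ln (V0 x)))%R ;
  A1_terminal : forall x,
    (`|terminal G x| <= M0 + Num.sqrt 2 / 2 * Num.sqrt (ln (V0 x)))%R ;
  mV1 : measurable_fun [set: borel S] V1 ;
  V1_ge1 : forall x, (1 <= V1 x)%R ;
  rho1_gt0 : (0 < rho1)%R ;
  b1_gt0 : (0 < b1)%R ;
  M1_gt0 : (0 < M1)%R ;
  A2_drift : forall x a b, actA G x a -> actB G x b ->
    signed_integral (rate G x a b) (fun y => (V1 y ^+ 2)%:E) <=
      (rho1 * V1 x ^+ 2 + b1)%:E ;
  A2_weight : forall x, (V0 x ^+ 2 <= M1 * V1 x)%R ;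
  A3_compactA : forall x, compact (actA G x) ;
  A3_compactB : forall x, compact (actB G x) ;
  A3_rate : forall x (D : set (borel S)), measurable D ->
    {within actA G x `*` actB G x, continuous
      ((fun ab => rate G x ab.1 ab.2 D) : A * B -> \bar R)} ;
  A3_payoff : forall x, {within actA G x `*` actB G x, continuous
      ((fun ab => payoff G x ab.1 ab.2) : A * B -> R)} ;
  A3_drift : forall x, {within actA G x `*` actB G x, continuous
      ((fun ab => signed_integral (rate G x ab.1 ab.2) (fun y => (V0 y)%:E))
        : A * B -> \bar R)} }.

Section unif.
Context (R : realType) (S A B : ptopologicalType) (G : game R S A B)
  (V0 V1 : S -> R) (rho0 L0 M0 rho1 b1 M1 : R).
Hypothesis H : growth G V0 V1 rho0 L0 M0 rho1 b1 M1.

Notation K := (admissible (actA G) (actB G) : set (borel S * borel A * borel B)).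

Definition clock (x : S) : R := (L0 * V0 x)%R.

Lemma V0_gt0 x : (0 < V0 x)%R. Proof. by have := V0_ge1 H x; lra. Qed.

Lemma V1_gt0 x : (0 < V1 x)%R. Proof. by have := V1_ge1 H x; lra. Qed.

Lemma clock_gt0 x : (0 < clock x)%R.
Proof. by rewrite /clock mulr_gt0 ?(L0_gt0 H)// V0_gt0. Qed.

Lemma measurable_clock : measurable_fun setT (clock : borel S -> R).
Proof. by apply: measurable_funM => //; exact: (mV0 H). Qed.

(** The only negative contribution is that of the atom at [x], whose mass is at most [max_rate G x]
    in absolute value and hence at most [clock x]. *)
Let rate_ge x a b (D : set (borel S)) : actA G x a -> actB G x b -> measurable D ->
  0 <= \d_(x : borel S) D + (clock x)^-1%:E * rate G x a b D.
Proof.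
move=> Aa Bb mD; have c0 := clock_gt0 x.
have mx : measurable ([set x] : set (borel S)) := measurable_singleton x (borelS G).
have [xD|xD] := pselect (D x); last first.
  rewrite diracE memNset//= add0e; apply: mule_ge0; last exact: rate_ge0 xD.
  by rewrite lee_fin invr_ge0 ltW.
rewrite diracE mem_set//=.
have : - rate G x a b [set x] <= (clock x)%:E.
  by apply: le_trans (A1_rate H x); apply: ereal_sup_ubound; exists (a, b).
have : rate G x a b D = rate G x a b (D `\ x) + rate G x a b [set x].
  rewrite [in LHS](chargeDI _ mD mx); congr (_ + rate G x a b _).
  by apply/seteqP; split=> [y []//|y ->].
have : 0 <= rate G x a b (D `\ x).
  by apply: rate_ge0 => //; [exact: measurableD|move=> -[_]; exact].
have /fineK <- : rate G x a b (D `\ x) \is a fin_num.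
  by apply: fin_num_measure; exact: measurableD.
have /fineK <- : rate G x a b [set x] \is a fin_num by exact: fin_num_measure.
rewrite -EFinN !lee_fin => r0 -> rc; rewrite -!(EFinD, EFinM) lee_fin.
have : (- (clock x) <= fine (rate G x a b (D `\ x)) + fine (rate G x a b [set x]))%R by lra.
by rewrite -(ler_pM2l (_ : 0 < (clock x)^-1)%R) ?invr_gt0// mulrN mulVf ?gt_eqF//; lra.
Qed.

Lemma unif_exists : exists U : R.-pker (borel S * borel A * borel B)%type ~> borel S,
  forall x a b D, actA G x a -> actB G x b -> measurable D ->
    U (x, a, b) D = \d_(x : borel S) D + (clock x)^-1%:E * rate G x a b D.
Proof.
(* Off the admissible triples, where the rate is unconstrained, the kernel stays where it is. *)
have /choice[m mP] (z : borel S * borel A * borel B) : exists m : {measure set (borel S) -> \bar R},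
    forall D, measurable D -> m D = if `[< K z >]
      then \d_z.1.1 D + (clock z.1.1)^-1%:E * rate G z.1.1 z.1.2 z.2 D else \d_z.1.1 D.
  case: asboolP => [[Aa Bb]|_]; last by exists (dirac z.1.1).
  have := @charge_measure _ _ R (cadd (charge_of_finite_measure (dirac z.1.1))
    (cscale (clock z.1.1)^-1 (rate G z.1.1 z.1.2 z.2))).
  by apply=> D mD; exact: rate_ge.
have [|z|U UE] := kernel_exists (k := m).
- move=> D mD; rewrite [X in measurable_fun _ X](_ : _ = (fun z : borel S * borel A * borel B => if `[< K z >]
      then \d_z.1.1 D + (clock z.1.1)^-1%:E * rate G z.1.1 z.1.2 z.2 D
      else \d_z.1.1 D)); last by apply/funext => z; exact: mP.
  have mdir : measurable_fun setT (fun z : borel S * borel A * borel B => \d_z.1.1 D : \bar R).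
    apply: (measurableT_comp (f := fun x : borel S => \d_x D : \bar R)); last exact: measurableT_comp.
    under eq_fun do rewrite diracE -indicE.
    by apply/measurable_EFinP; exact: measurable_indic.
  apply: measurable_fun_if => //.
    apply: (measurable_fun_bool true); rewrite setTI.
    rewrite (_ : _ @^-1` _ = K); first exact: measurable_admissible.
    by apply/seteqP; split=> z /asboolP.
  rewrite setTI (_ : _ @^-1` _ = K); last by apply/seteqP; split=> z /asboolP.
  apply: emeasurable_funD; first exact: measurable_funTS.
  apply: emeasurable_funM; last exact: measurable_rate.
  apply: measurable_funTS; apply/measurable_EFinP.
  apply: (measurableT_comp (f := fun x : borel S => (clock x)^-1%R)); last exact: measurableT_comp.
    by apply: measurable_inv => [x|]; [exact: clock_gt0|exact: measurable_clock].
  exact: measurable_funTS mdir.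
- rewrite mP//; case: asboolP => [[Aa Bb]|_]; last by rewrite diracT.
  by rewrite diracT rate_conservative// mule0 adde0.
- exists U => x a b D Aa Bb mD; rewrite UE mP//; case: asboolP => // nK.
  by exfalso; apply: nK.
Qed.

End unif.

(** * The uniformized game *)

Lemma kernel_comp d1 d2 d3 (X : measurableType d1) (Y : measurableType d2)
    (Z : measurableType d3) (R : realType) (l : R.-pker X ~> Y) (k : R.-pker (X * Y)%type ~> Z) :
  exists j : R.-pker X ~> Z, forall x f, measurable_fun setT f -> (forall z, 0 <= f z) ->
    \int[j x]_z f z = \int[l x]_y \int[k (x, y)]_z f z.
Proof.
have [||j jE] := @kernel_exists _ _ X Z R (mkcomp l k).
- by move=> U mU; exact: KCOMP_FINITE_KERNEL.measurable_fun_kcomp_finite.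
- move=> x; rewrite /mkcomp /= /kcomp (eq_integral (cst 1)) ?integral_pker_cst// => y _.
  exact: prob_kernel.
exists j => x f mf f0; rewrite -integral_kcomp//; apply: integral_eq_measurable => D mD.
exact: jE.
Qed.

Lemma measurable_comp2 d d1 d2 d3 (W : measurableType d) (X : measurableType d1)
    (Y : measurableType d2) (Z : measurableType d3) (F : X -> Y -> Z) (f : W -> X) (g : W -> Y) :
  measurable_fun setT (fun p : X * Y => F p.1 p.2) -> measurable_fun setT f ->
  measurable_fun setT g -> measurable_fun setT (fun w => F (f w) (g w)).
Proof.
move=> mF mf mg; exact: (measurableT_comp mF (measurable_fun_pair mf mg)).
Qed.

Lemma measurable_integral d d' (X : measurableType d) (Y : measurableType d') (R : realType)
    (k : R.-pker X ~> Y) (f : X -> Y -> \bar R) :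
  measurable_fun setT (fun p : X * Y => f p.1 p.2) -> (forall x y, 0 <= f x y) ->
  measurable_fun setT (fun x => \int[k x]_y f x y).
Proof.
by move=> mf f0; apply: (measurable_fun_integral_finite_kernel (fun p => f p.1 p.2)).
Qed.

Section gain.
Context (R : realType) (S A B : ptopologicalType) (G : game R S A B)
  (V0 V1 : S -> R) (rho0 L0 M0 rho1 b1 M1 : R).
Hypothesis H : growth G V0 V1 rho0 L0 M0 rho1 b1 M1.
Local Open Scope ring_scope.

Notation SAB := (borel S * borel A * borel B)%type.
Notation K := (admissible (actA G) (actB G) : set SAB).
Notation clock := (clock V0 L0).

Definition unif : R.-pker SAB ~> borel S := projT1 (cid (unif_exists H)).

Lemma unifE x a b D : actA G x a -> actB G x b -> measurable D ->
  (unif (x, a, b) D = \d_(x : borel S) D + (clock x)^-1%:E * rate G x a b D)%E.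
Proof. exact: (projT2 (cid (unif_exists H))). Qed.

Lemma rate_unif x a b D : actA G x a -> actB G x b -> measurable D ->
  (rate G x a b D = (clock x)%:E * (unif (x, a, b) D - \d_(x : borel S) D))%E.
Proof.
move=> Aa Bb mD; rewrite unifE//.
have /fineK <- : rate G x a b D \is a fin_num by exact: fin_num_measure.
rewrite diracE -!(EFinM, EFinD, EFinB) addrC addKr mulrA mulfV ?mul1r//.
by rewrite gt_eqF ?(clock_gt0 H).
Qed.

Definition mean (f : S -> R) (z : SAB) : R := \int[unif z]_y f y.

Definition dominated (f : S -> R) C := measurable_fun [set: borel S] f /\
  forall y, `|f y| <= C * V0 y.

Lemma integrable_dominated (mu : {measure set (borel S) -> \bar R}) f C :
  mu.-integrable setT (EFin \o V0) -> dominated f C -> mu.-integrable setT (EFin \o f).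
Proof.
move=> iV [mf fC]; apply: (le_integrable measurableT) (integrableZl measurableT C iV).
  exact/measurable_EFinP.
move=> y _ /=; rewrite lee_fin (le_trans (fC y))//; exact: ler_norm.
Qed.

Lemma dominated_ge0 f C (x : S) : dominated f C -> 0 <= C.
Proof.
move=> [_ /(_ x) h]; have := V0_gt0 H x; have := normr_ge0 (f x) => ? V.
by rewrite -(pmulr_lge0 _ V); lra.
Qed.

Section at_actions.
Variables (x : S) (a : A) (b : B).
Hypotheses (Aa : actA G x a) (Bb : actB G x b).
Let z : SAB := (x, a, b).

Lemma signed_unif f : (unif z).-integrable setT (EFin \o f) ->
  signed_integral (rate G x a b) (EFin \o f) = (clock x * (mean f z - f x))%:E.
Proof.
move=> fi; rewrite (@signed_integralE _ _ _ (unif z) (prob_kernel z) (x : borel S) (clock x)) //.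
- by rewrite [RHS]EFinM EFinB /mean /Rintegral fineK//; exact: integrable_fin_num fi.
- exact: measurable_singleton (borelS G).
- by rewrite ltW ?(clock_gt0 H).
- by move=> D mD; exact: rate_unif.
Qed.

Lemma integrable_unif (f : S -> R) (k : R) : measurable_fun [set: borel S] f -> (forall y, 0 <= f y) ->
  (signed_integral (rate G x a b) (EFin \o f) <= k%:E)%E ->
  (unif z).-integrable setT (EFin \o f) /\ clock x * (mean f z - f x) <= k.
Proof.
move=> mf f0 fk; have fi : (unif z).-integrable setT (EFin \o f).
  apply: (@signed_integral_integrable _ _ _ (unif z) (prob_kernel z) (x : borel S) (clock x)
    _ _ (rate G x a b) _ f k) => //.
  - exact: measurable_singleton (borelS G).
  - by rewrite ltW ?(clock_gt0 H).
  - by move=> D mD; exact: rate_unif.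
  - exact: clock_gt0 H x.
by split=> //; rewrite -lee_fin -signed_unif.
Qed.

Lemma integrable_V0 : (unif z).-integrable setT (EFin \o V0) /\
  clock x * (mean V0 z - V0 x) <= rho0 * V0 x.
Proof.
apply: integrable_unif (mV0 H) _ _ => [y|]; first exact: ltW (V0_gt0 H y).
exact: (A1_drift H).
Qed.

Lemma integrable_V1 : (unif z).-integrable setT (EFin \o (fun y => V1 y ^+ 2)) /\
  clock x * (mean (fun y => V1 y ^+ 2) z - V1 x ^+ 2) <= rho1 * V1 x ^+ 2 + b1.
Proof.
apply: integrable_unif => [|y|]; first exact: measurable_funX (mV1 H).
  exact: sqr_ge0.
exact: (A2_drift H).
Qed.

Lemma unif_integrable f C : dominated f C -> (unif z).-integrable setT (EFin \o f).
Proof. by apply: integrable_dominated; have [] := integrable_V0. Qed.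

Lemma mean_le f g C C' : dominated f C -> dominated g C' -> (forall y, f y <= g y) ->
  mean f z <= mean g z.
Proof. move=> df dg fg; apply: le_Rintegral => //; first exact: (unif_integrable df).
exact: (unif_integrable dg). Qed.

Lemma meanD f g C C' c : dominated f C -> dominated g C' ->
  mean (fun y => f y + c * g y) z = mean f z + c * mean g z.
Proof.
move=> df dg; have fi := unif_integrable df; have gi := unif_integrable dg.
by rewrite /mean RintegralD// ?RintegralZl//; exact: (integrableZl measurableT c gi).
Qed.

Lemma dominated_V0 : dominated V0 1.
Proof. by split=> [|y]; [exact: mV0 H|rewrite mul1r ger0_norm// ltW ?(V0_gt0 H)]. Qed.

Lemma dominatedD f g C C' c : dominated f C -> dominated g C' ->
  dominated (fun y => f y + c * g y) (C + `|c| * C').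
Proof.
move=> [mf fC] [mg gC]; split=> [|y].
  by apply: measurable_funD => //; exact: measurable_funM.
rewrite (le_trans (ler_normD _ _))// mulrDl lerD// normrM -mulrA ler_wpM2l//.
Qed.

Lemma mean_norm f C : dominated f C -> `|mean f z| <= C * mean V0 z.
Proof.
move=> df; have d0 : dominated (fun=> 0) 0.
  by split=> [|y]; [exact: measurable_cst|rewrite normr0 mul0r].
have e c : mean (fun y => 0 + c * V0 y) z = c * mean V0 z.
  by rewrite (meanD c d0 dominated_V0) [X in X + _]Rintegral_cst// mul0r add0r.
rewrite ler_norml -mulNr -!e; apply/andP; split;
  [apply: (mean_le (dominatedD (- C) d0 dominated_V0) df)|
   apply: (mean_le df (dominatedD C d0 dominated_V0))] => y;
  by have := df.2 y; rewrite ler_norml add0r ?mulNr => /andP[].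
Qed.

End at_actions.

Lemma within_rate x (D : set (borel S)) a b (F := within (actA G x `*` actB G x) (nbhs (a, b))) :
  actA G x a -> actB G x b -> measurable D ->
  fine (unif (x, ab.1, ab.2) D) @[ab --> F] --> fine (unif (x, a, b) D).
Proof.
move=> Aa Bb mD; have Kab : (actA G x `*` actB G x) (a, b) by [].
have cr : fine (rate G x ab.1 ab.2 D) @[ab --> F] --> fine (rate G x a b D).
  have rf : rate G x a b D \is a fin_num by exact: fin_num_measure.
  apply: fine_cvg; rewrite fineK//.
  by have /subspace_continuousP := A3_rate H mD (x := x); exact.
have e a' b' : actA G x a' -> actB G x b' -> fine (unif (x, a', b') D) =
    fine (\d_(x : borel S) D : \bar R) + (clock x)^-1 * fine (rate G x a' b' D).
  move=> Aa' Bb'; rewrite unifE// -{1}(fineK (fin_num_measure (rate G x a' b') _ mD)).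
  by rewrite diracE -EFinM -EFinD.
rewrite e//; apply: (@cvg_trans _ (fine (\d_(x : borel S) D : \bar R) +
    (clock x)^-1 * fine (rate G x ab.1 ab.2 D) @[ab --> F])).
apply: near_eq_cvg; apply: filterS (withinT _ _) => ab [Aab Bab].
  by rewrite /= e.
by apply: cvgD; [exact: cvg_cst|apply: cvgMr; exact: cr].
Qed.


Section lsc.
Import HBNNSimple.

(** For a measurable set the mass is continuous in the actions, hence so is the integral of a simple
    function; the integral of [f] is a supremum of such integrals. *)
Lemma mean_lsc x a b (f : S -> R) (C e : R) : actA G x a -> actB G x b -> dominated f C ->
  (forall y, 0 <= f y) -> 0 < e -> \forall ab \near (a, b), actA G x ab.1 ->
  actB G x ab.2 -> mean f (x, a, b) - e < mean f (x, ab.1, ab.2).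
Proof.
move=> Aa Bb df f0 e0.
have fE a' b' : actA G x a' -> actB G x b' -> (mean f (x, a', b'))%:E = ereal_sup
    [set sintegral (unif (x, a', b')) h | h in [set h : {nnsfun (borel S) >-> R} |
      forall y, (h y)%:E <= (f y)%:E]%E].
  move=> Aa' Bb'; rewrite /mean /Rintegral fineK; first by rewrite ge0_integralTE.
  by apply: integrable_fin_num => //; exact: (unif_integrable Aa' Bb' df).
have [_ [h hf <-]] : exists2 s, [set sintegral (unif (x, a, b)) h | h in
    [set h : {nnsfun (borel S) >-> R} | forall y, (h y)%:E <= (f y)%:E]%E] s &
    ((mean f (x, a, b) - e / 2)%:E < s)%E.
  by apply: ereal_sup_gt; rewrite -fE// lte_fin; lra.
have hE a' b' : sintegral (unif (x, a', b')) h =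
    (\sum_(r <- finmap.enum_fset (fset_set (range h))) r * fine (unif (x, a', b') (h @^-1` [set r])))%:E.
  rewrite sintegralE fsbig_finite//= -sumEFin; apply: eq_bigr => r _.
  rewrite EFinM fineK// ge0_fin_numE// (@le_lt_trans _ _ 1%E) ?ltry//.
  by rewrite -(prob_kernel (s := unif) (x, a', b')); apply: le_measure; rewrite ?inE.
rewrite hE lte_fin => hm; have /cvgrPdist_lt/(_ _ (divr_gt0 e0 (ltr0n R 2))) :
    (\sum_(r <- finmap.enum_fset (fset_set (range h))) r * fine (unif (x, ab.1, ab.2) (h @^-1` [set r])))
    @[ab --> within (actA G x `*` actB G x) (nbhs (a, b))] -->
    (\sum_(r <- finmap.enum_fset (fset_set (range h))) r * fine (unif (x, a, b) (h @^-1` [set r]))).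
  apply: cvg_big => [|r _]; first exact: add_continuous.
  apply: cvgMr; apply: within_rate => //.
rewrite near_withinE; apply: filterS => ab hab Aab Bab; have := hab (conj Aab Bab).
rewrite ltr_norml => /andP[_ h1].
rewrite -lte_fin fE//; apply: lt_le_trans (ereal_sup_ubound _); last by exists h.
by rewrite lte_fin; lra.
Qed.

End lsc.

(** The mean of [V0] is continuous by hypothesis (A3). Applying [mean_lsc] to [C * V0 - f] and to
    [C * V0 + f] gives the two halves. *)
Lemma mean_cont x a b (f : S -> R) (C e : R) : actA G x a -> actB G x b -> dominated f C -> 0 < e ->
  \forall ab \near (a, b), actA G x ab.1 -> actB G x ab.2 ->
  `|mean f (x, a, b) - mean f (x, ab.1, ab.2)| < e.
Proof.
move=> Aa Bb df e0; have C0 : 0 <= C := dominated_ge0 x df.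
have V0c : \forall ab \near (a, b), actA G x ab.1 -> actB G x ab.2 ->
    C * mean V0 (x, ab.1, ab.2) < C * mean V0 (x, a, b) + e / 2.
  have eC : 0 < clock x * (e / 2 / (C + 1)).
    have C1 : 0 < C + 1 by lra.
    by rewrite mulr_gt0 ?(clock_gt0 H)// !divr_gt0.
  have Kab : (actA G x `*` actB G x) (a, b) by [].
  have /subspace_continuousP/(_ _ Kab) := A3_drift H (x := x).
  rewrite /from_subspace /= => dr.
  have : fine (signed_integral (rate G x ab.1 ab.2) (EFin \o V0))
      @[ab --> within (actA G x `*` actB G x) (nbhs (a, b))] -->
      fine (signed_integral (rate G x a b) (EFin \o V0)).
    apply: fine_cvg; rewrite fineK//.
    by rewrite signed_unif//; have [] := integrable_V0 Aa Bb.
  move=> /cvgrPdist_lt/(_ _ eC); rewrite near_withinE; apply: filterS => ab hab Aab Bab.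
  have := hab (conj Aab Bab); rewrite !signed_unif//;
    [|by have [] := integrable_V0 Aab Bab|by have [] := integrable_V0 Aa Bb].
  rewrite /= -mulrBr normrM gtr0_norm ?(clock_gt0 H)// ltr_pM2l ?(clock_gt0 H)//.
  rewrite ltr_pdivlMr; last by lra.
  set u := mean V0 _; set v := mean V0 _; set d := u - _ - _ => h.
  have d0 : C * - d <= C * `|d| by rewrite ler_wpM2l// -normrN ler_norm.
  have := normr_ge0 d; rewrite /d in d0 *; lra.
have main g : dominated g C -> \forall ab \near (a, b), actA G x ab.1 -> actB G x ab.2 ->
    mean g (x, ab.1, ab.2) < mean g (x, a, b) + e.
  (* [C * V0 - g], written as an iterated sum of the shape that [dominatedD] and [meanD] treat. *)
  move=> dg; have dh := dominatedD (-1) (dominatedD (C - 1) (dominated_V0) dominated_V0) dg.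
  have h0 y : 0 <= V0 y + (C - 1) * V0 y + -1 * g y.
    by have := dg.2 y; rewrite ler_norml => /andP[_ ?]; lra.
  have := mean_lsc Aa Bb dh h0 (divr_gt0 e0 (ltr0n R 2)).
  apply: filterS2 V0c => ab hV hab Aab Bab; have := hab Aab Bab; have := hV Aab Bab.
  have hE a' b' : actA G x a' -> actB G x b' -> mean (fun y => V0 y + (C - 1) * V0 y + -1 * g y) (x, a', b') =
      C * mean V0 (x, a', b') - mean g (x, a', b').
    move=> Aa' Bb'; rewrite (meanD Aa' Bb' _ (dominatedD (C - 1) dominated_V0 dominated_V0) dg).
    by rewrite (meanD Aa' Bb' _ dominated_V0 dominated_V0); lra.
  by rewrite !hE//; lra.
have dN : dominated (fun y => - f y) C.
  by split=> [|y]; [exact: measurableT_comp df.1|rewrite normrN; exact: df.2].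
have NE a' b' : actA G x a' -> actB G x b' ->
    mean (fun y => - f y) (x, a', b') = - mean f (x, a', b').
  move=> Aa' Bb'; rewrite /mean -[RHS]mulN1r -RintegralZl//; last exact: (unif_integrable Aa' Bb' df).
  by apply: eq_Rintegral => y _; rewrite mulN1r.
apply: filterS2 (main f df) (main _ dN) => ab h1 h2 Aab Bab.
have := h1 Aab Bab; have := h2 Aab Bab; rewrite !NE// ltr_norml => ? ?.
by apply/andP; split; lra.
Qed.


Definition payoff_bound (x : S) : R := M0 + Num.sqrt 2 / 2 * Num.sqrt (ln (V0 x)).

Lemma payoff_bound_ge0 x : 0 <= payoff_bound x.
Proof. by rewrite addr_ge0 ?mulr_ge0 ?divr_ge0 ?sqrtr_ge0// ltW ?(M0_gt0 H). Qed.

(** The Hamiltonian at pure actions, with the signed integral rewritten by means of the uniformized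
    kernel. *)
Definition gain (f : S -> R) x a b : R :=
  theta G * payoff G x a b * f x + clock x * (mean f (x, a, b) - f x).

Definition gain_bound (C : R) (x : S) : R :=
  C * ((theta G * payoff_bound x + clock x *+ 2 + rho0) * V0 x).

Lemma gain_norm x a b f C : actA G x a -> actB G x b -> dominated f C ->
  `|gain f x a b| <= gain_bound C x.
Proof.
move=> Aa Bb df; have th := theta_gt0 G; have := clock_gt0 H x; set c := clock x => c0.
have C0 := dominated_ge0 x df.
have pf : `|payoff G x a b * f x| <= payoff_bound x * (C * V0 x).
  rewrite normrM ler_pM//; [exact: A1_payoff H x a b Aa Bb|exact: df.2].
have mf := mean_norm Aa Bb df; have [_ mV] := integrable_V0 Aa Bb.
have fx := df.2 x; move: mf mV fx pf; rewrite /gain /gain_bound -/c -mulrA.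
set m := mean f _; set mV := mean V0 _; set P := _ * f x; set W := payoff_bound x.
set v := V0 x; move=> h1 h2 h3 h4.
have h5 : `|theta G * P| <= theta G * (W * (C * v)) by rewrite normrM gtr0_norm// ler_pM2l.
have h6 : `|c * m| <= c * (C * mV) by rewrite normrM gtr0_norm// ler_pM2l.
have h7 : `|c * f x| <= c * (C * v) by rewrite normrM gtr0_norm// ler_pM2l.
have h8 : C * (c * (mV - v)) <= C * (rho0 * v) by rewrite ler_wpM2l.
move: h5 h6 h7; rewrite !ler_norml mulr2n => /andP[? ?] /andP[? ?] /andP[? ?].
apply/andP; split; lra.
Qed.

Lemma gain_cont x f C : dominated f C -> {within actA G x `*` actB G x,
  continuous ((fun ab => gain f x ab.1 ab.2) : A * B -> R)}.
Proof.
move=> df; apply/subspace_continuousP => -[a b] [Aa Bb].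
apply: cvgD.
  apply: cvgMl; apply: cvgMr.
  by have /subspace_continuousP := A3_payoff H (x := x); exact.
apply: cvgMr; apply: cvgB; last exact: cvg_cst.
apply/cvgrPdist_lt => e e0; rewrite /within /=.
by have := mean_cont Aa Bb df e0; apply: filterS => ab h [/= Aab Bab]; exact: h.
Qed.

Section measurability.
Context d (W : measurableType d) (F : W -> S -> R) (C : R).
Hypothesis mF : measurable_fun setT ((fun wy => F wy.1 wy.2) : W * borel S -> R).
Hypothesis FC : forall w y, `|F w y| <= C * V0 y.

Lemma dominated_param w : dominated (F w) C.
Proof. by split=> //; exact: (measurableT_comp mF (measurable_pair1 w)). Qed.

Let mpos : measurable_fun setT ((fun p => (F p.1.1 p.2 + C * V0 p.2)%:E) :
  W * SAB * borel S -> \bar R).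
Proof.
apply/measurable_EFinP; apply: measurable_funD; last first.
  by apply: measurable_funM => //; exact: (measurableT_comp (mV0 H)).
apply: (measurable_comp2 mF) => //.
exact: (measurableT_comp (@measurable_fst _ _ _ _) (@measurable_fst _ _ _ _)).
Qed.

Lemma measurable_gain : measurable_fun ([set p | K p.2] : set (W * SAB))
  (fun p => gain (F p.1) p.2.1.1 p.2.1.2 p.2.2).
Proof.
have mK : measurable ([set p | K p.2] : set (W * SAB)).
  exact: (measurable_preimageT (@measurable_snd _ _ W SAB) (measurable_admissible G)).
have mx : measurable_fun setT (fun p : W * SAB => p.2.1.1).
  exact: (measurableT_comp (f := fun z : SAB => z.1.1)
    (measurableT_comp (@measurable_fst _ _ _ _) (@measurable_fst _ _ _ _)) (@measurable_snd _ _ _ _)).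
have mFx : measurable_fun setT (fun p : W * SAB => F p.1 p.2.1.1).
  exact: (measurable_comp2 mF).
have mmean : measurable_fun ([set p | K p.2] : set (W * SAB)) (fun p => mean (F p.1) p.2).
  (* Adding [C * V0] makes the integrand nonnegative, so that its integral is measurable in the
     parameter; the mean of [V0] is subtracted afterwards. *)
  pose I (p : W * SAB) := (\int[kpre unif (@measurable_snd _ _ W SAB) p]_y
    (F p.1 y + C * V0 y)%:E)%E.
  have mI : measurable_fun setT I.
    apply: (measurable_integral (kpre unif _) (f := fun p y => (F p.1 y + C * V0 y)%:E)) => //.
    by move=> p y; rewrite lee_fin; have := FC p.1 y; rewrite ler_norml => /andP[]; lra.
  have mV : measurable_fun setT (fun z : SAB => (\int[unif z]_y (V0 y)%:E)%E).
    apply: (measurable_integral unif (f := fun _ y => (V0 y)%:E)).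
      by apply/measurable_EFinP; exact: (measurableT_comp (mV0 H)).
    by move=> _ y; rewrite lee_fin ltW ?(V0_gt0 H).
  apply: (eq_measurable_fun (fun p => fine (I p) - C * fine (\int[unif p.2]_y (V0 y)%:E)%E)).
    move=> [w [[x a] b]] /set_mem[Aa Bb]; have dw := dominated_param w.
    rewrite -[fine (I _)]/(mean (fun y => F w y + C * V0 y) (x, a, b)).
    by rewrite (meanD Aa Bb _ dw dominated_V0) -[X in _ - _ * X]/(mean V0 (x, a, b)) addrK.
  apply: measurable_funTS; apply: measurable_funB.
    exact: (measurableT_comp (fine_measurable measurableT)).
  apply: measurable_funM => //; apply: (measurableT_comp (f := fun z => fine (\int[unif z]_y (V0 y)%:E)%E)) => //.
  exact: (measurableT_comp (fine_measurable measurableT)).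
apply: measurable_funD.
  apply: measurable_funM; last exact: measurable_funTS.
  apply: measurable_funM => //.
  have mp := @measurable_payoff _ _ _ _ G.
  have sub : snd @` ([set p | K p.2] : set (W * SAB)) `<=` K by move=> _ [p Kp <-].
  exact: (measurable_comp (measurable_admissible G) sub mp (measurable_funTS measurable_snd)).
apply: measurable_funM.
  by apply: measurable_funTS; exact: (measurableT_comp (measurable_clock H)).
apply: (eq_measurable_fun (fun p => mean (F p.1) p.2 - F p.1 p.2.1.1)).
  by move=> [w [[x a] b]] _.
exact: (measurable_funB mmean (measurable_funTS mFx)).
Qed.

End measurability.

End gain.

(** * Randomized actions *)

Section kprob.
Context d d' (X : measurableType d) (Y : measurableType d') (R : realType) (k : R.-pker X ~> Y).

Definition kprob_subdef w : set Y -> \bar R := k w.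

HB.instance Definition _ w := Measure.on (kprob_subdef w).
HB.instance Definition _ w := Measure_isProbability.Build _ _ _ (kprob_subdef w) (prob_kernel w).

Definition kprob w : probability Y R := kprob_subdef w.

End kprob.

Lemma integral_full d (X : measurableType d) (R : realType) (mu : {measure set X -> \bar R})
    (D : set X) (f : X -> \bar R) : mu setT = 1 -> measurable D -> mu D = 1 ->
  measurable_fun setT f -> (forall x, 0 <= f x) ->
  \int[mu]_(x in D) f x = \int[mu]_x f x.
Proof.
move=> mu1 mD D1 mf f0; have mDC := measurableC mD.
rewrite [RHS](@ge0_negligible_integral _ _ _ _ _ (~` D)) ?setTD ?setCK//.
have : mu setT = mu (~` D) + mu D.
  by rewrite [LHS](measureDI mu measurableT mD) setTD setTI.
rewrite mu1 D1.
have := measure_ge0 mu (~` D); case: (mu (~` D)) => [r|//|//] _.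
by rewrite -EFinD => -[e]; congr (_%:E); lra.
Qed.

Section mixing.
Context (R : realType) (S A B : ptopologicalType) (G : game R S A B)
  (V0 V1 : S -> R) (rho0 L0 M0 rho1 b1 M1 : R).
Hypothesis H : growth G V0 V1 rho0 L0 M0 rho1 b1 M1.
Local Open Scope ring_scope.

Notation SAB := (borel S * borel A * borel B)%type.
Notation K := (admissible (actA G) (actB G) : set SAB).
Notation clock := (clock V0 L0).
Notation unif := (unif H).
Notation mean := (mean H).
Notation gain := (gain H).
Notation dominated := (dominated V0).

Lemma mix_exists d (W : measurableType d) (sg : W -> borel S) (k1 : R.-pker W ~> borel A)
    (k2 : R.-pker W ~> borel B) : measurable_fun setT sg ->
  exists m : R.-pker W ~> borel S, forall w f, measurable_fun setT f -> (forall y, 0 <= f y)%E ->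
    (\int[m w]_y f y = \int[k1 w]_a \int[k2 w]_b \int[unif (sg w, a, b)]_y f y)%E.
Proof.
move=> msg.
have mj : measurable_fun setT (fun p : W * borel A * borel B => (sg p.1.1, p.1.2, p.2) : SAB).
  apply: measurable_fun_pair => //; apply: measurable_fun_pair.
    exact: (measurableT_comp msg (measurableT_comp (@measurable_fst _ _ _ _) (@measurable_fst _ _ _ _))).
  exact: (measurableT_comp (@measurable_snd _ _ _ _) (@measurable_fst _ _ _ _)).
have [j jE] := kernel_comp (kpre k2 (@measurable_fst _ _ W (borel A))) (kpre unif mj).
have [m mE] := kernel_comp k1 j; exists m => w f mf f0; rewrite mE//.
by apply: eq_integral => a _; rewrite jE.
Qed.

Section static.
Variables (x : S) (phi : probability (borel A) R) (psi : probability (borel B) R).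
Hypotheses (phiA : phi (actA G x) = 1%E) (psiB : psi (actB G x) = 1%E).

Let Kx : set (borel A * borel B) := actA G x `*` actB G x.

Let mKx : measurable Kx.
Proof. by apply: measurableX; [exact: measurable_actA|exact: measurable_actB]. Qed.

Let P : {measure set (borel A * borel B) -> \bar R} := (phi \x psi)%E.

Definition tame (h : A -> B -> R) := measurable_fun Kx (fun ab => h ab.1 ab.2) /\
  exists M, forall a b, actA G x a -> actB G x b -> `|h a b| <= M.

Definition dbl (h : A -> B -> R) : R := \int[P]_(ab in Kx) h ab.1 ab.2.

Let Kx1 : (P Kx = 1)%E.
Proof.
apply: (etrans (product_measure1E phi psi (measurable_actA G x) (measurable_actB G x))).
by rewrite [X in (X * _)%E]phiA [X in (_ * X)%E]psiB mule1.
Qed.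

Lemma tame_integrable h : tame h -> P.-integrable Kx (EFin \o (fun ab => h ab.1 ab.2)).
Proof.
move=> [mh [M hM]]; apply: measurable_bounded_integrable => //; first by rewrite [X in (X < _)%E]Kx1 ltry.
exists M; split; first exact: num_real.
by move=> N MN [a b] [Aa Bb]; exact: le_trans (hM a b Aa Bb) (ltW MN).
Qed.

Lemma dbl_le h h' : tame h -> tame h' ->
  (forall a b, actA G x a -> actB G x b -> h a b <= h' a b) -> dbl h <= dbl h'.
Proof.
move=> th th' hh; apply: le_Rintegral => //; try exact: tame_integrable.
by move=> [a b] [Aa Bb]; exact: hh.
Qed.

Lemma tameD h h' c : tame h -> tame h' -> tame (fun a b => h a b + c * h' a b).
Proof.
move=> [mh [M hM]] [mh' [M' hM']]; split; first by apply: measurable_funD => //; exact: measurable_funM.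
exists (M + `|c| * M') => a b Aa Bb; rewrite (le_trans (ler_normD _ _))//.
by rewrite lerD ?hM// normrM ler_wpM2l// hM'.
Qed.

Lemma tame_cst c : tame (fun _ _ => c).
Proof. by split; [exact: measurable_cst|exists `|c|]. Qed.

Lemma dblD h h' c : tame h -> tame h' ->
  dbl (fun a b => h a b + c * h' a b) = dbl h + c * dbl h'.
Proof.
move=> /tame_integrable ih /tame_integrable ih'; rewrite /dbl RintegralD// ?RintegralZl//.
exact: (integrableZl mKx c ih').
Qed.

Lemma dbl_cst c : dbl (fun _ _ => c) = c.
Proof. by rewrite /dbl Rintegral_cst// [X in fine X]Kx1 mulr1. Qed.

Lemma iterated h : tame h ->
  (\int[phi]_(a in actA G x) \int[psi]_(b in actB G x) (h a b)%:E = (dbl h)%:E)%E /\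
  (\int[psi]_(b in actB G x) \int[phi]_(a in actA G x) (h a b)%:E = (dbl h)%:E)%E.
Proof.
move=> th; have ih := tame_integrable th.
pose h' : borel A * borel B -> \bar R := (EFin \o (fun ab => h ab.1 ab.2)) \_ Kx.
have ih' : P.-integrable setT h'.
  by rewrite /h' -integrable_mkcond.
have e : (\int[P]_ab h' ab = (dbl h)%:E)%E.
  by rewrite /dbl /Rintegral fineK ?integrable_fin_num// /h' -integral_mkcond.
have hE a b : h' (a, b) = if (a \in (actA G x : set (borel A))) && (b \in (actB G x : set (borel B)))
    then (h a b)%:E else 0%E.
  rewrite /h' patchE (_ : ((a, b) \in Kx) = (a \in (actA G x : set (borel A))) && (b \in (actB G x : set (borel B))))//.
  by apply/idP/andP => [/set_mem[? ?]|[/set_mem ? /set_mem ?]]; [split|]; exact: mem_set.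
split.
  rewrite -e -fubini1// [LHS]integral_mkcond; apply: eq_integral => a _.
  rewrite /fubini_F patchE; case: ifPn => aA; last first.
    by rewrite integral0_eq// => b _; rewrite hE (negbTE aA).
  by rewrite [LHS]integral_mkcond; apply: eq_integral => b _; rewrite hE aA patchE.
rewrite -e -fubini2// [LHS]integral_mkcond; apply: eq_integral => b _.
rewrite /fubini_G patchE; case: ifPn => bB; last first.
  by rewrite integral0_eq// => a _; rewrite hE (negbTE bB) andbF.
by rewrite [LHS]integral_mkcond; apply: eq_integral => a _; rewrite hE bB patchE andbT.
Qed.

Lemma tame_sectionA h b : tame h -> actB G x b ->
  phi.-integrable (actA G x) (fun a => (h a b)%:E).
Proof.
move=> [mh [M hM]] Bb; have mA := measurable_actA G x.
apply: (@measurable_bounded_integrable _ _ _ phi (h ^~ b)) => //; first by rewrite [X in (X < _)%E]phiA ltry.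
  have sub : (fun a => (a, b)) @` (actA G x : set (borel A)) `<=` Kx by move=> _ [a Aa <-].
  have mp : measurable_fun setT (fun a : borel A => (a, b : borel B)) by exact: measurable_fun_pair.
  have := measurable_comp mKx sub mh (measurable_funTS mp); exact.
by exists M; split=> [|N MN a Aa]; [exact: num_real|exact: le_trans (hM a b Aa Bb) (ltW MN)].
Qed.

Lemma tame_sectionB h a : tame h -> actA G x a ->
  psi.-integrable (actB G x) (fun b => (h a b)%:E).
Proof.
move=> [mh [M hM]] Aa; have mB := measurable_actB G x.
apply: (@measurable_bounded_integrable _ _ _ psi (h a)) => //; first by rewrite [X in (X < _)%E]psiB ltry.
  have sub : (fun b => (a, b)) @` (actB G x : set (borel B)) `<=` Kx by move=> _ [b Bb <-].
  have mp : measurable_fun setT (fun b : borel B => (a : borel A, b)) by exact: measurable_fun_pair.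
  have := measurable_comp mKx sub mh (measurable_funTS mp); exact.
by exists M; split=> [|N MN b Bb]; [exact: num_real|exact: le_trans (hM a b Aa Bb) (ltW MN)].
Qed.

Lemma dbl_ge h v : tame h -> (forall b, actB G x b ->
  (v%:E <= \int[phi]_(a in actA G x) (h a b)%:E)%E) -> v <= dbl h.
Proof.
move=> th vh; have mA := measurable_actA G x.
have t' : tame (fun a b => - v + 1 * h a b) := tameD 1 (tame_cst _) th.
rewrite -subr_ge0 addrC -(dbl_cst (- v)) -[dbl h]mul1r -(dblD 1 (tame_cst _) th) -lee_fin.
rewrite -(iterated t').2; apply: integral_ge0 => b Bb.
under eq_integral do rewrite mul1r EFinD.
have ih := tame_sectionA th Bb.
rewrite integralD//; last exact: (tame_sectionA (tame_cst (- v)) Bb).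
rewrite integral_cst//= [X in (_ * X)%E]phiA mule1 -(fineK (integrable_fin_num mA ih)) -EFinD.
by rewrite lee_fin addrC subr_ge0 -lee_fin (fineK (integrable_fin_num mA ih)) vh.
Qed.

Lemma dbl_le_value h v : tame h -> (forall a, actA G x a ->
  (\int[psi]_(b in actB G x) (h a b)%:E <= v%:E)%E) -> dbl h <= v.
Proof.
move=> th vh; have mB := measurable_actB G x.
have t' : tame (fun a b => v + -1 * h a b) := tameD (-1) (tame_cst _) th.
rewrite -subr_ge0 -(dbl_cst v) -mulN1r -(dblD (-1) (tame_cst _) th) -lee_fin.
rewrite -(iterated t').1; apply: integral_ge0 => a Aa.
under eq_integral do rewrite mulN1r EFinB.
have ih := tame_sectionB th Aa.
rewrite integralB//; last exact: (tame_sectionB (tame_cst v) Aa).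
rewrite integral_cst//= [X in (_ * X)%E]psiB mule1 -(fineK (integrable_fin_num mB ih)) -EFinB.
by rewrite lee_fin subr_ge0 -lee_fin (fineK (integrable_fin_num mB ih)) vh.
Qed.

Lemma tame_K (h : S -> A -> B -> R) M : measurable_fun K (fun z => h z.1.1 z.1.2 z.2) ->
  (forall a b, actA G x a -> actB G x b -> `|h x a b| <= M) -> tame (h x).
Proof.
move=> mh hM; split; last by exists M.
pose g (ab : borel A * borel B) : SAB := (x : borel S, ab.1, ab.2).
have sub : g @` Kx `<=` K by move=> _ [ab [Aa Bb] <-].
have mg : measurable_fun setT g.
  by apply: measurable_fun_pair => //; exact: measurable_fun_pair.
exact: (measurable_comp (measurable_admissible G) sub mh (measurable_funTS mg)).
Qed.

Lemma tame_gain f C : dominated f C -> tame (gain f x).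
Proof.
move=> df; apply: (tame_K (M := gain_bound G V0 rho0 L0 M0 C x)); last first.
  by move=> a b Aa Bb; exact: gain_norm.
have mF : measurable_fun setT (fun wy : unit * borel S => f wy.2) by exact: measurableT_comp df.1 _.
have := measurable_gain H mF (C := C) (fun _ => df.2).
pose g (z : SAB) : unit * SAB := (tt, z).
have sub : g @` K `<=` [set p | K p.2] by move=> _ [z Kz <-].
have mK : measurable ([set p | K p.2] : set (unit * SAB)).
  exact: (measurable_preimageT (@measurable_snd _ _ unit SAB) (measurable_admissible G)).
have mg : measurable_fun setT g by exact: measurable_fun_pair.
move=> mG; exact: (measurable_comp mK sub mG (measurable_funTS mg)).
Qed.


Lemma tame_payoff : tame (payoff G x).
Proof. apply: (tame_K (h := payoff G) (M := payoff_bound V0 M0 x)).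
  exact: measurable_payoff.
by move=> a b; exact: (A1_payoff H). Qed.

(** The mean is a linear combination of [gain], the payoff and a constant at fixed [x], all of them
    already tame. *)
Lemma tame_mean f C : dominated f C -> tame (fun a b => mean f (x, a, b)).
Proof.
move=> df; have [mg [M gM]] := tame_gain df; have [mp [N pN]] := tame_payoff.
have c0 := clock_gt0 H x.
have e a b : mean f (x, a, b) = (clock x)^-1 * gain f x a b +
    (f x - (clock x)^-1 * (theta G * f x) * payoff G x a b).
  rewrite /(gain) /(mean); set m := Rintegral _ _ _; set c := clock x in c0 *.
  set ci := c^-1; rewrite [ci * (_ + _)]mulrDr /ci (mulKf (lt0r_neq0 c0)) -/ci; lra.
have t1 : tame (fun a b => f x + - ((clock x)^-1 * (theta G * f x)) * payoff G x a b).
  exact: (tameD _ (tame_cst _) tame_payoff).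
have t2 := tameD (clock x)^-1 t1 (tame_gain df).
suff -> : (fun a b => mean f (x, a, b)) = (fun a b => f x +
  - ((clock x)^-1 * (theta G * f x)) * payoff G x a b + (clock x)^-1 * gain f x a b) by [].
by apply/funext => a; apply/funext => b; rewrite e; lra.
Qed.

Section mixture.
Variable m : {measure set (borel S) -> \bar R}.
Hypothesis mE : forall f, measurable_fun setT f -> (forall y, 0 <= f y)%E ->
  (\int[m]_y f y = \int[phi]_a \int[psi]_b \int[unif (x, a, b)]_y f y)%E.

Let ge0_mean (f : S -> R) : measurable_fun [set: borel S] f -> (forall y, 0 <= f y) ->
  (forall a b, actA G x a -> actB G x b -> (unif (x, a, b)).-integrable setT (EFin \o f)) ->
  tame (fun a b => mean f (x, a, b)) ->
  (\int[m]_y (f y)%:E = (dbl (fun a b => mean f (x, a, b)))%:E)%E.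
Proof.
move=> mf f0 fi tf; have mf' : measurable_fun setT (EFin \o f : borel S -> \bar R) by exact/measurable_EFinP.
have f0' y : (0 <= (EFin \o f) y)%E by rewrite /= lee_fin.
have mI : measurable_fun setT (fun z => \int[unif z]_y (f y)%:E)%E.
  by apply: (measurable_integral unif (f := fun _ y => (f y)%:E)) => //; exact: (measurableT_comp mf').
have mIx a : measurable_fun setT ((fun b => \int[unif (x, a, b)]_y (f y)%:E) : borel B -> \bar R)%E.
  by apply: (measurableT_comp mI (g := fun b => (x : borel S, a : borel A, b))); exact: measurable_fun_pair.
rewrite mE// -(iterated tf).1 -(integral_full (probability_setT phi) (measurable_actA G x) phiA).
- apply: eq_integral => a /set_mem Aa.
  rewrite -(integral_full (probability_setT psi) (measurable_actB G x) psiB)//.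
  + apply: eq_integral => b /set_mem Bb; rewrite fineK//.
    by apply: integrable_fin_num => //; exact: fi.
  + by move=> b; apply: integral_ge0 => y _; exact: f0'.
- apply: (@measurable_fun_fubini_tonelli_F _ _ _ _ _ psi (fun ab => \int[unif (x, ab.1, ab.2)]_y (f y)%:E)%E).
    apply: (measurableT_comp mI (g := fun ab : borel A * borel B => (x : borel S, ab.1, ab.2))).
    by apply: measurable_fun_pair => //; exact: measurable_fun_pair.
  by move=> ab; apply: integral_ge0 => y _; exact: f0'.
- by move=> a; apply: integral_ge0 => b _; apply: integral_ge0 => y _; exact: f0'.
Qed.

Lemma mixture_setT : m setT = 1%E.
Proof.
rewrite -[LHS]mul1e -integral_cst// mE// (eq_integral (cst 1%E)).
  by rewrite integral_cst//= mul1e; exact: probability_setT.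
move=> a _; rewrite (eq_integral (cst 1%E)).
  by rewrite integral_cst//= mul1e; exact: probability_setT.
by move=> b _; rewrite integral_pker_cst.
Qed.

Lemma mixture_V0 : m.-integrable setT (EFin \o V0) /\
  clock x * (fine (\int[m]_y (V0 y)%:E)%E - V0 x) <= rho0 * V0 x.
Proof.
have tV := tame_mean (dominated_V0 H).
have e : (\int[m]_y (V0 y)%:E = (dbl (fun a b => mean V0 (x, a, b)))%:E)%E.
  apply: ge0_mean => //; first exact: mV0 H.
    by move=> y; rewrite ltW ?(V0_gt0 H).
  by move=> a b Aa Bb; have [] := integrable_V0 H Aa Bb.
split.
  apply/integrableP; split; first by apply/measurable_EFinP; exact: mV0 H.
  under eq_integral do rewrite /= ger0_norm ?(ltW (V0_gt0 H _))//.
  by rewrite e ltry.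
have c0 := clock_gt0 H x; rewrite e /= -ler_pdivlMl// lerBlDr.
rewrite -(dbl_cst (_ + _)); apply: dbl_le => //; first exact: tame_cst.
move=> a b Aa Bb; have [_] := integrable_V0 H Aa Bb.
by rewrite -ler_pdivlMl// lerBlDr.
Qed.

Lemma mixture_mean f C : dominated f C ->
  (\int[m]_y (f y)%:E = (dbl (fun a b => mean f (x, a, b)))%:E)%E.
Proof.
move=> df; have [iV _] := mixture_V0; have fi := integrable_dominated iV df.
have dV := dominated_V0 H; have tV := tame_mean dV; have tf := tame_mean df.
have V_0 y : 0 <= V0 y by rewrite ltW ?(V0_gt0 H).
have eV : (\int[m]_y (V0 y)%:E = (dbl (fun a b => mean V0 (x, a, b)))%:E)%E.
  apply: ge0_mean => //; first exact: mV0 H.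
  by move=> a b Aa Bb; have [] := integrable_V0 H Aa Bb.
(* The property [mE] of the mixture is about nonnegative functions, hence the shift by [C * V0]. *)
pose g : S -> R := fun y => f y + C * V0 y.
have dg : dominated g (C + `|C| * 1) := dominatedD C df dV.
have tg := tame_mean dg; have V_ge1 := V0_ge1 H.
have eg : dbl (fun a b => mean g (x, a, b)) = dbl (fun a b => mean f (x, a, b)) +
    C * dbl (fun a b => mean V0 (x, a, b)).
  rewrite -(dblD C tf tV); apply: eq_Rintegral => -[a b] /set_mem[Aa Bb].
  exact: (meanD H Aa Bb C df dV).
have : (\int[m]_y (g y)%:E = (dbl (fun a b => mean g (x, a, b)))%:E)%E.
  apply: ge0_mean => //; first exact: dg.1.
  - by move=> y; have := df.2 y; rewrite /g ler_norml => /andP[+ _]; clear eg eV; lra.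
  - by move=> a b Aa Bb; exact: (unif_integrable H Aa Bb dg).
rewrite eg; under eq_integral do rewrite EFinD.
rewrite integralD//; last exact: (integrableZl measurableT C iV).
under [X in (_ + X)%E]eq_integral do rewrite EFinM.
rewrite integralZl// eV -(fineK (integrable_fin_num measurableT fi)) -EFinM -EFinD => -[e].
by congr (_%:E); move: e; clear eg eV; lra.
Qed.

(** The clock does not depend on the actions, so averaging over them commutes with uniformization;
    the mixed rate is again a measure with one negative atom, and [signed_integralE] applies to
    it. *)
Lemma rate_mixE D : measurable D ->
  rate_mix G x phi psi D = ((clock x)%:E * (m D - \d_(x : borel S) D))%E.
Proof.
move=> mD; pose f : S -> R := \1_(D : set (borel S)).
have mf : measurable_fun [set: borel S] f by exact: measurable_indic.
have df : dominated f 1.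
  split=> // y; rewrite mul1r /f indicE ger0_norm//.
  by apply: le_trans (V0_ge1 H y); case: (_ \in _); rewrite ?ler01.
have : (m D = \int[m]_y (f y)%:E)%E by rewrite integral_indic// setIT.
rewrite (mixture_mean df) => ->.
have e a b : actA G x a -> actB G x b -> fine (rate G x a b D) = - (clock x * f x) + clock x * mean f (x, a, b).
  move=> Aa Bb; rewrite (rate_unif H Aa Bb mD) /(mean) /Rintegral integral_indic// setIT.
  have /fineK <- : unif (x, a, b) D \is a fin_num.
    exact: (fin_num_measure (kprob unif (x, a, b))).
  by rewrite diracE /= /f indicE; lra.
have t := tameD (clock x) (tame_cst (- (clock x * f x))) (tame_mean df).
transitivity (\int[phi]_(a in actA G x) \int[psi]_(b in actB G x)
    (- (clock x * f x) + clock x * mean f (x, a, b))%:E)%E.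
  apply: eq_integral => a /set_mem Aa; apply: eq_integral => b /set_mem Bb.
  by rewrite -e// fineK//; exact: fin_num_measure.
rewrite (iterated t).1 dblD//; [|exact: tame_cst|exact: tame_mean df].
rewrite dbl_cst diracE -EFinB -EFinM; congr (_%:E); rewrite /f indicE; lra.
Qed.

Lemma payoff_mixE : payoff_mix G x phi psi = (dbl (payoff G x))%:E.
Proof. exact: (iterated tame_payoff).1. Qed.

Lemma hamiltonian_mixture f C : dominated f C -> hamiltonian G f x phi psi =
  (theta G * dbl (payoff G x) * f x + clock x * (fine (\int[m]_y (f y)%:E)%E - f x))%:E.
Proof.
move=> df; have [iV _] := mixture_V0; have fi := integrable_dominated iV df.
rewrite /hamiltonian payoff_mixE (@signed_integralE _ _ _ m mixture_setT (x : borel S) (clock x)) //.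
- by rewrite -[in LHS](fineK (integrable_fin_num measurableT fi)) -EFinB -!EFinM -EFinD.
- exact: measurable_singleton (borelS G).
- by rewrite ltW ?(clock_gt0 H).
- exact: rate_mixE.
Qed.

End mixture.

Lemma hamiltonianE f C : dominated f C ->
  hamiltonian G f x phi psi = (dbl (gain f x))%:E.
Proof.
move=> df.
have [||k1 k1E] := @kernel_exists _ _ unit (borel A) R (fun=> phi).
- by move=> U mU; exact: measurable_cst.
- by move=> _; exact: probability_setT.
have [||k2 k2E] := @kernel_exists _ _ unit (borel B) R (fun=> psi).
- by move=> U mU; exact: measurable_cst.
- by move=> _; exact: probability_setT.
have [m mE] := mix_exists k1 k2 (@measurable_cst _ _ unit (borel S) setT x).
have mE' f' : measurable_fun setT f' -> (forall y, 0 <= f' y)%E ->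
    (\int[m tt]_y f' y = \int[phi]_a \int[psi]_b \int[unif (x, a, b)]_y f' y)%E.
  move=> mf' f0'; rewrite mE//; transitivity (\int[phi]_a \int[k2 tt]_b \int[unif (x, a, b)]_y f' y)%E.
    by apply: integral_eq_measurable => D _; exact: k1E.
  by apply: eq_integral => a _; apply: integral_eq_measurable => D _; exact: k2E.
rewrite (hamiltonian_mixture mE' df) (mixture_mean mE' df) /=; congr (_%:E).
rewrite -[in RHS](_ : (fun a b => (- (clock x * f x) + clock x * mean f (x, a, b)) +
  (theta G * f x) * payoff G x a b) = gain f x).
  rewrite dblD; [|exact: (tameD _ (tame_cst _) (tame_mean df))|exact: tame_payoff].
  rewrite dblD; [|exact: tame_cst|exact: tame_mean df].
  by rewrite dbl_cst; lra.
by apply/funext => a; apply/funext => b; rewrite /(gain); lra.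
Qed.

End static.

Definition saddle (f : S -> R) x (v : R) (phi : probability (borel A) R)
    (psi : probability (borel B) R) :=
  [/\ phi (actA G x) = 1%E, psi (actB G x) = 1%E,
    forall b, actB G x b -> (v%:E <= \int[phi]_(a in actA G x) (gain f x a b)%:E)%E
  & forall a, actA G x a -> (\int[psi]_(b in actB G x) (gain f x a b)%:E <= v%:E)%E].

Section saddle_point.
Variables (f : S -> R) (C : R) (df : dominated f C) (x : S) (v : R).
Variables (phi : probability (borel A) R) (psi : probability (borel B) R).
Hypothesis sad : saddle f x v phi psi.

Lemma saddle_le_dbl (psi' : probability (borel B) R) : psi' (actB G x) = 1%E ->
  v <= dbl x phi psi' (gain f x).
Proof. by case: sad => phiA _ vb _ psiB; exact: (dbl_ge phiA psiB (tame_gain x df)). Qed.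

Lemma dbl_le_saddle (phi' : probability (borel A) R) : phi' (actA G x) = 1%E ->
  dbl x phi' psi (gain f x) <= v.
Proof. by case: sad => _ psiB _ va phiA; exact: (dbl_le_value phiA psiB (tame_gain x df)). Qed.

Lemma hamiltonian_saddle : hamiltonian G f x phi psi = v%:E.
Proof.
have [phiA psiB _ _] := sad; rewrite (hamiltonianE phiA psiB df); congr (_%:E).
by apply/le_anti; rewrite dbl_le_saddle ?saddle_le_dbl.
Qed.

Lemma hamiltonian_le (phi' : probability (borel A) R) : phi' (actA G x) = 1%E ->
  (hamiltonian G f x phi' psi <= v%:E)%E.
Proof.
have [_ psiB _ _] := sad.
by move=> phiA; rewrite (hamiltonianE phiA psiB df) lee_fin dbl_le_saddle.
Qed.

Lemma hamiltonian_ge (psi' : probability (borel B) R) : psi' (actB G x) = 1%E ->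
  (v%:E <= hamiltonian G f x phi psi')%E.
Proof.
have [phiA _ _ _] := sad.
by move=> psiB; rewrite (hamiltonianE phiA psiB df) lee_fin saddle_le_dbl.
Qed.

Lemma saddle_sup_inf : (ereal_sup [set ereal_inf [set hamiltonian G f x phi psi
  | psi in prob_on R (actB G x)] | phi in prob_on R (actA G x)] = v%:E)%E.
Proof.
have [phiA psiB _ _] := sad; apply/le_anti/andP; split.
  apply: ge_ereal_sup => _ [phi' phiA' <-]; apply: le_trans (hamiltonian_le phiA').
  by apply: ereal_inf_lbound; exists psi.
apply: le_trans (ereal_sup_ubound _); last by exists phi.
by apply: le_ereal_inf_tmp => _ [psi' psiB' <-]; exact: hamiltonian_ge.
Qed.

Lemma saddle_sup : (hamiltonian G f x phi psi =
  ereal_sup [set hamiltonian G f x phi' psi | phi' in prob_on R (actA G x)])%E.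
Proof.
have [phiA psiB _ _] := sad; rewrite hamiltonian_saddle; apply/le_anti/andP; split.
  by rewrite -hamiltonian_saddle; apply: ereal_sup_ubound; exists phi.
by apply: ge_ereal_sup => _ [phi' phiA' <-]; exact: hamiltonian_le.
Qed.

Lemma saddle_inf : (hamiltonian G f x phi psi =
  ereal_inf [set hamiltonian G f x phi psi' | psi' in prob_on R (actB G x)])%E.
Proof.
have [phiA psiB _ _] := sad; rewrite hamiltonian_saddle; apply/le_anti/andP; split.
  by apply: le_ereal_inf_tmp => _ [psi' psiB' <-]; exact: hamiltonian_ge.
by rewrite -hamiltonian_saddle; apply: ereal_inf_lbound; exists psi.
Qed.

End saddle_point.

(** Play the first player's strategy for [f] against the second player's strategy for [g]: this pair
    pays at least [v] in the first game and at most [v'] in the second. *)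
Lemma saddle_mono f g C C' x v v' phi psi phi' psi' c : dominated f C -> dominated g C' ->
  saddle f x v phi psi -> saddle g x v' phi' psi' ->
  (forall a b, actA G x a -> actB G x b -> gain f x a b <= gain g x a b + c) -> v <= v' + c.
Proof.
move=> df dg sf sg fg; have [phiA _ _ _] := sf; have [_ psiB _ _] := sg.
apply: le_trans (saddle_le_dbl df sf psiB) _.
have := dbl_le_saddle dg sg phiA; have tg := tame_gain x dg.
have t := tameD c tg (tame_cst x 1).
have := dbl_le phiA psiB (tame_gain x df) t; rewrite (dblD phiA psiB c tg (tame_cst x 1)).
rewrite (dbl_cst phiA psiB) mulr1 => h1 h2.
by apply: le_trans (h1 _) _ => [a b Aa Bb|]; [exact: fg|rewrite lerD2r].
Qed.

Lemma saddle_exists d (W : measurableType d) (sg : W -> borel S) (F : W -> S -> R) C :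
  measurable_fun setT sg ->
  measurable_fun setT ((fun wy => F wy.1 wy.2) : W * borel S -> R) ->
  (forall w y, `|F w y| <= C * V0 y) ->
  exists (v : W -> R) (phi : R.-pker W ~> borel A) (psi : R.-pker W ~> borel B),
    measurable_fun setT v /\ forall w, saddle (F w) (sg w) (v w) (kprob phi w) (kprob psi w).
Proof.
move=> msg mF FC; have dF := dominated_param mF FC.
have mG := measurable_gain H mF FC.
have mK : measurable ([set p | K p.2] : set (W * SAB)).
  exact: (measurable_preimageT (@measurable_snd _ _ W SAB) (measurable_admissible G)).
pose KA : set (borel S * borel A) := [set z | actA G z.1 z.2].
pose KB : set (borel S * borel B) := [set z | actB G z.1 z.2].
(* Only the joint graph [K] is given as measurable; the graph of the first player's sets is its
   projection along the compact sets of the second player. *)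
have mKA : measurable KA.
  have [U [C' cod]] := borel_space_coding (borelB G).
  have sSA := standard_borel_prod (standard_borel_space (borelS G)) (standard_borel_space (borelA G)).
  rewrite (_ : KA = [set z | exists2 b, K (z, b) & setT b]).
    apply: (measurable_meet cod sSA); [exact: measurable_admissible| |exact: closedT].
    move=> [x a]; have [Aa|nA] := pselect (actA G x a).
      rewrite (_ : [set b | _] = actB G x); first exact: (A3_compactB H).
      by apply/seteqP; split=> b /= => [[]|].
    rewrite (_ : [set b | _] = set0); first exact: compact0.
    by rewrite -subset0 => b [].
  apply/seteqP; split=> [[x a] /= Aa|[x a] [b [Aa _] _]//].
  by have [b Bb] := actB_neq0 G x; exists b.
have mKB : measurable KB.
  have [U [C' cod]] := borel_space_coding (borelA G).
  have sSB := standard_borel_prod (standard_borel_space (borelS G)) (standard_borel_space (borelB G)).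
  pose D : set (borel S * borel B * borel A) := [set p | K (p.1.1, p.2, p.1.2)].
  have mD : measurable D.
    apply: (measurable_preimageT (f := fun p : borel S * borel B * borel A => (p.1.1, p.2, p.1.2)) _
      (measurable_admissible G)).
    apply: measurable_fun_pair; first apply: measurable_fun_pair => //.
      exact: (measurableT_comp (@measurable_fst _ _ _ _) (@measurable_fst _ _ _ _)).
    exact: (measurableT_comp (@measurable_snd _ _ _ _) (@measurable_fst _ _ _ _)).
  rewrite (_ : KB = [set z | exists2 a, D (z, a) & setT a]).
    apply: (measurable_meet cod sSB) => //.
    move=> [x b]; have [Bb|nB] := pselect (actB G x b).
      rewrite (_ : [set a | _] = actA G x); first exact: (A3_compactA H).
      by apply/seteqP; split=> a /= => [[]|].
    rewrite (_ : [set a | _] = set0); first exact: compact0.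
    by rewrite -subset0 => a [].
  apply/seteqP; split=> [[x b] /= Bb|[x b] [a [_ Bb] _]//].
  by have [a Aa] := actA_neq0 G x; exists a.
have [|||v [phi [psi [mv conc vb va]]]] := @saddle_kernels _ _ W (borel S) R A B (borelA G) (borelB G)
  (standard_borel_space (borelS G)) KA KB mKA mKB (A3_compactA H) (A3_compactB H)
  (actA_neq0 G) (actB_neq0 G) sg msg (fun w => gain (F w) (sg w))
  (fun w => gain_cont (dF w)).
- move=> al be mal mbe aK bK; pose g w : W * SAB := (w, (sg w, al w, be w)).
  have sub : g @` setT `<=` [set p | K p.2] by move=> _ [w _ <-]; split; [exact: aK|exact: bK].
  have mg : measurable_fun setT g.
    by apply: measurable_fun_pair => //; apply: measurable_fun_pair => //; exact: measurable_fun_pair.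
  exact: (measurable_comp mK sub mG mg).
- move=> w b Bb; pose g (a : borel A) : W * SAB := (w, (sg w, a, b : borel B)).
  have sub : g @` (actA G (sg w) : set (borel A)) `<=` [set p | K p.2] by move=> _ [a Aa <-].
  have mg : measurable_fun setT g.
    by apply: measurable_fun_pair => //; apply: measurable_fun_pair => //; exact: measurable_fun_pair.
  have := measurable_comp mK sub mG (measurable_funTS mg); exact.
- move=> w a Aa; pose g (b : borel B) : W * SAB := (w, (sg w, a : borel A, b)).
  have sub : g @` (actB G (sg w) : set (borel B)) `<=` [set p | K p.2] by move=> _ [b Bb <-].
  have mg : measurable_fun setT g by apply: measurable_fun_pair => //; exact: measurable_fun_pair.
  have := measurable_comp mK sub mG (measurable_funTS mg); exact.
- exists v, phi, psi; split=> // w; split; [exact: (conc w).1|exact: (conc w).2|exact: vb|exact: va].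
Qed.

End mixing.

(** * The value operator and the barrier *)

Lemma sqrt2_half_le1 (R : realType) : (Num.sqrt 2 / 2 <= 1 :> R)%R.
Proof.
have : (Num.sqrt 2 ^+ 2 = 2 :> R)%R by rewrite sqr_sqrtr.
have : (0 <= Num.sqrt 2 :> R)%R by exact: sqrtr_ge0.
by nra.
Qed.

Section value.
Context (R : realType) (S A B : ptopologicalType) (G : game R S A B)
  (V0 V1 : S -> R) (rho0 L0 M0 rho1 b1 M1 : R).
Hypothesis H : growth G V0 V1 rho0 L0 M0 rho1 b1 M1.
Local Open Scope ring_scope.

Notation clock := (clock V0 L0).
Notation unif := (unif H).
Notation mean := (mean H).
Notation gain := (gain H).
Notation dominated := (dominated V0).
Notation saddle := (saddle H).
Notation payoff_bound := (payoff_bound V0 M0).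
Notation T := (horizon G).

Definition value (f : S -> R) x : R :=
  fine (ereal_sup [set ereal_inf [set hamiltonian G f x phi psi
    | psi in prob_on R (actB G x)] | phi in prob_on R (actA G x)]).

Lemma saddle_value f C x v phi psi : dominated f C -> saddle f x v phi psi -> value f x = v.
Proof. by move=> df sf; rewrite /value (saddle_sup_inf df sf). Qed.

Lemma value_saddle f C x : dominated f C -> exists phi psi, saddle f x (value f x) phi psi.
Proof.
move=> df; have mF : measurable_fun setT (fun wy : unit * borel S => f wy.2).
  exact: measurableT_comp df.1 _.
have [v [phi [psi [mv sP]]]] := saddle_exists H (@measurable_cst _ _ unit (borel S) setT x) mF
  (fun _ => df.2).
by exists (kprob phi tt), (kprob psi tt); rewrite (saddle_value df (sP tt)); exact: sP.
Qed.

Lemma value_mono f g C C' x c : dominated f C -> dominated g C' ->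
  (forall a b, actA G x a -> actB G x b -> gain f x a b <= gain g x a b + c) ->
  value f x <= value g x + c.
Proof.
move=> df dg; have [phi [psi sf]] := value_saddle x df.
by have [phi' [psi' sg]] := value_saddle x dg; exact: (saddle_mono df dg sf sg).
Qed.

Lemma value_le f C x c : dominated f C ->
  (forall a b, actA G x a -> actB G x b -> gain f x a b <= c) -> value f x <= c.
Proof.
move=> df fc; have [phi [psi sf]] := value_saddle x df; have [phiA psiB _ _] := sf.
apply: le_trans (saddle_le_dbl df sf psiB) _.
rewrite -(dbl_cst phiA psiB c); apply: dbl_le => //; [exact: tame_gain df|exact: tame_cst].
Qed.

Lemma value_ge f C x c : dominated f C ->
  (forall a b, actA G x a -> actB G x b -> c <= gain f x a b) -> c <= value f x.
Proof.
move=> df fc; have [phi [psi sf]] := value_saddle x df; have [phiA psiB _ _] := sf.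
apply: le_trans _ (dbl_le_saddle df sf phiA).
rewrite -(dbl_cst phiA psiB c); apply: dbl_le => //; [exact: tame_cst|exact: tame_gain df].
Qed.

Lemma value_norm f C x : dominated f C -> `|value f x| <= gain_bound G V0 rho0 L0 M0 C x.
Proof.
move=> df; have gb a b (Aa : actA G x a) (Bb : actB G x b) := gain_norm H Aa Bb df.
rewrite ler_norml (value_ge df) ?(value_le df)// => a b Aa Bb;
  by have := gb a b Aa Bb; rewrite ler_norml => /andP[].
Qed.

Lemma measurable_value d (W : measurableType d) (sg : W -> borel S) (F : W -> S -> R) C :
  measurable_fun setT sg ->
  measurable_fun setT ((fun wy => F wy.1 wy.2) : W * borel S -> R) ->
  (forall w y, `|F w y| <= C * V0 y) ->
  measurable_fun setT (fun w => value (F w) (sg w)).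
Proof.
move=> msg mF FC; have [v [phi [psi [mv sP]]]] := saddle_exists H msg mF FC.
rewrite (_ : (fun w => _) = v)//; apply/funext => w.
exact: saddle_value (dominated_param mF FC w) (sP w).
Qed.

(* Adding [damp x * f x] makes the value monotone in [f]. *)
Definition damp x : R := theta G * payoff_bound x + clock x.

Lemma damp_gt0 x : 0 < damp x.
Proof.
rewrite ltr_wpDl ?(clock_gt0 H)// mulr_ge0 ?(payoff_bound_ge0 H)//.
exact: ltW (theta_gt0 G).
Qed.

Lemma gain_damp f x a b : gain f x a b + damp x * f x =
  theta G * (payoff G x a b + payoff_bound x) * f x + clock x * mean f (x, a, b).
Proof. by rewrite /(gain) /damp; set m := mean f _; lra. Qed.

Lemma payoff_damp x a b : actA G x a -> actB G x b ->
  0 <= payoff G x a b + payoff_bound x <= payoff_bound x *+ 2.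
Proof.
move=> Aa Bb; have := A1_payoff H Aa Bb; rewrite -/(payoff_bound x) ler_norml mulr2n.
by move=> /andP[? ?]; apply/andP; split; lra.
Qed.

Lemma value_damp_mono f g C C' x : dominated f C -> dominated g C' ->
  (forall y, f y <= g y) -> value f x + damp x * f x <= value g x + damp x * g x.
Proof.
move=> df dg fg; rewrite -lerBrDr -addrA; apply: (value_mono df dg) => a b Aa Bb.
rewrite addrA lerBrDr !gain_damp; apply: lerD.
  have /andP[p0 _] := payoff_damp Aa Bb.
  by rewrite ler_wpM2l// mulr_ge0// ltW// theta_gt0.
by rewrite ler_pM2l ?(clock_gt0 H)// (mean_le H Aa Bb df dg).
Qed.

Lemma value_damp_ge0 f C x : dominated f C -> (forall y, 0 <= f y) ->
  0 <= value f x + damp x * f x.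
Proof.
move=> df f0; rewrite -lerBlDr sub0r; apply: (value_ge df) => a b Aa Bb.
rewrite -[- _]sub0r lerBlDr gain_damp addr_ge0// mulr_ge0//.
- by rewrite mulr_ge0 ?(ltW (theta_gt0 G))//; have /andP[] := payoff_damp Aa Bb.
- by rewrite ltW ?(clock_gt0 H).
- by apply: Rintegral_ge0 => y _; exact: f0.
Qed.

(** Used twice: with [V0], to bound the solution, and with a multiple of [V1 ^ 2], to bound the
    remainder of the comparison along paths. *)
Definition lyapunov (V : S -> R) (k : R) := [/\ measurable_fun [set: borel S] V,
  forall x, V0 x <= V x, 0 <= k & forall x a b, actA G x a -> actB G x b ->
    (unif (x, a, b)).-integrable setT (EFin \o V) /\
    clock x * (mean V (x, a, b) - V x) <= k * V x].

(* For [c] large, [barrier V c] is a supersolution: the slope [1 / (2 T)] of the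
   exponent of [V] absorbs the payoff, which is at most of order [sqrt (ln V)],
   and the exponent ranges over [1/2, 1], so that concavity gives the drift. *)
Definition barrier (V : S -> R) (c u : R) x := expR (c * u + (2^-1 + u / (2 * T)) * ln (V x)).

(** The chord of the exponential between 0 and [t], deduced from [1 + s <= expR s] at the points
    [(1 - a) * t] and [- a * t]. *)
Lemma expR_convex (a t : R) : 0 <= a <= 1 -> expR (a * t) <= 1 + a * (expR t - 1).
Proof.
move=> /andP[a0 a1]; have e1 := expR_ge1Dx ((1 - a) * t).
have e2 := expR_ge1Dx (- (a * t)); have e0 := expR_gt0 (a * t).
have E1 : expR ((1 - a) * t) * expR (a * t) = expR t.
  by rewrite -expRD; congr expR; lra.
have E2 : expR (- (a * t)) * expR (a * t) = 1 by rewrite -expRD addNr expR0.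
have h1 : a * (1 + (1 - a) * t) * expR (a * t) <= a * expR t.
  by rewrite -E1 mulrA; apply: ler_wpM2r; [exact: ltW|exact: ler_wpM2l].
have h2 : (1 - a) * (1 - a * t) * expR (a * t) <= 1 - a.
  rewrite -[leRHS]mulr1 -[X in _ <= _ * X]E2 mulrA; apply: ler_wpM2r; first exact: ltW.
  by apply: ler_wpM2l => //; rewrite subr_ge0.
by clear E1 E2 e1 e2; nra.
Qed.

Section barrier.
Variables (V : S -> R) (k c : R).
Hypothesis lV : lyapunov V k.
Hypothesis c_ge : theta G * M0 + k + T * theta G ^+ 2 / 2 <= c.

Lemma lyapunov_gt0 x : 0 < V x.
Proof. by have [_ h _ _] := lV; exact: lt_le_trans (V0_gt0 H x) (h x). Qed.

Lemma ln_lyapunov_ge0 x : 0 <= ln (V x).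
Proof. by have [_ h _ _] := lV; rewrite ln_ge0// (le_trans (V0_ge1 H x)). Qed.

(** With [s = sqrt (ln V)], the inequality [(s - T * theta) ^ 2 >= 0] bounds [theta * s] by
    [T * theta ^ 2 / 2 + s ^ 2 / (2 * T)]. The first term enters the condition on [c]; the second is
    the slope of the exponent of the barrier. *)
Lemma barrier_rate x : theta G * payoff_bound x + k <= c + (2 * T)^-1 * ln (V x).
Proof.
have th := theta_gt0 G; have T0 := horizon_gt0 G; have L := ln_lyapunov_ge0 x.
have [_ hV k0 _] := lV.
have s2 := sqrt2_half_le1 R.
have h1 : Num.sqrt 2 / 2 * Num.sqrt (ln (V0 x)) <= Num.sqrt (ln (V x)).
  rewrite -[leRHS]mul1r ler_pM ?divr_ge0 ?sqrtr_ge0//.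
  by rewrite ler_wsqrtr// ler_ln ?posrE ?(V0_gt0 H)// lyapunov_gt0.
have h2 : theta G * payoff_bound x <= theta G * M0 + theta G * Num.sqrt (ln (V x)).
  by rewrite -mulrDr ler_pM2l// lerD2l.
suff : theta G * Num.sqrt (ln (V x)) <= T * theta G ^+ 2 / 2 + (2 * T)^-1 * ln (V x).
  set i := (2 * T)^-1; set L' := ln _; set s := Num.sqrt L' in h2 *.
  by have hc := c_ge; set q := T * _ ^+ 2 / 2 in hc *; move=> h3; clear h1 s2; lra.
have e := sqr_sqrtr L; set s := Num.sqrt _ in e *.
rewrite -e -subr_ge0 (_ : _ - _ = (2 * T)^-1 * (s - T * theta G) ^+ 2).
  by rewrite mulr_ge0 ?sqr_ge0// invr_ge0 mulr_ge0// ltW.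
have : (2 * T)^-1 * T = 2^-1 by rewrite invfM -mulrA mulVf ?mulr1 ?gt_eqF.
set i := (_ * T)^-1 => iT; clear e h1 h2 s2.
have e1 : i * T * (theta G * s) = 2^-1 * (theta G * s) by rewrite iT.
have e2 : i * T * (T * theta G ^+ 2) = 2^-1 * (T * theta G ^+ 2) by rewrite iT.
by move: (theta G) e1 e2 => t; lra.
Qed.

Lemma measurable_barrier d (W : measurableType d) (f : W -> R) (g : W -> borel S) :
  measurable_fun setT f -> measurable_fun setT g ->
  measurable_fun setT (fun w => barrier V c (f w) (g w)).
Proof.
move=> mf mg; apply: (measurableT_comp (f := expR)) => //; apply: measurable_funD.
  exact: measurable_funM.
apply: measurable_funM.
  by apply: measurable_funD => //; exact: measurable_funM.
apply: measurableT_comp => //; have [mV _ _ _] := lV; exact: measurableT_comp mV mg.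
Qed.

Variables (u : R) (u0 : 0 <= u) (uT : u <= T).

Let al := 2^-1 + u / (2 * T).

Let al01 : 0 <= al <= 1 /\ 2^-1 <= al.
Proof.
have T0 := horizon_gt0 G; have h : 0 <= u / (2 * T) <= 2^-1.
  rewrite divr_ge0 ?mulr_ge0 ?(ltW T0)//=; rewrite ler_pdivrMr ?mulr_gt0//.
  by rewrite mulrA mulVf// mul1r.
by move: h => /andP[? ?]; split; [apply/andP; split|]; rewrite /al; lra.
Qed.

Lemma barrier_le x : barrier V c u x <= expR (c * u) * V x.
Proof.
rewrite /barrier -[X in _ + X]/(al * ln (V x)) expRD ler_pM2l ?expR_gt0//.
rewrite -[leRHS](lnK (lyapunov_gt0 x)) ler_expR ler_piMl ?ln_lyapunov_ge0//.
by have [/andP[]] := al01.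
Qed.

Lemma barrier_ge x : 0 <= c -> expR (2^-1 * ln (V x)) <= barrier V c u x.
Proof.
move=> c0; rewrite ler_expR (le_trans (ler_wpM2r (ln_lyapunov_ge0 x) al01.2))//.
by rewrite lerDr mulr_ge0.
Qed.

(** At fixed time the barrier is a constant times [V] to a power [al <= 1]. It lies below its
    tangent at [V x], an affine function of [V], to which the drift of [V] applies; the factor [al]
    only improves the bound. *)
Lemma barrier_mean x a b : actA G x a -> actB G x b ->
  (\int[unif (x, a, b)]_y (barrier V c u y)%:E <=
    (barrier V c u x + (clock x)^-1 * (k * barrier V c u x))%:E)%E.
Proof.
move=> Aa Bb; have [mV _ k0 /(_ x a b Aa Bb)[iV hV]] := lV.
have V_0 := lyapunov_gt0; have b0 : 0 < barrier V c u x := expR_gt0 _.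
set bx := barrier V c u x in b0 *.
have tangent y : barrier V c u y <= bx * (1 - al) + bx * al / V x * V y.
  have -> : barrier V c u y = bx * expR (al * (ln (V y) - ln (V x))).
    by rewrite -expRD /bx /barrier; congr expR; rewrite /al; lra.
  rewrite -!mulrA -mulrDr ler_pM2l//; have := expR_convex (ln (V y) - ln (V x)) al01.1.
  by rewrite expRB !lnK ?posrE// [_^-1 * _]mulrC; set q := _ / _; lra.
have iT : (unif (x, a, b)).-integrable setT (EFin \o (fun y => bx * (1 - al) + bx * al / V x * V y)).
  have i1 := integrable_pker_cst unif (x, a, b) (bx * (1 - al)).
  have i2 := integrableZl measurableT (bx * al / V x) iV.
  exact: (integrableD measurableT i1 i2).
apply: (@le_trans _ _ (\int[unif (x, a, b)]_y (bx * (1 - al) + bx * al / V x * V y)%:E)%E).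
  apply: ge0_le_integral => //.
  - by move=> y _; rewrite lee_fin ltW ?expR_gt0.
  - by apply/measurable_EFinP; exact: (measurable_barrier (measurable_cst _) (@measurable_id _ _ _)).
  - exact: (measurable_int _ iT).
  - by move=> y _; rewrite lee_fin.
have -> : (\int[unif (x, a, b)]_y (bx * (1 - al) + bx * al / V x * V y)%:E =
    (bx * (1 - al) + bx * al / V x * mean V (x, a, b))%:E)%E.
  have iZ := integrableZl measurableT (bx * al / V x) iV.
  under eq_integral do rewrite EFinD.
  rewrite integralD//; last exact: integrable_pker_cst.
  under [X in (_ + X)%E]eq_integral do rewrite EFinM.
  rewrite integralZl// integral_pker_cst -(fineK (integrable_fin_num measurableT iV)).
  by rewrite -EFinM -EFinD.
have c0 := clock_gt0 H x; have V_x := V_0 x; rewrite lee_fin.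
set m := mean V _ in hV *; set ci := (clock x)^-1.
have hV' : m - V x <= ci * (k * V x) by rewrite ler_pdivlMl.
have ci0 : 0 < ci by rewrite invr_gt0.
have [/andP[a0 a1] _] := al01.
have q0 : 0 <= bx * al / V x by rewrite divr_ge0// ?mulr_ge0// ltW.
have e : bx * al / V x * V x = bx * al by rewrite divfK ?gt_eqF.
have h1 : bx * al / V x * (m - V x) <= bx * al / V x * (ci * (k * V x)) by rewrite ler_wpM2l.
have h2 : bx * al / V x * (ci * (k * V x)) = al * (ci * (k * bx)).
  by rewrite mulrCA [X in ci * X = _]mulrCA e [in RHS]mulrCA [in X in _ = ci * X]mulrCA [bx * al]mulrC.
have h3 : al * (ci * (k * bx)) <= ci * (k * bx).
  by rewrite ler_piMl// !mulr_ge0// ltW.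
move: h1; rewrite mulrBr e h2; move: (bx * al / V x * m) => q; lra.
Qed.

End barrier.
End value.

(** * Construction of the solution *)

Section clamp.
Context (R : realType).
Local Open Scope ring_scope.

(** Extends a function of time beyond [[0, T]] by its end values, so that measurability and bounds
    hold at every real time. *)
Definition clamp (T u : R) : R := Num.max 0 (Num.min u T).

Lemma clamp_itv T u : 0 <= T -> 0 <= clamp T u <= T.
Proof.
by move=> T0; rewrite /clamp le_max lexx/= ge_max T0/= ge_min lexx orbT.
Qed.

Lemma clamp_id T u : 0 <= u <= T -> clamp T u = u.
Proof. by move=> /andP[u0 uT]; rewrite /clamp min_l// max_r. Qed.

Lemma measurable_clamp T : measurable_fun setT (clamp T).
Proof.
apply: measurable_maxr; first exact: measurable_cst.
by apply: measurable_minr => //; exact: measurable_cst.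
Qed.

Lemma integral_expR (a b u : R) : 0 <= u ->
  (\int[lebesgue_measure]_(v in `[0%R, u]) (b * expR (a + b * v))%:E =
    (expR (a + b * u) - expR a)%:E)%E.
Proof.
rewrite le_eqVlt => /orP[/eqP<-|u0].
  by rewrite set_itv1 integral_set1 mulr0 addr0 subrr.
have dE x : is_derive x (1 : R) (fun v => expR (a + b * v)) (b * expR (a + b * x)).
  have d1 : is_derive x (1 : R) (fun v => a + b * v) b.
    have d0 : is_derive x (1 : R) (b \*: (@id R)) (b *: (1 : R)) by apply: is_deriveZ.
    have d := is_deriveD (is_derive_cst a x 1) d0; rewrite add0r /GRing.scale/= mulr1 in d.
    exact: d.
  have := is_derive1_comp (f := expR) (g := fun v => a + b * v) (is_derive_expR _) d1.
  by move=> /= dd; apply: is_derive_eq; rewrite mulrC.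
have cE x : {for x, continuous (fun v : R => expR (a + b * v))}.
  by apply: differentiable_continuous; apply/derivable1_diffP; have [dx _] := dE x; exact: dx.
rewrite (@continuous_FTC2 R _ (fun v => expR (a + b * v)))//=.
- by rewrite mulr0 addr0 -EFinB.
- apply: continuous_subspaceT => x; apply: cvgM; [exact: cvg_cst|exact: cE].
- split; first by move=> x _; have [dx _] := dE x; exact: dx.
    by apply: cvg_at_right_filter; exact: cE.
  by apply: cvg_at_left_filter; exact: cE.
- by move=> x _; rewrite derive1E; exact: derive_val.
Qed.

End clamp.

Section pde.
Context (R : realType) (S A B : ptopologicalType) (G : game R S A B)
  (V0 V1 : S -> R) (rho0 L0 M0 rho1 b1 M1 : R).
Hypothesis H : growth G V0 V1 rho0 L0 M0 rho1 b1 M1.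
Local Open Scope ring_scope.

Notation clock := (clock V0 L0).
Notation unif := (unif H).
Notation mean := (mean H).
Notation gain := (gain H).
Notation dominated := (dominated V0).
Notation payoff_bound := (payoff_bound V0 M0).
Notation T := (horizon G).
Notation damp := (damp G V0 L0 M0).
Notation value := (value G).
Notation RS := (measurableTypeR R * borel S)%type.

Let T0 : 0 <= T. Proof. exact: ltW (horizon_gt0 G). Qed.

Lemma lyapunov_V0 : lyapunov H V0 rho0.
Proof.
split=> //; [exact: mV0 H|exact: ltW (rho0_gt0 H)|by move=> x a b Aa Bb; exact: integrable_V0].
Qed.

(* Dini's theorem on the compact set of pairs of admissible actions. *)
Lemma value_cvg (f_ : nat -> S -> R) f C x :
  (forall n, dominated (f_ n) C) -> dominated f C ->
  (forall n m y, (n <= m)%N -> f_ n y <= f_ m y) -> (forall y, f_ n y @[n --> \oo] --> f y) ->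
  value (f_ n) x @[n --> \oo] --> value f x.
Proof.
move=> dn df fmono fcvg.
have fle n y : f_ n y <= f y.
  by apply: (ler_cvg_to (cvg_cst (f_ n y)) (fcvg y)); exists n => // m /= nm; exact: fmono.
pose h n y := f y + -1 * f_ n y.
have h0 n y : 0 <= h n y by rewrite /h mulN1r subr_ge0.
have dh n : dominated (h n) (C + `|-1| * C) := dominatedD (-1) df (dn n).
have hE n a b : actA G x a -> actB G x b ->
    mean (h n) (x, a, b) = mean f (x, a, b) - mean (f_ n) (x, a, b).
  by move=> Aa Bb; rewrite (meanD H Aa Bb _ df (dn n)) mulN1r.
apply/cvgrPdist_le => e e0; have k0 := clock_gt0 H x; have l0 := damp_gt0 H x.
pose d := e / 2 / clock x; have d0 : 0 < d by rewrite !divr_gt0.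
have n1 : \forall n \near \oo, f x - f_ n x <= e / 2 / damp x.
  have /cvgrPdist_le/(_ _ (divr_gt0 (divr_gt0 e0 (ltr0n R 2)) l0)) := fcvg x.
  by apply: filterS => n; apply: le_trans; exact: ler_norm.
have n2 : \forall n \near \oo, actA G x `*` actB G x `<=`
    [set ab | actA G x ab.1 -> actB G x ab.2 -> mean (h n) (x, ab.1, ab.2) <= d].
  have cK := compact_setX (A3_compactA H (x := x)) (A3_compactB H (x := x)).
  move/compact_near_coveringP : cK; apply => -[a b] [/= Aa Bb].
  have [N hN] : exists N, mean (h N) (x, a, b) < d / 2.
    have hc : mean (f_ n) (x, a, b) @[n --> \oo] --> mean f (x, a, b).
      have iV := (integrable_V0 H Aa Bb).1.
      have := @dominated_cvg _ _ R (unif (x, a, b)) setT measurableT (fun n y => (f_ n y)%:E)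
        (fun y => (f y)%:E) (fun y => (C * V0 y)%:E).
      move=> /(_ _ _ _ (integrableZl measurableT C iV)) dc.
      apply: fine_cvg; rewrite fineK; last first.
        exact: (integrable_fin_num measurableT (unif_integrable H Aa Bb df)).
      apply: dc => //.
      - by move=> n; apply/measurable_EFinP; exact: (dn n).1.
      - by move=> y _; apply: cvg_EFin; [exact: nearW|exact: fcvg].
      - by move=> n y _; rewrite lee_fin; exact: (dn n).2.
    have /cvgrPdist_lt/(_ _ (divr_gt0 d0 (ltr0n R 2)))[N _ /(_ N (leqnn N))] := hc.
    by exists N; rewrite hE// (le_lt_trans (ler_norm _)).
  have := mean_cont H Aa Bb (dh N) (divr_gt0 d0 (ltr0n R 2)).
  move=> near_ab; exists ([set ab | actA G x ab.1 -> actB G x ab.2 ->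
      `|mean (h N) (x, a, b) - mean (h N) (x, ab.1, ab.2)| < d / 2], [set n | (N <= n)%N]).
    by split => //=; exists N.
  move=> [ab n] [/= hab Nn] Aab Bab; apply: (@le_trans _ _ (mean (h N) (x, ab.1, ab.2))).
    apply: (mean_le H Aab Bab (dh n) (dh N)) => y.
    by rewrite /h !mulN1r lerD2l lerN2; exact: fmono.
  by have := hab Aab Bab; rewrite ltr_norml => /andP[? ?]; lra.
apply: filterS2 n1 n2 => n n1 n2; have hx := h0 n x; rewrite /h mulN1r in hx.
rewrite ler_pdivlMr// in n1.
have both a b : actA G x a -> actB G x b ->
    gain f x a b <= gain (f_ n) x a b + e /\ gain (f_ n) x a b <= gain f x a b + e.
  move=> Aa Bb; have := n2 (a, b) (conj Aa Bb) Aa Bb; rewrite /= hE// /d ler_pdivlMr//.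
  have m0 : mean (f_ n) (x, a, b) <= mean f (x, a, b) by apply: (mean_le H Aa Bb (dn n) df).
  have := payoff_damp H Aa Bb; rewrite /(gain) /(damp) mulr2n => /andP[p0 p2].
  have th := theta_gt0 G; move: n1 hx k0 m0; rewrite /(damp).
  move: (mean f _) (mean (f_ n) _) (f x) (f_ n x) (clock x) (payoff_bound x) (payoff G x a b) (theta G) th p0 p2.
  move=> mf mn fx fn k pb p th th0 p0 p2 n1 hx k0 m0 hm.
  have q1 : 0 <= th * (p + pb) * (fx - fn) by rewrite mulr_ge0// mulr_ge0// ltW.
  have p3 : 0 <= pb - p by lra.
  have q2 : 0 <= th * (pb - p) * (fx - fn) by rewrite mulr_ge0// mulr_ge0// ltW.
  have q3 : 0 <= k * (mf - mn) by rewrite mulr_ge0 ?(ltW k0)// subr_ge0.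
  have q4 : 0 <= k * (fx - fn) by rewrite mulr_ge0// ltW.
  by clear -q1 q2 q3 q4 n1 hm; split; lra.
have v1 := value_mono (dn n) df (fun a b Aa Bb => (both a b Aa Bb).2).
have v2 := value_mono df (dn n) (fun a b Aa Bb => (both a b Aa Bb).1).
move: v1 v2; rewrite ler_norml; move: (value f x) (value (f_ n) x) => p q v1 v2.
by clear both n2 n1 hx d0; apply/andP; split; lra.
Qed.

Let c : R := theta G * M0 + rho0 + T * theta G ^+ 2 / 2.
(** Makes [bar 0] dominate the terminal data: the barrier starts at [V0] to the power 1/2, and
    [theta * s <= theta ^ 2 / 2 + s ^ 2 / 2] with [s = sqrt (ln V0)]. *)
Let C0 : R := expR (theta G * M0 + theta G ^+ 2 / 2).
Let bar u x : R := C0 * barrier G V0 c (clamp T u) x.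
Let Cd : R := C0 * expR (c * T).

Let c0 : 0 <= c.
Proof.
have th := ltW (theta_gt0 G); rewrite /c !addr_ge0//.
- by rewrite mulr_ge0// (ltW (M0_gt0 H)).
- exact: ltW (rho0_gt0 H).
- by rewrite divr_ge0// mulr_ge0// sqr_ge0.
Qed.

Let cl u : 0 <= clamp T u /\ clamp T u <= T.
Proof. by have /andP[] := clamp_itv u T0. Qed.

Let bar_gt0 u x : 0 < bar u x.
Proof. by rewrite mulr_gt0 ?expR_gt0. Qed.

Let bar_le u x : bar u x <= Cd * V0 x.
Proof.
have [u0 uT] := cl u; rewrite /bar /Cd -mulrA ler_pM2l ?expR_gt0//.
apply: le_trans (barrier_le c lyapunov_V0 u0 uT x) _.
by rewrite ler_pM2r ?(V0_gt0 H)// ler_expR ler_wpM2l.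
Qed.

Let terminal_bar x : expR (theta G * terminal G x) <= bar 0 x.
Proof.
have th := theta_gt0 G; rewrite /bar /C0 /barrier clamp_id ?lexx//= mulr0 mul0r add0r addr0 -expRD ler_expR.
have L := ln_lyapunov_ge0 lyapunov_V0 x; have e := sqr_sqrtr L.
have := A1_terminal H x; rewrite ler_norml => /andP[_ h].
have s2 := sqrt2_half_le1 R.
have h1 : theta G * terminal G x <= theta G * (M0 + Num.sqrt (ln (V0 x))).
  rewrite ler_pM2l// (le_trans h)// lerD2l -[leRHS]mul1r ler_wpM2r// sqrtr_ge0.
rewrite (le_trans h1)// mulrDr -addrA lerD2l; move: e; set s := Num.sqrt _.
move: (ln _) (theta G) (sqr_ge0 (s - theta G)) => l t q e; clear h h1 s2 L; lra.
Qed.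

Let ok (F : R -> S -> R) := measurable_fun setT (fun p : RS => F p.1 p.2) /\
  forall u x, 0 <= F u x <= bar u x.

Let ok_norm F : ok F -> forall u y, `|F u y| <= Cd * V0 y.
Proof.
move=> [_ h] u y; have /andP[F0 Fb] := h u y; rewrite ger0_norm//.
by apply: le_trans Fb _; exact: bar_le.
Qed.

Let ok_dominated F u : ok F -> dominated (F u) Cd.
Proof.
move=> oF; split; last exact: ok_norm.
exact: (measurableT_comp oF.1 (measurable_pair1 (u : measurableTypeR R))).
Qed.

Let rhs (F : R -> S -> R) v x := expR (damp x * v) * (value (F v) x + damp x * F v x).

(** Duhamel's formula, in the time to go [u], for [F' = value F] with [damp * F] added on both
    sides; the integrand is then monotone in [F]. *)
Let mild (F : R -> S -> R) u x := expR (- (damp x * clamp T u)) * (expR (theta G * terminal G x) +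
  \int[lebesgue_measure]_(v in `[0, clamp T u]) rhs F v x).

Let measurable_damp : measurable_fun setT (damp : borel S -> R).
Proof.
apply: measurable_funD; last exact: measurable_clock H.
apply: measurable_funM => //; apply: measurable_funD => //; apply: measurable_funM => //.
apply: (measurableT_comp (continuous_measurable_fun (@sqrt_continuous R))).
by apply: measurableT_comp => //; exact: mV0 H.
Qed.

Let measurable_rhs F : ok F -> measurable_fun setT (fun p : RS => rhs F p.1 p.2).
Proof.
move=> oF; have md : measurable_fun setT (fun p : RS => damp p.2).
  exact: (measurableT_comp measurable_damp (@measurable_snd _ _ _ _)).
apply: measurable_funM.
  by apply: measurableT_comp => //; exact: measurable_funM.
apply: measurable_funD; last exact: measurable_funM oF.1.
apply: (measurable_value H (sg := snd) (F := fun p : RS => F p.1) (C := Cd)) => //.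
  apply: (measurable_comp2 (F := fun (u : measurableTypeR R) (y : borel S) => F u y) oF.1) => //.
  exact: (measurableT_comp (@measurable_fst _ _ _ _) (@measurable_fst _ _ _ _)).
by move=> p y; exact: ok_norm.
Qed.

Let rhs_ge0 F v x : ok F -> 0 <= rhs F v x.
Proof.
move=> oF; rewrite mulr_ge0 ?expR_ge0// (value_damp_ge0 H x (ok_dominated v oF))// => y.
by have /andP[] := oF.2 v y.
Qed.

(** Logarithmic derivative in [v] of [expR (damp x * v) * bar v x]. *)
Let B_ x := damp x + c + (2 * T)^-1 * ln (V0 x).

(** The damped gain of a function below [bar] is at most [damp + theta * payoff_bound + rho0] times
    [bar], and [barrier_rate] bounds this factor by [B_]. So the integrand is below the derivative
    of the damped barrier, and [mild] keeps functions below [bar]. *)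
Let rhs_le F v x : ok F -> 0 <= v <= T ->
  rhs F v x <= C0 * (B_ x * expR (2^-1 * ln (V0 x) + B_ x * v)).
Proof.
move=> oF vT; have dF := ok_dominated v oF.
have bE : bar v x = C0 * barrier G V0 c v x by rewrite /bar clamp_id.
have -> : C0 * (B_ x * expR (2^-1 * ln (V0 x) + B_ x * v)) =
    expR (damp x * v) * (B_ x * bar v x).
  have e : expR (2^-1 * ln (V0 x) + B_ x * v) = expR (damp x * v) * barrier G V0 c v x.
    by rewrite -expRD /barrier /B_ invfM; congr expR; move: (T^-1) (ln _) => i l; lra.
  by rewrite bE e; move: (expR _) (barrier _ _ _ _ _) => p q; lra.
rewrite ler_pM2l ?expR_gt0// -lerBrDr; apply: (value_le (H := H) dF) => a b Aa Bb.
rewrite lerBrDr gain_damp; have /andP[p0 p2] := payoff_damp H Aa Bb.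
have th := theta_gt0 G; have /andP[F0 Fb] := oF.2 v x; have k0 := clock_gt0 H x.
have h1 : theta G * (payoff G x a b + payoff_bound x) * F v x <=
    theta G * (payoff_bound x *+ 2) * bar v x.
  by apply: ler_pM => //; [rewrite mulr_ge0// ltW|rewrite ler_pM2l].
have hm : mean (F v) (x, a, b) <= bar v x + (clock x)^-1 * (rho0 * bar v x).
  have [v0 vT'] : 0 <= v /\ v <= T by case/andP: vT.
  have i := integrable_fin_num measurableT (unif_integrable H Aa Bb dF).
  rewrite -lee_fin /(mean) /Rintegral fineK//.
  apply: (@le_trans _ _ (\int[unif (x, a, b)]_y (C0%:E * (barrier G V0 c v y)%:E))%E).
    apply: ge0_le_integral => //.
    - by move=> y _; rewrite lee_fin; have /andP[] := oF.2 v y.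
    - by apply/measurable_EFinP; exact: dF.1.
    - apply: measurable_funeM; apply/measurable_EFinP.
      exact: (measurable_barrier c lyapunov_V0 (measurable_cst _) (@measurable_id _ _ _)).
    - move=> y _; rewrite -EFinM lee_fin; have /andP[_] := oF.2 v y.
      by rewrite /bar clamp_id.
  have mb : measurable_fun setT (fun y : borel S => (barrier G V0 c v y)%:E).
    apply/measurable_EFinP.
    exact: (measurable_barrier c lyapunov_V0 (measurable_cst _) (@measurable_id _ _ _)).
  rewrite [leLHS](ge0_integralZl _ measurableT mb); [|by move=> y _; rewrite lee_fin expR_ge0|
    by rewrite lee_fin expR_ge0].
  apply: le_trans (lee_wpmul2l _ (barrier_mean c lyapunov_V0 v0 vT' Aa Bb)) _.
    by rewrite lee_fin expR_ge0.
  rewrite -EFinM lee_fin bE; move: (barrier _ _ _ _ _) (_^-1) => p q; lra.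
have h2 : clock x * mean (F v) (x, a, b) <= clock x * bar v x + rho0 * bar v x.
  rewrite (le_trans (ler_wpM2l (ltW k0) hm))// mulrDr mulVKf//; exact: lt0r_neq0.
have := barrier_rate lyapunov_V0 (lexx c) x => h3.
have h4 : (theta G * payoff_bound x + rho0) * bar v x <= (c + (2 * T)^-1 * ln (V0 x)) * bar v x.
  by rewrite ler_pM2r.
apply: le_trans (lerD h1 h2) _; move: h4; rewrite /B_ /(damp).
rewrite -[payoff_bound x *+ 2]/(payoff_bound x + payoff_bound x).
move: (bar v x) (clock x) (payoff_bound x) (_ * ln (V0 x)) => p q r s.
by clear h1 hm h2 h3 p0 p2 bE Fb; lra.
Qed.


Let rhs_integral F (u : R) x : ok F -> 0 <= u <= T ->
  (\int[lebesgue_measure]_(v in `[0%R, u]) (rhs F v x)%:E <=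
    (expR (damp x * u) * bar u x - bar 0 x)%:E)%E.
Proof.
move=> oF /andP[u0 uT].
apply: (@le_trans _ _ (\int[lebesgue_measure]_(v in `[0%R, u])
    (C0%:E * (B_ x * expR (2^-1 * ln (V0 x) + B_ x * v))%:E))%E).
  apply: ge0_le_integral => //.
  - by move=> v _; rewrite lee_fin rhs_ge0.
  - apply/measurable_EFinP/measurable_funTS.
    exact: (measurableT_comp (measurable_rhs oF) (measurable_pair2 (x : borel S))).
  - apply: measurable_funeM; apply/measurable_EFinP/measurable_funTS.
    apply: measurable_funM => //; apply: (measurableT_comp (f := expR)) => //.
    by apply: measurable_funD => //; exact: measurable_funM.
  - move=> v; rewrite /= in_itv/= => /andP[v0 vu]; rewrite -EFinM lee_fin.
    by apply: rhs_le => //; rewrite v0 (le_trans vu).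
have L := ln_lyapunov_ge0 lyapunov_V0 x; have T1 := horizon_gt0 G.
have B0 : 0 <= B_ x.
  rewrite /B_ addr_ge0//; first by rewrite addr_ge0// ltW ?(damp_gt0 H).
  by rewrite mulr_ge0// invr_ge0 mulr_ge0.
rewrite ge0_integralZl//.
- rewrite integral_expR// -EFinM lee_fin /bar !clamp_id ?lexx ?u0//=.
  have -> : expR (2^-1 * ln (V0 x) + B_ x * u) = expR (damp x * u) * barrier G V0 c u x.
    by rewrite -expRD /barrier /B_ invfM; congr expR; move: (T^-1) (ln _) => i l; lra.
  have -> : expR (2^-1 * ln (V0 x)) = barrier G V0 c 0 x.
    by rewrite /barrier mulr0 mul0r add0r addr0.
  by move: (expR _) (barrier _ _ _ u _) (barrier _ _ _ 0 _) => p q r; lra.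
- apply/measurable_EFinP/measurable_funTS.
  apply: measurable_funM => //; apply: (measurableT_comp (f := expR)) => //.
  by apply: measurable_funD => //; exact: measurable_funM.
- by move=> v _; rewrite lee_fin mulr_ge0 ?expR_ge0.
- by rewrite lee_fin expR_ge0.
Qed.

Let rhs_integrable F (u : R) x : ok F -> 0 <= u <= T ->
  lebesgue_measure.-integrable `[0, u] (fun v => (rhs F v x)%:E).
Proof.
move=> oF u0T; apply/integrableP; split.
  apply/measurable_EFinP/measurable_funTS.
  exact: (measurableT_comp (measurable_rhs oF) (measurable_pair2 (x : borel S))).
under eq_integral do rewrite /= ger0_norm ?rhs_ge0//.
exact: le_lt_trans (rhs_integral x oF u0T) (ltry _).
Qed.

Let mild_ok F : ok F -> ok (mild F).
Proof.
move=> oF; split; last first.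
  move=> u x; have u0T := clamp_itv u T0; apply/andP; split.
    by rewrite mulr_ge0 ?expR_ge0// addr_ge0 ?expR_ge0// Rintegral_ge0// => v _; exact: rhs_ge0.
  have := rhs_integral x oF u0T; rewrite -(fineK (integrable_fin_num _ (rhs_integrable x oF u0T)))//.
  rewrite lee_fin => h; rewrite /mild expRN ler_pdivrMl ?expR_gt0//.
  have := terminal_bar x; rewrite /Rintegral.
  have e : bar (clamp T u) x = bar u x by rewrite /bar [clamp T (clamp T u)]clamp_id.
  rewrite e in h.
  by move=> ?; lra.
have mc : measurable_fun setT (fun p : RS => clamp T p.1).
  exact: (measurableT_comp (measurable_clamp T) (@measurable_fst _ _ _ _)).
have md : measurable_fun setT (fun p : RS => damp p.2).
  exact: (measurableT_comp measurable_damp (@measurable_snd _ _ _ _)).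
apply: measurable_funM.
  by apply: measurableT_comp => //; apply: measurableT_comp => //; exact: measurable_funM.
apply: measurable_funD.
  apply: measurableT_comp => //; apply: measurable_funM => //.
  exact: (measurableT_comp (measurable_terminal G) (@measurable_snd _ _ _ _)).
pose I (p : RS) v : R := if 0 <= v <= clamp T p.1 then rhs F v p.2 else 0.
have mI : measurable_fun setT (fun q : RS * measurableTypeR R => (I q.1 q.2)%:E).
  apply/measurable_EFinP; apply: measurable_fun_ifT.
  - apply: measurable_and; apply: measurable_fun_ler => //.
    exact: (measurableT_comp mc (@measurable_fst _ _ _ _)).
  - apply: (measurable_comp2 (F := fun (v : measurableTypeR R) (x : borel S) => rhs F v x) (measurable_rhs oF)) => //.
    exact: (measurableT_comp (@measurable_snd _ _ _ _) (@measurable_fst _ _ _ _)).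
  - exact: measurable_cst.
have I0 (q : RS * measurableTypeR R) : (0 <= (I q.1 q.2)%:E)%E.
  by rewrite lee_fin /I; case: ifP => // _; exact: rhs_ge0.
have := @measurable_fun_fubini_tonelli_F _ _ _ _ _ (@lebesgue_measure R) (fun q => (I q.1 q.2)%:E) mI I0.
move=> /(measurableT_comp (fine_measurable measurableT)); congr measurable_fun.
apply/funext => p /=; congr fine; rewrite [RHS]integral_mkcond; apply: eq_integral => v _.
by rewrite /= patchE /I mem_setE in_itv/=; case: ifP.
Qed.

Let ok0 : ok (fun _ _ => 0).
Proof. by split=> [|u x]; [exact: measurable_cst|rewrite lexx ltW]. Qed.

Let rhs_mono F F' v x : ok F -> ok F' -> (forall u y, F u y <= F' u y) -> rhs F v x <= rhs F' v x.
Proof.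
move=> oF oF' FF'; rewrite ler_pM2l ?expR_gt0//.
exact: (value_damp_mono H x (ok_dominated v oF) (ok_dominated v oF')).
Qed.

Let mild_mono F F' u x : ok F -> ok F' -> (forall u y, F u y <= F' u y) ->
  mild F u x <= mild F' u x.
Proof.
move=> oF oF' FF'; have u0T := clamp_itv u T0.
rewrite ler_pM2l ?expR_gt0// lerD2l; apply: le_Rintegral => //; try exact: rhs_integrable.
by move=> v _; exact: rhs_mono.
Qed.

Let F_ n := iter n mild (fun _ _ => 0).

Let ok_F n : ok (F_ n).
Proof. by elim: n => [|n ih]; [exact: ok0|exact: mild_ok]. Qed.

Let F_mono n u x : F_ n u x <= F_ n.+1 u x.
Proof.
elim: n u x => [|n ih] u x; first by have /andP[] := (ok_F 1).2 u x.
exact: (mild_mono u x (ok_F n) (ok_F n.+1)).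
Qed.

Let F_nd u x : nondecreasing_seq (fun n => F_ n u x).
Proof. by apply/nondecreasing_seqP => n; exact: F_mono. Qed.

Let sol u x : R := limn (fun n => F_ n u x).

Let F_cvg u x : F_ n u x @[n --> \oo] --> sol u x.
Proof.
apply: nondecreasing_is_cvgn; first exact: F_nd.
by exists (bar u x) => _ [n _ <-]; have /andP[] := (ok_F n).2 u x.
Qed.

Let ok_sol : ok sol.
Proof.
split.
  apply: (measurable_fun_cvg (h := fun n (p : RS) => F_ n p.1 p.2)) => [n|p _].
    exact: (ok_F n).1.
  exact: F_cvg.
move=> u x; apply/andP; split.
  apply: limr_ge; first by apply: cvgP; exact: F_cvg.
  by apply: nearW => n; have /andP[] := (ok_F n).2 u x.
apply: limr_le; first by apply: cvgP; exact: F_cvg.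
by apply: nearW => n; have /andP[] := (ok_F n).2 u x.
Qed.

Let mF_ n x : measurable_fun setT (fun v : measurableTypeR R => (rhs (F_ n) v x)%:E).
Proof.
apply/measurable_EFinP.
exact: (measurableT_comp (measurable_rhs (ok_F n)) (measurable_pair2 (x : borel S))).
Qed.

(** The value passes to the limit along increasing sequences by [value_cvg], and the time integral
    by monotone convergence. *)
Let sol_mild u x : sol u x = mild sol u x.
Proof.
have u0T := clamp_itv u T0.
have h : mild (F_ n) u x @[n --> \oo] --> mild sol u x.
  apply: cvgMr; apply: cvgD; first exact: cvg_cst.
  apply: fine_cvg; rewrite fineK; last first.
    exact: (integrable_fin_num _ (rhs_integrable x ok_sol u0T)).
  have -> : (\int[lebesgue_measure]_(v in `[0%R, clamp T u]) (EFin \o (fun v => rhs sol v x)) v =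
      \int[lebesgue_measure]_(v in `[0%R, clamp T u]) limn (fun n => (rhs (F_ n) v x)%:E))%E.
    apply: eq_integral => v _; apply/esym/cvg_lim => //.
    apply: cvg_EFin; first exact: nearW.
    apply: cvgMr; apply: cvgD; last by apply: cvgMr; exact: F_cvg.
    apply: (value_cvg (C := Cd)) => [n||n m y nm|y].
    - exact: ok_dominated.
    - exact: (ok_dominated v ok_sol).
    - exact: F_nd.
    - exact: F_cvg.
  apply: cvg_monotone_convergence => //.
  - by move=> n; exact: measurable_funTS (mF_ n x).
  - by move=> n v _; rewrite lee_fin; exact: rhs_ge0.
  - move=> v _ n m nm; rewrite lee_fin; apply: rhs_mono => // u' y.
    exact: F_nd.
apply: (cvg_unique _ _ h) => //.
by have := @F_cvg u x; rewrite -(cvg_shiftS (fun n => F_ n u x)); exact.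
Qed.


Lemma payoff_bound_le x : payoff_bound x <= (M0 + 1) * V0 x.
Proof.
have L := ln_lyapunov_ge0 lyapunov_V0 x; have V_1 := V0_ge1 H x; have m0 := M0_gt0 H.
have e := sqr_sqrtr L; have lnV := ln_sublinear (V0_gt0 H x).
have s0 : 0 <= Num.sqrt (ln (V0 x)) by exact: sqrtr_ge0.
have s2 := sqrt2_half_le1 R.
have h1 : Num.sqrt 2 / 2 * Num.sqrt (ln (V0 x)) <= Num.sqrt (ln (V0 x)).
  by rewrite -[leRHS]mul1r ler_wpM2r.
have h2 : Num.sqrt (ln (V0 x)) <= V0 x.
  by move: s0 e lnV; set s := Num.sqrt _; have := sqr_ge0 (s - 1); nra.
have h3 : M0 * 1 <= M0 * V0 x by rewrite ler_pM2l.
by rewrite /(payoff_bound); move: h1 h2 h3; clear e s2; lra.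
Qed.

Let Dm x : R := gain_bound G V0 rho0 L0 M0 Cd x + damp x * (Cd * V0 x).

Let Cd_ge0 : 0 <= Cd. Proof. by rewrite mulr_ge0 ?expR_ge0. Qed.

(** The damping and the clock are of order [V0] and so is the solution: its Lipschitz constant in
    time is of order [V0 ^ 2], the quantity that [V1] controls. *)
Let L_ : R := Cd * (2 * theta G * (M0 + 1) + 3 * L0 + rho0).

Let Dm_le x : Dm x <= L_ * V0 x ^+ 2.
Proof.
have h := payoff_bound_le x; have V_1 := V0_ge1 H x; have r0 := rho0_gt0 H.
have th := theta_gt0 G; have q : 0 <= Cd * V0 x by rewrite mulr_ge0// ltW ?(V0_gt0 H).
have h1 : theta G * payoff_bound x <= theta G * ((M0 + 1) * V0 x) by rewrite ler_pM2l.
have h2 : rho0 * 1 <= rho0 * V0 x by rewrite ler_pM2l.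
have k : 2 * (theta G * payoff_bound x) + 3 * (L0 * V0 x) + rho0 <=
    (2 * theta G * (M0 + 1) + 3 * L0 + rho0) * V0 x.
  by move: h1 h2; move: (payoff_bound x) (V0 x) (theta G) => p v t; clear h; lra.
have := ler_wpM2r q k; rewrite /Dm /gain_bound /(damp) /(clock) /L_ -[_ *+ 2]/(_ + _).
by move: (payoff_bound x) (V0 x) (theta G) => p v t; clear h h1 h2 k; lra.
Qed.

Let Dm_ge x : damp x * (Cd * V0 x) <= Dm x.
Proof.
rewrite /Dm lerDr; have d0 : dominated (fun=> 0) Cd.
  by split=> [|y]; [exact: measurable_cst|rewrite normr0 mulr_ge0// ltW ?(V0_gt0 H)].
have [a Aa] := actA_neq0 G x; have [b Bb] := actB_neq0 G x.
exact: le_trans (normr_ge0 _) (gain_norm H Aa Bb d0).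
Qed.

Let rhs_bound v x : rhs sol v x <= expR (damp x * v) * Dm x.
Proof.
rewrite ler_pM2l ?expR_gt0// lerD//.
  exact: le_trans (ler_norm _) (value_norm H x (ok_dominated v ok_sol)).
by rewrite ler_pM2l ?(damp_gt0 H)// (le_trans (ler_norm _))// (ok_norm ok_sol).
Qed.

Let sol_lip_le x u u' : 0 <= u -> u <= u' -> u' <= T ->
  `|sol u' x - sol u x| <= Dm x * (u' - u).
Proof.
move=> u0 uu' u'T; have l0 := damp_gt0 H x.
have uT := le_trans uu' u'T; have u'0 := le_trans u0 uu'.
have h0 : 0 <= u <= T by rewrite u0.
have h' : 0 <= u' <= T by rewrite u'0.
pose I v : R := \int[lebesgue_measure]_(v in `[0%R, v]) rhs sol v x.
have sE v : 0 <= v <= T -> sol v x = expR (- (damp x * v)) * (expR (theta G * terminal G x) + I v).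
  by move=> vT; rewrite sol_mild /mild clamp_id.
have iI := rhs_integrable x ok_sol h'.
have dI : 0 <= I u' - I u <= expR (damp x * u') * Dm x * (u' - u).
  have sub : `]u, u'] `<=` `[0, u'].
    by move=> v /=; rewrite !in_itv/= => /andP[uv ->]; rewrite (le_trans u0)// ltW.
  rewrite /I (Rintegral_itvB (a := BLeft 0) (b := BRight u'))//.
  rewrite Rintegral_ge0/=; last by move=> v _; exact: rhs_ge0.
  have -> : expR (damp x * u') * Dm x * (u' - u) =
      \int[lebesgue_measure]_(v in `]u, u']) (expR (damp x * u') * Dm x).
    rewrite Rintegral_cst//= lebesgue_measure_itv/= lte_fin.
    by case: ltP => //= h; congr (_ * _); apply/eqP; rewrite subr_eq0 eq_le h.
  apply: le_Rintegral => //; first by apply: integrableS iI.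
    apply/integrableP; split; first exact: measurable_cst.
    rewrite integral_cst//= lebesgue_measure_itv/= lte_fin; case: ifP => _; last by rewrite mule0 ltry.
    by rewrite -EFinB -EFinM ltry.
  move=> v; rewrite /= in_itv/= => /andP[_ vu]; apply: le_trans (rhs_bound v x) _.
  rewrite ler_wpM2r ?ler_expR ?ler_pM2l//; apply: le_trans _ (Dm_ge x).
  by rewrite (mulr_ge0 (ltW l0))// mulr_ge0// ltW ?(V0_gt0 H).
have sol0 : 0 <= sol u x <= Cd * V0 x.
  have /andP[-> _] := ok_sol.2 u x; exact: le_trans (ler_norm _) (ok_norm ok_sol u x).
have e1 : expR (- (damp x * u')) = expR (- (damp x * u)) * expR (- (damp x * (u' - u))).
  by rewrite -expRD; congr expR; lra.
have e2 : 1 - damp x * (u' - u) <= expR (- (damp x * (u' - u))) := expR_ge1Dx _.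
have e3 : expR (- (damp x * (u' - u))) <= 1.
  by rewrite -expR0 ler_expR oppr_le0 mulr_ge0 ?(ltW l0)// subr_ge0.
have e4 : expR (- (damp x * u')) * expR (damp x * u') = 1 by rewrite -expRD addNr expR0.
have su := sE u h0; have h1 : sol u' x = expR (- (damp x * (u' - u))) * sol u x +
    expR (- (damp x * u')) * (I u' - I u).
  by rewrite su (sE u' h') e1; move: (expR _) (expR _) => p q; lra.
have du : 0 <= u' - u by rewrite subr_ge0.
have /andP[dI0 dI1] := dI; have D0 := Dm_ge x; have /andP[s0 s1] := sol0.
have h2 : 0 <= expR (- (damp x * u')) * (I u' - I u) <= Dm x * (u' - u).
  rewrite mulr_ge0 ?expR_ge0//= (le_trans (ler_wpM2l (expR_ge0 _) dI1))//.
  by rewrite !mulrA e4 mul1r.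
rewrite h1; move: h2; move: (_ * (I u' - I u)) => J /andP[J0 J1].
move: e2 e3; move: (expR _) => q q1 q2.
(* The loss from the damping factor and the gain from the integral have opposite signs and each is
   at most [Dm x * (u' - u)]; their sum obeys the same bound. *)
have k1 : (1 - q) * sol u x <= damp x * (u' - u) * (Cd * V0 x).
  by rewrite ler_pM// ?subr_ge0//; lra.
have k2 : damp x * (Cd * V0 x) * (u' - u) <= Dm x * (u' - u) by rewrite ler_wpM2r.
have k3 : 0 <= (1 - q) * sol u x by rewrite mulr_ge0// subr_ge0.
move: (sol u x) s0 s1 k1 k2 k3 => s *.
by clear e1 e4 su h1 sE dI0 dI1 dI sol0; rewrite ler_norml; apply/andP; split; lra.
Qed.

Let sol_lip x u u' : 0 <= u <= T -> 0 <= u' <= T ->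
  `|sol u' x - sol u x| <= L_ * V0 x ^+ 2 * `|u' - u|.
Proof.
move=> /andP[u0 uT] /andP[u'0 u'T]; apply: (@le_trans _ _ (Dm x * `|u' - u|)); last first.
  by rewrite ler_wpM2r// Dm_le.
have [uu'|/ltW u'u] := leP u u'; first by rewrite [`|u' - u|]ger0_norm ?subr_ge0// sol_lip_le.
by rewrite distrC [`|u' - u|]distrC [`|u - u'|]ger0_norm ?subr_ge0// sol_lip_le.
Qed.


Let V1_bound x : R := (theta G * payoff_bound x + clock x) * (L_ * V0 x ^+ 2) +
  L_ * M1 * (clock x * V1 x ^+ 2 + (rho1 * V1 x ^+ 2 + b1)).

Let L_ge0 : 0 <= L_.
Proof.
rewrite mulr_ge0// !addr_ge0// ?mulr_ge0// ?ltW ?(theta_gt0 G) ?(L0_gt0 H) ?(rho0_gt0 H)//.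
by rewrite addr_gt0 ?(M0_gt0 H).
Qed.

(** The Lipschitz constant [L_ * V0 ^ 2] has to be averaged over the next state. It is at most a
    multiple of [V1 ^ 2], whose mean is bounded by the drift condition in (A2). *)
Let gain_lip x u u' a b : 0 <= u <= T -> 0 <= u' <= T -> actA G x a -> actB G x b ->
  gain (sol u') x a b <= gain (sol u) x a b + V1_bound x * `|u' - u|.
Proof.
move=> u0T u'0T Aa Bb; have lip y := sol_lip y u0T u'0T.
have du := ok_dominated u ok_sol; have du' := ok_dominated u' ok_sol.
set e := `|u' - u| in lip *; have e0 : 0 <= e := normr_ge0 _.
have [iV1 hV1] := integrable_V1 H Aa Bb.
have iu := unif_integrable H Aa Bb du; have iu' := unif_integrable H Aa Bb du'.
have iZ : (unif (x, a, b)).-integrable setT (EFin \o (fun y => L_ * M1 * e * V1 y ^+ 2)).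
  exact: (integrableZl measurableT (L_ * M1 * e) iV1).
have hm : mean (sol u') (x, a, b) <= mean (sol u) (x, a, b) +
    L_ * M1 * e * mean (fun y => V1 y ^+ 2) (x, a, b).
  rewrite /(mean) -RintegralZl// -RintegralD//; apply: le_Rintegral => //.
    exact: (integrableD measurableT iu iZ).
  move=> y _; rewrite -lerBlDl (le_trans (ler_norm _))// (le_trans (lip y))//.
  have V_1 := V1_ge1 H y; have m1 := M1_gt0 H.
  have k : V0 y ^+ 2 <= M1 * V1 y ^+ 2.
    by rewrite (le_trans (A2_weight H y))// ler_pM2l// expr2 -[leLHS]mulr1 ler_wpM2l// (le_trans ler01).
  have := ler_wpM2l (mulr_ge0 L_ge0 e0) k.
  by move: (V0 y ^+ 2) (V1 y ^+ 2) => v w; clear lip k hV1; lra.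
have th := theta_gt0 G; have k0 := clock_gt0 H x.
have hx : `|theta G * payoff G x a b - clock x| * `|sol u' x - sol u x| <=
    (theta G * payoff_bound x + clock x) * (L_ * V0 x ^+ 2 * e).
  rewrite ler_pM//; apply: le_trans (ler_normB _ _) _; rewrite [`|clock x|]gtr0_norm// lerD2r.
  by rewrite normrM gtr0_norm// ler_pM2l//; exact: A1_payoff H x a b Aa Bb.
rewrite -normrM in hx; have hx' := le_trans (ler_norm _) hx.
have hm' := ler_wpM2l (ltW k0) hm.
have q : 0 <= L_ * M1 * e := mulr_ge0 (mulr_ge0 L_ge0 (ltW (M1_gt0 H))) e0.
have hv := ler_wpM2l q hV1.
move: hx' hm' hv; rewrite /(gain) /V1_bound.
move: (mean _ _) (mean _ _) (mean _ _) (sol u' x) (sol u x) (clock x) (V1 x ^+ 2) (L_ * M1).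
clear lip hm hx iZ iu iu' iV1 hV1 q e0 th k0.
move: (L_ * V0 x ^+ 2) (theta G) (payoff G x a b) (payoff_bound x) e => c1 c2 c3 c4 c5.
by move=> c6 c7 c8 c9 c10 c11 c12 c13 h1 h2 h3; lra.
Qed.

Let value_lip x u u' : 0 <= u <= T -> 0 <= u' <= T ->
  `|value (sol u') x - value (sol u) x| <= V1_bound x * `|u' - u|.
Proof.
move=> u0T u'0T; have du := ok_dominated u ok_sol; have du' := ok_dominated u' ok_sol.
have v1 := value_mono du' du (fun a b => gain_lip (x := x) u0T u'0T).
have v2 := value_mono du du' (fun a b => gain_lip (x := x) u'0T u0T).
rewrite distrC in v2; rewrite ler_norml; move: v1 v2.
move: (value _ _) (value _ _) (_ * _) => p q r v1 v2; apply/andP; split; lra.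
Qed.

Let lip_continuous (f : R -> R) (C u : R) : 0 < u < T ->
  (forall v, 0 <= v <= T -> `|f v - f u| <= C * `|v - u|) -> {for u, continuous f}.
Proof.
move=> /andP[u0 uT] fC; apply/cvgrPdist_le => e e0.
have C1 : 0 < `|C| + 1 by rewrite ltr_wpDl.
have : \forall v \near u, `|u - v| < e / (`|C| + 1).
  by apply/nbhs_normP; exists (e / (`|C| + 1)) => //=; rewrite divr_gt0.
have uI : u \in `]0, T[ by rewrite in_itv/= u0.
apply: filterS2 (near_in_itvoo uI) => v; rewrite in_itv/= => /andP[v0 vT].
rewrite ltr_pdivlMr// => h.
rewrite distrC (le_trans (fC v _)) ?(ltW v0) ?(ltW vT)// distrC.
apply: le_trans (ltW h); rewrite mulrC ler_wpM2l//.
by rewrite (le_trans (ler_norm _))// lerDl.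
Qed.

(** The solution and its value being Lipschitz in time, the integrand of the mild equation is
    continuous, so the equation holds at every interior time. *)
Let is_derive_sol x u : 0 < u < T -> is_derive u (1 : R) (sol ^~ x) (value (sol u) x).
Proof.
move=> u0T; have /andP[u0 uT] := u0T; have u0T' : 0 <= u <= T by rewrite !ltW.
have cs : {for u, continuous (sol ^~ x)}.
  by apply: (lip_continuous (C := L_ * V0 x ^+ 2)) => // v vT; exact: sol_lip.
have cv : {for u, continuous (fun v => value (sol v) x)}.
  by apply: (lip_continuous (C := V1_bound x)) => // v vT; exact: value_lip.
have cE (c' : R) : {for u, continuous (fun v : R => expR (c' * v))}.
  apply: (@continuous_comp _ _ _ (fun v => c' * v) expR); last exact: continuous_expR.
  by apply: cvgMr; exact: cvg_id.
have cr : {for u, continuous (fun v => rhs sol v x)}.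
  by apply: cvgM; [exact: cE|apply: cvgD => //; exact: cvgMr].
have TT : 0 <= T <= T by rewrite lexx T0.
have [dI I'] := @continuous_FTC1 R (fun v => rhs sol v x) (BLeft 0) u T uT
  (rhs_integrable x ok_sol TT) u0 cr.
set I := (fun v => _) in dI I'.
have dI' : is_derive u (1 : R) I (rhs sol u x) by apply: DeriveDef; [exact: dI|rewrite -derive1E; exact: I'].
have dE : is_derive u (1 : R) (fun v => expR (- damp x * v)) (- damp x * expR (- damp x * u)).
  have d0 : is_derive u (1 : R) (- damp x \*: (@id R)) (- damp x *: (1 : R)) by apply: is_deriveZ.
  have := is_derive1_comp (is_derive_expR _) d0 => d.
  by apply: is_derive_eq; rewrite /GRing.scale/= mulr1 mulrC.
apply: (@near_eq_is_derive _ _ _ (fun v => expR (- damp x * v) * (expR (theta G * terminal G x) + I v))).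
  have uI : u \in `]0, T[ by rewrite in_itv/= u0.
  apply: filterS (near_in_itvoo uI) => v; rewrite in_itv/= => /andP[v0 vT].
  by rewrite sol_mild /mild clamp_id ?ltW// mulNr.
have dS : is_derive u (1 : R) (fun v => expR (theta G * terminal G x) + I v) (rhs sol u x).
  by have := is_deriveD (is_derive_cst (expR (theta G * terminal G x)) u 1) dI'; rewrite add0r; exact.
have := is_deriveM dE dS => d; apply: is_derive_eq.
rewrite /GRing.scale/= /rhs mulrA -expRD mulNr addNr expR0 mul1r.
have := sol_mild u x; rewrite /mild clamp_id// -/(I u) mulNr => ->.
by move: (expR _) => p; lra.
Qed.

Lemma solution : exists (F : R -> S -> R) (C L : R),
  [/\ measurable_fun setT (fun p : RS => F p.1 p.2), forall u x, `|F u x| <= C * V0 x,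
    forall x, F 0 x = expR (theta G * terminal G x),
    forall x u u', 0 <= u <= T -> 0 <= u' <= T -> `|F u' x - F u x| <= L * V0 x ^+ 2 * `|u' - u|
  & forall x u, 0 < u < T -> is_derive u (1 : R) (F ^~ x) (value (F u) x)].
Proof.
exists sol, Cd, L_; split; [exact: ok_sol.1|exact: ok_norm ok_sol| |exact: sol_lip|exact: is_derive_sol].
move=> x; rewrite sol_mild /mild clamp_id ?lexx//= mulr0 oppr0 expR0 mul1r.
by rewrite set_itv1 Rintegral_set1 addr0.
Qed.

End pde.

(** * Absolutely continuous functions *)

Section absolutely_continuous.
Context (R : realType).
Local Open Scope ring_scope.
Implicit Types (f g : R -> R) (a b : R).

Lemma ac_cst a b (r : R) : absolutely_continuous a b (cst r).
Proof. by move=> e e0; exists 1 => // n l r' _ _ _; rewrite big1// => i _; rewrite subrr normr0. Qed.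

Lemma expR_lip (x y z : R) : expR x <= z -> expR y <= z -> `|expR y - expR x| <= z * `|y - x|.
Proof.
move=> hx hy; have := expR_ge1Dx (y - x); have := expR_ge1Dx (x - y).
rewrite !expRD !expRN; move: (expR_gt0 x) (expR_gt0 y) hx hy.
move: (expR x) (expR y) => X Y X0 Y0 hx hy; rewrite ler_pdivlMr// ler_pdivlMr// => h1 h2.
have := ler_norm (y - x); have := ler_norm (x - y); rewrite distrC; have := normr_ge0 (y - x).
move: (`|y - x|) h1 h2; rewrite -(opprB y); move: (y - x) => D M h1 h2 M0 h3 h4.
have h5 : D * Y <= M * Y by rewrite ler_pM2r.
have h6 : - D * X <= M * X by rewrite ler_pM2r.
have h7 : M * X <= M * z by rewrite ler_wpM2l.
have h8 : M * Y <= M * z by rewrite ler_wpM2l.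
by rewrite ler_norml mulrC; apply/andP; split; lra.
Qed.

(** With a constant [f] and [C = 0] it covers Lipschitz functions; with a general [f] it covers
    products and sums with Lipschitz functions. *)
Lemma ac_dominated f g a b C L : absolutely_continuous a b f -> 0 <= C -> 0 <= L ->
  (forall x y, a <= x -> x <= y -> y <= b -> `|g y - g x| <= C * `|f y - f x| + L * (y - x)) ->
  absolutely_continuous a b g.
Proof.
move=> acf C0 L0 gf e e0; have C1 : 0 < C + 1 by rewrite ltr_wpDl.
have [d d0 dP] := acf (e / 2 / (C + 1)) (divr_gt0 (divr_gt0 e0 (ltr0n R 2)) C1).
have L1 : 0 < L + 1 by rewrite ltr_wpDl.
exists (Num.min d (e / 2 / (L + 1))); first by rewrite lt_min d0/= !divr_gt0.
move=> n l r lr dis; rewrite lt_min => /andP[sd se].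
apply: (@le_lt_trans _ _ (C * (\sum_(i < n) `|f (r i) - f (l i)|) + L * \sum_(i < n) (r i - l i))).
  rewrite !mulr_sumr -big_split; apply: ler_sum => i _; have [h1 h2 h3] := lr i; exact: gf.
have := dP n l r lr dis sd; move: se; rewrite ltr_pdivlMr// => se.
set s := \sum_(i < n) (r i - l i) in sd se *; have s0 : 0 <= s.
  by apply: sumr_ge0 => i _; have [_ h _] := lr i; rewrite subr_ge0.
have : 0 <= \sum_(i < n) `|f (r i) - f (l i)| by apply: sumr_ge0.
rewrite ltr_pdivlMr//; move: (\sum_(i < n) `|_|) => v v0; have := mulr_ge0 L0 s0; clear dP gf lr dis; nra.
Qed.

(** * Monotonicity from the sign of an almost everywhere derivative *)

Section decreasing.
Variables (G : R -> R) (a b : R) (E : set R).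
Hypotheses (ab : a <= b) (acG : absolutely_continuous a b G) (mE : measurable E).
Hypothesis E0 : lebesgue_measure (`[a, b] `\` E) = 0%E.
Hypothesis dG : forall t, E t -> a < t -> t < b -> derivable G t 1 /\ derive1 G t <= 0.

Section eps.
Variables (e : R) (O : set R).
Hypotheses (e0 : 0 < e) (oO : open O) (aO : O a) (bO : O b).
Hypothesis EO : forall t, a <= t <= b -> E t \/ O t.

Let good t := exists (n : nat) (l r : nat -> R),
  [/\ forall i, (i < n)%N -> [/\ a <= l i, l i <= r i & r i <= t],
      forall i j, (i < j)%N -> (j < n)%N -> r i <= l j,
      ((\sum_(i < n) (r i - l i))%:E <= lebesgue_measure (O `&` `[a, t]))%E
    & G t - G a <= e * (t - a) + \sum_(i < n) `|G (r i) - G (l i)|].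

Let good_flat t t' : good t -> t <= t' -> G t' - G t <= e * (t' - t) -> good t'.
Proof.
move=> [n [l [r [h1 h2 h3 h4]]]] tt' Gt; exists n, l, r; split=> //.
- by move=> i /h1[? ? ri]; split=> //; exact: le_trans ri tt'.
- apply: le_trans h3 _; apply: le_measure; rewrite ?inE; try by apply: measurableI => //; exact: open_measurable.
  by move=> v [Ov /=]; rewrite !in_itv/= => /andP[av vt]; split=> //; rewrite av (le_trans vt).
- by clear h1 h2 h3; lra.
Qed.

Let good_bad t t' : a <= t -> good t -> t <= t' -> `[t, t'] `<=` O -> good t'.
Proof.
move=> a_t [n [l [r [h1 h2 h3 h4]]]] tt' tO.
exists n.+1, (fun i => if i == n then t else l i), (fun i => if i == n then t' else r i); split.
- move=> i; rewrite ltnS leq_eqVlt; case: eqP => [_ _|_ /= /h1[? ? ri]]; first by split.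
  by split=> //; exact: le_trans ri tt'.
- move=> i j ij; rewrite ltnS leq_eqVlt => /predU1P[e'|jn].
    by rewrite e' eqxx; rewrite e' in ij; rewrite ltn_eqF//; have [] := h1 i ij.
  by rewrite !ltn_eqF ?(ltn_trans ij)//; exact: h2.
- rewrite big_ord_recr/= eqxx (eq_bigr (fun i : 'I_n => r i - l i)); last first.
    by move=> i _; rewrite ltn_eqF.
  have mO := open_measurable oO.
  have -> : O `&` `[a, t'] = (O `&` `[a, t]) `|` `]t, t'].
    apply/seteqP; split=> [v [Ov]|v [[Ov]|]] /=; rewrite !in_itv/=.
    + by move=> /andP[av vt']; have [vt|tv] := leP v t; [left; rewrite av|right].
    + by move=> /andP[av vt]; split=> //; rewrite av (le_trans vt).
    + move=> /andP[tv vt']; split; last by rewrite vt' (le_trans a_t)// ltW.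
      by apply: tO; rewrite /= in_itv/= vt' ltW.
  rewrite measureU//; first last.
  + rewrite -subset0 => v [[_ /=]]; rewrite !in_itv/= => /andP[_ vt] /andP[tv _].
    by move: (lt_le_trans tv vt); rewrite ltxx.
  + exact: measurableI.
  rewrite EFinD; apply: leeD => //.
  rewrite -[X in (_ <= X)%E]/(lebesgue_measure `]t, t']) lebesgue_measure_itv/= lte_fin -EFinB.
  by case: ltP => // t't; rewrite lee_fin subr_le0.
- rewrite big_ord_recr/= eqxx (eq_bigr (fun i : 'I_n => `|G (r i) - G (l i)|)); last first.
    by move=> i _; rewrite ltn_eqF.
  have := ler_norm (G t' - G t); have : 0 <= e * (t' - t) by rewrite mulr_ge0 ?subr_ge0//; exact: ltW.
  by clear h1 h2 h3; lra.
Qed.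

(** At an interior point of [E] the derivative is at most 0, so short increments cost at most [e]
    per unit of time; near a point of [O] a short interval stays in [O] and joins the family. *)
Let local s : a <= s <= b -> exists2 d, 0 < d & forall t t', s - d < t -> t <= s -> s <= t' ->
  t' < s + d -> a <= t -> t' <= b -> good t -> good t'.
Proof.
move=> sab; have badcase : O s -> exists2 d, 0 < d & forall t t', s - d < t -> t <= s -> s <= t' ->
    t' < s + d -> a <= t -> t' <= b -> good t -> good t'.
  move=> Os; have /nbhs_normP[d /= d0 dO] := open_nbhs_nbhs (conj oO Os).
  exists d => // t t' dt ts st' td a_t _ gt; apply: (good_bad a_t gt (le_trans ts st')).
  move=> v /=; rewrite in_itv/= => /andP[tv vt']; apply: dO; rewrite /ball_/=.
  by rewrite ltr_norml; apply/andP; split; lra.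
have [Es|Os] := EO sab; last exact: badcase.
have [as_|na] := eqVneq a s; first by apply: badcase; rewrite -as_.
have [sb_|nb] := eqVneq s b; first by apply: badcase; rewrite sb_.
have /andP[as' sb'] := sab; have as1 : a < s by rewrite lt_neqAle na.
have sb1 : s < b by rewrite lt_neqAle nb.
have [ds ds0] := dG Es as1 sb1.
have [d d0 dP] : exists2 d : R, 0 < d &
    forall h, h != 0 -> `|h| < d -> `|derive1 G s - h^-1 * (G (h + s) - G s)| <= e.
  have /cvgrPdist_le/(_ _ e0) := ds; rewrite near_withinE => /nbhs_normP[d /= d0 dP].
  exists d => // h h0 hd; rewrite derive1E.
  by have := dP h; rewrite /ball_/= sub0r normrN /GRing.scale/= mulr1; apply.
exists d => // t t' dt ts st' td a_t t'b gt.
apply: (good_flat gt (le_trans ts st')).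
have h1 : G s - G t <= e * (s - t).
  have [->|nts] := eqVneq t s; first by rewrite !subrr mulr0.
  have h0 : t - s < 0 by rewrite subr_lt0 lt_neqAle nts.
  have := dP (t - s); rewrite lt_eqF// ltr0_norm// subrK => /(_ isT); have -> : - (t - s) < d by lra.
  move=> /(_ isT); rewrite ler_norml => /andP[q _].
  have := ler_wnM2r (ltW h0) q; rewrite mulrBl mulrAC mulVf ?lt_eqF// mul1r.
  have : derive1 G s * (t - s) >= 0 by rewrite mulr_le0// ltW.
  by move: (_ * _) => p; lra.
have h2 : G t' - G s <= e * (t' - s).
  have [->|nts] := eqVneq t' s; first by rewrite !subrr mulr0.
  have h0 : 0 < t' - s by rewrite subr_gt0 lt_neqAle eq_sym nts.
  have := dP (t' - s); rewrite gt_eqF// gtr0_norm// subrK => /(_ isT); have -> : t' - s < d by lra.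
  move=> /(_ isT); rewrite ler_norml => /andP[q _].
  have := ler_wpM2r (ltW h0) q; rewrite mulrBl mulrAC mulVf ?gt_eqF// mul1r.
  have : derive1 G s * (t' - s) <= 0 by rewrite mulr_le0_ge0// ltW.
  by move: (_ * _) => p; lra.
by lra.
Qed.

(** Induction along the real line: at the supremum of the good times, [local] leads from a good time
    just before it to one just after it, unless the supremum is [b]. *)
Lemma good_end : good b.
Proof.
have ga : good a.
  exists 0, (fun=> 0), (fun=> 0); rewrite !big_ord0; split=> //; by rewrite !subrr mulr0 addr0.
pose X := [set t | a <= t <= b /\ good t]; have Xa : X a by rewrite /X/= lexx ab.
have hs : has_sup X by split; [exists a|exists b => t [/andP[]]].
have cab : a <= sup X <= b.
  by rewrite sup_upper_bound//=; apply: sup_le_ub; [exists a|move=> t [/andP[]]].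
have [d d0 dP] := local cab.
have [t [/andP[a_t tb] gt] dt] : exists2 t, X t & sup X - d < t := sup_adherent d0 hs.
have /andP[ac cb] := cab.
have tc : t <= sup X by apply: sup_upper_bound => //; split=> //; rewrite a_t.
have ct' : sup X <= Num.min (sup X + d / 2) b by rewrite le_min cb andbT lerDl divr_ge0// ltW.
have t'd : Num.min (sup X + d / 2) b < sup X + d by rewrite gt_min; apply/orP; left; lra.
have t'b : Num.min (sup X + d / 2) b <= b by rewrite ge_min lexx orbT.
have gt' := dP _ _ dt tc ct' t'd a_t t'b gt.
have : Num.min (sup X + d / 2) b <= sup X.
  by apply: sup_upper_bound => //; split=> //; rewrite (le_trans ac ct') ge_min lexx orbT.
rewrite ge_min => /orP[|bc]; first by rewrite gerDl leNgt divr_gt0.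
by have -> : b = Num.min (sup X + d / 2) b; first by rewrite min_r// (le_trans bc)// lerDl divr_ge0// ltW.
Qed.

End eps.

(** Absolute continuity makes the variation over the intervals in [O] less than [e1] once [O] has
    small measure; the total growth is then at most [e1 * (b - a) + e1 = e]. *)
Lemma ac_nonincreasing : G b <= G a.
Proof.
apply/ler_addgt0Pr => e e0.
pose e1 := e / (b - a + 1); have ba1 : 0 < b - a + 1 by rewrite ltr_wpDl ?subr_ge0.
have e1_gt0 : 0 < e1 by rewrite divr_gt0.
have [d d0 dP] := acG e1_gt0.
(* The end points join the null set because the derivative is controlled at interior times only. *)
pose N := (`[a, b] `\` E) `|` ([set a] `|` [set b]).
have mN : measurable N by apply: measurableU; [exact: measurableD|exact: measurableU].
have N0 : lebesgue_measure N = 0%E.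
  apply/eqP; rewrite eq_le measure_ge0 andbT.
  apply: le_trans (measureU2 _ _ _) _ => //; first exact: measurableD; first exact: measurableU.
  rewrite [X in (X + _)%E]E0 add0e; apply: le_trans (measureU2 _ _ _) _ => //.
  by rewrite -[X in (X + _)%E]/(lebesgue_measure [set a]) -[X in (_ + X)%E]/(lebesgue_measure [set b]) !lebesgue_measure_set1 adde0.
have [|O [oO NO Od]] := @lebesgue_regularity_outer R N d mN _ d0; first by rewrite [X in (X < _)%E]N0.
have Ole : (lebesgue_measure O < d%:E)%E.
  rewrite -(setDUK NO); apply: le_lt_trans (measureU2 _ _ _) _ => //.
    by apply: measurableD => //; exact: open_measurable.
  by rewrite [X in (X + _)%E]N0 add0e.
have [| | |n [l [r [h1 h2 h3 h4]]]] := @good_end e1 O e1_gt0 oO.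
- by apply: NO; right; left.
- by apply: NO; right; right.
- move=> t tab; have [Et|nE] := pselect (E t); [by left|right].
  by apply: NO; left; split=> //; rewrite /= in_itv.
have h5 : \sum_(i < n) `|G (r i) - G (l i)| < e1.
  apply: dP => [i|i j ij|]; first exact: h1.
    have [ij'|ji|/val_inj ij'] := ltngtP i j; [by left; exact: h2|by right; exact: h2|].
    by rewrite ij' eqxx in ij.
  rewrite -lte_fin; apply: le_lt_trans h3 (le_lt_trans _ Ole).
  by apply: le_measure; rewrite ?inE//; [apply: measurableI => //|]; exact: open_measurable.
move: h4 h5 => h4; set s := \sum_(i < n) _ in h4 * => h5.
have : e1 * (b - a + 1) = e by rewrite divfK// gt_eqF.
by clear h1 h2 h3 dP; lra.
Qed.

End decreasing.

(** * Primitives of locally integrable functions *)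

Section primitive.
Local Notation mu := lebesgue_measure.

Definition prim (k : R -> R) (y : R) : R := \int[mu]_(t in `[0%R, y]) k t.

Lemma measurable_prim d (W : measurableType d) (k : W * R -> R) : measurable_fun setT k ->
  measurable_fun setT (fun p : W * R => prim (fun t => k (p.1, t)) p.2).
Proof.
move=> mk; apply: (measurableT_comp (fine_measurable measurableT)) => //=.
pose D := [set z : (W * R) * R | 0 <= z.2 <= z.1.2].
have mD : measurable D.
  have mb : measurable_fun setT (fun z : (W * R) * R => (0 <= z.2) && (z.2 <= z.1.2)).
    apply: measurable_and; apply: measurable_fun_ler => //.
    exact: (measurableT_comp measurable_snd measurable_fst).
  by have := mb measurableT [set true] Logic.I; rewrite setTI.
have pos (g : W * R -> \bar R) : measurable_fun setT g -> (forall z, 0 <= g z)%E ->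
    measurable_fun setT (fun p : W * R => \int[mu]_(t in `[0%R, p.2]) g (p.1, t))%E.
  move=> mg g0.
  pose h (z : (W * R) * R) := ((g (z.1.1, z.2)) * (\1_D z)%:E)%E.
  have mh : measurable_fun setT h.
    apply: emeasurable_funM; last by apply/measurable_EFinP.
    exact: (measurableT_comp mg (measurable_fun_pair (measurableT_comp measurable_fst measurable_fst) measurable_snd)).
  have h0 z : (0 <= h z)%E by rewrite mule_ge0// lee_fin.
  suff -> : (fun p : W * R => \int[mu]_(t in `[0%R, p.2]) g (p.1, t))%E = fubini_F mu h.
    exact: measurable_fun_fubini_tonelli_F.
  apply/funext => p; rewrite /fubini_F [LHS]integral_mkcond; apply: eq_integral => t _.
  rewrite /h epatch_indic/= !indicE; suff -> : (t \in `[0, p.2]%classic) = ((p, t) \in D) by [].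
  by apply/idP/idP; rewrite !inE /D/= ?in_itv.
have mk' : measurable_fun setT (EFin \o k) by apply/measurable_EFinP.
have h1 := pos (EFin \o k)^\+%E (measurable_funepos mk') (fun z => funepos_ge0 _ z).
have h2 := pos (EFin \o k)^\-%E (measurable_funeneg mk') (fun z => funeneg_ge0 _ z).
apply: (eq_measurable_fun _ _ (emeasurable_funB h1 h2)) => p _ /=.
by rewrite [RHS]integralE; congr (_ - _)%E; apply: eq_integral => t _; rewrite ?funeposE ?funenegE.
Qed.

Lemma itv_integrable (k : R -> R) (K L : R) : measurable_fun setT k ->
  (forall t, 0 <= t <= L -> `|k t| <= K) -> mu.-integrable `[0, L] (EFin \o k).
Proof.
move=> mk kK; apply: measurable_bounded_integrable => //.
- by rewrite -[X in (X < _)%E]/(lebesgue_measure `[0, L]) lebesgue_measure_itv; case: ifP; rewrite ?ltry.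
- exact: measurable_funTS.
exists K; split; [exact: num_real|move=> M KM x /=; rewrite in_itv/= => xL].
exact: le_trans (kK x xL) (ltW KM).
Qed.

Lemma integral_prim (k : R -> R) (L : R) : measurable_fun setT k -> mu.-integrable `[0, L] (EFin \o k) ->
  (\int[mu]_(u in `]0%R, +oo[) ((EFin \o k) \_ `]-oo, L]) u = (prim k L)%:E)%E.
Proof.
move=> mk ik; rewrite -integral_mkcondr (_ : _ `&` _ = `]0%R, L]%classic); last first.
  apply/seteqP; split=> u /=; rewrite !in_itv/=; first by move=> [/andP[-> _]].
  by move=> /andP[-> ->].
rewrite integral_itv_obnd_cbnd; last by apply/measurable_EFinP; exact: measurable_funTS.
by rewrite /prim /Rintegral fineK//; exact: (integrable_fin_num _ ik).
Qed.

Variables (k : R -> R) (K : R).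
Hypotheses (mk : measurable_fun setT k) (kK : forall t, `|k t| <= K).

Lemma lebesgue_bounded_integrable (D : set R) : measurable D -> (mu D < +oo)%E -> mu.-integrable D (EFin \o k).
Proof.
move=> mD Doo; apply: measurable_bounded_integrable => //; first exact: measurable_funTS.
by exists K; split; [exact: num_real|move=> M KM x _ /=; exact: le_trans (kK x) (ltW KM)].
Qed.

Lemma prim_integrable y : mu.-integrable `[0, y] (EFin \o k).
Proof. by apply: lebesgue_bounded_integrable => //; rewrite lebesgue_measure_itv; case: ifP; rewrite ?ltry. Qed.

Lemma prim_lip x y : 0 <= x -> x <= y -> `|prim k y - prim k x| <= K * (y - x).
Proof.
move=> x0 xy; rewrite /prim (Rintegral_itvB (a := BLeft 0) (b := BRight y))//; last exact: prim_integrable.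
have fin : (mu `]x, y] < +oo)%E by rewrite lebesgue_measure_itv; case: ifP; rewrite ?ltry.
have iI := lebesgue_bounded_integrable (measurable_itv _) fin.
apply: le_trans (le_normr_Rintegral _ iI) _ => //.
have -> : K * (y - x) = \int[mu]_(v in `]x, y]) K.
  rewrite Rintegral_cst//= lebesgue_measure_itv/= lte_fin.
  by case: ltP => //= h; congr (_ * _); apply/eqP; rewrite subr_eq0 eq_le h.
apply: le_Rintegral => //; first exact: (integrable_norm iI).
apply/integrableP; split; first exact: measurable_cst.
by rewrite integral_cst//=; apply: lte_mul_pinfty; rewrite ?lee_fin.
Qed.

Lemma prim_norm y : 0 <= y -> `|prim k y| <= K * y.
Proof.
move=> y0; have := prim_lip (lexx 0) y0; rewrite [X in _ - X](_ : _ = 0) ?subr0//.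
by rewrite /prim set_itv1 Rintegral_set1.
Qed.

Lemma primN y : prim (fun t => - k t) y = - prim k y.
Proof.
rewrite /prim -mulN1r -RintegralZl//; last exact: prim_integrable.
by apply: eq_Rintegral => t _; rewrite mulN1r.
Qed.

Lemma primD (k' : R -> R) y :
  mu.-integrable `[0, y] (EFin \o k') -> prim (fun t => k t + k' t) y = prim k y + prim k' y.
Proof. by move=> i'; rewrite /prim -RintegralD//; exact: prim_integrable. Qed.

Lemma prim_ae : exists N, [/\ measurable N, mu N = 0%E &
  forall t, 0 < t -> ~ N t -> is_derive t (1 : R) (prim k) (k t)].
Proof.
have loc : locally_integrable setT k.
  split=> //; first exact: openT.
  move=> C _ cC; have fin := compact_finite_measure cC.
  by have /integrableP[] := lebesgue_bounded_integrable (compact_measurable cC) fin.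
have [N [mN N0 NP]] := lebesgue_differentiation loc.
exists N; split=> // t t0 nN.
have pt : lebesgue_pt k t by apply: contrapT => np; apply: nN; apply: NP.
have t1 : t < t + 1 by rewrite ltrDl.
have [d1 d2] := FTC1_lebesgue_pt t1 (prim_integrable (t + 1)) t0 pt.
by apply: DeriveDef; [exact: d1|rewrite -derive1E; exact: d2].
Qed.

End primitive.

(** * Linear differential inequalities for absolutely continuous functions *)

Section linear.
Variables (f k p : R -> R) (K P C L : R) (E : set R).
Hypotheses (L0 : 0 <= L) (acf : absolutely_continuous 0 L f) (fC : forall t, 0 <= t <= L -> `|f t| <= C).
Hypotheses (mk : measurable_fun setT k) (kK : forall t, `|k t| <= K).
Hypotheses (mp : measurable_fun setT p) (pP : forall t, `|p t| <= P).
Hypotheses (mE : measurable E) (E0 : lebesgue_measure (`[0, L] `\` E) = 0%E).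
Hypothesis dE : forall t, E t -> 0 < t -> t < L -> derivable f t 1 /\ 0 <= derive1 f t + k t * f t + p t.

Let w t := expR (prim k t).
(** Cut off outside [[0, L]], since the integrating factor [w] is bounded on that interval only and
    [prim_ae] asks for a global bound. *)
Let q := (fun t => w t * p t) \_ `[0, L].

Let K0 : 0 <= K := le_trans (normr_ge0 _) (kK 0).
Let P0 : 0 <= P := le_trans (normr_ge0 _) (pP 0).
Let C0 : 0 <= C. Proof. by apply: le_trans (normr_ge0 _) (fC (t := 0) _); rewrite lexx. Qed.

Let mprim : measurable_fun setT (prim k).
Proof.
have mk' : measurable_fun setT (fun z : R * R => k z.2) by apply: measurableT_comp.
have := measurable_prim mk' => mp'; have := measurableT_comp mp' (measurable_pair1 (0 : R)); exact.
Qed.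

Let mw : measurable_fun setT w. Proof. exact: (measurableT_comp (@measurable_expR R) mprim). Qed.

Let w_le t : 0 <= t -> t <= L -> w t <= expR (K * L).
Proof.
move=> t0 tL; rewrite ler_expR (le_trans (ler_norm _))// (le_trans (prim_norm mk kK t0))//.
by rewrite ler_wpM2l.
Qed.

Let mq : measurable_fun setT q.
Proof. by apply/(measurable_restrictT _ _).1 => //; apply: measurable_funTS; exact: measurable_funM. Qed.

Let q_le t : `|q t| <= expR (K * L) * P.
Proof.
rewrite /q patchE; case: ifPn => [|_]; last by rewrite normr0 mulr_ge0 ?expR_ge0.
rewrite inE /= in_itv/= => /andP[t0 tL]; rewrite normrM ler_pM// ger0_norm ?expR_ge0//; exact: w_le.
Qed.

Let w_lip x y : 0 <= x -> x <= y -> y <= L -> `|w y - w x| <= expR (K * L) * K * (y - x).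
Proof.
move=> x0 xy yL; have := prim_lip mk kK x0 xy; have hx := w_le x0 (le_trans xy yL).
have hy := w_le (le_trans x0 xy) yL; rewrite /w in hx hy *.
by move=> h; apply: le_trans (expR_lip hx hy) _; rewrite -mulrA ler_wpM2l ?expR_ge0.
Qed.

(** Gronwall's argument: with the integrating factor [w], the function [w * f] plus the primitive of
    [w * p] has a nonnegative derivative almost everywhere. It is absolutely continuous because [w]
    and the primitive are Lipschitz. *)
Lemma linear_le : f 0 <= w L * f L + prim (fun t => w t * p t) L.
Proof.
have [N1 [mN1 N10 dN1]] := prim_ae mk kK.
have [N2 [mN2 N20 dN2]] := prim_ae mq q_le.
pose H t := - (w t * f t + prim q t).
have acH : absolutely_continuous 0 L H.
  apply: (ac_dominated (C := expR (K * L)) (L := C * (expR (K * L) * K) + expR (K * L) * P) acf).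
  - exact: expR_ge0.
  - by rewrite addr_ge0// !mulr_ge0// expR_ge0.
  move=> x y x0 xy yL; have h1 := prim_lip mq q_le x0 xy; have h2 := w_lip x0 xy yL.
  have hx := fC (t := x) _; rewrite x0 (le_trans xy)// in hx; have {}hx := hx isT.
  have hy := w_le (le_trans x0 xy) yL.
  have -> : H y - H x = - (w y * (f y - f x)) + (- (f x * (w y - w x)) - (prim q y - prim q x)).
    by rewrite /H; move: (w y) (w x) (f y) (f x) (prim q y) (prim q x) => w1 w2 f1 f2 p1 p2; ring.
  apply: le_trans (ler_normD _ _) _; apply: lerD.
    by rewrite normrN normrM ler_wpM2r// ger0_norm// expR_ge0.
  apply: le_trans (ler_normB _ _) _; rewrite normrN normrM mulrDl -mulrA lerD//.
  by rewrite ler_pM.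
have dH t : (E `\` (N1 `|` N2)) t -> 0 < t -> t < L -> derivable H t 1 /\ derive1 H t <= 0.
  move=> [Et /not_orP[n1 n2]] t0 tL.
  have [df hf] := dE Et t0 tL; have d1 := dN1 t t0 n1; have d2 := dN2 t t0 n2.
  have dw : is_derive t (1 : R) w (w t * k t) := is_derive1_comp (is_derive_expR _) d1.
  have df' : is_derive t (1 : R) f (derive1 f t) by apply: DeriveDef => //; rewrite derive1E.
  have d3 := is_deriveN (is_deriveD (is_deriveM dw df') d2).
  have eH : derive1 H t = - (w t * (derive1 f t + k t * f t + p t)).
    rewrite derive1E; have [_ e] := d3; rewrite /H in e *; rewrite [LHS]e /q patchE mem_set ?in_itv/= ?ltW//.
    by rewrite /GRing.scale/=; lra.
    by rewrite in_itv/= !ltW.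
  by split; [have [] := d3|rewrite eH oppr_le0 mulr_ge0// expR_ge0].
have E'0 : lebesgue_measure (`[0, L] `\` (E `\` (N1 `|` N2))) = 0%E.
  have mN : measurable (N1 `|` N2) by exact: measurableU.
  apply/eqP; rewrite eq_le measure_ge0 andbT.
  apply: (@le_trans _ _ (lebesgue_measure ((`[0%R, L] `\` E) `|` (N1 `|` N2)))).
    apply: le_measure; rewrite ?inE; [|by apply: measurableU => //; exact: measurableD|].
      by apply: measurableD => //; exact: measurableD.
    move=> t [tI nE]; have [Et|] := pselect (E t); last by left.
    by right; apply: contrapT => nN; apply: nE.
  apply: le_trans (measureU2 _ _ _) _ => //; first exact: measurableD.
  rewrite [X in (X + _)%E]E0 add0e; apply: le_trans (measureU2 _ _ _) _ => //.
  by rewrite [X in (X + _)%E]N10 [X in (_ + X)%E]N20 adde0.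
have := ac_nonincreasing L0 acH (measurableD mE (measurableU _ _ mN1 mN2)) E'0 dH.
rewrite /H lerN2 /w; have z r : prim r 0 = 0 by rewrite /prim set_itv1 Rintegral_set1.
rewrite !z expR0 mul1r addr0; suff -> : prim q L = prim (fun t => w t * p t) L by [].
by apply: eq_Rintegral => t tL; rewrite /q patchE tL.
Qed.

End linear.
End absolutely_continuous.

(** * Jump kernels *)

Section functional.
Import HBNNSimple.
Context d d' (X : measurableType d) (Z : measurableType d') (R : realType).
Variable I : X -> (Z -> \bar R) -> \bar R.

Definition nneg_measurable (f : Z -> \bar R) := measurable_fun setT f /\ forall z, 0 <= f z.

(** A Daniell functional on nonnegative measurable functions. Kernels are built from such
    functionals, so that sigma-additivity and measurability are checked once and for all. *)
Record integral_like : Prop := IntegralLike {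
  il_ge0 : forall w f, (forall z, 0 <= f z) -> 0 <= I w f ;
  il_D : forall w f g, nneg_measurable f -> nneg_measurable g ->
    I w (fun z => f z + g z) = I w f + I w g ;
  il_Z : forall w (r : R) f, (0 <= r)%R -> nneg_measurable f ->
    I w (fun z => r%:E * f z) = r%:E * I w f ;
  il_lim : forall w (f : nat -> Z -> \bar R), (forall n, nneg_measurable (f n)) ->
    (forall z, nondecreasing_seq (f ^~ z)) ->
    I w (fun z => limn (f ^~ z)) = limn (fun n => I w (f n)) ;
  il_measurable : forall f, nneg_measurable f -> measurable_fun setT (I ^~ f) }.

Hypothesis HI : integral_like.

Let nneg_indic (D : set Z) : measurable D -> nneg_measurable (EFin \o \1_D).
Proof. by move=> mD; split=> [|z]; [apply/measurable_EFinP|rewrite lee_fin]. Qed.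

Lemma nneg_sum (J : Type) (s : seq J) (g : J -> Z -> \bar R) : (forall j, nneg_measurable (g j)) ->
  nneg_measurable (fun z => \sum_(j <- s) g j z).
Proof.
move=> hg; split=> [|z]; first elim: s => [|j s IH].
- by under eq_fun do rewrite big_nil; exact: measurable_cst.
- by under eq_fun do rewrite big_cons; apply: emeasurable_funD => //; have [] := hg j.
- by apply: sume_ge0 => j _; have [] := hg j.
Qed.

Lemma il_0 w : I w (cst 0) = 0.
Proof.
rewrite (_ : cst 0 = fun z : Z => 0%:E * (cst 0 z : \bar R)); first by rewrite (il_Z HI) ?mul0e.
by apply/funext => z; rewrite mul0e.
Qed.

Lemma il_sum w (J : Type) (s : seq J) (g : J -> Z -> \bar R) : (forall j, nneg_measurable (g j)) ->
  I w (fun z => \sum_(j <- s) g j z) = \sum_(j <- s) I w (g j).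
Proof.
move=> hg; elim: s => [|j s IH].
  by rewrite big_nil -[RHS](il_0 w); congr (I w _); apply/funext => z; rewrite big_nil.
rewrite big_cons -IH -(il_D HI)//; last exact: nneg_sum.
by congr (I w _); apply/funext => z; rewrite big_cons.
Qed.

Section measure.
Variable w : X.

Definition il_measure of integral_like := fun D : set Z => I w (EFin \o \1_D).

Let mu := il_measure HI.

Let mu0 : mu set0 = 0.
Proof. by rewrite -[RHS](il_0 w); congr (I w _); apply/funext => z; rewrite /= indic0. Qed.

Let mu_ge0 D : 0 <= mu D.
Proof. by apply: (il_ge0 HI) => z; rewrite lee_fin. Qed.

Let mu_additive : semi_sigma_additive mu.
Proof.
move=> F mF tF mU; pose g n z : \bar R := \sum_(0 <= i < n) (EFin \o \1_(F i)) z.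
have hg n : nneg_measurable (g n) by apply: nneg_sum => j; exact: nneg_indic.
have nd z : nondecreasing_seq (g ^~ z).
  by apply: ereal_nondecreasing_series => i _ _; rewrite lee_fin.
have gE : (EFin \o \1_(\bigcup_n F n)) = fun z => limn (g ^~ z).
  apply/funext => z; apply/esym/cvg_lim => //.
  have := @measure_semi_sigma_additive _ _ R (\d_z) F mF tF mU.
  by rewrite /= !diracE indicE /g; under eq_fun do under eq_bigr do rewrite diracE -indicE.
have muE n : \sum_(0 <= i < n) mu (F i) = I w (g n).
  by rewrite il_sum// => j; exact: nneg_indic.
under eq_fun do rewrite muE.
have -> : mu (\bigcup_n F n) = limn (fun n => I w (g n)) by rewrite -(il_lim HI)// -gE.
apply: ereal_nondecreasing_is_cvgn => m n mn; rewrite -!muE.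
have h : nondecreasing_seq (fun n => \sum_(0 <= i < n) mu (F i)).
  by apply: ereal_nondecreasing_series => i _ _; exact: mu_ge0.
exact: h.
Qed.

HB.instance Definition _ := isMeasure.Build _ _ _ mu mu0 mu_ge0 mu_additive.

Definition il_kernel : {measure set Z -> \bar R} := mu.

End measure.

Lemma il_integral w f : nneg_measurable f -> \int[il_kernel w]_z f z = I w f.
Proof.
move=> [mf f0].
pose h n : Z -> R := nnsfun_approx measurableT mf n.
have hf z : f z = limn (fun n => (h n z)%:E).
  by apply/esym/cvg_lim => //; exact: (cvg_nnsfun_approx measurableT mf (fun z _ => f0 z)).
have hn n : nneg_measurable (EFin \o h n) by split=> [|z]; [apply/measurable_EFinP|rewrite lee_fin].
have nd z : nondecreasing_seq (fun n => (EFin \o h n) z).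
  by move=> m n mn; rewrite lee_fin; exact/lefP/nd_nnsfun_approx.
rewrite (_ : f = fun z => limn (fun n => (EFin \o h n) z)); last exact/funext.
rewrite (il_lim HI)// monotone_convergence//; last 2 first.
- by move=> n; have [] := hn n.
- by move=> n z _; have [] := hn n.
congr (limn _); apply/funext => n.
pose s := finmap.enum_fset (fset_set (range (h n))).
pose g y z : \bar R := `|y|%R%:E * (EFin \o \1_(h n @^-1` [set y])) z.
have mg y : nneg_measurable (EFin \o \1_(h n @^-1` [set y]) : Z -> \bar R) by exact: nneg_indic.
have hg y : nneg_measurable (g y).
  split=> [|z]; first by apply: measurable_funeM; have [] := mg y.
  by rewrite mule_ge0// lee_fin.
have -> : EFin \o h n = fun z => \sum_(y <- s) g y z.
  apply/funext => z; rewrite /= /h fimfunE fsbig_finite//= -sumEFin.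
  apply: eq_big_seq => y; rewrite in_fset_set// inE => -[z' _ <-].
  by rewrite /g/= EFinM ger0_norm.
rewrite il_sum// ge0_integral_sum//; last 2 first.
- by move=> y; have [] := hg y.
- by move=> y z _; have [] := hg y.
apply: eq_bigr => y _; rewrite (il_Z HI)// ge0_integralZl_EFin//;
  try (by have [] := mg y); try by (move=> z _; have [_] := mg y).
by rewrite integral_indic// setIT.
Qed.

Lemma kernel_of_functional : (forall w, I w (cst 1) = 1) -> exists k : R.-pker X ~> Z,
  forall w f, nneg_measurable f -> \int[k w]_z f z = I w f.
Proof.
move=> I1; have [U mU|w|k kE] := @kernel_exists _ _ X Z R il_kernel.
- by apply: (il_measurable HI); exact: nneg_indic.
- rewrite /il_kernel/= /il_measure (_ : _ \o _ = cst 1)//.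
  by apply/funext => z; rewrite /= indicT.
exists k => w f hf; rewrite -il_integral//; apply: integral_eq_measurable => U _; exact: kE.
Qed.

End functional.

Section mixture_functional.
Context d0 d d' (T : measurableType d0) (Z : measurableType d) (Y : measurableType d') (R : realType).
Variables (P : {measure set T -> \bar R}) (A : set T) (mA : measurable A) (k : R.-pker T ~> Z).
Variables (phi : T * Z -> Y) (mphi : measurable_fun setT phi).

Definition mixed (_ : unit) (f : Y -> \bar R) := \int[P]_(w in A) \int[k w]_z f (phi (w, z)).

Let mf_in (f : Y -> \bar R) w : nneg_measurable f -> measurable_fun setT (fun z => f (phi (w, z))).
Proof. by move=> [mf _]; exact: (measurableT_comp mf (measurableT_comp mphi (measurable_pair1 w))). Qed.

Let mf_out (f : Y -> \bar R) : nneg_measurable f -> measurable_fun A (fun w => \int[k w]_z f (phi (w, z))).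
Proof.
move=> [mf f0]; apply: measurable_funTS; apply: measurable_integral => //.
by have := measurableT_comp mf mphi; apply: eq_measurable_fun => -[].
Qed.

Lemma mixed_integral_like : integral_like mixed.
Proof.
split.
- by move=> w f f0; apply: integral_ge0 => t _; exact: integral_ge0.
- move=> w f g hf hg; have [_ f0] := hf; have [_ g0] := hg.
  rewrite /mixed -ge0_integralD//; try exact: mf_out; try by move=> t _; exact: integral_ge0.
  by apply: eq_integral => t _; rewrite ge0_integralD//; exact: mf_in.
- move=> w r f r0 hf; have [_ f0] := hf.
  rewrite /mixed -ge0_integralZl_EFin//; try exact: mf_out; try by move=> t _; exact: integral_ge0.
  by apply: eq_integral => t _; rewrite ge0_integralZl_EFin//; exact: mf_in.
- move=> w f hf nd; have f0 n z : 0 <= f n z by have [] := hf n.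
  rewrite /mixed -monotone_convergence//; try by move=> n; exact: mf_out.
  + apply: eq_integral => t _; rewrite monotone_convergence//; try (by move=> n; exact: mf_in).
  + by move=> n t _; exact: integral_ge0.
  + move=> t _ m n mn; apply: ge0_le_integral => //; try exact: mf_in.
    by move=> z _; exact: nd.
- by move=> f hf; exact: measurable_cst.
Qed.

End mixture_functional.

(* A conditional law given on rectangles. *)
Lemma integral_disintegration d0 d d' (T : measurableType d0) (X : measurableType d) (Z : measurableType d')
    (R : realType) (P : probability T R) (A : set T) (h : T -> X) (z : T -> Z) (N : R.-pker X ~> Z) :
  measurable A -> measurable_fun setT h -> measurable_fun setT z ->
  (forall C D, measurable C -> measurable D ->
    P (A `&` (h @^-1` C `&` z @^-1` D)) = \int[P]_(w in A `&` h @^-1` C) N (h w) D) ->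
  forall Psi : X * Z -> \bar R, nneg_measurable Psi ->
    \int[P]_(w in A) Psi (h w, z w) = \int[P]_(w in A) \int[N (h w)]_y Psi (h w, y).
Proof.
move=> mA mh mz rect Psi hPsi.
have mphi : measurable_fun setT (fun p : T * Z => (h p.1, p.2)).
  exact: (measurable_fun_pair (measurableT_comp mh measurable_fst) measurable_snd).
have l1 := mixed_integral_like P mA (kdirac mz) mphi.
have l2 := mixed_integral_like P mA (kpre N mh) mphi.
have e1 : mixed P A (kdirac mz) (fun p => (h p.1, p.2)) tt Psi = \int[P]_(w in A) Psi (h w, z w).
  apply: eq_integral => w _; rewrite /kdirac/= integral_dirac ?diracT ?mul1e//.
  by have [mP _] := hPsi; exact: (measurableT_comp mP (measurable_pair1 (h w))).
rewrite -e1 -[RHS]/(mixed P A (kpre N mh) (fun p => (h p.1, p.2)) tt Psi).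
transitivity (\int[il_kernel l1 tt]_p Psi p); first by apply/esym; exact: il_integral.
transitivity (\int[il_kernel l2 tt]_p Psi p); last exact: il_integral.
apply: integral_eq_measurable => U mU.
apply: (measure_unique [set C `*` D | C in measurable & D in measurable] (fun=> setT)) => //.
- exact: measurable_prod_measurableType.
- move=> _ _ [C1 mC1 [D1 mD1 <-]] [C2 mC2 [D2 mD2 <-]].
  exists (C1 `&` C2); first exact: measurableI.
  by exists (D1 `&` D2); [exact: measurableI|rewrite setXI].
- by exists setT => //; exists setT => //; rewrite setXTT.
- by rewrite bigcup_const.
- move=> _ [C mC [D mD <-]].
  have E (w : T) : (h w, z w) \in C `*` D = (w \in h @^-1` C `&` z @^-1` D) by apply/idP/idP; rewrite !inE.
  transitivity (P (A `&` (h @^-1` C `&` z @^-1` D))).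
    rewrite /il_kernel/= /il_measure /mixed.
    have mhz : measurable (h @^-1` C `&` z @^-1` D).
      by apply: measurableI; [exact: (measurable_preimageT mh)|exact: (measurable_preimageT mz)].
    rewrite setIC -integral_indic//; apply: eq_integral => w _.
    have mi : measurable_fun setT (fun y => (\1_(C `*` D) (h w, y) : R)%:E).
      apply/measurable_EFinP; apply: (measurableT_comp (@measurable_indic _ _ R setT _ _) (measurable_pair1 (h w))).
      exact: measurableX.
    by rewrite /kdirac/= integral_dirac// diracT mul1e !indicE E.
  rewrite rect// /il_kernel/= /il_measure /mixed integral_mkcondr; apply: eq_integral => w _.
  rewrite patchE; case: ifPn => hw.
    transitivity (\int[N (h w)]_y (\1_D y : R)%:E); first by rewrite integral_indic// setIT.
    apply: eq_integral => y _; rewrite /= !indicE; suff -> : (y \in D) = ((h w, y) \in C `*` D) by [].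
    by apply/idP/idP; rewrite !inE/=; [split=> //; rewrite inE in hw|case].
  apply/esym/integral0_eq => y _; rewrite /= indicE memNset// => -[Cw _].
  by rewrite mem_set in hw.
- move=> _; rewrite /il_kernel/= /il_measure /mixed (eq_integral (cst 1)) => [|w _].
    by rewrite integral_cst// mul1e (le_lt_trans (probability_le1 P mA))// ltry.
  by rewrite (eq_integral (cst 1)) ?integral_pker_cst// => y _; rewrite /= indicT.
Qed.


(** * The law of the next jump *)

Section jump.
Context d (W : measurableType d) (R : realType) (S : ptopologicalType).
Variables (sg : W -> borel S) (c : W -> R) (mk : R.-pker (W * R)%type ~> borel S).
Hypotheses (msg : measurable_fun setT sg) (mc : measurable_fun setT c) (c0 : forall w, (0 <= c w)%R).
Hypothesis sS : standard_borel (borel S).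

Local Notation Z := (step R S).
Local Notation mu := lebesgue_measure.

Definition moved (w : W) : set (borel S) := ~` [set sg w].

(** The diagonal of a standard Borel space is measurable, as equality can be tested on the countably
    many bits of the code. *)
Lemma measurable_moved : measurable [set p : W * borel S | moved p.1 p.2].
Proof.
have [e [g [me mg eg]]] := sS.
rewrite (_ : [set _ | _] = ~` (\bigcap_n [set p : W * borel S | e p.2 n = e (sg p.1) n])).
  apply/measurableC/bigcap_measurable => // n _.
  have mb b : measurable_fun setT b -> measurable_fun setT (fun p : W * borel S => (e (b p) n : bool)).
    move=> mb; apply: (measurable_fun_bool true) => //.
    exact: (measurableT_comp me mb) measurableT _ (measurable_bit n).
  have m1 := mb _ measurable_snd; have m2 := mb _ (measurableT_comp msg measurable_fst).
  rewrite (_ : [set _ | _] = [set p | e p.2 n == e (sg p.1) n]); last first.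
    by apply/seteqP; split=> p /=; [move=> ->|move/eqP].
  apply: measurable_pred; rewrite (_ : (fun p => _) = fun p : W * borel S => ~~ (e p.2 n (+) e (sg p.1) n)); last first.
    by apply/funext => p; case: (e p.2 n); case: (e (sg p.1) n).
  rewrite (_ : (fun p => _) = fun p : W * borel S => (e p.2 n && e (sg p.1) n) || (~~ e p.2 n && ~~ e (sg p.1) n)); last first.
    by apply/funext => p; case: (e p.2 n); case: (e (sg p.1) n).
  by apply: measurable_or; apply: measurable_and => //; exact: measurable_neg.
apply/seteqP; split=> p /= nE; last by move=> E; apply: nE => n _ /=; rewrite E.
move=> E; apply: nE; rewrite -(eg p.2) -(eg (sg p.1)); congr g; apply/funext => n; exact: E.
Qed.

Let mmv (w : W) : measurable (moved w).
Proof.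
have := measurable_moved; move/(measurable_xsection w); congr measurable.
by apply/seteqP; split=> y; rewrite /xsection/= inE.
Qed.

Definition leave w u : R := c w * fine (mk (w, u) (moved w)).
Definition survival w u : R := expR (prim (fun v => - leave w v)%R u).
(** Density of the jump with respect to [du] and the uniformized kernel. The indicator removes the
    fictitious jumps of uniformization, which leave the state unchanged. *)
Definition density w u y : R := c w * survival w u * \1_(moved w) y.

Definition jump_int w (g : R -> S -> \bar R) : \bar R :=
  \int[mu]_(u in `]0%R, +oo[) \int[mk (w, u)]_y ((density w u y)%:E * g u y).

Let mk1 w u : mk (w, u) (moved w) <= 1.
Proof. by rewrite -[leRHS](@prob_kernel _ _ _ _ _ mk (w, u)); apply: le_measure; rewrite ?inE. Qed.

Let mk_fin w u : mk (w, u) (moved w) \is a fin_num.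
Proof. by rewrite ge0_fin_numE ?measure_ge0// (le_lt_trans (mk1 w u))// ltry. Qed.

Let m_indic : measurable_fun setT (fun p : (W * R) * borel S => \1_(moved p.1.1) p.2 : R).
Proof.
have := @measurable_indic _ _ R setT _ measurable_moved => h.
exact: (measurableT_comp h (measurable_fun_pair (measurableT_comp measurable_fst measurable_fst) measurable_snd)).
Qed.

Lemma leave_bounds w u : (0 <= leave w u <= c w)%R.
Proof.
have := mk1 w u; rewrite -(fineK (mk_fin w u)) lee_fin => m1.
have m0 : (0 <= fine (mk (w, u) (moved w)))%R by rewrite fine_ge0// measure_ge0.
by rewrite /leave mulr_ge0//= -[leRHS]mulr1 ler_wpM2l.
Qed.

Lemma leaveE w u : (leave w u)%:E = (c w)%:E * mk (w, u) (moved w).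
Proof. by rewrite /leave EFinM fineK. Qed.

Lemma measurable_leave : measurable_fun setT (fun p : W * R => leave p.1 p.2).
Proof.
apply: measurable_funM; first exact: measurableT_comp.
apply: (measurableT_comp (fine_measurable measurableT)).
have h := measurable_integral mk (f := fun p y => (\1_(moved p.1) y)%:E).
apply: (eq_measurable_fun _ _ (h _ _)) => [[w u] _||p y]; last by rewrite lee_fin.
  by rewrite integral_indic// setIT.
by apply/measurable_EFinP.
Qed.

Let mNleave : measurable_fun setT (fun p : W * R => - leave p.1 p.2)%R.
Proof. exact: measurableT_comp measurable_leave. Qed.

Lemma measurable_survival : measurable_fun setT (fun p : W * R => survival p.1 p.2).
Proof. exact: (measurableT_comp (@measurable_expR R) (measurable_prim mNleave)). Qed.

Lemma measurable_density : measurable_fun setT (fun p : (W * R) * borel S => density p.1.1 p.1.2 p.2).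
Proof.
apply: measurable_funM => //; apply: measurable_funM; last exact: (measurableT_comp measurable_survival).
by apply: (measurableT_comp mc); exact: (measurableT_comp measurable_fst measurable_fst).
Qed.

Lemma density_ge0 w u y : (0 <= density w u y)%R.
Proof. by rewrite !mulr_ge0// expR_ge0. Qed.

Let dg_ge0 w u g y : (forall y, 0 <= g y) -> 0 <= (density w u y)%:E * g y.
Proof. by move=> g0; rewrite mule_ge0// lee_fin density_ge0. Qed.

Lemma measurable_density_integral (g : R -> S -> \bar R) :
  measurable_fun setT (fun p : R * borel S => g p.1 p.2) -> (forall u y, 0 <= g u y) ->
  measurable_fun setT (fun p : W * R => \int[mk p]_y ((density p.1 p.2 y)%:E * g p.2 y)).
Proof.
move=> mg g0; apply: measurable_integral => [|p y]; last exact: dg_ge0.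
apply: emeasurable_funM; first by apply/measurable_EFinP; exact: measurable_density.
exact: (measurableT_comp mg (measurable_fun_pair (measurableT_comp measurable_snd measurable_fst) measurable_snd)).
Qed.

Section fixed.
Variable w : W.

Let mdw u : measurable_fun setT (density w u : borel S -> R).
Proof.
exact: (measurableT_comp measurable_density (measurable_pair1 (w, u))).
Qed.

Let mgu (g : R -> S -> \bar R) u : measurable_fun setT (fun p : R * borel S => g p.1 p.2) ->
  measurable_fun setT (g u : borel S -> \bar R).
Proof. by move=> mg; exact: (measurableT_comp mg (measurable_pair1 u)). Qed.

Let mdg (g : R -> S -> \bar R) u : measurable_fun setT (fun p : R * borel S => g p.1 p.2) ->
  measurable_fun setT ((fun y => (density w u y)%:E * g u y) : borel S -> \bar R).
Proof. by move=> /(mgu u) h; apply: emeasurable_funM => //; apply/measurable_EFinP. Qed.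

Let m_inner (g : R -> S -> \bar R) :
  measurable_fun setT (fun p : R * borel S => g p.1 p.2) -> (forall u y, 0 <= g u y) ->
  measurable_fun setT ((fun u => \int[mk (w, u)]_y ((density w u y)%:E * g u y)) : R -> \bar R).
Proof.
by move=> mg g0; exact: (measurableT_comp (measurable_density_integral mg g0) (measurable_pair1 w)).
Qed.

Let inner_ge0 (g : R -> S -> \bar R) u : (forall u y, 0 <= g u y) ->
  0 <= \int[mk (w, u)]_y ((density w u y)%:E * g u y).
Proof. by move=> g0; apply: integral_ge0 => y _; exact: dg_ge0. Qed.

Lemma density_indic u (E : set (borel S)) : measurable E ->
  \int[mk (w, u)]_y ((density w u y)%:E * (\1_E y : R)%:E) =
  (c w * survival w u)%:E * mk (w, u) (E `\ sg w).
Proof.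
move=> mE; have mF : measurable (E `\ sg w) by rewrite setDE; apply: measurableI => //; exact: (mmv w).
rewrite -[X in mk _ X]setIT -integral_indic// -ge0_integralZl_EFin//;
  try (by apply/measurable_EFinP; exact: measurable_indic); try (by rewrite mulr_ge0// expR_ge0);
  try (by move=> y _; rewrite lee_fin).
apply: eq_integral => y _.
have -> : (\1_(E `\ sg w) y : R) = (\1_(moved w) y * \1_E y)%R.
  by rewrite setDE !indicE in_setI mulrC -natrM mulnb.
by rewrite /density -!EFinM !mulrA.
Qed.

Lemma jump_int_ge0 g : (forall u y, 0 <= g u y) -> 0 <= jump_int w g.
Proof. by move=> g0; apply: integral_ge0 => u _; exact: inner_ge0. Qed.

Lemma jump_int_le g h : measurable_fun setT (fun p : R * borel S => g p.1 p.2) -> (forall u y, 0 <= g u y) ->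
  measurable_fun setT (fun p : R * borel S => h p.1 p.2) -> (forall u y, g u y <= h u y) ->
  jump_int w g <= jump_int w h.
Proof.
move=> mg g0 mh gh; have h0 u y : 0 <= h u y := le_trans (g0 u y) (gh u y).
apply: ge0_le_integral => //.
- by move=> u _; exact: inner_ge0.
- by apply: measurable_funTS; exact: m_inner.
- by apply: measurable_funTS; exact: m_inner.
move=> u _; apply: ge0_le_integral => //.
- by move=> y _; exact: dg_ge0.
- exact: mdg.
- exact: mdg.
- by move=> y _; rewrite lee_wpmul2l ?lee_fin ?density_ge0//; exact: gh.
Qed.

Lemma jump_intD g h : measurable_fun setT (fun p : R * borel S => g p.1 p.2) -> (forall u y, 0 <= g u y) ->
  measurable_fun setT (fun p : R * borel S => h p.1 p.2) -> (forall u y, 0 <= h u y) ->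
  jump_int w (fun u y => g u y + h u y) = jump_int w g + jump_int w h.
Proof.
move=> mg g0 mh h0; rewrite /jump_int -ge0_integralD//; last first.
- by apply: measurable_funTS; exact: m_inner.
- by move=> u _; exact: inner_ge0.
- by apply: measurable_funTS; exact: m_inner.
- by move=> u _; exact: inner_ge0.
apply: eq_integral => u _; rewrite -ge0_integralD//; last first.
- exact: mdg.
- by move=> y _; exact: dg_ge0.
- exact: mdg.
- by move=> y _; exact: dg_ge0.
by apply: eq_integral => y _; rewrite ge0_muleDr.
Qed.

Lemma jump_intZ g r : measurable_fun setT (fun p : R * borel S => g p.1 p.2) -> (forall u y, 0 <= g u y) ->
  (0 <= r)%R -> jump_int w (fun u y => r%:E * g u y) = r%:E * jump_int w g.
Proof.
move=> mg g0 r0; rewrite /jump_int -ge0_integralZl_EFin//; last first.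
- by apply: measurable_funTS; exact: m_inner.
- by move=> u _; exact: inner_ge0.
apply: eq_integral => u _; rewrite -ge0_integralZl_EFin//; last first.
- exact: mdg.
- by move=> y _; exact: dg_ge0.
by apply: eq_integral => y _; rewrite muleCA.
Qed.

Lemma jump_int_lim (g : nat -> R -> S -> \bar R) :
  (forall n, measurable_fun setT (fun p : R * borel S => g n p.1 p.2)) -> (forall n u y, 0 <= g n u y) ->
  (forall u y, nondecreasing_seq (fun n => g n u y)) ->
  jump_int w (fun u y => limn (fun n => g n u y)) = limn (fun n => jump_int w (g n)).
Proof.
move=> mg g0 nd; rewrite /jump_int -monotone_convergence//; last first.
- move=> u _ m n mn; apply: ge0_le_integral => //.
  + by move=> y _; exact: dg_ge0.
  + exact: mdg.
  + exact: mdg.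
  + by move=> y _; rewrite lee_wpmul2l ?lee_fin ?density_ge0//; exact: nd.
- by move=> n u _; exact: inner_ge0.
- by move=> n; apply: measurable_funTS; exact: m_inner.
apply: eq_integral => u _; rewrite -monotone_convergence//; last first.
- by move=> y _ m n mn; rewrite lee_wpmul2l ?lee_fin ?density_ge0//; exact: nd.
- by move=> n y _; exact: dg_ge0.
- by move=> n; exact: mdg.
apply: eq_integral => y _; rewrite -limeMl//.
by apply: ereal_nondecreasing_is_cvgn; exact: nd.
Qed.

Let nl_norm t : (`|- leave w t| <= c w)%R.
Proof. by rewrite normrN ger0_norm; have /andP[] := leave_bounds w t. Qed.

Let mlw : measurable_fun setT (leave w).
Proof. exact: (measurableT_comp measurable_leave (measurable_pair1 w)). Qed.

Let mslw : measurable_fun setT (fun v => survival w v * leave w v)%R.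
Proof.
by apply: measurable_funM => //; exact: (measurableT_comp measurable_survival (measurable_pair1 w)).
Qed.

Lemma survival_le1 u : (survival w u <= 1)%R.
Proof.
rewrite /survival -expR0 ler_expR /prim.
rewrite [leRHS](_ : 0%R = (\int[mu]_(t in `[0%R, u]) (cst 0 t))%R); last by rewrite Rintegral_cst// mul0r.
apply: le_Rintegral => //; first by apply: (prim_integrable _ nl_norm); exact: measurableT_comp mlw.
  by apply: (@prim_integrable R (cst 0%R) 0%R) => [|t]; [exact: measurable_cst|rewrite normr0].
by move=> t _; rewrite oppr_le0; have /andP[] := leave_bounds w t.
Qed.

Let slw_norm t : (`|survival w t * leave w t| <= c w)%R.
Proof.
have /andP[l0 lc] := leave_bounds w t; rewrite ger0_norm ?mulr_ge0 ?expR_ge0//.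
by apply: le_trans lc; rewrite ler_piMl// survival_le1.
Qed.

(** Survival solves a linear equation at almost every time. [linear_le] applied to the constants 1
    and -1 gives the two inequalities. *)
Lemma survival_prim L : (0 <= L)%R -> prim (fun v => survival w v * leave w v)%R L = (1 - survival w L)%R.
Proof.
move=> L0; have mN : measurable_fun setT (fun v => - leave w v)%R by exact: measurableT_comp mlw.
have acc (r : R) : absolutely_continuous 0 L (cst r) := ac_cst _ _ _.
have D0 : lebesgue_measure (`[0%R, L] `\` [set: R]) = 0 by rewrite setDT measure0.
have key (s : R) : (`|s| = 1 -> s <= survival w L * s + s * prim (fun v => survival w v * leave w v) L)%R.
  move=> s1; have := @linear_le R (cst s) (fun v => - leave w v)%R (fun v => s * leave w v)%R (c w) (c w) 1 L setT L0 (acc s).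
  have -> : prim (fun t => expR (prim (fun v => - leave w v) t) * (s * leave w t))%R L =
      (s * prim (fun v => survival w v * leave w v) L)%R.
    rewrite /prim -RintegralZl//; last exact: prim_integrable mslw slw_norm L.
    by apply: eq_Rintegral => t _; rewrite mulrCA.
  apply=> //.
  - by move=> t _ /=; rewrite s1.
  - by apply: measurable_funM.
  - by move=> t; rewrite normrM s1 mul1r -normrN; exact: nl_norm.
  - move=> t _ _ _; split; first exact: derivable_cst.
    by rewrite derive1_cst/=; lra.
have := key 1%R (normr1 _); have := key (-1)%R; rewrite normrN1 => /(_ erefl).
by move: (prim _ _) (survival _ _) => p q; lra.
Qed.

Lemma jump_mass L : (0 <= L)%R ->
  jump_int w (fun u _ => (\1_`]-oo, L] u : R)%:E) = (1 - survival w L)%:E.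
Proof.
move=> L0; have inner u : \int[mk (w, u)]_y ((density w u y)%:E * (\1_`]-oo, L] u : R)%:E) =
    ((fun u => (survival w u * leave w u)%:E) \_ `]-oo, L]) u.
  have mI : measurable_fun setT (EFin \o (\1_(moved w) : borel S -> R)).
    by apply/measurable_EFinP; exact: measurable_indic.
  have s0 : (0 <= c w * survival w u)%R by rewrite mulr_ge0// expR_ge0.
  under eq_integral do rewrite muleC /density EFinM.
  transitivity ((\1_`]-oo, L] u : R)%:E * \int[mk (w, u)]_y ((c w * survival w u)%:E * (\1_(moved w) y)%:E)).
    apply: ge0_integralZl_EFin => // [y _|]; first by rewrite mule_ge0 ?lee_fin.
    exact: measurable_funeM.
  rewrite ge0_integralZl_EFin//; try by move=> y _; rewrite lee_fin.
  rewrite integral_indic// setIT -(fineK (mk_fin w u)) -!EFinM patchE indicE.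
  by case: ifPn => _; rewrite ?mul0r// mul1r -mulrA mulrCA.
rewrite /jump_int; under eq_integral do rewrite inner.
rewrite integral_prim ?survival_prim//; exact: prim_integrable mslw slw_norm L.
Qed.

Lemma jump_int_le1 : jump_int w (fun _ _ => 1) <= 1.
Proof.
pose g n (u : R) (y : S) : \bar R := (\1_`]-oo, n%:R] u : R)%:E.
have mg n : measurable_fun setT (fun p : R * borel S => g n p.1 p.2).
  by apply/measurable_EFinP; apply: measurableT_comp => //; exact: measurable_indic.
have nd u y : nondecreasing_seq (fun n => g n u y).
  move=> m n mn; rewrite /g !indicE lee_fin ler_nat.
  case: (boolP (u \in `]-oo, m%:R]%classic)) => // /set_mem/=; rewrite in_itv/= => um.
  by rewrite mem_set//= in_itv/= (le_trans um)// ler_nat.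
have -> : (fun (_ : R) (_ : S) => 1 : \bar R) = fun u y => limn (fun n => g n u y).
  apply/funext => u; apply/funext => y; apply/esym/cvg_lim => //.
  apply: cvg_near_cst; exists (Num.bound `|u|%R) => // n /= un; rewrite /g indicE mem_set//=.
  rewrite in_itv/= (le_trans (ler_norm u))// ltW// (lt_le_trans (archi_boundP _))// ler_nat//.
rewrite jump_int_lim//; last by move=> n u y; rewrite lee_fin.
apply: lime_le; first apply: ereal_nondecreasing_is_cvgn => m n mn.
  by apply: jump_int_le => // u y; [rewrite lee_fin|exact: nd].
by apply: nearW => n; rewrite jump_mass// lee_fin gerBl// expR_ge0.
Qed.

End fixed.

Lemma measurable_Some : measurable_fun setT (Some : (R * borel S)%type -> Z).
Proof.
apply: (@measurability _ _ _ Z setT _ [set [set Some z | z in U] | U in @measurable _ (R * borel S)%type]) => //.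
move=> _ [_ [U mU <-] <-]; rewrite setTI (_ : _ @^-1` _ = U)//.
by apply/seteqP; split=> [z [z' Uz' [<-]]|z Uz]//; exists z.
Qed.

Lemma measurable_Some_image (U : set (R * borel S)) : measurable U -> measurable ([set Some z | z in U] : set Z).
Proof. by move=> mU; apply: sub_sigma_algebra; exists U. Qed.

(** [None] is a measurable point, so only the branch [Some] matters. *)
Lemma measurable_step d' (T : measurableType d') (f : Z -> T) :
  measurable_fun setT (fun z : R * borel S => f (Some z)) -> measurable_fun setT f.
Proof.
move=> mf _ B mB; have mS := mf measurableT B mB; rewrite !setTI in mS *.
have mN : measurable [set (None : Z)].
  rewrite (_ : [set None] = ~` [set Some z | z in setT]); first by apply: measurableC; exact: measurable_Some_image.
  by apply/seteqP; split=> [_ -> [z]|[z|]]// h; exfalso; apply: h; exists z.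
have [BN|BN] := pselect (B (f None)).
  rewrite (_ : f @^-1` B = [set Some z | z in [set z | B (f (Some z))]] `|` [set None]).
    by apply: measurableU => //; exact: measurable_Some_image.
  by apply/seteqP; split=> [[z|] h|_ [[z Bz <-]|->]]//; [left; exists z|right].
rewrite (_ : f @^-1` B = [set Some z | z in [set z | B (f (Some z))]]); first exact: measurable_Some_image.
by apply/seteqP; split=> [[z|] h|_ [z Bz <-]]//; exists z.
Qed.

Lemma measurable_jump_int (g : R -> S -> \bar R) :
  measurable_fun setT (fun p : R * borel S => g p.1 p.2) -> (forall u y, 0 <= g u y) ->
  measurable_fun setT (jump_int ^~ g).
Proof.
move=> mg g0; pose h (p : W * R) : \bar R := (\int[mk p]_y ((density p.1 p.2 y)%:E * g p.2 y)) * (\1_`]0%R, +oo[ p.2)%:E.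
have h0 p : 0 <= h p by rewrite mule_ge0 ?lee_fin//; apply: integral_ge0 => y _; exact: dg_ge0.
have mh : measurable_fun setT h.
  apply: emeasurable_funM; first exact: measurable_density_integral.
  by apply/measurable_EFinP; apply: (measurableT_comp (measurable_indic (measurable_itv _))).
suff -> : jump_int ^~ g = fubini_F mu h by exact: measurable_fun_fubini_tonelli_F.
apply/funext => w; rewrite /fubini_F /jump_int [LHS]integral_mkcond; apply: eq_integral => u _.
by rewrite /h epatch_indic.
Qed.

Let cst1 : measurable_fun setT (fun p : R * borel S => 1 : \bar R). Proof. exact: measurable_cst. Qed.
Let rest w : \bar R := 1 - jump_int w (fun _ _ => 1).

Let ji_fin w : jump_int w (fun _ _ => 1) \is a fin_num.
Proof. by rewrite ge0_fin_numE ?jump_int_ge0// (le_lt_trans (jump_int_le1 w))// ltry. Qed.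

Let rest_ge0 w : 0 <= rest w. Proof. by rewrite sube_ge0 ?jump_int_le1// ji_fin. Qed.

Let rest_fin w : (fine (rest w))%:E = rest w.
Proof. by rewrite fineK// fin_numB ji_fin. Qed.

Lemma jump_kernel_exists : exists N : R.-pker W ~> Z, forall w f, nneg_measurable f ->
  \int[N w]_z f z = jump_int w (fun u y => f (Some (u, y))) +
    (1 - jump_int w (fun _ _ => 1)) * f None.
Proof.
have mS f : nneg_measurable f -> measurable_fun setT (fun p : R * borel S => f (Some (p.1, p.2) : Z)).
  move=> [mf _]; have := measurableT_comp mf measurable_Some; apply: eq_measurable_fun.
  by move=> [u y] _.
have [||N NE] := @kernel_of_functional _ _ W Z R (fun w f => jump_int w (fun u y => f (Some (u, y))) +
    (1 - jump_int w (fun _ _ => 1)) * f None); [split| |by exists N].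
- move=> w f f0; rewrite adde_ge0 ?mule_ge0//; [exact: jump_int_ge0|exact: rest_ge0].
- move=> w f g hf hg; have [_ f0] := hf; have [_ g0] := hg.
  by rewrite jump_intD//; [rewrite ge0_muleDr// addeACA|exact: mS|exact: mS].
- move=> w r f r0 hf; have [_ f0] := hf; rewrite jump_intZ//; last exact: mS.
  rewrite [RHS]ge0_muleDr ?jump_int_ge0//; try by (rewrite mule_ge0//; exact: rest_ge0).
  by rewrite muleCA.
- move=> w f hf nd; have f0 n z : 0 <= f n z by have [_] := hf n.
  rewrite jump_int_lim//; last by move=> n; exact: mS.
  rewrite -/(rest w) -(rest_fin w) -limeMl//; last by apply: ereal_nondecreasing_is_cvgn; exact: nd.
  have c1 : cvgn (fun n => jump_int w (fun u y => f n (Some (u, y)))).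
    apply: ereal_nondecreasing_is_cvgn => m n mn; apply: jump_int_le => //; [exact: mS|exact: mS|].
    by move=> u y; exact: nd.
  have c2 : cvgn (fun n => (fine (rest w))%:E * f n None).
    apply: ereal_nondecreasing_is_cvgn => m n mn; apply: lee_wpmul2l; last exact: nd.
    by rewrite rest_fin; exact: rest_ge0.
  apply/esym/cvg_lim => //; apply: cvgeD => //; apply: ge0_adde_def; rewrite inE.
    by apply: lime_ge => //; apply: nearW => n; exact: jump_int_ge0.
  apply: lime_ge => //; apply: nearW => n; rewrite mule_ge0// rest_fin; exact: rest_ge0.
- move=> f hf; have [_ f0] := hf; apply: emeasurable_funD; first by apply: measurable_jump_int => //; exact: mS.
  by apply: emeasurable_funM => //; apply: emeasurable_funB => //; exact: measurable_jump_int.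
- by move=> w; rewrite mule1 addeC subeK.
Qed.

End jump.

Lemma measurable_step_param d' d'' (X : measurableType d') (T : measurableType d'') (R : realType)
    (S : ptopologicalType) (f : X -> R * borel S -> T) (g : X -> T) :
  measurable_fun setT (fun p : X * (R * borel S) => f p.1 p.2) -> measurable_fun setT g ->
  measurable_fun setT (fun p : X * step R S => if p.2 is Some q then f p.1 q else g p.1).
Proof.
move=> mf mg.
have mS : measurable [set p : X * step R S | p.2 <> None].
  rewrite (_ : [set p | _] = setT `*` [set Some z | z in setT]).
    by apply: measurableX => //; exact: measurable_Some_image.
  by apply/seteqP; split=> [[a [z|]] //= _|[a [z|]] /= [_ [?]]//]; split=> //; exists z.
have m_odflt : measurable_fun setT (fun z : step R S => odflt point z).
  by apply: measurable_step; exact: measurable_id.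
rewrite (_ : (fun p => _) = fun p : X * step R S => if `[< p.2 <> None >] then f p.1 (odflt point p.2) else g p.1).
  apply: measurable_fun_ifT.
  - apply: (measurable_fun_bool true); rewrite setTI (_ : _ @^-1` _ = [set p : X * step R S | p.2 <> None])//.
    by apply/seteqP; split=> p /asboolP.
  - have ms : measurable_fun setT (fun p : X * step R S => odflt point p.2).
      exact: (measurableT_comp m_odflt measurable_snd).
    exact: (@measurable_comp2 _ _ _ _ (X * step R S)%type X (R * borel S)%type T f fst _ mf measurable_fst ms).
  - exact: (measurableT_comp mg measurable_fst).
by apply/funext => -[a [q|]]/=; [rewrite asboolT|rewrite asboolF//; apply].
Qed.

(** * Sequences of random kernels *)

Notation seqs Y := (g_sigma_algebraType
  [set C : set (nat -> Y) | exists n, exists2 U : set Y, measurable U & C = [set w | U (w n)]]).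

Definition past (Y T : Type) k (f : (nat -> Y) -> T) := forall w w', agree k w w' -> f w = f w'.

Section ionescu_tulcea.
Context d (Y : measurableType d) (R : realType).
Hypothesis sY : standard_borel Y.

Local Notation O := (seqs Y).

Lemma measurable_nth n : measurable_fun setT (fun w : O => w n).
Proof. by move=> _ U mU; rewrite setTI; apply: sub_sigma_algebra; exists n, U. Qed.

Lemma measurable_into_seqs d' (X : measurableType d') (f : X -> O) :
  (forall n, measurable_fun setT (fun x => f x n)) -> measurable_fun setT f.
Proof.
move=> mf; apply: (@measurability _ _ X O setT f
  [set C : set (nat -> Y) | exists n, exists2 U : set Y, measurable U & C = [set w | U (w n)]]) => //.
by move=> _ [_ [n [U mU ->]] <-]; exact: mf.
Qed.

Definition upd k (w : nat -> Y) y : nat -> Y := fun n => if n == k then y else w n.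

Lemma upd_agree k w y : agree k (upd k w y) w.
Proof. by move=> i ik; rewrite /upd ltn_eqF. Qed.

Let mupd k : measurable_fun setT (fun p : O * Y => upd k p.1 p.2 : O).
Proof.
apply: measurable_into_seqs => n; rewrite /upd; case: eqP => _; first exact: measurable_snd.
exact: (measurableT_comp (measurable_nth n) measurable_fst).
Qed.

Variable kap : nat -> R.-pker O ~> Y.
Hypothesis kap_past : forall k D, measurable D -> past k (fun w => kap k w D).

(** [L k] draws the first [k] entries and leaves the others at a default value. The laws of all
    prefixes then live on the same space, and their consistency is the equality of masses in
    [law_past]. *)
Lemma prefix_laws : exists L : nat -> R.-pker unit ~> O, forall k f, measurable_fun setT f ->
  (forall w, 0 <= f w) ->
  \int[L k.+1 tt]_w f w = \int[L k tt]_w \int[kap k w]_y f (upd k w y).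
Proof.
have [nx nxP] := choice (fun p : (nat * (R.-pker unit ~> O))%type =>
  kernel_comp p.2 (kpre (kmap (kap p.1) (mupd p.1)) (@measurable_snd _ _ unit O))).
have [e [g _]] := sY.
have [U mU|w|L0 _] := @kernel_exists _ _ unit O R (fun=> \d_((fun=> g (fun=> false)) : O)).
- exact: measurable_cst.
- by rewrite /= diracT.
exists (fix L k := if k is k'.+1 then nx (k', L k') else L0) => k f mf f0.
rewrite nxP//; apply: eq_integral => w _; rewrite /kpre/=.
exact: (ge0_integral_kmap (kap k) (mupd k) w mf f0).
Qed.

Section extension.
Variables (e : Y -> cantorM) (g : cantorM -> Y).
Hypotheses (me : measurable_fun setT e) (mg : measurable_fun setT g) (eg : cancel e g).
Variable L : nat -> R.-pker unit ~> O.
Hypothesis LS : forall k f, measurable_fun setT f -> (forall w, 0 <= f w) ->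
  \int[L k.+1 tt]_w f w = \int[L k tt]_w \int[kap k w]_y f (upd k w y).

Let law_past k k' (E : set O) : (k <= k')%N -> measurable E -> past k E -> L k' tt E = L k tt E.
Proof.
move=> + mE Ek; elim: k' => [|k' IH]; first by rewrite leqn0 => /eqP->.
rewrite leq_eqVlt => /predU1P[->//|]; rewrite ltnS => kk'; rewrite -IH//.
have indE k'' : L k'' tt E = \int[L k'' tt]_w (\1_E w : R)%:E by rewrite integral_indic// setIT.
have mI : measurable_fun setT (fun w : O => (\1_E w : R)%:E) by apply/measurable_EFinP; exact: measurable_indic.
have I0 (w : O) : 0 <= (\1_E w : R)%:E by rewrite lee_fin.
rewrite !indE (LS k' mI I0); apply: eq_integral => w _; rewrite (eq_integral (fun=> (\1_E w : R)%:E)) ?integral_pker_cst// => y _.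
  rewrite !indicE; suff -> : (upd k' w y \in E) = (w \in E) by [].
  have EE : E (upd k' w y) = E w.
    by apply: Ek; apply: agree_le kk' _; exact: upd_agree.
  by apply/idP/idP; rewrite !inE EE.
Qed.

Let code (w : O) : cantorM := fun m => e (w (unpr m).1) (unpr m).2.
Let decode (c : cantorM) : O := fun n => g (fun j => c (pr n j)).
(** Number of entries that determine the first [s] bits of the code. *)
Let bound s := (\max_(i < s) (unpr i).1.+1)%N.

Let mcode : measurable_fun setT code.
Proof.
apply: measurable_into_cantor => m.
exact: (measurable_coord (unpr m).2 (measurableT_comp me (measurable_nth (unpr m).1))).
Qed.

Let mdecode : measurable_fun setT decode.
Proof.
apply: measurable_into_seqs => n; apply: (measurableT_comp mg).
apply: measurable_into_cantor => j; exact: (measurable_bit (pr n j)).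
Qed.

Let codeK w : decode (code w) = w.
Proof. by apply/funext => n; rewrite /decode/code; under eq_fun do rewrite prK/=; exact: eg. Qed.

Let code_past s : past (bound s) (fun w => pre (code w) s).
Proof.
move=> w w' a; apply/pre_agree => i si; rewrite /code a//.
exact: (@leq_bigmax _ (fun i : 'I_s => (unpr i).1.+1) (Ordinal si)).
Qed.

Let bound_le s s' : (s <= s')%N -> (bound s <= bound s')%N.
Proof.
move=> ss'; apply/bigmax_leqP => i _.
exact: (@leq_bigmax _ (fun i : 'I_s' => (unpr i).1.+1) (widen_ord ss' i)).
Qed.

Let cyl (t : seq bool) : set cantorM := [set d | agree (size t) d (word t)].

Let mcyl t : measurable (cyl t). Proof. exact: measurable_agree. Qed.

Let cyl_rcons t b d0 : cyl (rcons t b) d0 <-> cyl t d0 /\ d0 (size t) = b.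
Proof.
rewrite /cyl/= size_rcons; split=> [a|[a <-] i]; [split=> [i it|]|].
- by rewrite a ?ltnS 1?ltnW// /word nth_rcons it.
- by rewrite a// /word nth_rcons ltnn eqxx.
rewrite ltnS leq_eqVlt => /predU1P[->|it]; first by rewrite /word nth_rcons ltnn eqxx.
by rewrite a// /word nth_rcons it.
Qed.

Let mcodecyl (A : set cantorM) : measurable A -> measurable [set w | A (code w)].
Proof. by move=> mA; exact: (measurable_preimageT mcode mA). Qed.

Let q (_ : unit) t : R := fine (L (bound (size t)) tt [set w | cyl t (code w)]).

Let q_fin k (E : set O) : measurable E -> (fine (L k tt E))%:E = L k tt E.
Proof. by move=> mE; rewrite fineK//; exact: (fin_num_measure (kprob (L k) tt)). Qed.

Let cyl_split t (A : set cantorM) : cyl t `&` A = (cyl (rcons t false) `&` A) `|` (cyl (rcons t true) `&` A).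
Proof.
apply/seteqP; split=> d0 /=; last by case=> -[/cyl_rcons[]].
move=> [ct Ad]; case b: (d0 (size t)); [right|left]; split=> //; exact/cyl_rcons.
Qed.

Let cyl_disj t (A : set cantorM) : (cyl (rcons t false) `&` A) `&` (cyl (rcons t true) `&` A) = set0.
Proof. by rewrite -subset0 => d0 [[/cyl_rcons[_ e0] _] [/cyl_rcons[_ e1] _]]; rewrite e0 in e1. Qed.

Let LcylD k t A : measurable A -> L k tt [set w | (cyl t `&` A) (code w)] =
  L k tt [set w | (cyl (rcons t false) `&` A) (code w)] + L k tt [set w | (cyl (rcons t true) `&` A) (code w)].
Proof.
move=> mA; rewrite -measureU//; last 3 first.
- by apply: mcodecyl; exact: measurableI.
- by apply: mcodecyl; exact: measurableI.
- by rewrite -subset0 => w [h1 h2]; have : (cyl (rcons t false) `&` A `&` (cyl (rcons t true) `&` A)) (code w) by []; rewrite cyl_disj.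
by congr (L k tt _); apply/seteqP; split=> w /=; have := cyl_split t A; move=> /seteqP[h1 h2]; [exact: h1|exact: h2].
Qed.

Let cyl_past t : past (bound (size t)) (fun w => cyl t (code w)).
Proof.
move=> w w' /code_past e1; rewrite /cyl/=; apply/propext.
by rewrite -!pre_agree e1.
Qed.

Let qD w t : q w t = (q w (rcons t false) + q w (rcons t true))%R.
Proof.
have cT t' : [set w | cyl t' (code w)] = [set w | (cyl t' `&` setT) (code w)] by rewrite setIT.
apply: EFin_inj; rewrite EFinD /q !q_fin; try (by apply: mcodecyl).
rewrite !size_rcons -(law_past (bound_le (leqnSn (size t))) (mcodecyl (mcyl t)) (@cyl_past t)).
by rewrite !cT LcylD.
Qed.

Let q1 w : q w [::] = 1%R.
Proof.
apply: EFin_inj; rewrite /q q_fin; last exact: mcodecyl.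
rewrite (_ : [set w' | cyl [::] (code w')] = setT) ?prob_kernel//.
by apply/seteqP; split=> // w' _ i.
Qed.

Lemma bits_law_exists : exists mu : R.-pker unit ~> cantorM, forall t, mu tt (cyl t) = (q tt t)%:E.
Proof.
have [||||mu muE] := @tree_law _ unit R q.
- by move=> t; exact: measurable_cst.
- by move=> w t; rewrite fine_ge0.
- exact: q1.
- exact: qD.
by exists mu => t; exact: muE.
Qed.

Variable mu : R.-pker unit ~> cantorM.
Hypothesis muE : forall t, mu tt (cyl t) = (q tt t)%:E.

Let mu_past s (A : set cantorM) : measurable A -> past s A -> mu tt A = L (bound s) tt [set w | A (code w)].
Proof.
move=> mA pA.
suff key n t : (size t + n)%N = s -> mu tt (cyl t `&` A) = L (bound s) tt [set w | (cyl t `&` A) (code w)].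
  have c0 : cyl [::] = setT by apply/seteqP; split=> // w' _ i.
  by have := key s [::] erefl; rewrite c0 setTI.
elim: n t => [|n IH] t.
  rewrite addn0 => st; have [At|nAt] := pselect (A (word t)).
    have -> : cyl t `&` A = cyl t.
      by apply/seteqP; split=> [d0 []//|d0 ct]; split=> //; rewrite (pA d0 (word t))// -st.
    rewrite muE /q q_fin; last exact: mcodecyl.
    by rewrite st.
  have -> : cyl t `&` A = set0.
    by rewrite -subset0 => d0 [ct]; rewrite (pA d0 (word t))// -st.
  by rewrite measure0; apply/esym; exact: measure0.
move=> st; rewrite LcylD//.
rewrite -!IH ?size_rcons ?addSnnS//.
by rewrite cyl_split measureU ?cyl_disj//; exact: measurableI.
Qed.

Let mask k (d0 : cantorM) : cantorM := fun m => ((unpr m).1 < k)%N && d0 m.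

Let mmask k : measurable_fun setT (mask k).
Proof.
apply: measurable_into_cantor => m; rewrite /mask.
by case: (_ < _)%N => /=; [exact: measurable_bit|rewrite set_false; exact: measurable0].
Qed.

Let P := kmap mu (measurableT_comp mdecode (@measurable_snd _ _ unit cantorM)).

(** An event about the first [k] entries may involve infinitely many bits, beyond the reach of
    [mu_past]. After [mask k], which erases the bits of the later entries, both laws are compared on
    events determined by finitely many bits, and these generate. *)
Let P_past k (E : set O) : measurable E -> past k E -> P tt E = L k tt E.
Proof.
move=> mE Ek; pose B : set cantorM := [set d | E (decode d)].
have mB : measurable B := measurable_preimageT mdecode mE.
have EB c : E (decode c) = B (mask k c).
  by apply: Ek => n nk; rewrite /decode; congr g; apply/funext => j; rewrite /mask prK/= nk.
pose m1 : {measure set cantorM -> \bar R} := kmap_measure mu (measurableT_comp (@mmask k) (@measurable_snd _ _ unit cantorM)) tt.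
pose m2 : {measure set cantorM -> \bar R} :=
  kmap_measure (L k) (measurableT_comp (@mmask k) (measurableT_comp mcode (@measurable_snd _ _ unit O))) tt.
have -> : P tt E = m1 B by rewrite /P kmapE; congr (mu tt _); apply/funext => c; exact: EB.
have -> : L k tt E = m2 B.
  by congr (L k tt _); apply/funext => w; rewrite -[in LHS](codeK w); exact: EB.
apply: (measure_unique [set A : set cantorM | measurable A /\ exists s, past s A] (fun=> setT)) => //.
- apply/seteqP; split=> [A|A].
    apply: smallest_sub; first exact: smallest_sigma_algebra.
    move=> _ [i _ <-]; apply: sub_sigma_algebra; split; first exact: measurable_bit.
    by exists i.+1 => w w' a; rewrite /bit/= a.
  by apply: smallest_sub; [exact: sigma_algebra_measurable|move=> A' []].
- move=> A1 A2 [mA1 [s1 p1]] [mA2 [s2 p2]]; split; first exact: measurableI.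
  exists (maxn s1 s2) => w w' a; rewrite /setI/= (p1 w w') ?(p2 w w')//.
    by apply: agree_le a; rewrite leq_maxr.
  by apply: agree_le a; rewrite leq_maxl.
- by split=> //; exists 0%N.
- by rewrite bigcup_const.
- move=> A [mA [s As]].
  have mA' := measurable_preimageT (@mmask k) mA.
  have As' : past s (fun c => A (mask k c)).
    by move=> c c' a; apply: As => m ms; rewrite /mask a.
  rewrite /m1 /m2 /kmap_measure/= /pushforward/=.
  transitivity (mu tt [set c | A (mask k c)]) => //; rewrite (mu_past mA' As').
  transitivity (L k tt [set w | A (mask k (code w))]) => //.
  have mw : measurable [set w | A (mask k (code w))] := mcodecyl mA'.
  have wk : past k (fun w => A (mask k (code w))).
    move=> w w' a; congr A; apply/funext => m; rewrite /mask; case mk: ((unpr m).1 < k)%N => //=.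
    by rewrite /code a.
  have wb : past (bound s) (fun w => A (mask k (code w))).
    by move=> w w' /code_past/pre_agree a; apply: As'.
  rewrite -(law_past (leq_maxl _ k) mw wb); exact: law_past (leq_maxr _ _) mw wk.
- by move=> _; rewrite /m1 /kmap_measure/= /pushforward preimage_setT prob_kernel ltry.
Qed.

Let trunc k (w : O) : O := fun n => if (n < k)%N then w n else g (fun=> false).

Let mtrunc k : measurable_fun setT (trunc k).
Proof.
apply: measurable_into_seqs => n; rewrite /trunc; case: (n < k)%N; last exact: measurable_cst.
exact: measurable_nth.
Qed.

Let integral_past k (f : O -> \bar R) : measurable_fun setT f -> (forall w, 0 <= f w) -> past k f ->
  \int[P tt]_w f w = \int[L k tt]_w f w.
Proof.
move=> mf f0 fk; have mt := measurableT_comp (@mtrunc k) (@measurable_snd _ _ unit O).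
have fE w : f w = f (trunc k w) by apply: fk => n nk; rewrite /trunc nk.
rewrite (eq_integral (fun w => f (trunc k w))) => [|w _]; last exact: fE.
rewrite [RHS](eq_integral (fun w => f (trunc k w))) => [|w _]; last exact: fE.
rewrite -(ge0_integral_kmap P mt tt mf f0) -(ge0_integral_kmap (L k) mt tt mf f0).
apply: integral_eq_measurable => D mD; rewrite !kmapE; apply: P_past.
  exact: (measurable_preimageT (@mtrunc k) mD).
move=> w w' a /=; congr D; apply/funext => n; rewrite /trunc; case: ifP => // nk; exact: a.
Qed.

Lemma extension_law k (E : set O) (D : set Y) : measurable E -> past k E -> measurable D ->
  P tt (E `&` [set w | D (w k)]) = \int[P tt]_(w in E) kap k w D.
Proof.
move=> mE Ek mD; set F := E `&` _.
have mF : measurable F by apply: measurableI => //; exact: (measurable_preimageT (measurable_nth k) mD).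
have Fk : past k.+1 F.
  move=> w w' a; rewrite /F/setI/= (a k)//; congr (_ /\ _); apply: Ek; exact: agree_le a.
rewrite (P_past mF Fk).
have mI : measurable_fun setT (fun w : O => (\1_F w : R)%:E) by apply/measurable_EFinP; exact: measurable_indic.
have I0 (w : O) : 0 <= (\1_F w : R)%:E by rewrite lee_fin.
have -> : L k.+1 tt F = \int[L k.+1 tt]_w (\1_F w : R)%:E by rewrite integral_indic// setIT.
rewrite (LS k mI I0) [RHS]integral_mkcond (@integral_past k); last 3 first.
- by apply/(measurable_restrictT _ mE); apply: measurable_funTS; exact: measurable_kernel.
- by move=> w; rewrite patchE; case: ifP => // _; exact: measure_ge0.
- move=> w w' a; rewrite !patchE (kap_past mD a); suff -> : (w \in E) = (w' \in E) by [].
  by apply/idP/idP; rewrite !inE (Ek w w' a).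
apply: eq_integral => w _; rewrite patchE.
have FE y : F (upd k w y) = (E w /\ D y).
  rewrite /F/setI/= /upd eqxx; congr (_ /\ _); apply: Ek; exact: upd_agree.
case: ifPn => [|] wE.
  rewrite (eq_integral (fun y => (\1_D y : R)%:E)) ?integral_indic ?setIT// => y _.
  rewrite !indicE; suff -> : (upd k w y \in F) = (y \in D) by [].
  by apply/idP/idP; rewrite !inE FE; [case|split=> //; rewrite inE in wE].
rewrite integral0_eq// => y _; rewrite indicE memNset//= FE => -[Ew _].
by rewrite mem_set in wE.
Qed.

End extension.

(** The consistent prefix laws give masses to the clopen sets of codes; [tree_law] produces the law
    of the whole code, and decoding gives the law of the sequence. *)
Lemma ionescu_tulcea : exists P : probability O R, forall k (E : set O) (D : set Y),
  measurable E -> past k E -> measurable D ->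
  P (E `&` [set w | D (w k)]) = \int[P]_(w in E) kap k w D.
Proof.
have [e [g [me mg eg]]] := sY; have [L LS] := prefix_laws.
have [mu muE] := bits_law_exists me LS.
by have h := extension_law me mg eg LS muE; eexists (kprob _ tt) => k E D mE Ek mD; exact: h.
Qed.

End ionescu_tulcea.

(** The sigma-algebra of [measurableTypeR] and the one generated by the open sets coincide, but they
    are different structures; the second is the one that [borel_space] is about. *)
Lemma standard_borel_real (R : realType) : standard_borel (measurableTypeR R).
Proof.
have : borel_space R R.
  exists R, id; split.
  - exact: Rhausdorff.
  - by exists (range (@ratr R)); [exact: sub_countable (card_image_le _ _) _|exact: dense_rat].
  - by split=> // U; split=> [oU|[V oV ->]]//; exists U.
  - rewrite (_ : range id = setT); first exact: (@measurableT _ (borel R)).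
    by apply/seteqP; split=> // x _; exists x.
move=> /standard_borel_space[e [g [me mg eg]]].
have mb (A : set R) : measurable (A : set (borel R)) <-> measurable (A : set (measurableTypeR R)).
  split=> [|].
    apply: (smallest_sub (@sigma_algebra_measurable _ (measurableTypeR R))) => U oU.
    exact: open_measurable.
  have -> : measurable (A : set (measurableTypeR R)) = (@RGenOpens.G R).-sigma.-measurable A.
    by rewrite -RGenOpens.measurableE.
  apply: smallest_sub; first exact: (@sigma_algebra_measurable _ (borel R)).
  by move=> _ [x [y ->]]; apply: sub_sigma_algebra; exact: interval_open.
exists e, g; split=> // _ U mU; rewrite setTI.
  by apply/mb; rewrite -[X in measurable X]setTI; exact: me.
by have := mg measurableT U ((mb U).2 mU); rewrite setTI.
Qed.

Lemma standard_borel_step (R : realType) (S : ptopologicalType) :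
  standard_borel (borel S) -> standard_borel (step R S).
Proof.
move=> sS; have [e [g [me mg eg]]] := standard_borel_prod (standard_borel_real R) sS.
exists (fun z => if z is Some p then (fun n => if n is n'.+1 then e p n' else true) else (fun=> false)),
  (fun c => if c 0%N then Some (g (fun n => c n.+1)) else None); split.
- apply: measurable_step; apply: measurable_into_cantor => -[|n] /=.
    by rewrite set_true; exact: measurableT.
  exact: (measurable_coord n me).
- move=> _ B mB; rewrite setTI.
  have m0 := measurable_bit 0; pose h (c : cantorM) := g (fun n => c n.+1) : (R * borel S)%type.
  have mh : measurable_fun setT h.
    by apply: (measurableT_comp mg); apply: measurable_into_cantor => n; exact: measurable_bit.
  have mS := measurable_preimageT (measurableT_comp (@measurable_Some R S) mh) mB.
  have [BN|BN] := pselect (B None).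
    rewrite (_ : _ @^-1` B = (bit 0 `&` [set c | B (Some (h c))]) `|` ~` bit 0).
      by apply: measurableU; [exact: measurableI|exact: measurableC].
    apply/seteqP; split=> c; rewrite /bit/=; case: (c 0%N) => //=; [by left|by right|by case=> [[]|]].
  rewrite (_ : _ @^-1` B = bit 0 `&` [set c | B (Some (h c))]); first exact: measurableI.
  by apply/seteqP; split=> c; rewrite /bit/=; case: (c 0%N) => //= -[].
- by case=> //= p; congr Some; exact: eg.
Qed.

(** * The law of the paths *)

Section next.
Context (R : realType) (S A B : ptopologicalType) (G : game R S A B)
  (V0 V1 : S -> R) (rho0 L0 M0 rho1 b1 M1 : R).
Hypothesis H : growth G V0 V1 rho0 L0 M0 rho1 b1 M1.
Variables (p1 : policy1 G) (p2 : policy2 G).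
Local Open Scope ring_scope.
Notation clock := (clock V0 L0).
Notation hist k := (hist R S k).

Let sS : standard_borel (borel S) := standard_borel_space (borelS G).

Let msg k : measurable_fun setT (fun hu : hist k * R => last_state hu.1).
Proof. exact: (measurableT_comp (@measurable_last_state _ _ k) measurable_fst). Qed.

Definition hist_mix k : R.-pker (hist k * R)%type ~> borel S :=
  projT1 (cid (mix_exists H (policy_kernel p1 k) (policy_kernel p2 k) (@msg k))).

Lemma hist_mixE k (h : hist k) u f : measurable_fun setT f -> (forall y, 0 <= f y)%E ->
  (\int[hist_mix k (h, u)]_y f y = \int[kprob (policy_kernel p1 k) (h, u)]_a
    \int[kprob (policy_kernel p2 k) (h, u)]_b \int[unif H (last_state h, a, b)]_y f y)%E.
Proof. exact: (projT2 (cid (mix_exists H _ _ (@msg k)))). Qed.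

Definition hist_clock k (h : hist k) : R := clock (last_state h).

Lemma hist_clock_ge0 k (h : hist k) : 0 <= hist_clock h.
Proof. by rewrite ltW// (clock_gt0 H). Qed.

Lemma measurable_hist_clock k : measurable_fun setT (@hist_clock k).
Proof. exact: (measurableT_comp (measurable_clock H) (@measurable_last_state _ _ k)). Qed.

Notation hleave := (leave (@last_state _ _ _) (@hist_clock _) (hist_mix _)).
Notation hsurvival := (survival (@last_state _ _ _) (@hist_clock _) (hist_mix _)).
Notation hjump := (jump_int (@last_state _ _ _) (@hist_clock _) (hist_mix _)).

Lemma jump_rateE k (h : hist k) u D : measurable D ->
  (jump_rate p1 p2 h u D = (hist_clock h)%:E * hist_mix k (h, u) (D `\ last_state h))%E.
Proof.
move=> mD; have mx : measurable (D `\ last_state h).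
  by apply: measurableD => //; exact: measurable_singleton (borelS G).
rewrite /jump_rate (rate_mixE (H := H) _ _ (hist_mixE h u))//.
- by rewrite diracE memNset ?sube0// => -[_]; exact.
- exact: policy_adm.
- exact: policy_adm.
Qed.

Lemma jump_rate_setT k (h : hist k) u : jump_rate p1 p2 h u setT = (hleave h u)%:E.
Proof.
rewrite jump_rateE// setTD; apply/esym; apply: leaveE; [exact: measurable_last_state|exact: sS].
Qed.

Definition next_kernel k : R.-pker hist k ~> step R S :=
  projT1 (cid (jump_kernel_exists (hist_mix k) (@measurable_last_state _ _ k) (@measurable_hist_clock k)
    (@hist_clock_ge0 k) sS)).

Lemma integral_next k (h : hist k) (f : step R S -> \bar R) : nneg_measurable f ->
  (\int[next_kernel k h]_z f z = hjump h (fun u y => f (Some (u, y))) +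
    (1 - hjump h (fun _ _ => 1)) * f None)%E.
Proof. exact: (projT2 (cid (jump_kernel_exists (hist_mix k) _ _ _ sS))). Qed.

Lemma jump_lawE k (h : hist k) D : measurable D ->
  jump_law p1 p2 h D = hjump h (fun u y => (\1_D (Some (u, y)) : R)%:E).
Proof.
move=> mD; rewrite /jump_law /jump_int; apply: eq_integral => u; rewrite inE/= in_itv/= andbT => u0.
have mDu : measurable ([set y | D (Some (u, y))] : set (borel S)).
  exact: (measurable_preimageT (measurableT_comp (@measurable_Some R S) (measurable_pair1 u)) mD).
transitivity (\int[hist_mix k (h, u)]_y ((density (@last_state _ _ _) (@hist_clock _) (hist_mix _) h u y)%:E *
    (\1_[set y | D (Some (u, y))] y : R)%:E))%E; last first.
  apply: eq_integral => y _; rewrite !indicE.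
  suff -> : (y \in [set y | D (Some (u, y))]) = (Some (u, y) \in D) by [].
  by apply/idP/idP; rewrite !inE.
rewrite (density_indic (hist_mix k) (@measurable_last_state _ _ k) (@hist_clock_ge0 k) sS)// jump_rateE//.
have ln v : `|hleave h v| <= hist_clock h.
  by have /andP[l0 lc] := leave_bounds (hist_mix k) (@measurable_last_state _ _ k) (@hist_clock_ge0 k) sS h v; rewrite ger0_norm.
have ml : measurable_fun setT (hleave h).
  exact: (measurableT_comp (measurable_leave (hist_mix k) (@measurable_last_state _ _ k) (@measurable_hist_clock k) sS) (measurable_pair1 h)).
have -> : (\int[lebesgue_measure]_(v in `[0%R, u]) jump_rate p1 p2 h v setT)%E = (prim (hleave h) u)%:E.
  transitivity (\int[lebesgue_measure]_(v in `[0%R, u]) (hleave h v)%:E)%E.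
    by apply: eq_integral => v _; exact: jump_rate_setT.
  by rewrite /prim /Rintegral fineK//; exact: (integrable_fin_num _ (prim_integrable ml ln u)).
have -> : expeR (- (prim (hleave h) u)%:E) = (hsurvival h u)%:E by rewrite /survival (primN ml ln).
by rewrite muleAC -EFinM.
Qed.


Lemma next_lawE k (h : hist k) D : measurable D -> next_law p1 p2 h D = next_kernel k h D.
Proof.
move=> mD; have hD : nneg_measurable (fun z : step R S => (\1_D z : R)%:E).
  by split=> [|z]; [apply/measurable_EFinP; exact: measurable_indic|rewrite lee_fin].
have -> : next_kernel k h D = (\int[next_kernel k h]_z (\1_D z : R)%:E)%E.
  by rewrite integral_indic// setIT.
rewrite (integral_next h hD) /next_law (jump_lawE h mD) (jump_lawE h measurableT) diracE indicE.
have -> : (fun (u : R) (y : S) => (\1_[set: step R S] (Some (u, y)) : R)%:E) = (fun _ _ => 1%E) by [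
  apply/funext => u; apply/funext => y; rewrite indicT].
by [].
Qed.

End next.

(** * Path measures with an absorbing dead entry *)

Section path_measure.
Context d0 d (X0 : measurableType d0) (Y : measurableType d) (R : realType).
Context (dH : nat -> measure_display) (F : forall k, measurableType (dH k)).
Variables (dead : Y) (hk : forall k, X0 * seqs Y -> F k) (N : forall k, R.-pker F k ~> Y) (x : X0).
Hypotheses (sY : standard_borel Y) (mdead : measurable [set dead]) (mx : measurable [set x]).
Hypotheses (mhk : forall k, measurable_fun setT (@hk k)) (hk_past : forall k z, past k (fun w => @hk k (z, w))).

Local Notation O := (seqs Y).
Local Notation path_type := (X0 * O)%type.

Definition undead k (w : path_type) := forall i, (i < k)%N -> w.2 i <> dead.

Lemma measurable_path_entry k : measurable_fun setT (fun w : path_type => w.2 k).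
Proof. exact: (measurableT_comp (@measurable_nth _ Y k) measurable_snd). Qed.

Lemma measurable_undead k : measurable [set w | undead k w].
Proof.
rewrite (_ : [set w | _] = \bigcap_(i in [set i | (i < k)%N]) ~` [set w : path_type | w.2 i = dead]).
  apply: bigcap_measurableType => i _; apply: measurableC.
  exact: (measurable_preimageT (measurable_path_entry i) mdead).
by apply/seteqP; split.
Qed.

Let path (w : O) : path_type := (x, w).

Let mpath : measurable_fun setT path. Proof. exact: measurable_pair1. Qed.

(** Once dead, a path is continued by the Dirac mass at [dead]; this makes the last clause of
    [path_measure_exists] hold. *)
Let kap_exists k : exists kap : R.-pker O ~> Y,
  (forall w D, undead k (path w) -> kap w D = N k (hk k (path w)) D) /\
  (forall w D, ~ undead k (path w) -> kap w D = \d_dead D).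
Proof.
pose m w : {measure set Y -> \bar R} := if pselect (undead k (path w)) then N k (hk k (path w)) else \d_dead.
have [U mU|w|kap kapE] := @kernel_exists _ _ O Y R m.
- rewrite (_ : (fun w => _) = fun w => if `[< undead k (path w) >] then N k (hk k (path w)) U else \d_dead U).
    apply: measurable_fun_ifT; last exact: measurable_cst.
      apply: (measurable_fun_bool true); rewrite setTI.
      rewrite (_ : _ @^-1` _ = path @^-1` [set w | undead k w]).
        exact: (measurable_preimageT mpath (measurable_undead k)).
      by apply/seteqP; split=> w /asboolP.
    exact: (measurableT_comp (measurable_kernel (N k) U mU) (measurableT_comp (@mhk k) mpath)).
  by apply/funext => w; rewrite /m; case: pselect => h; [rewrite asboolT|rewrite asboolF].
- by rewrite /m; case: pselect => lw; [exact: prob_kernel|exact: diracT].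
by exists kap; split=> w D h; rewrite kapE /m; case: pselect.
Qed.

Lemma path_measure_exists : exists Q : probability path_type R,
  [/\ Q [set w | w.1 = x] = 1,
      forall k (C : set (F k)) (D : set Y), measurable C -> measurable D ->
        Q [set w | [/\ undead k w, C (hk k w) & D (w.2 k)]] =
        \int[Q]_(w in [set w | undead k w /\ C (hk k w)]) N k (hk k w) D
    & forall k, Q [set w | w.2 k = dead /\ w.2 k.+1 <> dead] = 0].
Proof.
have [kap kapP] := choice kap_exists.
have live_past k : past k (fun w => undead k (path w)).
  by move=> w w' a; apply/propext; split=> h i ik; have := h i ik; rewrite /= a.
have [|P PE] := @ionescu_tulcea _ Y R sY kap.
  move=> k D mD w w' a; have [lw|lw] := pselect (undead k (path w)).
    have lw' : undead k (path w') by rewrite -(live_past k _ _ a).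
    by rewrite !(kapP k).1// /path (hk_past x a).
  have lw' : ~ undead k (path w') by rewrite -(live_past k _ _ a).
  by rewrite !(kapP k).2.
have [||l lE] := @kernel_exists _ _ unit O R (fun=> P).
- by move=> U mU; exact: measurable_cst.
- by move=> _; exact: probability_setT.
have mps := measurableT_comp mpath (@measurable_snd _ _ unit O).
pose Q := kprob (kmap l mps) tt.
have QE E : measurable E -> Q E = P [set w | E (path w)] by move=> mE; rewrite /Q/= /kprob_subdef kmapE lE.
exists Q; split.
- have mx' : measurable [set w : path_type | w.1 = x] := measurable_preimageT measurable_fst mx.
  by rewrite QE// -[RHS](probability_setT P); congr (P _); apply/seteqP; split.
- move=> k C D mC mD; pose B0 := [set w : path_type | undead k w /\ C (hk k w)].
  have mB0 : measurable B0 := measurableI _ _ (measurable_undead k) (measurable_preimageT (@mhk k) mC).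
  pose E0 := [set w : O | B0 (path w)].
  have mE0 : measurable E0 := measurable_preimageT mpath mB0.
  have pE0 : past k E0.
    by move=> w w' a; rewrite /E0/B0/= (live_past k w w')// /path (hk_past x a).
  have mBD : measurable (B0 `&` [set w : path_type | D (w.2 k)]).
    exact: (measurableI _ _ mB0 (measurable_preimageT (measurable_path_entry k) mD)).
  transitivity (Q (B0 `&` [set w : path_type | D (w.2 k)])).
    by congr (Q _); apply/seteqP; split=> w [] => [? ? ?|[? ?] ?].
  rewrite QE// -[LHS]/(P (E0 `&` [set w : O | D (w k)])) PE//.
  transitivity (\int[P]_(w in E0) N k (hk k (path w)) D).
    by apply: eq_integral => w /set_mem[lw _]; rewrite (kapP k).1.
  have mf : measurable_fun setT ((fun w => N k (hk k w) D) \_ B0).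
    apply/(measurable_restrictT _ mB0); apply: measurable_funTS.
    exact: (measurableT_comp (measurable_kernel (N k) D mD) (@mhk k)).
  rewrite [RHS]integral_mkcond -[RHS]/(\int[kmap l mps tt]_w _) ge0_integral_kmap//; last first.
    by move=> w; rewrite patchE; case: ifP => // _; exact: measure_ge0.
  transitivity (\int[P]_y (((fun w => N k (hk k w) D) \_ B0) (path y))).
    by rewrite integral_mkcond; apply: eq_integral => y _; rewrite !patchE; congr (if _ then _ else _); rewrite !mem_setE.
  by apply: integral_eq_measurable => U _; rewrite lE.
- move=> k; pose E0 := [set w : O | w k = dead].
  have mE0 : measurable E0 := measurable_preimageT (@measurable_nth _ Y k) mdead.
  have pE0 : past k.+1 E0 by move=> w w' a; rewrite /E0/= a.
  have mD : measurable (~` [set dead]) by apply: measurableC.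
  rewrite QE; last exact: (measurableI _ _ (measurable_preimageT (measurable_path_entry k) mdead)
      (measurable_preimageT (measurable_path_entry k.+1) mD)).
  rewrite -[LHS]/(P (E0 `&` [set w : O | (~` [set dead]) (w k.+1)])) PE//.
  rewrite integral0_eq// => w Ew; rewrite (kapP k.+1).2.
    by rewrite diracE memNset//=; exact.
  by move=> /(_ k (ltnSn k)); apply.
Qed.

Lemma integral_path_next (Q : probability path_type R) k :
  (forall (C : set (F k)) (D : set Y), measurable C -> measurable D ->
        Q [set w | [/\ undead k w, C (hk k w) & D (w.2 k)]] =
        \int[Q]_(w in [set w | undead k w /\ C (hk k w)]) N k (hk k w) D) ->
  forall Psi : F k * Y -> \bar R, nneg_measurable Psi ->
  \int[Q]_(w in [set w | undead k w]) Psi (hk k w, w.2 k) =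
  \int[Q]_(w in [set w | undead k w]) \int[N k (hk k w)]_z Psi (hk k w, z).
Proof.
move=> QE; apply: (integral_disintegration (measurable_undead k) (@mhk k) (measurable_path_entry k)).
move=> C D mC mD; rewrite (_ : _ `&` (_ `&` _) = [set w | [/\ undead k w, C (hk k w) & D (w.2 k)]]).
  by rewrite QE.
by apply/seteqP; split=> w /=; [move=> [? [? ?]]|move=> [? ? ?]].
Qed.

End path_measure.

Section law.
Context (R : realType) (S A B : ptopologicalType) (G : game R S A B)
  (V0 V1 : S -> R) (rho0 L0 M0 rho1 b1 M1 : R).
Hypothesis H : growth G V0 V1 rho0 L0 M0 rho1 b1 M1.
Variables (p1 : policy1 G) (p2 : policy2 G) (x : S).
Notation next_kernel := (next_kernel H p1 p2).

Lemma measurable_None : measurable [set None : step R S].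
Proof.
rewrite (_ : [set None] = ~` [set Some z | z in setT]).
  by apply: measurableC; exact: measurable_Some_image.
by apply/seteqP; split=> [_ -> [z]|[z|]]// h; exfalso; apply: h; exists z.
Qed.

Lemma measurable_hist_of k : measurable_fun setT (fun w : path_space R S => hist_of k w).
Proof.
have m_odflt : measurable_fun setT (fun z : step R S => odflt point z).
  by apply: measurable_step; exact: measurable_id.
apply/measurable_fun_pairP; split; first exact: measurable_fst.
apply/measurable_fun_tnthP => i.
rewrite (_ : _ \o _ = fun w : path_space R S => odflt point (w.2 i : step R S)).
  exact: (measurableT_comp m_odflt (@measurable_path_entry _ _ (borel S) (step R S) i)).
by apply/funext => w; rewrite /= tnth_mktuple.
Qed.

Let hist_past k (z : borel S) : past k (fun w : nat -> step R S => hist_of k (z, w)).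
Proof.
move=> w w' a; rewrite /hist_of; congr (_, _); apply: eq_from_tnth => i.
by rewrite !tnth_mktuple /entry/= a.
Qed.

(** [path_law] picks a solution with [xget], so exhibiting one solution yields these clauses for the
    one that is picked. The comparison with the criterion rests on them. *)
Lemma path_lawP : is_path_law p1 p2 x (path_law p1 p2 x).
Proof.
have [|Q [Q1 Q2 Q3]] := @path_measure_exists _ _ (borel S) (step R S) R (fun k => _) (fun k => (hist R S k : measurableType _)) None (@hist_of R S)
  next_kernel x (standard_borel_step R (standard_borel_space (borelS G))) measurable_None _ measurable_hist_of hist_past.
  exact: measurable_singleton (borelS G).
have QP : is_path_law p1 p2 x Q.
  split=> // k C D mC mD; have := Q2 k C D mC mD => /= E; apply: (etrans E).
  by apply: eq_integral => w _; rewrite (next_lawE H).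
exact: (xgetPex _ (ex_intro _ Q QP)).
Qed.

Lemma path_law_next k (Psi : hist R S k * step R S -> \bar R) : nneg_measurable Psi ->
  \int[path_law p1 p2 x]_(w in [set w | alive k w]) Psi (hist_of k w, w.2 k) =
  \int[path_law p1 p2 x]_(w in [set w | alive k w])
    \int[next_kernel k (hist_of k w)]_z Psi (hist_of k w, z).
Proof.
move=> hPsi; have [_ lawE _] := path_lawP.
have QE : forall C D, measurable C -> measurable D ->
    path_law p1 p2 x [set w | [/\ undead (None : step R S) k w, C (hist_of k w) & D (w.2 k)]] =
    \int[path_law p1 p2 x]_(w in [set w | undead (None : step R S) k w /\ C (hist_of k w)]) next_kernel k (hist_of k w) D.
  move=> C D mC mD; apply: (etrans (lawE k C D mC mD)).
  by apply: eq_integral => w _; rewrite (next_lawE H).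
exact: (@integral_path_next _ _ (borel S) (step R S) R (fun k => _) (fun k => (hist R S k : measurableType _)) None (@hist_of R S)
  next_kernel measurable_None measurable_hist_of (path_law p1 p2 x) k QE Psi hPsi).
Qed.

End law.

(** * One jump *)

Lemma prim_opp (R : realType) (k : R -> R) (K L : R) : measurable_fun setT k ->
  (forall t, 0 <= t <= L -> `|k t| <= K)%R -> (prim (fun t => - k t) L = - prim k L)%R.
Proof.
move=> mk kK; rewrite /prim -mulN1r -RintegralZl//; last exact: itv_integrable mk kK.
by apply: eq_Rintegral => t _; rewrite mulN1r.
Qed.

Section mixture_lyapunov.
Context (R : realType) (S A B : ptopologicalType) (G : game R S A B)
  (V0 V1 : S -> R) (rho0 L0 M0 rho1 b1 M1 : R).
Hypothesis H : growth G V0 V1 rho0 L0 M0 rho1 b1 M1.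
Variables (x : S) (phi : probability (borel A) R) (psi : probability (borel B) R).
Hypotheses (phiA : phi (actA G x) = 1) (psiB : psi (actB G x) = 1).
Variable m : {measure set (borel S) -> \bar R}.
Hypothesis mE : forall f, measurable_fun setT f -> (forall y, 0 <= f y) ->
  \int[m]_y f y = \int[phi]_a \int[psi]_b \int[unif H (x, a, b)]_y f y.

Lemma mixture_le (f : borel S -> \bar R) (r : R) : measurable_fun setT f -> (forall y, 0 <= f y) ->
  (forall a b, actA G x a -> actB G x b -> \int[unif H (x, a, b)]_y f y <= r%:E) ->
  \int[m]_y f y <= r%:E.
Proof.
move=> mf f0 fr; have [a0 Aa0] := actA_neq0 G x; have [b0 Bb0] := actB_neq0 G x.
have r0 : 0 <= r%:E by apply: le_trans (fr a0 b0 Aa0 Bb0); exact: integral_ge0.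
have mI : measurable_fun setT (fun z => \int[unif H z]_y f y).
  by apply: (measurable_integral (unif H) (f := fun _ y => f y)) => //; exact: (measurableT_comp mf).
have mIx a : measurable_fun setT ((fun b => \int[unif H (x, a, b)]_y f y) : borel B -> \bar R).
  by apply: (measurableT_comp mI (g := fun b => (x : borel S, a : borel A, b))); exact: measurable_fun_pair.
have I0 a b : 0 <= \int[unif H (x, a, b)]_y f y by exact: integral_ge0.
have mJ : measurable_fun setT ((fun a => \int[psi]_b \int[unif H (x, a, b)]_y f y) : borel A -> \bar R).
  apply: (@measurable_fun_fubini_tonelli_F _ _ _ _ _ psi (fun ab => \int[unif H (x, ab.1, ab.2)]_y f y)) => [|ab]//.
  apply: (measurableT_comp mI (g := fun ab : borel A * borel B => (x : borel S, ab.1, ab.2))).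
  by apply: measurable_fun_pair => //; exact: measurable_fun_pair.
have J0 a : 0 <= \int[psi]_b \int[unif H (x, a, b)]_y f y by exact: integral_ge0.
have bnd d (X : measurableType d) (mu : probability X R) (D : set X) (F : X -> \bar R) :
    measurable D -> mu D = 1 -> measurable_fun setT F -> (forall z, 0 <= F z) ->
    (forall z, D z -> F z <= r%:E) -> \int[mu]_z F z <= r%:E.
  move=> mD D1 mF F0 Fr; rewrite -(integral_full (probability_setT mu) mD D1 mF F0).
  apply: (@le_trans _ _ (\int[mu]_(z in D) r%:E)); last by rewrite integral_cst//= [X in _ * X]D1 mule1.
  by apply: ge0_le_integral => //; exact: measurable_funTS.
rewrite mE//; apply: (bnd _ _ _ _ _ (measurable_actA G x) phiA mJ J0) => a Aa.
by apply: (bnd _ _ _ _ _ (measurable_actB G x) psiB (mIx a)) => // b Bb; exact: fr.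
Qed.

Lemma mixture_lyapunov U (k : R) : lyapunov H U k -> m.-integrable setT (EFin \o U) /\
  (clock V0 L0 x * (fine (\int[m]_y (U y)%:E) - U x) <= k * U x)%R.
Proof.
move=> [mU VU k0 hU]; have U0 y : (0 <= U y)%R by rewrite (le_trans _ (VU y))// ltW// (V0_gt0 H).
have c0 := clock_gt0 H x.
have le : \int[m]_y (U y)%:E <= (U x + (clock V0 L0 x)^-1 * (k * U x))%:E.
  apply: mixture_le => [|y|a b Aa Bb]; [exact/measurable_EFinP|by rewrite lee_fin|].
  have [iU] := hU x a b Aa Bb; rewrite -ler_pdivlMl// lerBlDl => h.
  by rewrite -(fineK (integrable_fin_num measurableT iU)) lee_fin.
have iU : m.-integrable setT (EFin \o U).
  apply/integrableP; split; first exact/measurable_EFinP.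
  under eq_integral do rewrite /= ger0_norm//.
  by apply: le_lt_trans le _; rewrite ltry.
split=> //; rewrite -ler_pdivlMl// lerBlDl -lee_fin fineK//.
exact: (integrable_fin_num measurableT iU).
Qed.

End mixture_lyapunov.

Section step.
Context (R : realType) (S A B : ptopologicalType) (G : game R S A B)
  (V0 V1 : S -> R) (rho0 L0 M0 rho1 b1 M1 : R).
Hypothesis H : growth G V0 V1 rho0 L0 M0 rho1 b1 M1.
Variables (p1 : policy1 G) (p2 : policy2 G) (tau : R).
Local Open Scope ring_scope.
Notation clock := (clock V0 L0).
Notation payoff_bound := (payoff_bound V0 M0).
Notation hist k := (hist R S k).
Notation hist_mix := (hist_mix H p1 p2).
Notation hist_clock := (hist_clock V0 L0).
Notation next_kernel := (next_kernel H p1 p2).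
Notation hleave := (leave (@last_state _ _ _) (@hist_clock _) (hist_mix _)).
Notation hsurvival := (survival (@last_state _ _ _) (@hist_clock _) (hist_mix _)).
Notation hjump := (jump_int (@last_state _ _ _) (@hist_clock _) (hist_mix _)).

Variable rho : forall k, hist k -> R -> R.
Hypothesis mrho : forall k, measurable_fun setT (fun p : hist k * R => rho p.1 p.2).
Hypothesis rho_le : forall k (h : hist k) u, `|rho h u| <= theta G * payoff_bound (last_state h).

Definition discount k (h : hist k) u := expR (prim (rho h) u).

(** Zero for a jump beyond the horizon, so that products of weights retain exactly the paths whose
    jumps so far occur by [tau]. *)
Definition weight k (h : hist k) u : R :=
  if 0 < u <= tau - hist_time h then discount h u else 0.

Definition run (g : R -> S -> R) k (h : hist k) (z : step R S) : \bar R :=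
  if z is Some q then (weight h q.1 * g (hist_time h + q.1) q.2)%:E else 0%E.

Definition off (g : S -> R) k (h : hist k) u : R := hist_clock h *
  fine (\int[hist_mix k (h, u)]_y (g y * \1_(moved (@last_state _ _ k) h) y)%:E)%E.

Lemma measurable_discount k : measurable_fun setT (fun p : hist k * R => discount p.1 p.2).
Proof. exact: (measurableT_comp (@measurable_expR R) (measurable_prim (@mrho k))). Qed.

Lemma measurable_weight k : measurable_fun setT (fun p : hist k * R => weight p.1 p.2).
Proof.
apply: measurable_fun_ifT; last exact: measurable_cst; last exact: measurable_discount.
apply: measurable_and; first exact: (measurable_fun_ltr (measurable_cst _) measurable_snd).
apply: measurable_fun_ler; first exact: measurable_snd.
apply: measurable_funB => //; exact: (measurableT_comp (@measurable_hist_time _ _ k) measurable_fst).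
Qed.

Lemma weight_ge0 k (h : hist k) u : 0 <= weight h u.
Proof. by rewrite /weight; case: ifP => _ //; exact: expR_ge0. Qed.

Lemma measurable_run g k : measurable_fun setT (fun p : R * borel S => g p.1 p.2) ->
  measurable_fun setT (fun p : hist k * step R S => run g p.1 p.2).
Proof.
move=> mg; have mq : measurable_fun setT (fun p : hist k * (R * borel S) =>
    (weight p.1 p.2.1 * g (hist_time p.1 + p.2.1) p.2.2)%:E).
  have m1 : measurable_fun setT (fun p : hist k * (R * borel S) => p.2.1) by exact: (measurableT_comp measurable_fst measurable_snd).
  have m2 : measurable_fun setT (fun p : hist k * (R * borel S) => p.2.2) by exact: (measurableT_comp measurable_snd measurable_snd).
  have m3 : measurable_fun setT (fun p : hist k * (R * borel S) => hist_time p.1) by exact: (measurableT_comp (@measurable_hist_time _ _ k) measurable_fst).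
  apply/measurable_EFinP; apply: measurable_funM.
    exact: (measurableT_comp (@measurable_weight k) (measurable_fun_pair measurable_fst m1)).
  exact: (measurableT_comp mg (measurable_fun_pair (measurable_funD m3 m1) m2)).
exact: (@measurable_step_param _ _ _ _ _ _ (fun (h : hist k) q => (weight h q.1 * g (hist_time h + q.1) q.2)%:E) (fun=> 0%E) mq (measurable_cst 0%E)).
Qed.

Variables (U : S -> R) (kU : R).
Hypothesis lU : lyapunov H U kU.

Section fixed.
Variables (k : nat) (h : hist k).
Let x := last_state h.
Let L := tau - hist_time h.
Let sS : standard_borel (borel S) := standard_borel_space (borelS G).

Let mixE u f : measurable_fun setT f -> (forall y, 0 <= f y)%E ->
  (\int[hist_mix k (h, u)]_y f y = \int[kprob (policy_kernel p1 k) (h, u)]_a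
    \int[kprob (policy_kernel p2 k) (h, u)]_b \int[unif H (x, a, b)]_y f y)%E.
Proof. exact: hist_mixE. Qed.

Let mU u := @mixture_lyapunov R S A B G V0 V1 rho0 L0 M0 rho1 b1 M1 H x (kprob (policy_kernel p1 k) (h, u))
  (kprob (policy_kernel p2 k) (h, u)) (policy_adm p1 h u) (policy_adm p2 h u) (hist_mix k (h, u)) (mixE u) U kU lU.

Let U_ge1 y : 1 <= U y.
Proof. by have [_ VU _ _] := lU; exact: le_trans (V0_ge1 H y) (VU y). Qed.

Let m_moved : measurable (moved (@last_state R S k) h).
Proof. by apply: measurableC; exact: measurable_singleton (borelS G). Qed.

Let leave_le u : 0 <= hleave h u <= hist_clock h.
Proof. exact: (leave_bounds _ (@measurable_last_state _ _ k) (@hist_clock_ge0 _ _ _ _ _ _ _ _ _ _ _ _ _ H k)). Qed.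

Let moved_integrable g C u : dominated U g C ->
  (hist_mix k (h, u)).-integrable setT (fun y => (g y * \1_(moved (@last_state _ _ k) h) y)%:E).
Proof.
move=> dg; have [iV _] := mU u; apply: (integrable_dominated (C := C) iV).
have [mg gC] := dg; split=> [|y]; first by apply: measurable_funM => //; exact: measurable_indic.
apply: le_trans (gC y); rewrite normrM ler_piMr// indicE; case: (_ \in _) => /=; by rewrite ?normr1 ?normr0.
Qed.

(** The mass that uniformization leaves at [x] contributes the same amount to both sides and
    cancels. The true jump rates thus inherit the bounds known for the uniformized mean. *)
Lemma off_mean g C u : dominated U g C ->
  off g h u - hleave h u * g x = hist_clock h * (fine (\int[hist_mix k (h, u)]_y (g y)%:E)%E - g x).
Proof.
move=> dg; have ig := moved_integrable u dg.
have mI : measurable ([set x] : set (borel S)) := measurable_singleton x (borelS G).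
have i1 : (hist_mix k (h, u)).-integrable setT (fun y => (g x * \1_[set x] y)%:E).
  have [iV _] := mU u; apply: (integrable_dominated (C := `|g x|) iV); split=> [|y].
    by apply: measurable_funM => //; exact: measurable_indic.
  have := U_ge1 y => V_1; rewrite normrM ler_wpM2l// indicE.
  by case: (_ \in _); rewrite /= ?normr1// normr0 (le_trans ler01).
have e : (\int[hist_mix k (h, u)]_y (g y)%:E = \int[hist_mix k (h, u)]_y (g y * \1_(moved (@last_state _ _ k) h) y)%:E +
    (g x)%:E * hist_mix k (h, u) [set x])%E.
  transitivity (\int[hist_mix k (h, u)]_y ((g y * \1_(moved (@last_state _ _ k) h) y)%:E + (g x * \1_[set x] y)%:E))%E.
    apply: eq_integral => y _; rewrite -EFinD; congr EFin; rewrite /moved !indicE in_setC.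
    by have [->|yx] := pselect (y = x); [rewrite mem_set//=|rewrite memNset//=]; rewrite ?mulr0 ?mulr1 ?add0r ?addr0.
  rewrite (integralD measurableT ig i1); congr (_ + _)%E.
  under eq_integral do rewrite EFinM.
  have iI : (hist_mix k (h, u)).-integrable setT (EFin \o (\1_[set x] : S -> R)).
    have [iV _] := mU u; apply: (integrable_dominated (C := 1) iV); split=> [|y]; first exact: measurable_indic.
    have := U_ge1 y => V_1; rewrite mul1r indicE.
    by case: (_ \in _); rewrite /= ?normr1// normr0 (le_trans ler01).
  by rewrite (integralZl measurableT iI) integral_indic// setIT.
have p1' : hist_mix k (h, u) [set x] = (1 - fine (hist_mix k (h, u) (moved (@last_state _ _ k) h)))%:E.
  have := probability_setC (kprob (hist_mix k) (h, u)) m_moved.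
  have -> : ~` moved (@last_state _ _ k) h = [set x] by rewrite /moved setCK.
  by move=> E; apply: (etrans E); rewrite EFinB fineK//; exact: (fin_num_measure (kprob (hist_mix k) (h, u))).
rewrite e p1' -(fineK (integrable_fin_num measurableT ig)) -EFinM -EFinD/= /off /leave.
by move: (fine _) (fine _) (g x) (hist_clock h) => *; ring.
Qed.

Let off_integrand_ge0 (g : S -> R) : (forall y, 0 <= g y) ->
  forall y : borel S, 0 <= g y * (\1_(moved (@last_state R S k) h) y : R).
Proof. by move=> g0 y; rewrite mulr_ge0. Qed.

Lemma off_bound g C u : dominated U g C -> (forall y, 0 <= g y) ->
  0 <= off g h u <= C * (hist_clock h * U x + kU * U x).
Proof.
move=> dg g0; have [iV hV] := mU u; have c0 := hist_clock_ge0 H h.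
have i0 : (0 <= \int[hist_mix k (h, u)]_y (g y * \1_(moved (@last_state _ _ k) h) y)%:E)%E.
  by apply: integral_ge0 => y _; rewrite lee_fin; exact: off_integrand_ge0.
rewrite /off mulr_ge0 ?fine_ge0//=.
have [mg gC] := dg; have C0 : 0 <= C.
  by have := gC x; have := U_ge1 x; have := normr_ge0 (g x); move: (U x) `|g x| => v n; nra.
have le1 : fine (\int[hist_mix k (h, u)]_y (g y * \1_(moved (@last_state _ _ k) h) y)%:E)%E <=
    C * fine (\int[hist_mix k (h, u)]_y (U y)%:E)%E.
  have iV' := integrableZl measurableT C iV.
  have -> : C * fine (\int[hist_mix k (h, u)]_y (U y)%:E)%E = fine (\int[hist_mix k (h, u)]_y (C%:E * (U y)%:E))%E.
    by rewrite integralZl// fineM ?integrable_fin_num.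
  apply: fine_le; try exact: integrable_fin_num.
    by apply: integrable_fin_num => //; exact: moved_integrable dg.
  apply: le_integral => //; first exact: moved_integrable dg.
  move=> y _; rewrite -EFinM lee_fin; apply: le_trans (gC y).
  rewrite ger0_norm//; apply: ler_piMr => //; rewrite indicE; by case: (_ \in _).
have := ler_wpM2l c0 le1; have := ler_wpM2l C0 hV; rewrite /hist_clock /= -/x.
move: (clock x) (fine _) (fine _) => c I J; lra.
Qed.

Section mono.
Variables (g : R -> S -> R) (C : R).
Hypotheses (mg : measurable_fun setT (fun p : R * borel S => g p.1 p.2)) (gC : forall t y, `|g t y| <= C * U y).
Hypothesis g0 : forall t y, 0 <= g t y.

Let T := hist_time h.
Let kappa u := rho h u - hleave h u.
Let G' u := expR (prim kappa u) * off (g (T + u)) h u.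

Let dg t : dominated U (g t) C.
Proof. by split; [exact: (measurableT_comp mg (measurable_pair1 t))|exact: gC]. Qed.

Let mrh : measurable_fun setT (rho h).
Proof. exact: (measurableT_comp (@mrho k) (measurable_pair1 h)). Qed.

Let mlh : measurable_fun setT (hleave h).
Proof.
exact: (measurableT_comp (measurable_leave (hist_mix k) (@measurable_last_state _ _ k) (measurable_hist_clock H (k := k)) sS) (measurable_pair1 h)).
Qed.

Let mkappa : measurable_fun setT kappa. Proof. exact: measurable_funB. Qed.

Let kappa_le u : `|kappa u| <= theta G * payoff_bound x + hist_clock h.
Proof.
apply: le_trans (ler_normB _ _) _; apply: lerD; first exact: rho_le.
by have /andP[l0 lc] := leave_le u; rewrite ger0_norm.
Qed.

Let nleave_le u : `|- hleave h u| <= hist_clock h.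
Proof. by have /andP[l0 lc] := leave_le u; rewrite normrN ger0_norm. Qed.

Let expE u : expR (prim kappa u) = discount h u * hsurvival h u.
Proof.
rewrite /discount /survival -expRD; congr expR; apply: (primD mrh (rho_le h)).
by apply: prim_integrable nleave_le _; exact: measurableT_comp mlh.
Qed.

Let moff : measurable_fun setT (fun u => off (g (T + u)) h u).
Proof.
apply: measurable_funM => //; apply: (measurableT_comp (fine_measurable measurableT)).
have mi : measurable_fun setT (fun p : (hist k * R) * borel S => (g (T + p.1.2) p.2 * \1_(moved (@last_state _ _ k) h) p.2)%:E).
  apply/measurable_EFinP; apply: measurable_funM.
    apply: (measurableT_comp mg (measurable_fun_pair _ measurable_snd)); apply: measurable_funD => //.
    exact: (measurableT_comp measurable_snd measurable_fst).
  by apply: (measurableT_comp (measurable_indic m_moved) measurable_snd).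
have h1 := measurable_integral (hist_mix k) (f := fun p y => (g (T + p.2) y * \1_(moved (@last_state _ _ k) h) y)%:E) mi.
apply: (measurableT_comp (h1 _) (measurable_pair1 h)) => p y.
by rewrite lee_fin; exact: off_integrand_ge0.
Qed.

Let mexp : measurable_fun setT (fun u => expR (prim kappa u)).
Proof.
apply: (measurableT_comp (@measurable_expR R)).
have mk' : measurable_fun setT (fun z : R * R => kappa z.2) by apply: measurableT_comp mkappa _.
by have mp' := measurable_prim mk'; have := measurableT_comp mp' (measurable_pair1 (0 : R)); exact.
Qed.

Let mG : measurable_fun setT G'. Proof. exact: measurable_funM mexp moff. Qed.

Let G'_le t : 0 <= t <= L ->
  `|G' t| <= expR ((theta G * payoff_bound x + hist_clock h) * L) * (C * (hist_clock h * U x + kU * U x)).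
Proof.
move=> /andP[t0 tL]; have /andP[h0 hC] := off_bound t (dg (T + t)) (g0 (T + t)).
rewrite normrM ler_pM// ?(ger0_norm (expR_ge0 _)) ?(ger0_norm h0)// ler_expR.
apply: le_trans (ler_norm _) (le_trans (prim_norm mkappa kappa_le t0) _).
by rewrite ler_wpM2l// (le_trans _ (kappa_le 0)).
Qed.

Lemma next_run : 0 <= L -> (\int[next_kernel k h]_z run g h z =
  (prim (fun u => expR (prim (fun v => rho h v - hleave h v) u) * off (g (hist_time h + u)) h u) L)%:E)%E.
Proof.
move=> L_ge0; have w0 z : (0 <= run g h z)%E.
  by case: z => [[u y]|]//=; rewrite lee_fin mulr_ge0 ?weight_ge0.
have mrun : measurable_fun setT (run g h : step R S -> \bar R).
  exact: (measurableT_comp (measurable_run (k := k) mg) (measurable_pair1 h)).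
rewrite integral_next//= mule0 adde0.
rewrite -(integral_prim mG (itv_integrable mG G'_le)); apply: eq_integral => u; rewrite inE/= in_itv/= andbT => u0.
rewrite patchE /weight u0/= -/L; case: ifPn => [|] uL; last first.
  rewrite integral0_eq; last by move=> y _; rewrite mul0r mule0.
  by rewrite memNset//= in_itv/=; exact/negP.
rewrite mem_set /= ?in_itv//= /G' expE /off.
have ig := moved_integrable u (dg (T + u)).
rewrite -[fine _ in RHS]/(fine _) [in RHS]mulrA EFinM fineK; last exact: integrable_fin_num.
rewrite -integralZl//; apply: eq_integral => y _; rewrite /density -!EFinM; congr EFin.
by rewrite -/T; move: (hist_clock h) (hsurvival h u) (discount h u) (\1_ _ y) (g _ y) => *; ring.
Qed.

Variables (phi : R -> R) (M : R) (E : set R).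
Hypotheses (L_ge0 : 0 <= L) (acp : absolutely_continuous 0 L phi) (phiM : forall t, 0 <= t <= L -> `|phi t| <= M).
Hypotheses (mE : measurable E) (E0 : lebesgue_measure (`[0, L] `\` E) = 0%E).

Let poff u : `|off (g (T + u)) h u| <= C * (hist_clock h * U x + kU * U x).
Proof. by have /andP[h0 hC] := off_bound u (dg (T + u)) (g0 (T + u)); rewrite ger0_norm. Qed.

(** [phi] is the candidate along one sojourn. [linear_le], with the coefficient [rho - leave] and
    the source [off], integrates the inequality: the first term is the case without a jump before
    the horizon, the integral is the first jump. *)
Lemma step_le : (forall u, E u -> 0 < u -> u < L -> derivable phi u 1 /\
    0 <= derive1 phi u + (rho h u - hleave h u) * phi u + off (g (hist_time h + u)) h u) ->
  ((phi 0)%:E <= (discount h L * phi L * hsurvival h L)%:E + \int[next_kernel k h]_z run g h z)%E.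
Proof.
move=> dE; have := linear_le L_ge0 acp phiM mkappa kappa_le moff poff mE E0 dE.
by rewrite next_run// -EFinD lee_fin expE mulrAC.
Qed.

Lemma step_ge : (forall u, E u -> 0 < u -> u < L -> derivable phi u 1 /\
    derive1 phi u + (rho h u - hleave h u) * phi u + off (g (hist_time h + u)) h u <= 0) ->
  ((discount h L * phi L * hsurvival h L)%:E + \int[next_kernel k h]_z run g h z <= (phi 0)%:E)%E.
Proof.
move=> dE; have acn : absolutely_continuous 0 L (fun u => - phi u).
  by apply: (ac_dominated (C := 1) (L := 0) acp) => // u v _ _ _; rewrite mul1r mul0r addr0 -opprD normrN.
have phiM' t : 0 <= t <= L -> `|- phi t| <= M by move=> /phiM; rewrite normrN.
have poff' u : `|- off (g (T + u)) h u| <= C * (hist_clock h * U x + kU * U x) by rewrite normrN.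
have moff' : measurable_fun setT (fun u => - off (g (T + u)) h u) by exact: measurableT_comp moff.
have := linear_le L_ge0 acn phiM' mkappa kappa_le moff' poff' mE E0.
have -> : prim (fun t => expR (prim kappa t) * - off (g (T + t)) h t) L = - prim G' L.
  by rewrite -(prim_opp mG G'_le); congr (prim _ L); apply/funext => t; rewrite mulrN.
rewrite next_run// -EFinD lee_fin -/(kappa) -/(G') expE mulrN -mulrAC => key.
rewrite -lerN2 opprD; apply: key => u Eu u0 uL; have [du hu] := dE u Eu u0 uL.
split; first exact: derivableN.
have -> : derive1 (fun u => - phi u) u = - derive1 phi u by rewrite !derive1E deriveN.
by rewrite /kappa; move: hu; move: (derive1 _ _) (rho h u) (hleave h u) (off _ _ _) (phi u) => a b c d e; lra.
Qed.

End mono.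
End fixed.
End step.

(** * Integrals along an interval and on a set of full measure *)

Lemma lebesgue_shift (R : realType) (s : R) (A : set R) : measurable A ->
  lebesgue_measure [set u | A (s + u)%R] = lebesgue_measure A.
Proof.
move=> mA; have ms : measurable_fun setT ((fun u => s + u)%R : measurableTypeR R -> measurableTypeR R).
  exact: measurable_funD.
pose mu : {measure set (measurableTypeR R) -> \bar R} :=
  measure_function_pushforward__canonical__measure_function_Measure (@lebesgue_measure R) ms.
rewrite -[LHS]/(mu A); apply/esym; apply: lebesgue_measure_unique mA => _ [[a b] _ <-].
rewrite /mu/= /pushforward.
have -> : (fun u : R => s + u)%R @^-1` [set` `]a, b]] = [set` `]a - s, b - s]]%R.
  by apply/seteqP; split=> u /=; rewrite !in_itv/= ltrBlDl lerBrDl.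
rewrite !lebesgue_measure_itv/= !lte_fin ltrD2r; case: ifP => // _.
by rewrite -!EFinB; congr EFin; lra.
Qed.

Lemma integral_shift (R : realType) (f : R -> \bar R) (s : R) : measurable_fun setT f ->
  lebesgue_measure.-integrable setT (fun u => f (s + u)%R) ->
  \int[lebesgue_measure]_t f t = \int[lebesgue_measure]_u f (s + u)%R.
Proof.
move=> mf fi; have ms : measurable_fun setT ((fun u => s + u)%R : measurableTypeR R -> measurableTypeR R).
  exact: measurable_funD.
pose mu : {measure set (measurableTypeR R) -> \bar R} :=
  measure_function_pushforward__canonical__measure_function_Measure (@lebesgue_measure R) ms.
transitivity (\int[mu]_t f t).
  by apply: integral_eq_measurable => D mD; rewrite -(lebesgue_shift s mD).
exact: (integral_pushforward ms mf fi measurableT).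
Qed.

Lemma integrable_patch d (T : measurableType d) (R : realType) (mu : {measure set T -> \bar R})
    (D : set T) (f : T -> \bar R) : measurable D -> mu.-integrable D f -> mu.-integrable setT (f \_ D).
Proof. by move=> mD fi; apply/(integrable_mkcond f mD). Qed.

(** The payoff along a path is integrated sojourn by sojourn. The value at the right end is left
    free on purpose: at a jump time the state is already the new one while the action is still that
    of the previous sojourn. *)
Lemma integral_extend (R : realType) (F : R -> \bar R) (r : R -> R) (K s L a : R) :
  (0 <= s)%R -> (0 <= L)%R -> measurable_fun setT r -> (forall u, `|r u| <= K)%R ->
  measurable_fun `[0%R, s] F -> \int[lebesgue_measure]_(t in `[0%R, s]) F t = a%:E ->
  (forall t, (s < t)%R -> (t < s + L)%R -> F t = (r (t - s))%:E) ->
  measurable_fun `[0%R, (s + L)%R] F /\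
  \int[lebesgue_measure]_(t in `[0%R, (s + L)%R]) F t = (a + prim r L)%:E.
Proof.
move=> s0; rewrite le_eqVlt => /orP[/eqP<- mr rK mF aE _|L0 mr rK mF aE Fr].
  by rewrite addr0 aE /prim set_itv1 Rintegral_set1 addr0.
have mrs : measurable_fun setT (fun t : R => (r (t - s))%:E).
  apply/measurable_EFinP; apply: (measurableT_comp mr); exact: measurable_funB.
have mI : measurable_fun `]s, (s + L)%R[%classic F.
  have h : {in `]s, (s + L)%R[%classic, (fun t : R => (r (t - s))%:E) =1 F}.
    by move=> t; rewrite inE/= in_itv/= => /andP[h1 h2]; rewrite Fr.
  exact: (eq_measurable_fun _ h (measurable_funTS mrs)).
have m1 : measurable_fun (`[0%R, s]%classic `|` `]s, (s + L)%R[%classic) F by apply/measurable_funU.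
have e : `[0%R, (s + L)%R]%classic = (`[0%R, s]%classic `|` `]s, (s + L)%R[%classic) `|` [set (s + L)%R].
  apply/seteqP; split=> t /=; rewrite !in_itv/=.
    move=> /andP[t0 tL]; have [ts|st] := leP t s; first by left; left; rewrite t0.
    by move: tL; rewrite le_eqVlt => /orP[/eqP ->|tL]; [right|left; right; rewrite tL].
  by move=> [[/andP[-> ts]|/andP[st tL]]|->]; rewrite ?(le_trans ts) ?lerDl ?(ltW L0) ?(ltW tL) ?andbT ?addr_ge0 ?(ltW L0)//= ltW// (le_lt_trans s0 st).
have mF' : measurable_fun `[0%R, (s + L)%R]%classic F.
  by rewrite e; apply/measurable_funU; rewrite //; [exact: measurableU|split=> //; exact: measurable_fun_set1].
split=> //; rewrite e integral_setU//; last 3 first.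
- exact: measurableU.
- by rewrite -e.
- apply/disj_set2P/seteqP; split=> t //= -[h E]; move: h; rewrite E !in_itv/= ltxx andbF.
  by move=> [/andP[_ h]|//]; move: h; rewrite leNgt ltrDl L0.
rewrite integral_set1 adde0 integral_setU//; last first.
  by apply/disj_set2P/seteqP; split=> t //= -[]; rewrite !in_itv/= => /andP[_ ts] /andP[st _]; move: st; rewrite ltNge ts.
rewrite aE EFinD; congr (_ + _).
transitivity (\int[lebesgue_measure]_(t in `]s, (s + L)%R[) (r (t - s))%:E).
  by apply: eq_integral => t; rewrite inE/= in_itv/= => /andP[h1 h2]; rewrite Fr.
have iL : lebesgue_measure.-integrable `]0%R, L[%classic (EFin \o r).
  apply: (lebesgue_bounded_integrable mr rK) => //.
  by rewrite -[X in (X < _)]/(lebesgue_measure `]0%R, L[%classic) lebesgue_measure_itv/=; case: ifP => _; rewrite ?ltry.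
rewrite integral_mkcond; set f := _ \_ _.
have fE u : f (s + u)%R = ((EFin \o r) \_ `]0%R, L[%classic) u.
  rewrite /f !patchE !mem_setE !in_itv/= ltrDl ltrD2l.
  by case: ifP => // _; rewrite [(s + u)%R]addrC addrK.
rewrite (integral_shift (s := s)); last 2 first.
- by apply/(measurable_restrictT _ (measurable_itv _)); exact: measurable_funTS mrs.
- have -> : (fun u : R => f (s + u)%R) = (EFin \o r) \_ `]0%R, L[%classic by exact/funext.
  by apply: integrable_patch; [exact: measurable_itv|exact: iL].
under eq_integral do rewrite fE.
rewrite -integral_mkcond /prim /Rintegral fineK; last first.
  by apply: (integrable_fin_num _ (prim_integrable mr rK L)).
rewrite -integral_itv_obnd_cbnd; last exact: measurable_funTS (measurableT_comp _ mr).
by rewrite -integral_itv_bndo_bndc//; exact: measurable_funTS (measurableT_comp _ mr).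
Qed.

Section full_measure.
Import HBNNSimple.
Context d (T : measurableType d) (R : realType) (P : probability T R).

(** Holds without measurability, the integral of a nonnegative function being a supremum over the
    simple functions below it. It serves for the integrand of the criterion, which is not known to
    be measurable. *)
Lemma ge0_integral_mono (f g : T -> \bar R) : (forall x, 0 <= f x) -> (forall x, f x <= g x) ->
  \int[P]_x f x <= \int[P]_x g x.
Proof.
move=> f0 fg; have g0 x : 0 <= g x := le_trans (f0 x) (fg x).
rewrite !ge0_integralTE//; apply: le_ereal_sup => _ [h hf <-]; exists h => //= x.
exact: le_trans (hf x) (fg x).
Qed.

Lemma integral_on_full (D : set T) (f : T -> \bar R) : measurable D -> P D = 1 -> (forall x, 0 <= f x) ->
  \int[P]_x f x = \int[P]_(x in D) f x.
Proof.
move=> mD D1 f0; have fD0 x : 0 <= (f \_ D) x by rewrite patchE; case: ifP.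
rewrite [RHS]integral_mkcond; apply/le_anti/andP; split; last first.
  by apply: ge0_integral_mono => // x; rewrite patchE; case: ifP.
rewrite [leLHS]ge0_integralTE//; apply: ge_ereal_sup => _ [h hf <-].
have mh : measurable_fun setT (fun x => (h x)%:E) by apply/measurable_EFinP.
rewrite -integralT_nnsfun -(integral_full (probability_setT P) mD D1 mh); last by move=> x; rewrite lee_fin.
rewrite integral_mkcond; apply: ge0_integral_mono => x; rewrite !patchE; case: ifP => // _.
by rewrite lee_fin.
Qed.

Lemma negligible_full (N : set T) : P.-negligible N ->
  exists D, [/\ measurable D, P D = 1 & D `<=` ~` N].
Proof.
move=> [N' [mN' N0 sub]]; exists (~` N'); split; first exact: measurableC.
  by rewrite probability_setC// N0 sube0.
exact: subsetC.
Qed.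

End full_measure.

(** * Verification along a path *)

Section histories.
Context (R : realType) (S : ptopologicalType).
Implicit Types k : nat.

Definition extend k (h : hist R S k) (q : R * borel S) : hist R S k.+1 := (h.1, [tuple of rcons h.2 q]).
Definition keep k (h : hist R S k.+1) : hist R S k :=
  (h.1, [tuple tnth h.2 (widen_ord (leqnSn k) i) | i < k]).
Definition gap k (h : hist R S k.+1) : R := (tnth h.2 ord_max).1.

Lemma keep_extend k (h : hist R S k) q : keep (extend h q) = h.
Proof.
case: h => y t; congr (_, _); apply: eq_from_tnth => i; rewrite tnth_mktuple.
by rewrite !(tnth_nth (0%R, y)) /= nth_rcons size_tuple ltn_ord.
Qed.

Lemma gap_extend k (h : hist R S k) q : gap (extend h q) = q.1.
Proof. by rewrite /gap (tnth_nth q)/= nth_rcons size_tuple ltnn eqxx. Qed.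

Lemma last_extend k (h : hist R S k) q : last_state (extend h q) = q.2.
Proof. by rewrite /last_state/= map_rcons last_rcons. Qed.

Lemma time_extend k (h : hist R S k) q : hist_time (extend h q) = (hist_time h + q.1)%R.
Proof.
rewrite /hist_time big_ord_recr/=; congr (_ + _)%R; last exact: gap_extend.
apply: eq_bigr => i _; congr (_.1).
by rewrite !(tnth_nth q)/= nth_rcons size_tuple ltn_ord.
Qed.

Lemma measurable_keep k : measurable_fun setT (@keep k).
Proof.
apply/measurable_fun_pairP; split; first exact: measurable_fst.
apply/measurable_fun_tnthP => i.
rewrite (_ : _ \o _ = fun h : hist R S k.+1 => tnth h.2 (widen_ord (leqnSn k) i)).
  exact: measurable_hist_entry.
by apply/funext => h; rewrite /= tnth_mktuple.
Qed.

Lemma measurable_gap k : measurable_fun setT (@gap k).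
Proof. exact: (measurableT_comp measurable_fst (@measurable_hist_entry _ _ k.+1 ord_max)). Qed.

Section weights.
Variables (tau : R) (rho : forall k, hist R S k -> R -> R).
Hypothesis mrho : forall k, measurable_fun setT (fun p : hist R S k * R => rho p.1 p.2).

Fixpoint path_weight k : hist R S k -> R :=
  if k is k'.+1 then fun h => (path_weight (keep h) * weight tau rho (keep h) (gap h))%R else fun=> 1%R.

Lemma measurable_path_weight k : measurable_fun setT (@path_weight k).
Proof.
elim: k => [|k IH]; first exact: measurable_cst.
apply: measurable_funM; first exact: (measurableT_comp IH (@measurable_keep k)).
exact: (measurableT_comp (measurable_weight tau mrho (k := k)) (measurable_fun_pair (@measurable_keep k) (@measurable_gap k))).
Qed.

Lemma path_weight_ge0 k (h : hist R S k) : (0 <= path_weight h)%R.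
Proof. by elim: k h => [|k IH] h //=; rewrite mulr_ge0// weight_ge0. Qed.

Lemma path_weight_extend k (h : hist R S k) q :
  path_weight (extend h q) = (path_weight h * weight tau rho h q.1)%R.
Proof. by rewrite /= keep_extend gap_extend. Qed.

End weights.
End histories.

Section verification.
Context d (T : measurableType d) (R : realType) (S : ptopologicalType) (P : probability T R).
Variables (live : nat -> set T) (hst : forall k, T -> hist R S k) (nxt : nat -> T -> step R S)
  (N : forall k, R.-pker hist R S k ~> step R S).
Hypotheses (mlive : forall k, measurable (live k)) (mhst : forall k, measurable_fun setT (@hst k)).
Hypotheses (live0 : live 0%N = setT) (liveS : forall k w, live k.+1 w <-> live k w /\ nxt k w <> None).
Hypothesis hstS : forall k w q, nxt k w = Some q -> hst k.+1 w = extend (hst k w) q.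
Hypothesis cond : forall k (Psi : hist R S k * step R S -> \bar R), nneg_measurable Psi ->
  \int[P]_(w in live k) Psi (hst k w, nxt k w) =
  \int[P]_(w in live k) \int[N k (hst k w)]_z Psi (hst k w, z).
Variable x : S.
Hypothesis mx : measurable [set x : borel S].
Hypothesis start : P [set w | (hst 0%N w).1 = x] = 1.
Variables (tau : R) (rho : forall k, hist R S k -> R -> R).
Hypotheses (tau0 : (0 <= tau)%R) (mrho : forall k, measurable_fun setT (fun p : hist R S k * R => rho p.1 p.2)).

Local Notation wt := (path_weight tau rho).
Local Notation run := (run tau rho).

Definition nneg_fun (g : R -> S -> R) := measurable_fun setT (fun p : R * borel S => g p.1 p.2) /\
  forall t y, (0 <= g t y)%R.

Definition at_hist (g : R -> S -> R) k (h : hist R S k) : R := g (hist_time h) (last_state h).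

(** Expectation of the discounted [g] at the time of the [k]-th jump, restricted to the paths on
    which that jump occurs by [tau]. *)
Definition state_mean g k : \bar R := \int[P]_(w in live k) (wt (hst k w) * at_hist g (hst k w))%:E.

Definition stop_mean (st : forall k, hist R S k -> \bar R) k : \bar R :=
  \int[P]_(w in live k) ((wt (hst k w))%:E * st k (hst k w)).

Lemma measurable_at_hist g k : nneg_fun g -> measurable_fun setT (@at_hist g k).
Proof.
by move=> [mg _]; exact: (measurableT_comp mg (measurable_fun_pair (@measurable_hist_time _ _ k) (@measurable_last_state _ _ k))).
Qed.

Let mwt k : measurable_fun setT (fun w => wt (hst k w)).
Proof. exact: (measurableT_comp (measurable_path_weight tau mrho (k := k)) (@mhst k)). Qed.

Lemma weight_time k (h : hist R S k) : (wt h != 0 -> 0 <= hist_time h <= tau)%R.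
Proof.
elim: k h => [|k IH] h /=; first by rewrite /hist_time big_ord0 lexx.
rewrite mulf_eq0 negb_or => /andP[/IH/andP[T0 _]]; rewrite /weight; case: ifP; last by rewrite eqxx.
move=> /andP[g0]; rewrite lerBrDl => g_ _.
have -> : hist_time h = (hist_time (keep h) + gap h)%R.
  by rewrite /hist_time big_ord_recr/=; congr (_ + _)%R; apply: eq_bigr => i _; rewrite tnth_mktuple.
by rewrite g_ addr_ge0// ltW.
Qed.

Let wt0 k (h : hist R S k) : (0 <= wt h)%R. Proof. exact: path_weight_ge0. Qed.

Let state_ge0 g k w : nneg_fun g -> 0 <= (wt (hst k w) * at_hist g (hst k w))%:E.
Proof. by move=> [_ g0]; rewrite lee_fin mulr_ge0//; exact: g0. Qed.

Let mrun g k : nneg_fun g -> nneg_measurable (fun p : hist R S k * step R S => (wt p.1)%:E * run g p.1 p.2).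
Proof.
move=> [mg g0]; split=> [|[h z]].
  apply: emeasurable_funM; last exact: (measurable_run tau mrho (k := k) mg).
  by apply/measurable_EFinP; exact: (measurableT_comp (measurable_path_weight tau mrho (k := k)) measurable_fst).
rewrite mule_ge0 ?lee_fin ?path_weight_ge0//=; case: z => [q|]//=.
by rewrite lee_fin mulr_ge0 ?weight_ge0.
Qed.

Lemma state_mean_succ g k : nneg_fun g -> state_mean g k.+1 =
  \int[P]_(w in live k) ((wt (hst k w))%:E * \int[N k (hst k w)]_z run g (hst k w) z).
Proof.
move=> hg; have [mg g0] := hg.
transitivity (\int[P]_(w in live k) \int[N k (hst k w)]_z ((wt (hst k w))%:E * run g (hst k w) z)).
  rewrite -(cond (mrun k hg)) /state_mean integral_mkcond [RHS]integral_mkcond.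
  apply: eq_integral => w _; rewrite !patchE.
  case: ifPn => [/set_mem/liveS[lw]|lw1].
    case e: (nxt k w) => [q|]// _; rewrite mem_set// (hstS e) path_weight_extend /at_hist.
    by rewrite last_extend time_extend -EFinM mulrA.
  case: ifPn => // /set_mem lw; case e: (nxt k w) => [q|]; last by rewrite mule0.
  by exfalso; move/negP: lw1; apply; rewrite inE; apply/liveS; rewrite e.
apply: eq_integral => w _; rewrite ge0_integralZl_EFin ?path_weight_ge0//.
- by move=> z _; case: z => [q|]//=; rewrite lee_fin mulr_ge0 ?weight_ge0.
- exact: (measurableT_comp (measurable_run tau mrho (k := k) mg) (measurable_pair1 (hst k w))).
Qed.

Let run_ge0 g k (h : hist R S k) : nneg_fun g -> 0 <= \int[N k h]_z run g h z.
Proof.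
by move=> [_ g0]; apply: integral_ge0 => -[q|]//= _; rewrite lee_fin mulr_ge0 ?weight_ge0.
Qed.

Let m_state g k : nneg_fun g -> measurable_fun (live k) (fun w => (wt (hst k w) * at_hist g (hst k w))%:E).
Proof.
move=> hg; apply/measurable_EFinP; apply: measurable_funTS; apply: measurable_funM => //.
exact: (measurableT_comp (measurable_at_hist (k := k) hg) (@mhst k)).
Qed.

Let m_run g k : nneg_fun g -> measurable_fun (live k) (fun w => (wt (hst k w))%:E * \int[N k (hst k w)]_z run g (hst k w) z).
Proof.
move=> [mg g0]; apply: measurable_funTS; apply: emeasurable_funM; first by apply/measurable_EFinP.
have := measurable_integral (N k) (f := fun h z => run g h z) (measurable_run tau mrho (k := k) mg).
move=> h; apply: (measurableT_comp (h _) (@mhst k)) => h' -[q|]//=.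
by rewrite lee_fin mulr_ge0 ?weight_ge0.
Qed.

Lemma state_mean_ge0 g k : nneg_fun g -> 0 <= state_mean g k.
Proof. by move=> hg; apply: integral_ge0 => w _; exact: state_ge0. Qed.

Lemma state_mean0 g : nneg_fun g -> state_mean g 0%N = (g 0%R x)%:E.
Proof.
move=> hg; have [mg g0] := hg; pose D := [set w | (hst 0%N w).1 = x].
have mD : measurable D := measurable_preimageT (measurableT_comp measurable_fst (@mhst 0%N)) mx.
have m0 := m_state (k := 0%N) hg; rewrite live0 in m0.
rewrite /state_mean live0 -(integral_full (probability_setT P) mD start m0); last first.
  by move=> w; exact: state_ge0.
transitivity (\int[P]_(w in D) (g 0%R x)%:E); last by rewrite integral_cst//= [X in _ * X]start mule1.
apply: eq_integral => w /set_mem Dw; rewrite /= mul1r /at_hist /hist_time big_ord0; congr ((g _ _)%:E).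
by move: Dw; rewrite /D/= /last_state; case: (hst 0%N w) => y t /=; rewrite (tuple0 t).
Qed.

Section stop.
Variable st : forall k, hist R S k -> \bar R.
Hypotheses (mst : forall k, measurable_fun setT (@st k)) (st0 : forall k h, 0 <= @st k h).

Let m_stop k : measurable_fun (live k) (fun w => (wt (hst k w))%:E * st (hst k w)).
Proof.
apply: measurable_funTS; apply: emeasurable_funM; first by apply/measurable_EFinP.
exact: (measurableT_comp (@mst k) (@mhst k)).
Qed.

Lemma stop_mean_ge0 k : 0 <= stop_mean st k.
Proof. by apply: integral_ge0 => w _; rewrite mule_ge0// lee_fin path_weight_ge0. Qed.

Lemma mean_step_ge g g' k : nneg_fun g -> nneg_fun g' ->
  (forall h, (0 <= hist_time h <= tau)%R -> st h + \int[N k h]_z run g' h z <= (at_hist g h)%:E) ->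
  stop_mean st k + state_mean g' k.+1 <= state_mean g k.
Proof.
move=> hg hg' le; rewrite state_mean_succ// /stop_mean /state_mean -ge0_integralD;
  try exact: mlive; try exact: m_stop; try exact: m_run;
  try (by move=> w _; rewrite mule_ge0 ?lee_fin ?path_weight_ge0// run_ge0).
apply: ge0_le_integral => //.
- by move=> w _; rewrite adde_ge0// mule_ge0 ?lee_fin ?path_weight_ge0// run_ge0.
- by apply: emeasurable_funD; [exact: m_stop|exact: m_run].
- exact: m_state.
move=> w _; rewrite -ge0_muleDr// ?run_ge0// EFinM.
have [->|wn0] := eqVneq (wt (hst k w)) 0%R; first by rewrite !mul0e.
by rewrite lee_wpmul2l ?lee_fin ?path_weight_ge0//; apply: le; exact: weight_time.
Qed.

Lemma mean_step_le g g' k : nneg_fun g -> nneg_fun g' ->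
  (forall h, (0 <= hist_time h <= tau)%R -> (at_hist g h)%:E <= st h + \int[N k h]_z run g' h z) ->
  state_mean g k <= stop_mean st k + state_mean g' k.+1.
Proof.
move=> hg hg' le; rewrite state_mean_succ// /stop_mean /state_mean -ge0_integralD;
  try exact: mlive; try exact: m_stop; try exact: m_run;
  try (by move=> w _; rewrite mule_ge0 ?lee_fin ?path_weight_ge0// run_ge0).
have [_ g0] := hg; apply: ge0_le_integral => //.
- by move=> w _; exact: state_ge0.
- exact: m_state.
- by apply: emeasurable_funD; [exact: m_stop|exact: m_run].
move=> w _; rewrite -ge0_muleDr// ?run_ge0// EFinM.
have [->|wn0] := eqVneq (wt (hst k w)) 0%R; first by rewrite !mul0e.
by rewrite lee_wpmul2l ?lee_fin ?path_weight_ge0//; apply: le; exact: weight_time.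
Qed.

(** The one-jump inequalities telescope; the term left after [n] jumps is nonnegative and is
    dropped. *)
Lemma sum_stop_le g : nneg_fun g ->
  (forall k (h : hist R S k), (0 <= hist_time h <= tau)%R -> st h + \int[N k h]_z run g h z <= (at_hist g h)%:E) ->
  \sum_(k <oo) stop_mean st k <= (g 0%R x)%:E.
Proof.
move=> hg le; rewrite -state_mean0//; apply: lime_le; first by apply: is_cvg_nneseries => k _ _; exact: stop_mean_ge0.
apply: nearW => n.
suff h : \sum_(0 <= k < n) stop_mean st k + state_mean g n <= state_mean g 0.
  by apply: le_trans h; rewrite leeDl// state_mean_ge0.
elim: n => [|n IH]; first by rewrite big_nil add0e.
rewrite big_nat_recr//= -addeA; apply: le_trans IH; rewrite leeD2l//.
exact: mean_step_ge (le n).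
Qed.

Lemma le_sum_stop g : nneg_fun g ->
  (forall k (h : hist R S k), (0 <= hist_time h <= tau)%R -> (at_hist g h)%:E <= st h + \int[N k h]_z run g h z) ->
  state_mean g n @[n --> \oo] --> 0 -> (g 0%R x)%:E <= \sum_(k <oo) stop_mean st k.
Proof.
move=> hg le c0; rewrite -state_mean0//.
have h n : state_mean g 0 <= \sum_(0 <= k < n) stop_mean st k + state_mean g n.
  elim: n => [|n IH]; first by rewrite big_nil add0e.
  rewrite big_nat_recr//= -addeA; apply: le_trans IH _; rewrite leeD2l//.
  exact: mean_step_le (le n).
have c1 : \sum_(0 <= k < n) stop_mean st k @[n --> \oo] --> \sum_(k <oo) stop_mean st k.
  by apply: is_cvg_nneseries => k _ _; exact: stop_mean_ge0.
have c2 : (\sum_(0 <= k < n) stop_mean st k + state_mean g n) @[n --> \oo] --> \sum_(k <oo) stop_mean st k + 0.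
  have c2 := cvgeD (fin_num_adde_defl _ (isT : 0%E \is a fin_num)) c1 c0.
  exact: c2 _.
rewrite -[leRHS]adde0 -(cvg_lim _ c2)//; apply: lime_ge; first exact: cvgP c2.
exact: nearW.
Qed.

End stop.

Lemma state_meanZ g c k : nneg_fun g -> (0 <= c)%R -> state_mean (fun t y => c * g t y)%R k = c%:E * state_mean g k.
Proof.
move=> hg c0; have [mg g0] := hg; rewrite /state_mean -ge0_integralZl_EFin//; last 2 first.
- by move=> w _; exact: state_ge0.
- exact: m_state.
by apply: eq_integral => w _; rewrite -EFinM mulrCA.
Qed.

Lemma state_mean_le g g' k : nneg_fun g -> nneg_fun g' -> (forall t y, (g t y <= g' t y)%R) ->
  state_mean g k <= state_mean g' k.
Proof.
move=> hg hg' gg'; have [_ g0] := hg; apply: ge0_le_integral => //.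
- by move=> w _; exact: state_ge0.
- exact: m_state.
- exact: m_state.
- by move=> w _; rewrite lee_fin ler_wpM2l ?path_weight_ge0//; exact: gg'.
Qed.

(* The potential [W] pays for one more visit of weight [V] at each jump. *)
Lemma state_mean_cvg0 (W V : R -> S -> R) : nneg_fun W -> nneg_fun V ->
  (forall k (h : hist R S k), (0 <= hist_time h <= tau)%R ->
    \int[N k h]_z run (fun t y => W t y + V t y)%R h z <= (at_hist W h)%:E) ->
  state_mean V n @[n --> \oo] --> 0.
Proof.
move=> hW hV le; have [mW W0] := hW; have [mV V_0] := hV.
have hD : nneg_fun (fun t y => W t y + V t y)%R.
  by split=> [|t y]; [exact: measurable_funD|exact: addr_ge0].
have sD n : state_mean (fun t y => W t y + V t y)%R n = state_mean W n + state_mean V n.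
  rewrite /state_mean -ge0_integralD//; try exact: m_state; try (by move=> w _; exact: state_ge0).
  by apply: eq_integral => w _; rewrite -EFinD -mulrDr.
have key n : \sum_(0 <= k < n) state_mean V k.+1 + state_mean W n <= (W 0%R x)%:E.
  elim: n => [|n IH]; first by rewrite big_nil add0e state_mean0.
  rewrite big_nat_recr//= -addeA; apply: le_trans IH; rewrite leeD2l// addeC -sD.
  have := @mean_step_ge (fun=> fun=> 0) (fun=> measurable_cst _) (fun _ _ => lexx _) W _ n hW hD.
  rewrite /stop_mean integral0_eq ?add0e; last by move=> w _; rewrite mule0.
  by apply => h ht; rewrite add0e; exact: le.
have fin : \sum_(k <oo) state_mean V k.+1 < +oo.
  apply: le_lt_trans (ltry (W 0%R x)); apply: lime_le.
    by apply: is_cvg_nneseries => k _ _; exact: state_mean_ge0.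
  by apply: nearW => n; apply: le_trans (key n); rewrite leeDl// state_mean_ge0.
rewrite -(cvg_shiftn 1).
have := nneseries_tail_cvg fin (fun k _ => state_mean_ge0 k.+1 hV) => c0.
apply: (squeeze_cvge _ _ c0); last exact: cvg_cst.
apply: nearW => n; rewrite /= addn1 state_mean_ge0//=.
have := nneseries_lim_ge n.+1 (fun k (_ : (n <= k)%N) (_ : true) => state_mean_ge0 k.+1 hV).
by rewrite big_nat1.
Qed.

Section reward.
Hypothesis mnxt : forall k, measurable_fun setT (nxt k).
Hypothesis gapN : forall k (h : hist R S k),
  \int[N k h]_z (if z is Some q then ((q.1 <= 0)%R : nat)%:R%:E else 0) = 0.

Definition stays k (h : hist R S k) (z : step R S) : bool :=
  if z is Some q then (tau - hist_time h < q.1)%R else true.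

Definition good k := [set w | [/\ live k w, wt (hst k w) != 0%R & stays (hst k w) (nxt k w)]].

Lemma measurable_stays k : measurable_fun setT (fun p : hist R S k * step R S => stays p.1 p.2).
Proof.
apply: (@measurable_step_param _ _ _ _ _ _ (fun (h : hist R S k) q => (tau - hist_time h < q.1)%R) (fun=> true)) => //.
apply: measurable_fun_ltr; last exact: (measurableT_comp measurable_fst measurable_snd).
apply: measurable_funB => //; exact: (measurableT_comp (@measurable_hist_time _ _ k) measurable_fst).
Qed.

Let mhn k : measurable_fun setT (fun w => (hst k w, nxt k w)).
Proof. exact: (measurable_fun_pair (@mhst k) (@mnxt k)). Qed.

Lemma measurable_good k : measurable (good k).
Proof.
rewrite (_ : good k = live k `&` ([set w | (wt (hst k w) != 0)%R] `&` [set w | stays (hst k w) (nxt k w)])); last first.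
  by apply/seteqP; split=> w /=; [move=> [? ? ?]|move=> [? [? ?]]].
apply: measurableI => //; apply: measurableI.
  rewrite (_ : [set w | _] = ~` [set w | wt (hst k w) = 0%R]); last first.
    by apply/seteqP; split=> w /= /eqP.
  apply: measurableC; exact: (measurable_preimageT (@mwt k) (measurable_set1 0%R)).
have := measurable_preimageT (measurableT_comp (@measurable_stays k) (@mhn k)) (I : measurable [set true]).
by [].
Qed.

Lemma wt_before k j w : (j < k)%N -> live k w -> wt (hst k w) != 0%R ->
  exists2 q, nxt j w = Some q & (0 < q.1 <= tau - hist_time (hst j w))%R /\ wt (hst j w) != 0%R.
Proof.
elim: k => // k IH; rewrite ltnS leq_eqVlt => /orP[/eqP->|jk] /liveS[lw].
  case e: (nxt k w) => [q|]// _; rewrite (hstS e) path_weight_extend mulf_eq0 negb_or => /andP[w0].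
  by rewrite /weight; case: ifP => [h _|]; [exists q|rewrite eqxx].
case e: (nxt k w) => [q|]// _; rewrite (hstS e) path_weight_extend mulf_eq0 negb_or => /andP[w0 _].
exact: IH.
Qed.

Lemma trivIset_good : trivIset setT good.
Proof.
suff h i j w : (i < j)%N -> good i w -> good j w -> False.
  by move=> i j _ _ [w [gi gj]]; case: (ltngtP i j) => // ij; exfalso; [exact: (h _ _ _ ij gi gj)|exact: (h _ _ _ ij gj gi)].
move=> ij [_ _ st] [lj wj _]; have [q e [/andP[_ qt] _]] := wt_before ij lj wj.
by move: st; rewrite /stays e ltNge qt.
Qed.

Definition explode := [set w | forall k, live k w /\ wt (hst k w) != 0%R].

(** When nonzero weights are at least 1 and [V >= 1], the mean of [V] at the [k]-th jump bounds the
    probability that this jump occurs by the horizon. *)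
Lemma negligible_explode V : nneg_fun V -> (forall t y, (1 <= V t y)%R) ->
  (forall k (h : hist R S k), wt h != 0%R -> (1 <= wt h)%R) ->
  state_mean V n @[n --> \oo] --> 0 -> P.-negligible explode.
Proof.
move=> hV V1' wt1 c0; pose F k := live k `&` ~` [set w | wt (hst k w) = 0%R].
have mF k : measurable (F k).
  apply: measurableI => //; apply: measurableC; exact: (measurable_preimageT (@mwt k) (measurable_set1 0%R)).
have PF k : P (F k) <= state_mean V k.
  rewrite -[leLHS]mul1e -integral_cst// /state_mean [leLHS]integral_mkcond [leRHS]integral_mkcond.
  apply: ge0_integral_mono => w; rewrite !patchE; first by case: ifP.
  case: ifP => [Fw|_]; last by case: ifP => // _; exact: state_ge0.
    rewrite mem_set; last by move/set_mem: Fw => [].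
    move/set_mem: Fw => [lw /eqP w0]; rewrite lee_fin -[leLHS]mulr1 ler_pM//; last exact: V1'.
    exact: wt1.
exists (\bigcap_k F k); split.
- by apply: bigcap_measurableType => k _.
- apply/le_anti/andP; split; last exact: measure_ge0.
  have : limn (state_mean V) = 0 by exact: cvg_lim c0.
  move=> <-; apply: lime_ge; first exact: cvgP c0.
  apply: nearW => k; apply: le_trans (PF k); apply: le_measure; rewrite ?inE//.
    by apply: bigcap_measurableType => j _.
  by move=> w; exact.
- by move=> w ew k _; have [lw w0] := ew k; split=> //; exact/eqP.
Qed.

Let negligible_gap : P.-negligible (\bigcup_k [set w | live k w /\ exists2 q, nxt k w = Some q & (q.1 <= 0)%R]).
Proof.
apply: negligible_bigcup => k.
pose ind (z : step R S) : \bar R := if z is Some q then ((q.1 <= 0)%R : nat)%:R%:E else 0.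
have mind : measurable_fun setT (fun p : hist R S k * step R S => ind p.2).
  apply: (@measurable_step_param _ _ _ _ _ _ (fun (h : hist R S k) q => ((q.1 <= 0)%R : nat)%:R%:E) (fun=> 0)) => //.
  apply/measurable_EFinP; rewrite (_ : (fun _ => _) = \1_[set p : hist R S k * (R * borel S) | (p.2.1 <= 0)%R]); last first.
    by apply/funext => p; rewrite indicE; congr (nat_of_bool _)%:R; apply/idP/idP; rewrite inE.
  apply: measurable_indic; have m1 : measurable_fun setT (fun p : hist R S k * (R * borel S) => p.2.1).
    exact: (measurableT_comp measurable_fst measurable_snd).
  have := measurable_preimageT m1 (measurable_itv `]-oo, 0%R]).
  by congr measurable; apply/seteqP; split=> p /=; rewrite in_itv.
have ind0 z : 0 <= ind z by case: z => [q|]//=; rewrite lee_fin.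
pose Z := [set w | live k w /\ exists2 q, nxt k w = Some q & (q.1 <= 0)%R].
have ZE : Z = live k `&` [set w | ind (nxt k w) = 1].
  apply/seteqP; split=> w /=; first by move=> [lw [q e q0]]; split=> //; rewrite e /= q0.
  move=> [lw]; case e: (nxt k w) => [q|] /=; last by move=> /eqP; rewrite eq_sym onee_eq0.
  by move=> h; split=> //; exists q => //; move: h; case: (q.1 <= 0)%R => // /eqP; rewrite eq_sym onee_eq0.
have mw : measurable_fun setT (fun w => ind (nxt k w)) by exact: (measurableT_comp mind (@mhn k)).
exists Z; split=> //; first by rewrite ZE; apply: measurableI => //; exact: (measurable_preimageT mw (emeasurable_set1 1)).
have mZ : measurable Z by rewrite ZE; apply: measurableI => //; exact: (measurable_preimageT mw (emeasurable_set1 1)).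
apply/le_anti/andP; split; last exact: measure_ge0.
have <- : \int[P]_(w in live k) ind (nxt k w) = 0.
  rewrite (cond (Psi := fun p => ind p.2)); last by split=> [|[h z]].
  by rewrite integral0_eq// => w _; exact: gapN.
rewrite -[leLHS]mul1e -integral_cst// [leLHS]integral_mkcond [leRHS]integral_mkcond.
apply: ge0_integral_mono => w; rewrite !patchE; first by case: ifP.
case: ifP => [/set_mem|_]; last by case: ifP.
by rewrite ZE => -[lw /= ->]; rewrite mem_set.
Qed.

(* Almost surely exactly one jump count [k] is current at time [tau]. *)
Lemma integral_reward (X : T -> \bar R) (rew : forall k, hist R S k -> R) (Bad : set T) :
  (forall w, 0 <= X w) -> (forall k, measurable_fun setT (@rew k)) -> (forall k h, (0 <= @rew k h)%R) ->
  P.-negligible Bad -> P.-negligible explode ->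
  (forall k w, ~ Bad w -> (forall j, live j w -> forall q, nxt j w = Some q -> (0 < q.1)%R) ->
    good k w -> X w = (wt (hst k w) * rew k (hst k w))%:E) ->
  \int[P]_w X w =
    \sum_(k <oo) stop_mean (fun k h => (rew k h)%:E * \int[N k h]_z (stays h z : nat)%:R%:E) k.
Proof.
move=> X0 mrew rew0 nB nE XE.
have [D0 [mD0 D01 D0sub]] := negligible_full (negligibleU (negligibleU nB nE) negligible_gap).
have D0gap w : D0 w -> forall j, live j w -> forall q, nxt j w = Some q -> (0 < q.1)%R.
  move=> Dw j lw q e; rewrite ltNge; apply/negP => q0; apply: (D0sub _ Dw); right.
  by exists j => //; split=> //; exists q.
have mG k : measurable (good k `&` D0) by apply: measurableI => //; exact: measurable_good.
pose g k w := (wt (hst k w) * rew k (hst k w))%:E.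
have mg k : measurable_fun setT (g k).
  by apply/measurable_EFinP; apply: measurable_funM => //; exact: (measurableT_comp (@mrew k) (@mhst k)).
have XgE k w : (good k `&` D0) w -> X w = g k w.
  move=> [gw Dw]; apply: XE => //; last exact: D0gap.
  by move=> Bw; apply: (D0sub _ Dw); left; left.
have cover : D0 = \bigcup_k (good k `&` D0).
  apply/seteqP; split=> [w Dw|w [k _ []//]].
  have [k [lk wk nk]] : exists k, [/\ live k w, wt (hst k w) != 0%R & ~ (live k.+1 w /\ wt (hst k.+1 w) != 0%R)].
    apply: contrapT => nok; apply: (D0sub _ Dw); left; right => k.
    elim: k => [|k [lk wk]]; first by split; [rewrite live0|rewrite /= oner_eq0].
    by apply: contrapT => n; apply: nok; exists k.
  exists k => //; split=> //; split=> //; rewrite /stays; case e: (nxt k w) => [q|]//.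
  rewrite ltNge; apply/negP => qt; apply: nk; split; first by apply/liveS; rewrite e.
  rewrite (hstS e) path_weight_extend mulf_neq0// /weight qt (D0gap w Dw k lk q e)/=.
  by rewrite gt_eqF// expR_gt0.
(* [X] is an arbitrary nonnegative function; on the set [D0] of full measure it coincides piece by
   piece with the measurable functions [g k]. *)
have mX : measurable_fun D0 X.
  rewrite cover; apply/measurable_fun_bigcup => // k.
  have h : {in good k `&` D0, g k =1 X} by move=> w /set_mem gw; rewrite (XgE k).
  exact: (eq_measurable_fun _ h (measurable_funTS (mg k))).
rewrite (integral_on_full mD0 D01 X0) [in LHS]cover ge0_integral_bigcup//; last 2 first.
- by rewrite -cover.
- move=> i j _ _ [w [[gi _] [gj _]]]; apply: (trivIset_good I I); by exists w.
apply: eq_eseriesr => k _.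
pose Psi (p : hist R S k * step R S) : \bar R := (wt p.1 * rew k p.1)%:E * (stays p.1 p.2 : nat)%:R%:E.
have mst : measurable_fun setT (fun p : hist R S k * step R S => (stays p.1 p.2 : nat)%:R%:E : \bar R).
  apply/measurable_EFinP; rewrite (_ : (fun _ => _) = \1_[set p : hist R S k * step R S | stays p.1 p.2]); last first.
    by apply/funext => p; rewrite indicE; congr (nat_of_bool _)%:R; apply/idP/idP; rewrite inE.
  apply: measurable_indic; have := measurable_preimageT (@measurable_stays k) (I : measurable [set true]); by [].
have hPsi : nneg_measurable Psi.
  split=> [|p]; last by rewrite mule_ge0// lee_fin ?mulr_ge0// path_weight_ge0.
  apply: emeasurable_funM => //; apply/measurable_EFinP; apply: measurable_funM.
    exact: (measurableT_comp (measurable_path_weight tau mrho (k := k)) measurable_fst).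
  exact: (measurableT_comp (@mrew k) measurable_fst).
transitivity (\int[P]_(w in live k) Psi (hst k w, nxt k w)).
  have [mPsi Psi0] := hPsi.
  have P0 w : 0 <= ((fun w => Psi (hst k w, nxt k w)) \_ (live k)) w by rewrite patchE; case: ifP.
  rewrite [RHS]integral_mkcond (integral_on_full mD0 D01 P0) integral_mkcond [RHS]integral_mkcond.
  apply: eq_integral => w _; rewrite !patchE.
  have [Dw|nD] := pselect (D0 w); last by rewrite !memNset// => -[].
  rewrite (mem_set Dw); have [gw|ng] := pselect (good k w).
    have [lw _ sw] := gw; by rewrite (mem_set lw) mem_set// (XgE k)// /Psi/= sw mule1.
  rewrite memNset; last by move=> [].
  case: ifP => // /set_mem lw; rewrite /Psi/=; case sw : (stays _ _); last by rewrite mule0.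
  have -> : wt (hst k w) = 0%R by apply/eqP/negPn/negP => w0; apply: ng.
  by rewrite mul0r mul0e.
rewrite (cond hPsi) /stop_mean; apply: eq_integral => w _.
rewrite /Psi/= ge0_integralZl_EFin//.
- by rewrite EFinM muleA.
- exact: (measurableT_comp mst (measurable_pair1 (hst k w))).
- by rewrite mulr_ge0// path_weight_ge0.
Qed.

End reward.

End verification.

(** * The criterion as a sum over the jumps *)

Lemma measurable_entry_eq d0 d (X0 : measurableType d0) (Y : measurableType d) (y : Y) k :
  measurable [set y] -> measurable [set w : X0 * seqs Y | w.2 k = y].
Proof. exact: (measurable_preimageT (@measurable_path_entry _ _ X0 Y k)). Qed.

Section paths.
Context (R : realType) (S : ptopologicalType).
Implicit Type w : path_space R S.

Lemma measurable_alive k : measurable [set w : path_space R S | alive k w].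
Proof. exact (@measurable_undead _ _ (borel S) (step R S) (None : step R S) (@measurable_None R S) k). Qed.

Lemma alive0 : [set w : path_space R S | alive 0 w] = setT.
Proof. by apply/seteqP; split. Qed.

Lemma aliveS k w : alive k.+1 w <-> alive k w /\ entry w k <> None.
Proof.
split=> [h|[h e] i]; first by split=> [i ik|]; apply: h => //; exact: ltnW.
by rewrite ltnS leq_eqVlt => /orP[/eqP->|/h].
Qed.

Lemma measurable_entry k : measurable_fun setT (fun w : path_space R S => w.2 k : step R S).
Proof. exact: (@measurable_path_entry _ _ (borel S) (step R S) k). Qed.

Lemma hist_of_succ k w q : entry w k = Some q -> hist_of k.+1 w = extend (hist_of k w) q.
Proof.
move=> e; congr (_, _); apply: eq_from_tnth => i; rewrite tnth_mktuple (tnth_nth q)/= nth_rcons size_map size_enum_ord.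
case: ltnP => ik; first by rewrite -[in LHS](_ : nat_of_ord (Ordinal ik) = i)// -(tnth_nth q (hist_of k w).2 (Ordinal ik)) tnth_mktuple.
have ii : i = k :> nat by apply/anti_leq; rewrite ik -ltnS ltn_ord.
by rewrite ii eqxx e.
Qed.

Lemma sojourn_gt0 w : (forall k, entry w k = None -> entry w k.+1 = None) ->
  (forall j, alive j w -> forall q, entry w j = Some q -> (0 < q.1)%R) -> forall j, 0 < sojourn w j.
Proof.
move=> dead gap j; rewrite /sojourn; case e: (entry w j) => [q|]; last exact: ltry.
rewrite lte_fin; apply: (gap j _ q e) => i ij ei.
have : forall n, entry w (i + n) = None by elim=> [|n IH]; rewrite ?addn0// addnS; exact: dead.
by move=> /(_ (j - i)%N); rewrite subnKC ?(ltnW ij)// e.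
Qed.

End paths.

Section trajectory.
Context (R : realType) (S : ptopologicalType).
Variable w : path_space R S.
Hypothesis pos : forall j, 0 < sojourn w j.

Lemma jump_time_succ j : jump_time w j.+1 = jump_time w j + sojourn w j.
Proof. by rewrite /jump_time big_ord_recr. Qed.

Lemma jump_time_le i j : (i <= j)%N -> jump_time w i <= jump_time w j.
Proof.
move=> /subnK <-; elim: (j - i)%N => [|n IH] //.
by rewrite addSn jump_time_succ (le_trans IH)// leeDl// ltW.
Qed.

Lemma jump_time_hist k : alive k w -> jump_time w k = (hist_time (hist_of k w))%:E.
Proof.
move=> ak; rewrite /jump_time /hist_time -sumEFin; apply: eq_bigr => i _.
rewrite tnth_mktuple /sojourn; case e: (entry w i) => [q|]//=.
by exfalso; exact: (ak i (ltn_ord i)).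
Qed.

Lemma state_atE j t : jump_time w j <= t%:E -> t%:E < jump_time w j.+1 ->
  state_at w t = Some (last_state (hist_of j w)).
Proof.
move=> h1 h2; rewrite /state_at; set N := [set k | _].
have Nj : N j by rewrite /N/= h1.
rewrite asboolT; last by exists j.
have /andP[k1 k2] : N (xget 0%N N) by apply: xgetPex; exists j.
congr (Some (last_state (hist_of _ w))); apply/eqP; rewrite eqn_leq; apply/andP; split; rewrite leqNgt; apply/negP => lt.
  by have := le_lt_trans (le_trans (jump_time_le lt) k1) h2; rewrite ltxx.
by have := le_lt_trans (le_trans (jump_time_le lt) h1) k2; rewrite ltxx.
Qed.

Lemma action_atE (X : ptopologicalType) (adm : S -> set X) (p : policy R adm) j t :
  jump_time w j < t%:E -> t%:E <= jump_time w j.+1 ->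
  action_at p w t = Some (policy_kernel p j (hist_of j w, t - hist_time (hist_of j w))%R : set (borel X) -> \bar R).
Proof.
move=> h1 h2; rewrite /action_at; set N := [set k | _].
have Nj : N j by left; rewrite h1.
have t0 : (0 < t)%R.
  by rewrite -lte_fin; apply: le_lt_trans h1; apply: le_trans (jump_time_le (leq0n j)); rewrite /jump_time big_ord0.
rewrite asboolT; last by exists j.
have [/andP[k1 k2]|[t00]] : N (xget 0%N N) by apply: xgetPex; exists j.
  suff -> : xget 0%N N = j by [].
  apply/eqP; rewrite eqn_leq; apply/andP; split; rewrite leqNgt; apply/negP => lt.
    by have := lt_le_trans k1 (le_trans h2 (jump_time_le lt)); rewrite ltxx.
  by have := lt_le_trans h1 (le_trans k2 (jump_time_le lt)); rewrite ltxx.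
by move: t0; rewrite t00 ltxx.
Qed.

End trajectory.

Section criterion.
Context (R : realType) (S A B : ptopologicalType) (G : game R S A B)
  (V0 V1 : S -> R) (rho0 L0 M0 rho1 b1 M1 : R).
Hypothesis H : growth G V0 V1 rho0 L0 M0 rho1 b1 M1.
Variables (p1 : policy1 G) (p2 : policy2 G).
Notation payoff_bound := (payoff_bound V0 M0).
Notation SAB := (borel S * borel A * borel B)%type.
Notation K := (admissible (actA G) (actB G) : set SAB).

Definition hist_payoff k (h : hist R S k) u : R :=
  fine (payoff_mix G (last_state h) (policy_kernel p1 k (h, u)) (policy_kernel p2 k (h, u))).

Definition hist_rate k (h : hist R S k) u : R := (theta G * hist_payoff h u)%R.

Section at_hist.
Variables (k : nat) (h : hist R S k) (u : R).
Let x := last_state h.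
Let phi := kprob (policy_kernel p1 k) (h, u).
Let psi := kprob (policy_kernel p2 k) (h, u).
Let phiA : phi (actA G x) = 1 := policy_adm p1 h u.
Let psiB : psi (actB G x) = 1 := policy_adm p2 h u.

Lemma hist_payoff_dbl : hist_payoff h u = dbl G x phi psi (payoff G x).
Proof. by rewrite /hist_payoff [X in fine X](payoff_mixE H phiA psiB). Qed.

Lemma payoff_mix_hist :
  payoff_mix G x (policy_kernel p1 k (h, u)) (policy_kernel p2 k (h, u)) = (hist_payoff h u)%:E.
Proof. by rewrite hist_payoff_dbl; exact: (payoff_mixE H phiA psiB). Qed.

Lemma hist_payoff_le : (`|hist_payoff h u| <= payoff_bound x)%R.
Proof.
have tp := tame_payoff H x; rewrite hist_payoff_dbl ler_norml; apply/andP; split.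
  rewrite -(dbl_cst phiA psiB (- payoff_bound x)); apply: dbl_le => //; first exact: tame_cst.
  by move=> a b Aa Bb; have := A1_payoff H Aa Bb; rewrite ler_norml => /andP[].
rewrite -(dbl_cst phiA psiB (payoff_bound x)); apply: dbl_le => //; first exact: tame_cst.
by move=> a b Aa Bb; have := A1_payoff H Aa Bb; rewrite ler_norml => /andP[].
Qed.

Lemma hist_rate_le : (`|hist_rate h u| <= theta G * payoff_bound x)%R.
Proof.
by rewrite normrM (ger0_norm (ltW (theta_gt0 G))) ler_wpM2l ?(ltW (theta_gt0 G))// hist_payoff_le.
Qed.

End at_hist.

Let mpb : measurable_fun setT (payoff_bound : borel S -> R).
Proof.
apply: measurable_funD => //; apply: measurable_funM => //.
by apply: (measurableT_comp (continuous_measurable_fun (@sqrt_continuous R))); apply: (measurableT_comp (@measurable_ln R)); exact: mV0 H.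
Qed.

(** The payoff shifted by its bound is nonnegative on the admissible triples, and it is cut off
    elsewhere, where the payoff is unconstrained. The shift is subtracted once the measurability of
    the iterated integrals is obtained. *)
Let posK : SAB -> \bar R := (fun z => (payoff G z.1.1 z.1.2 z.2 + payoff_bound z.1.1)%:E) \_ K.

Let mposK : measurable_fun setT posK.
Proof.
apply/(measurable_restrictT _ (measurable_admissible G)); apply/measurable_EFinP.
apply: measurable_funD; first exact: measurable_payoff.
apply: measurable_funTS; apply: (measurableT_comp mpb).
exact: (measurableT_comp measurable_fst measurable_fst).
Qed.

Let posK_ge0 z : 0 <= posK z.
Proof.
rewrite /posK patchE; case: ifP => // /set_mem[Aa Bb]; rewrite lee_fin.
by have := A1_payoff H Aa Bb; rewrite ler_norml => /andP[h _]; rewrite -lerBlDr sub0r.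
Qed.

Lemma measurable_hist_rate k : measurable_fun setT (fun p : hist R S k * R => hist_rate p.1 p.2).
Proof.
apply: measurable_funM => //.
pose W := (hist R S k * R)%type.
have mfw : measurable_fun setT (fun p : W * borel A * borel B => (last_state p.1.1.1, p.1.2, p.2) : SAB).
  apply: measurable_fun_pair => //; apply: measurable_fun_pair.
    apply: (measurableT_comp (@measurable_last_state _ _ k)).
    exact: (measurableT_comp measurable_fst (measurableT_comp measurable_fst measurable_fst)).
  exact: (measurableT_comp measurable_snd measurable_fst).
pose k2 := kpre (policy_kernel p2 k) (@measurable_fst _ _ W (borel A)).
pose I2 (w : W) (a : borel A) := \int[k2 (w, a)]_b posK (last_state w.1, a, b).
have mI2 : measurable_fun setT (fun p : W * borel A => I2 p.1 p.2).
  rewrite (_ : (fun p => I2 p.1 p.2) = fun p => \int[k2 p]_b posK (last_state p.1.1, p.2, b)); last by apply/funext => -[w a].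
  exact: (measurable_integral k2 (f := fun p b => posK (last_state p.1.1, p.2, b)) (measurableT_comp mposK mfw)).
have I20 w a : 0 <= I2 w a by apply: integral_ge0 => b _; exact: posK_ge0.
have mI1 := measurable_integral (policy_kernel p1 k) (f := I2) mI2 I20.
rewrite (_ : (fun _ => _) = fun w : W => (fine (\int[policy_kernel p1 k w]_a I2 w a) - payoff_bound (last_state w.1))%R).
  apply: measurable_funB; first exact: (measurableT_comp (fine_measurable measurableT) mI1).
  exact: (measurableT_comp mpb (measurableT_comp (@measurable_last_state _ _ k) measurable_fst)).
apply/funext => -[h u] /=; rewrite hist_payoff_dbl; set x := last_state h.
pose phi := kprob (policy_kernel p1 k) (h, u); pose psi := kprob (policy_kernel p2 k) (h, u).
have phiA : phi (actA G x) = 1 := policy_adm p1 h u.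
have psiB : psi (actB G x) = 1 := policy_adm p2 h u.
have tp := tame_payoff H x; have tc := tame_cst G x (payoff_bound x : R).
have tD := tameD 1 tp tc.
have -> : \int[policy_kernel p1 k (h, u)]_a I2 (h, u) a =
    (dbl G x phi psi (fun a b => payoff G x a b + 1 * payoff_bound x)%R)%:E.
  rewrite -(iterated phiA psiB tD).1 [RHS]integral_mkcond; apply: eq_integral => a _.
  rewrite patchE; case: ifPn => [/set_mem Aa|nA]; last first.
    rewrite /I2 integral0_eq// => b _; rewrite /posK patchE memNset// => -[Aa _].
    by move/negP: nA; apply; rewrite inE.
  rewrite [RHS]integral_mkcond; apply: eq_integral => b _; rewrite /posK !patchE mul1r.
  case: ifPn => [/set_mem[_ Bb]|nK]; first by rewrite mem_set.
  by rewrite memNset// => Bb; move/negP: nK; apply; rewrite inE.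
by rewrite /= (dblD phiA psiB _ tp tc) (dbl_cst phiA psiB) mul1r addrK.
Qed.

Variables (tau : R) (x : S).
Hypothesis tau0 : (0 <= tau)%R.
Notation wt := (path_weight tau hist_rate).
Notation L h := (tau - hist_time h)%R.

Let mpay k (h : hist R S k) : measurable_fun setT (hist_payoff h).
Proof.
rewrite (_ : hist_payoff h = fun u => (theta G)^-1 * hist_rate h u)%R.
  apply: measurable_funM => //.
  exact: (measurableT_comp (@measurable_hist_rate k) (measurable_pair1 h)).
by apply/funext => u; rewrite /hist_rate mulKf// gt_eqF// theta_gt0.
Qed.

Let discountE k (h : hist R S k) u : discount hist_rate h u = expR (theta G * prim (hist_payoff h) u).
Proof.
rewrite /discount /prim RintegralZl//.
exact: (prim_integrable (mpay h) (hist_payoff_le h)).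
Qed.

Section along.
Variable w : path_space R S.
Hypothesis pos : forall j, 0 < sojourn w j.

Let pay_at j t : alive j w -> (hist_time (hist_of j w) < t)%R -> t%:E < jump_time w j.+1 ->
  payoff_at p1 p2 w t = (hist_payoff (hist_of j w) (t - hist_time (hist_of j w)))%:E.
Proof.
move=> aj h1 h2; have h1' : jump_time w j < t%:E by rewrite jump_time_hist.
rewrite /payoff_at (state_atE pos (ltW h1') h2) !(action_atE pos _ h1' (ltW h2)).
exact: payoff_mix_hist.
Qed.

(** The weight of a history is the exponential of the payoff accumulated along the path.
    Measurability of the payoff on the elapsed interval is part of the induction because it is known
    on one sojourn at a time. *)
Lemma payoff_prefix k : alive k w -> wt (hist_of k w) != 0%R ->
  exists a : R, [/\ measurable_fun `[0%R, hist_time (hist_of k w)] (payoff_at p1 p2 w),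
    \int[lebesgue_measure]_(t in `[0%R, hist_time (hist_of k w)]) payoff_at p1 p2 w t = a%:E &
    wt (hist_of k w) = expR (theta G * a)].
Proof.
elim: k => [|k IH] ak wk.
  exists 0%R; rewrite /hist_time big_ord0 set_itv1 integral_set1 mulr0 expR0; split=> //.
  exact: measurable_fun_set1.
case e: (entry w k) => [q|]; last by exfalso; exact: (ak k (ltnSn k)).
have ak' : alive k w by move=> i ik; exact: ak (ltnW ik).
move: wk; rewrite (hist_of_succ e) path_weight_extend mulf_eq0 negb_or => /andP[wk].
rewrite /weight time_extend; case: ifP; last by rewrite eqxx.
move=> /andP[q0 qL] _; have [a [mF aE wE]] := IH ak' wk.
have /andP[T0 _] := weight_time tau0 wk.
have Fr t : (hist_time (hist_of k w) < t)%R -> (t < hist_time (hist_of k w) + q.1)%R ->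
    payoff_at p1 p2 w t = (hist_payoff (hist_of k w) (t - hist_time (hist_of k w)))%:E.
  by move=> h1 h2; apply: pay_at => //; rewrite jump_time_succ jump_time_hist// /sojourn e -EFinD lte_fin.
have [m1 i1] := integral_extend T0 (ltW q0) (mpay (hist_of k w)) (hist_payoff_le (hist_of k w)) mF aE Fr.
by exists (a + prim (hist_payoff (hist_of k w)) q.1)%R; split=> //; rewrite wE discountE -expRD mulrDr.
Qed.

Lemma reward_good k : alive k w -> wt (hist_of k w) != 0%R -> stays tau (hist_of k w) (w.2 k : step R S) ->
  expeR ((theta G)%:E * (\int[lebesgue_measure]_(s in `[0%R, tau]) payoff_at p1 p2 w s)
           + (theta G)%:E * terminal_at G w tau) =
  (wt (hist_of k w) * (discount hist_rate (hist_of k w) (L (hist_of k w)) *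
    expR (theta G * terminal G (last_state (hist_of k w)))))%:E.
Proof.
move=> ak wk st; have [a [mF aE wE]] := payoff_prefix ak wk.
have /andP[T0 Tt] := weight_time tau0 wk; set h := hist_of k w in aE wE mF T0 Tt st *.
have tl : tau%:E < jump_time w k.+1.
  rewrite jump_time_succ jump_time_hist//; move: st; rewrite /stays /sojourn /entry.
  case: (w.2 k) => [q|] st; last by rewrite addey ?ltry.
  by rewrite -EFinD lte_fin -ltrBlDl.
have L_0 : (0 <= L h)%R by rewrite subr_ge0.
have Fr t : (hist_time h < t)%R -> (t < hist_time h + L h)%R ->
    payoff_at p1 p2 w t = (hist_payoff h (t - hist_time h))%:E.
  move=> h1 h2; apply: pay_at => //; apply: le_lt_trans tl; rewrite lee_fin ltW//.
  by move: h2; rewrite addrC subrK.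
have [m1 i1] := integral_extend T0 L_0 (mpay h) (hist_payoff_le h) mF aE Fr.
rewrite addrC subrK in i1.
have h1 : jump_time w k <= tau%:E by rewrite jump_time_hist// lee_fin.
rewrite i1 /terminal_at (state_atE pos h1 tl) -!EFinM -EFinD /= wE discountE -!expRD.
by congr (expR _)%:E; rewrite -/h; lra.
Qed.

End along.

Notation P := (path_law p1 p2 x).
Notation live := (fun k => [set w : path_space R S | alive k w]).
Notation hst := (fun k (w : path_space R S) => hist_of k w).
Notation nxt := (fun k (w : path_space R S) => w.2 k : step R S).
Notation N := (next_kernel H p1 p2).

Lemma next_gap k (h : hist R S k) :
  \int[N k h]_z (if z is Some q then ((q.1 <= 0)%R : nat)%:R%:E else 0) = 0.
Proof.
rewrite integral_next; last first.
  split=> [|[q|]//].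
  apply: (measurable_step (f := fun z : step R S => if z is Some q then ((q.1 <= 0)%R : nat)%:R%:E else 0)) => /=.
  apply/measurable_EFinP; rewrite (_ : (fun _ => _) = \1_[set q : R * borel S | (q.1 <= 0)%R]); last first.
    by apply/funext => q; rewrite indicE; congr (nat_of_bool _)%:R; apply/idP/idP; rewrite inE.
  apply: measurable_indic; have := measurable_preimageT (@measurable_fst _ _ R (borel S)) (measurable_itv `]-oo, 0%R]).
  by congr measurable; apply/seteqP; split=> p /=; rewrite in_itv.
rewrite mule0 adde0 /jump_int integral0_eq// => u; rewrite /= in_itv/= andbT => u0.
by rewrite integral0_eq// => y _; rewrite leNgt u0 mule0.
Qed.

Lemma next_stays k (h : hist R S k) : (0 <= L h)%R ->
  \int[N k h]_z (stays tau h z : nat)%:R%:E =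
  (survival (@last_state _ _ k) (hist_clock V0 L0 (k := k)) (hist_mix H p1 p2 k) h (L h))%:E.
Proof.
move=> L_0; have sS := standard_borel_space (borelS G).
have mst : measurable_fun setT (fun z : step R S => (stays tau h z : nat)%:R%:E : \bar R).
  apply/measurable_EFinP; rewrite (_ : (fun _ => _) = \1_[set z : step R S | stays tau h z]); last first.
    by apply/funext => p; rewrite indicE; congr (nat_of_bool _)%:R; apply/idP/idP; rewrite inE.
  apply: measurable_indic; have := measurable_preimageT (measurableT_comp (@measurable_stays _ _ tau k) (measurable_pair1 h)) (I : measurable [set true]).
  by [].
have mns : measurable_fun setT (fun z : step R S => (~~ stays tau h z : nat)%:R%:E : \bar R).
  rewrite (_ : (fun _ => _) = fun z : step R S => 1 - (stays tau h z : nat)%:R%:E); last first.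
    by apply/funext => z; case: (stays _ _ _); rewrite /= ?subee// sube0.
  exact: emeasurable_funB.
have tot : \int[N k h]_z (stays tau h z : nat)%:R%:E + \int[N k h]_z (~~ stays tau h z : nat)%:R%:E = 1.
  rewrite -ge0_integralD//; try by move=> z _; rewrite lee_fin.
  rewrite -[RHS](@prob_kernel _ _ _ _ _ (N k) h) -[RHS]mul1e -integral_cst//; apply: eq_integral => z _.
  by case: (stays _ _ _); rewrite /= ?adde0 ?add0e.
have : \int[N k h]_z (~~ stays tau h z : nat)%:R%:E =
    (1 - survival (@last_state _ _ k) (hist_clock V0 L0 (k := k)) (hist_mix H p1 p2 k) h (L h))%:E.
  rewrite integral_next; last by split=> // z; rewrite lee_fin.
  rewrite mule0 adde0 -(jump_mass (hist_mix H p1 p2 k) (@measurable_last_state _ _ k) (measurable_hist_clock H (k := k)) (hist_clock_ge0 H (k := k)) sS h L_0).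
  congr jump_int; apply/funext => u; apply/funext => y; rewrite /stays/= -leNgt indicE; congr ((nat_of_bool _)%:R%:E).
  by apply/idP/idP; rewrite inE/= in_itv.
move=> e; move: tot; rewrite e => /eqP; rewrite eq_sym -sube_eq//; first by move=> /eqP <-; rewrite -EFinB subKr.
by rewrite fin_num_adde_defl.
Qed.

(** Almost surely the path has finitely many jumps by [tau]. The sum is over their number, the
    survival factor being the conditional probability that the current sojourn outlasts the
    horizon. *)
Lemma criterion_sum : P.-negligible (explode live hst tau hist_rate) ->
  criterion_upto p1 p2 tau x = \sum_(k <oo) stop_mean P live hst tau hist_rate
    (fun k h => (discount hist_rate h (L h) * expR (theta G * terminal G (last_state h)) *
       survival (@last_state _ _ k) (hist_clock V0 L0 (k := k)) (hist_mix H p1 p2 k) h (L h))%:E) k.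
Proof.
move=> nE; pose Bad := \bigcup_k [set w : path_space R S | entry w k = None /\ entry w k.+1 <> None].
have [_ _ lawN] := path_lawP H p1 p2 x.
have mE k : measurable [set w : path_space R S | entry w k = None].
  exact (@measurable_entry_eq _ _ (borel S) (step R S) (None : step R S) k (@measurable_None R S)).
have nB : P.-negligible Bad.
  apply: negligible_bigcup => k; exists ([set w : path_space R S | entry w k = None] `&` ~` [set w | entry w k.+1 = None]).
  split; [exact (measurableI _ _ (mE k) (measurableC (mE k.+1)))|exact: lawN|by []].
have mrew k : measurable_fun setT (fun h : hist R S k => discount hist_rate h (L h) * expR (theta G * terminal G (last_state h)))%R.
  apply: measurable_funM.
    have mL : measurable_fun setT (fun h : hist R S k => L h) by apply: measurable_funB => //; exact: measurable_hist_time.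
    exact: (measurableT_comp (measurable_discount measurable_hist_rate (k := k)) (measurable_fun_pair (@measurable_id _ _ _) mL)).
  apply: (measurableT_comp (@measurable_expR R)); apply: measurable_funM => //.
  exact: (measurableT_comp (measurable_terminal G) (@measurable_last_state _ _ k)).
have XE k (w : path_space R S) : ~ Bad w -> (forall j, alive j w -> forall q, entry w j = Some q -> (0 < q.1)%R) ->
    good live hst nxt tau hist_rate k w ->
    expeR ((theta G)%:E * (\int[lebesgue_measure]_(s in `[0%R, tau]) payoff_at p1 p2 w s)
           + (theta G)%:E * terminal_at G w tau) = (wt (hist_of k w) *
      (discount hist_rate (hist_of k w) (L (hist_of k w)) * expR (theta G * terminal G (last_state (hist_of k w)))))%:E.
  move=> nBw gap [ak wk st]; apply: reward_good => //; apply: sojourn_gt0 => // j ej.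
  by apply: contrapT => ej1; apply: nBw; exists j.
have rew0 k (h : hist R S k) : (0 <= discount hist_rate h (L h) * expR (theta G * terminal G (last_state h)))%R.
  by rewrite mulr_ge0 ?expR_ge0.
have := integral_reward (P := P) (N := N) (@measurable_alive R S) (@measurable_hist_of R S) (alive0 R S) (@aliveS R S) (@hist_of_succ R S)
  (path_law_next H p1 p2 x) measurable_hist_rate (@measurable_entry R S) next_gap (fun w => expeR_ge0 _) mrew rew0 nB nE XE.
move=> e; apply: (etrans e); apply: eq_eseriesr => k _; apply: eq_integral => w _.
have [->|wk] := eqVneq (wt (hist_of k w)) 0%R; first by rewrite !mul0e.
by have /andP[_ Tt] := weight_time tau0 wk; rewrite next_stays ?subr_ge0// -EFinM.
Qed.

End criterion.

(** * Comparison with the criterion *)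

Section shift.
Context (R : realType).
Local Open Scope ring_scope.

Lemma ac_shift (f : R -> R) (s L T : R) : 0 <= s -> s + L <= T ->
  absolutely_continuous 0%R T f -> absolutely_continuous 0%R L (fun u => f (s + u)%R).
Proof.
move=> s0 sL acf e e0; have [d d0 dP] := acf e e0; exists d => // n l r lr dis sm.
apply: (dP n (fun i => s + l i) (fun i => s + r i)).
- move=> i; have [l0 lr_ rL] := lr i; split; [exact: addr_ge0|by rewrite lerD2l|].
  by apply: le_trans sL; rewrite lerD2l.
- by move=> i j /dis[h|h]; [left|right]; rewrite lerD2l.
- by apply: le_lt_trans sm; apply: ler_sum => i _; rewrite opprD addrACA subrr add0r.
Qed.

Lemma derive_shift (f : R -> R) (s u : R) : derivable f (s + u)%R 1 ->
  derivable (fun v => f (s + v)) u 1 /\ derive1 (fun v => f (s + v)) u = derive1 f (s + u)%R.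
Proof.
move=> df; have d1 : is_derive u (1 : R) (fun v => s + v) 1.
  by have := is_deriveD (is_derive_cst s u (1 : R)) (is_derive_id u (1 : R)); rewrite add0r.
have d2 : is_derive (s + u)%R (1 : R) f (derive1 f (s + u)%R) by rewrite derive1E; exact: derivableP.
have d3 := is_derive1_comp (f := f) (g := fun v => s + v) d2 d1.
have d4 : is_derive u (1 : R) (fun v => f (s + v)) (derive1 f (s + u)%R).
  by apply: (is_derive_eq d3); rewrite mulr1.
by split; [have [] := d4|rewrite derive1E; exact: derive_val].
Qed.

Lemma null_shift (E : set R) (s L T : R) : 0 <= s -> s + L <= T -> measurable E ->
  lebesgue_measure (`[0, T] `\` E) = 0%E ->
  measurable [set u | E (s + u)%R] /\ lebesgue_measure (`[0, L] `\` [set u | E (s + u)%R]) = 0%E.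
Proof.
move=> s0 sL mE E0; have ms : measurable_fun setT ((fun u => s + u)%R : R -> R) by exact: measurable_funD.
have mE' : measurable [set u | E (s + u)%R] by exact: (measurable_preimageT ms mE).
split=> //; have mD : measurable (`[0, T] `\` E) by apply: measurableD.
apply/le_anti/andP; split; last exact: measure_ge0.
rewrite -E0 -(lebesgue_shift s mD); apply: le_measure; rewrite ?inE.
- by apply: measurableD.
- exact: (measurable_preimageT ms mD).
move=> u [/=]; rewrite !in_itv/= => /andP[u0 uL] nE; split=> //=.
by rewrite addr_ge0//= (le_trans _ sL)// lerD2l.
Qed.

End shift.

Section comparison.
Context (R : realType) (S A B : ptopologicalType) (G : game R S A B)
  (V0 V1 : S -> R) (rho0 L0 M0 rho1 b1 M1 : R).
Hypothesis H : growth G V0 V1 rho0 L0 M0 rho1 b1 M1.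
Variables (p1 : policy1 G) (p2 : policy2 G) (x : S) (t0 : R).
Hypotheses (t00 : (0 <= t0)%R) (t0T : (t0 <= horizon G)%R).
Notation payoff_bound := (payoff_bound V0 M0).
Notation T := (horizon G).
Notation tau := (T - t0)%R.
Notation hist_clock := (hist_clock V0 L0).
Notation P := (path_law p1 p2 x).
Notation live := (fun k => [set w : path_space R S | alive k w]).
Notation hst := (fun k (w : path_space R S) => hist_of k w).
Notation N := (next_kernel H p1 p2).
Notation surv h := (survival (@last_state _ _ _) (@hist_clock _) (hist_mix H p1 p2 _) h (tau - hist_time h)%R).
Notation m k h u := (hist_mix H p1 p2 k (h, u)).

Let tau0 : (0 <= tau)%R. Proof. by rewrite subr_ge0. Qed.

(** Its square root dominates [V0 ^ 2]. As the exponent of the barrier starts at 1/2, so does the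
    potential [W], which is enough to pay a visit of weight [V0] at an exit rate up to [L0 * V0]. *)
Let V y : R := ((M1 + 1) * V1 y) ^+ 2.
Let kV : R := rho1 + b1.

Let V_root y : (V0 y ^+ 2 <= (M1 + 1) * V1 y)%R.
Proof. by have := A2_weight H y; have := V1_gt0 H y; rewrite mulrDl mul1r; lra. Qed.

Let V0_le_sqr y : (V0 y <= V0 y ^+ 2)%R.
Proof. by have := V0_ge1 H y; rewrite expr2; nra. Qed.

Let V_ge y : (V0 y <= V y)%R.
Proof.
apply: le_trans (V0_le_sqr y) _; apply: le_trans (V_root y) _; have := V0_ge1 H y; have := V_root y; have := V0_le_sqr y.
by rewrite /V [in leRHS]expr2; move: ((M1 + 1) * V1 y)%R => q h1 h2 h3; nra.
Qed.

Let k0 : (0 <= kV)%R. Proof. by rewrite addr_ge0// ltW ?(rho1_gt0 H)// (b1_gt0 H). Qed.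

Let lV : lyapunov H V kV.
Proof.
split=> //; first by apply: measurable_funX; apply: measurable_funM => //; exact: mV1 H.
move=> y a b Aa Bb; have [iV hV] := integrable_V1 H Aa Bb.
have VE : V = (fun z => (M1 + 1) ^+ 2 * V1 z ^+ 2)%R by apply/funext => z; rewrite /V exprMn.
have iZ := integrableZl measurableT ((M1 + 1) ^+ 2)%R iV.
split; first by rewrite VE; exact: iZ.
have -> : mean H V (y, a, b) = ((M1 + 1) ^+ 2 * mean H (fun z => V1 z ^+ 2) (y, a, b))%R.
  by rewrite VE /mean RintegralZl.
rewrite VE -mulrBr mulrCA; have c0 : (0 <= (M1 + 1) ^+ 2)%R by rewrite sqr_ge0.
apply: le_trans (ler_wpM2l c0 hV) _; rewrite [leRHS]mulrCA; apply: ler_wpM2l => //; rewrite /kV mulrDl lerD2l.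
by rewrite ler_peMr ?(ltW (b1_gt0 H))// exprn_ege1// (V1_ge1 H).
Qed.

(** The surplus [rho0 + L0] over the drift [kV] of [V] covers the extra visit: [rho0 * V0] for the
    drift of [V0], and at most [L0 * V0 ^ 2] for the exit rate times [V0]. *)
Let kV' : R := kV + (rho0 + L0).

Let lV' : lyapunov H V kV'.
Proof.
have [h1 h2 _ h4] := lV; have e : (kV <= kV')%R by rewrite lerDl addr_ge0// ltW ?(rho0_gt0 H)// (L0_gt0 H).
split=> //; first exact: le_trans k0 e.
move=> y a b Aa Bb; have [i h] := h4 y a b Aa Bb; split=> //; apply: le_trans h _.
by rewrite ler_wpM2r// (le_trans _ (V_ge y))// ltW// (V0_gt0 H).
Qed.

Let c : R := theta G * M0 + kV' + T * theta G ^+ 2 / 2.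

Let c0 : (0 <= c)%R.
Proof.
have [_ _ h _] := lV'; apply: addr_ge0; first apply: addr_ge0 => //.
  by rewrite mulr_ge0 ?(ltW (theta_gt0 G))// ltW// (M0_gt0 H).
by rewrite divr_ge0// mulr_ge0 ?sqr_ge0// ltW// (horizon_gt0 G).
Qed.

Let W (t : R) y := barrier G V c (clamp T (tau - t)%R) y.

Let cl t : (0 <= clamp T (tau - t)%R <= T)%R. Proof. exact: clamp_itv (ltW (horizon_gt0 G)). Qed.

Let W_ge t y : (V0 y ^+ 2 <= W t y)%R.
Proof.
have /andP[u0 uT] := cl t; apply: le_trans (barrier_ge lV u0 uT y c0).
have q0 : (0 < (M1 + 1) * V1 y)%R by rewrite mulr_gt0 ?(V1_gt0 H)// addr_gt0 ?(M1_gt0 H).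
have -> : ln (V y) = (ln ((M1 + 1) * V1 y) *+ 2)%R by rewrite /V expr2 lnM ?posrE// mulr2n.
rewrite -[(ln _ *+ 2)%R]mulr_natl mulrA mulVf ?pnatr_eq0// mul1r lnK ?posrE//.
Qed.

Let nW : nneg_fun W.
Proof.
split=> [|t y]; last exact: expR_ge0.
apply: (measurable_barrier c lV); last exact: measurable_snd.
apply: (measurableT_comp (@measurable_clamp R T)); exact: measurable_funB.
Qed.

Let nV0 : nneg_fun (fun (_ : R) => V0).
Proof.
split=> [|t y]; last exact: ltW (V0_gt0 H y).
by apply: (measurableT_comp (mV0 H)); exact: measurable_snd.
Qed.

Let mixE k (h : hist R S k) u U kU : lyapunov H U kU -> (m k h u).-integrable setT (EFin \o U) /\
  (hist_clock h * (fine (\int[m k h u]_y (U y)%:E) - U (last_state h)) <= kU * U (last_state h))%R.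
Proof.
exact: (@mixture_lyapunov R S A B G V0 V1 rho0 L0 M0 rho1 b1 M1 H (last_state h) (kprob (policy_kernel p1 k) (h, u))
  (kprob (policy_kernel p2 k) (h, u)) (policy_adm p1 h u) (policy_adm p2 h u) (m k h u) (hist_mixE H p1 p2 h u) U kU).
Qed.

Let W_dominated t : dominated V (W t) (expR (c * T)%R).
Proof.
split=> [|y]; first by exact: (measurableT_comp nW.1 (measurable_pair1 t)).
have /andP[u0 uT] := cl t; rewrite ger0_norm ?expR_ge0//; apply: le_trans (barrier_le c lV u0 uT y) _.
by apply: ler_wpM2r; [rewrite (le_trans _ (V_ge y))// ltW// (V0_gt0 H)|rewrite ler_expR ler_wpM2l].
Qed.

Let W_mean k (h : hist R S k) u t :
  (hist_clock h * (fine (\int[m k h u]_y (W t y)%:E) - W t (last_state h)) <= kV * W t (last_state h))%R.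
Proof.
have /andP[u0 uT] := cl t; have [iV _] := mixE h u lV; have iW := integrable_dominated iV (W_dominated t).
have ck := clock_gt0 H (last_state h); rewrite -ler_pdivlMl// lerBlDl -lee_fin fineK; last exact: integrable_fin_num.
apply: (@mixture_le R S A B G V0 V1 rho0 L0 M0 rho1 b1 M1 H (last_state h) (kprob (policy_kernel p1 k) (h, u))
  (kprob (policy_kernel p2 k) (h, u)) (policy_adm p1 h u) (policy_adm p2 h u) (m k h u) (hist_mixE H p1 p2 h u)).
- by apply/measurable_EFinP; have [] := W_dominated t.
- by move=> y; rewrite lee_fin expR_ge0.
- by move=> a b Aa Bb; exact: (barrier_mean c lV u0 uT Aa Bb).
Qed.

Section rate.
Variable rho : forall k, hist R S k -> R -> R.
Hypothesis mrho : forall k, measurable_fun setT (fun p : hist R S k * R => rho p.1 p.2).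
Hypothesis rho_le : forall k (h : hist R S k) u, (`|rho h u| <= theta G * payoff_bound (last_state h))%R.

Lemma potential_step k (h : hist R S k) : (0 <= hist_time h <= tau)%R ->
  \int[N k h]_z run tau rho (fun t y => W t y + V0 y)%R h z <= (at_hist W h)%:E.
Proof.
move=> /andP[T0 Tt]; set y := last_state h; set L := (tau - hist_time h)%R.
have L_ge0 : (0 <= L)%R by rewrite subr_ge0.
(* During a sojourn the state is fixed and the time to go decreases from [L], so the barrier is the
   exponential of an affine function of slope [b]. *)
pose b := (- (c + (2 * T)^-1 * ln (V y)))%R; pose a := (c * L + (2^-1 + L / (2 * T)) * ln (V y))%R.
pose phi (u : R) : R := expR (a + b * u)%R.
have phiE u : phi u = barrier G V c (L - u)%R y.
  by rewrite /phi /a /b /barrier -/(L) [(L / _)%R]mulrC [((L - u) / _)%R]mulrC; congr expR; move: (ln _) (2 * T)^-1%R => l q; ring.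
have dphi (u : R) : is_derive u (1%R : R) phi (b * phi u)%R.
  have d1 : is_derive u (1%R : R) (fun v : R => a + b * v)%R b.
    have d0 : is_derive u (1%R : R) (b \*: (@id R))%R (b *: (1%R : R))%R by apply: is_deriveZ.
    have d := is_deriveD (is_derive_cst a u 1%R) d0; rewrite add0r /GRing.scale/= mulr1 in d.
    exact: d.
  have := is_derive1_comp (f := expR) (g := fun v : R => (a + b * v)%R) (is_derive_expR _) d1.
  by move=> /= dd; apply: is_derive_eq; rewrite mulrC.
have V_0 : (0 <= V y)%R by rewrite (le_trans _ (V_ge y))// ltW// (V0_gt0 H).
have key := barrier_rate lV' (lexx c) y.
have b0 : (b <= 0)%R.
  rewrite /b oppr_le0 addr_ge0// mulr_ge0 ?(ln_lyapunov_ge0 lV)// invr_ge0 mulr_ge0// ltW//; exact: horizon_gt0.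
have phi_le u : (0 <= u)%R -> (phi u <= expR a)%R.
  by move=> u0; rewrite ler_expR gerDl mulr_le0_ge0.
have acp : absolutely_continuous 0%R L phi.
  have acc : absolutely_continuous 0%R L (cst (0%R : R)) := ac_cst _ _ _.
  apply: (ac_dominated (C := 0%R) (L := (expR a * `|b|)%R) acc) => //; try by rewrite mulr_ge0 ?expR_ge0.
  move=> u v u0 uv vL; rewrite mul0r add0r; apply: le_trans (expR_lip _ _) _.
  - exact: (phi_le u).
  - by apply: (phi_le v); exact: le_trans uv.
  by rewrite opprD addrACA subrr add0r -mulrBr normrM (ger0_norm (_ : 0 <= v - u)%R) ?subr_ge0// mulrA.
have mD : measurable_fun setT (fun p : R * borel S => W p.1 p.2 + V0 p.2)%R.
  by apply: measurable_funD; [exact: nW.1|exact: nV0.1].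
have gC t z : (`|W t z + V0 z| <= (expR (c * T)%R + 1)%R * V z)%R.
  rewrite mulrDl mul1r (le_trans (ler_normD _ _))// lerD//; first by have [_] := W_dominated t.
  by rewrite ger0_norm// ltW// (V0_gt0 H).
have g0 t z : (0 <= W t z + V0 z)%R by rewrite addr_ge0 ?expR_ge0// ltW// (V0_gt0 H).
have phi0 : phi 0%R = at_hist W h by rewrite phiE subr0 /at_hist /W clamp_id// L_ge0 /L; have := t00; have := T0; lra.
have dis0 : (0 <= discount rho h L * phi L * surv h)%R by rewrite !mulr_ge0 ?expR_ge0.
rewrite -phi0; apply: le_trans (step_ge (p1 := p1) (p2 := p2) mrho rho_le lV mD gC g0 (M := expR a) (E := setT) L_ge0 acp _ measurableT _ _).
- by rewrite leeDr// lee_fin.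
- by move=> t /andP[t_0 _]; rewrite ger0_norm ?expR_ge0//; exact: phi_le.
- by rewrite setDT measure0.
move=> u _ u0 uL; split; first by have [] := dphi u.
have -> : derive1 phi u = (b * phi u)%R by rewrite derive1E; exact: derive_val.
set g := (fun z => W (hist_time h + u)%R z + V0 z)%R.
have dg : dominated V g (expR (c * T)%R + 1)%R.
  by split=> [|z]; [exact: (measurableT_comp mD (measurable_pair1 (hist_time h + u)%R))|exact: gC].
have wE : W (hist_time h + u)%R y = phi u.
  rewrite phiE /W clamp_id; first by congr barrier; rewrite /L; lra.
  by rewrite /L in uL *; have := t00; have := T0; lra.
have om := off_mean p1 p2 lV h u dg.
have [iV _] := mixE h u lV; have [iV0 hV0] := mixE h u (lyapunov_V0 H).
have iW := integrable_dominated iV (W_dominated (hist_time h + u)%R).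
have Jg : fine (\int[m k h u]_z (g z)%:E) =
    (fine (\int[m k h u]_z (W (hist_time h + u)%R z)%:E) + fine (\int[m k h u]_z (V0 z)%:E))%R.
  rewrite -fineD ?integrable_fin_num// -(integralD measurableT iW iV0).
  by congr fine; apply: eq_integral => z _.
have hW := W_mean h u (hist_time h + u)%R.
have w2 := W_ge (hist_time h + u)%R y; rewrite -/y wE in hW w2.
have gy : g y = (phi u + V0 y)%R by rewrite /g wE.
rewrite -/y gy Jg in om.
have /andP[l0 lc] := leave_bounds (hist_mix H p1 p2 k) (@measurable_last_state _ _ k) (@hist_clock_ge0 _ _ _ _ _ _ _ _ _ _ _ _ _ H k) (standard_borel_space (borelS G)) h u.
have r_le : (rho h u <= theta G * payoff_bound y)%R by apply: le_trans (ler_norm _) (rho_le h u).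
have v1 := V0_ge1 H y; have vv := V0_le_sqr y; have L00 := L0_gt0 H; have r00 := rho0_gt0 H.
have cE : hist_clock h = (L0 * V0 y)%R by [].
have p0 : (0 < phi u)%R := expR_gt0 _.
move: om hW hV0 key b0 l0 lc w2 vv r_le p0 v1; rewrite -/y /b /kV' cE !expr2.
move: (off _ _ _ _ _ _) (leave _ _ _ _ _) (fine _) (fine _) (rho h u) (phi u) (V0 y) ((2 * T)^-1 * ln (V y))%R (theta G * payoff_bound y)%R L00 r00.
move=> {gy wE Jg dg g iW iV iV0 dis0 phi0 g0 gC mD acp phi_le dphi phiE L_ge0}.
move=> O l J1 J2 r w v q tp L00 r00 om hW hV0 key b0 l0 lc w2 vv r_le p0 v1.
(* In turn: the payoff rate against its bound, the decay of the barrier against payoff, drift and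
   surplus, then the two halves of the surplus against the exit rate times [V0] and the drift of
   [V0]. *)
have e1 : ((r - tp) * w <= 0)%R by rewrite mulr_le0_ge0 ?subr_le0// ltW.
have e2 : ((tp + (kV + (rho0 + L0)) - c - q) * w <= 0)%R.
  by rewrite mulr_le0_ge0 ?(ltW p0)//; lra.
have e3 : (l * v <= L0 * w)%R.
  apply: le_trans (ler_wpM2r _ lc) _; first by lra.
  by rewrite -mulrA ler_wpM2l// ltW.
have e4 : (rho0 * v <= rho0 * w)%R by rewrite ler_wpM2l ?(ltW r00)// (le_trans vv).
move: om hW hV0 e1 e2 e3 e4; lra.
Qed.

Lemma remainder_cvg0 : state_mean P live hst tau rho (fun _ => V0) n @[n --> \oo] --> 0.
Proof.
have [start _ _] := path_lawP H p1 p2 x.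
exact: (state_mean_cvg0 (P := P) (N := N) (@measurable_alive R S) (@measurable_hist_of R S) (alive0 R S) (@aliveS R S) (@hist_of_succ R S)
  (path_law_next H p1 p2 x) (measurable_singleton x (borelS G)) start tau0 mrho nW nV0 potential_step).
Qed.

End rate.

(** Whether a weight vanishes does not depend on the payoff rate. At rate 0 the nonzero weights are
    at least 1, so that [negligible_explode] applies. *)
Lemma nonexplosion : P.-negligible (explode live hst tau (hist_rate p1 p2)).
Proof.
pose z k (_ : hist R S k) (_ : R) : R := 0%R.
have mz k : measurable_fun setT (fun p : hist R S k * R => z k p.1 p.2) by exact: measurable_cst.
have z_le k (h : hist R S k) u : (`|z k h u| <= theta G * payoff_bound (last_state h))%R.
  by rewrite normr0 mulr_ge0 ?(ltW (theta_gt0 G))// (payoff_bound_ge0 H).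
have wz rho k (h : hist R S k) : path_weight tau rho h != 0%R -> (1 <= path_weight tau z h)%R.
  elim: k h => [|k IH] h //=; rewrite mulf_eq0 negb_or => /andP[/IH h1].
  rewrite /weight; case: ifP => [_ _|]; last by rewrite eqxx.
  have -> : discount z (keep h) (gap h) = 1%R by rewrite /discount /prim Rintegral_cst// mul0r expR0.
  by rewrite mulr1.
have ng := negligible_explode (@measurable_alive R S) (@measurable_hist_of R S) mz nV0 (fun _ y => V0_ge1 H y) (@wz z) (remainder_cvg0 mz z_le).
apply: negligibleS ng => w h k; have [ak wk] := h k; split=> //.
by rewrite gt_eqF// (lt_le_trans ltr01)//; exact: wz wk.
Qed.

Section function.
Variables (f g : R -> S -> R) (C : R) (E : S -> set R).
Hypotheses (mg : measurable_fun setT (fun p : R * borel S => g p.1 p.2)) (gC : forall t y, (`|g t y| <= C * V0 y)%R).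
Hypothesis fg : forall t y, (0 <= t <= T)%R -> g t y = f t y.
Hypothesis acf : forall y, absolutely_continuous 0%R T (fun t => f t y).
Hypotheses (mE : forall y, measurable (E y)) (E0 : forall y, lebesgue_measure (`[0%R, T] `\` E y) = 0).
Hypothesis dE : forall y t, E y t -> derivable (fun s => f s y) t 1%R.
Variable term : S -> R.
Hypotheses (mterm : measurable_fun [set: borel S] term) (term0 : forall y, (0 <= term y)%R).

Notation rho := (hist_rate p1 p2).
Notation slope h u := ((derive1 (fun s => f s (last_state h)) (t0 + hist_time h + u))%:E +
  hamiltonian G (f (t0 + hist_time h + u)%R) (last_state h) (policy_kernel p1 _ (h, u)) (policy_kernel p2 _ (h, u))).

Definition stop k (h : hist R S k) : \bar R :=
  (discount rho h (tau - hist_time h)%R * term (last_state h) * surv h)%:E.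

Let mrho := measurable_hist_rate H p1 p2.
Let rho_le k (h : hist R S k) u := hist_rate_le H p1 p2 h u.

Let stop_ge0 k (h : hist R S k) : 0 <= stop h.
Proof. by rewrite lee_fin !mulr_ge0 ?expR_ge0. Qed.

Let mstop k : measurable_fun setT (@stop k).
Proof.
have mL : measurable_fun setT (fun h : hist R S k => tau - hist_time h)%R by apply: measurable_funB => //; exact: measurable_hist_time.
have mp : measurable_fun setT (fun h : hist R S k => (h, (tau - hist_time h)%R)) := measurable_fun_pair (@measurable_id _ _ _) mL.
apply/measurable_EFinP; apply: measurable_funM; first apply: measurable_funM.
- exact: (measurableT_comp (measurable_discount mrho (k := k)) mp).
- exact: (measurableT_comp mterm (@measurable_last_state _ _ k)).
- exact: (measurableT_comp (measurable_survival (hist_mix H p1 p2 k) (@measurable_last_state _ _ k) (measurable_hist_clock H (k := k)) (standard_borel_space (borelS G))) mp).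
Qed.

Let dg t : dominated V0 (g t) C.
Proof. by split; [exact: (measurableT_comp mg (measurable_pair1 t))|exact: gC]. Qed.

Section local.
Variables (k : nat) (h : hist R S k).
Hypothesis hT : (0 <= hist_time h <= tau)%R.
Let y := last_state h.
Let s := (t0 + hist_time h)%R.
Let L := (tau - hist_time h)%R.

Let s0 : (0 <= s)%R. Proof. by have /andP[? _] := hT; rewrite addr_ge0. Qed.
Let sL : (s + L = T)%R. Proof. by rewrite /s /L; lra. Qed.
Let L_ge0 : (0 <= L)%R. Proof. by have /andP[_ ?] := hT; rewrite subr_ge0. Qed.
Let in_T u : (0 <= u <= L)%R -> (0 <= s + u <= T)%R.
Proof. by have := s0; have := sL; lra. Qed.

Lemma slope_off u : (0 < u)%R -> (u < L)%R -> slope h u =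
  (derive1 (fun r => f r y) (s + u)%R + (rho h u - leave (@last_state _ _ _) (@hist_clock _) (hist_mix H p1 p2 _) h u) * f (s + u)%R y
    + off H p1 p2 (g (s + u)%R) h u)%:E.
Proof.
move=> u0 uL; have iT : (0 <= s + u <= T)%R by apply: in_T; rewrite !ltW.
have fE : f (s + u)%R = g (s + u)%R by apply/funext => z; rewrite fg.
have om := off_mean p1 p2 (lyapunov_V0 H) h u (dg (s + u)%R).
have hm := @hamiltonian_mixture R S A B G V0 V1 rho0 L0 M0 rho1 b1 M1 H (last_state h) (kprob (policy_kernel p1 k) (h, u))
  (kprob (policy_kernel p2 k) (h, u)) (policy_adm p1 h u) (policy_adm p2 h u) (m k h u) (hist_mixE H p1 p2 h u) (g (s + u)%R) C (dg (s + u)%R).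
rewrite -/s fE [hamiltonian _ _ _ _ _]hm.
rewrite -EFinD; congr EFin; rewrite /hist_rate (hist_payoff_dbl H) -/y.
rewrite -[(clock V0 L0 _ * _)%R]om -/y.
by move: (off _ _ _ _ _ _) (leave _ _ _ _ _) (dbl _ _ _ _ _) (derive1 _ _) (g _ _) => O l d D v; ring.
Qed.

Let acp : absolutely_continuous 0%R L (fun u => f (s + u)%R y).
Proof. by apply: (ac_shift s0 _ (acf y)); rewrite sL. Qed.

Let nE : measurable [set u | E y (s + u)%R] /\ lebesgue_measure (`[0%R, L] `\` [set u | E y (s + u)%R]) = 0.
Proof. by apply: (null_shift s0 _ (mE y) (E0 y)); rewrite sL. Qed.

Let phiM t : (0 <= t <= L)%R -> (`|f (s + t)%R y| <= C * V0 y)%R.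
Proof. by move=> /in_T tT; rewrite -fg. Qed.

Let mgs : measurable_fun setT (fun p : R * borel S => g (t0 + p.1) p.2)%R.
Proof.
apply: (measurableT_comp mg (measurable_fun_pair _ measurable_snd)).
by apply: measurable_funD => //; exact: measurable_fst.
Qed.

Lemma super_step : (forall u, E y (s + u)%R -> (0 < u)%R -> (u < L)%R -> slope h u <= 0) ->
  (forall t z, (0 <= g t z)%R) -> (forall z, (term z <= f T z)%R) ->
  stop h + \int[N k h]_z run tau rho (fun t => g (t0 + t)%R) h z <= (at_hist (fun t => g (t0 + t)%R) h)%:E.
Proof.
move=> sup g0 tf; have [mE' E'0] := nE.
have := step_ge (p1 := p1) (p2 := p2) mrho rho_le (lyapunov_V0 H) (h := h) (g := fun t => g (t0 + t)%R) mgs (fun t => gC (t0 + t)%R) (fun t => g0 (t0 + t)%R) L_ge0 acp phiM mE' E'0.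
have -> : (f (s + 0)%R y)%R = at_hist (fun t => g (t0 + t)%R) h.
  by rewrite /at_hist fg ?addr0//; have := in_T (u := 0%R); rewrite addr0 lexx L_ge0; exact.
rewrite -/L sL => key; apply: le_trans (key _).
  rewrite leeD2r// lee_fin ler_wpM2r ?expR_ge0// ler_wpM2l ?expR_ge0//; exact: tf.
move=> u Eu u0 uL; have [d1 d2] := derive_shift (dE Eu); split=> //; rewrite d2.
by have := sup u Eu u0 uL; rewrite slope_off// lee_fin /s addrA.
Qed.

(** The means at jump times are integrals of nonnegative functions, whereas a subsolution may take
    either sign. Replacing it by its positive part after the jump only increases the right-hand
    side, and where it is negative the left-hand side becomes 0. *)
Let pos_part t z : R := Num.max 0%R (g t z).

Lemma sub_step : (forall u, E y (s + u)%R -> (0 < u)%R -> (u < L)%R -> 0 <= slope h u) ->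
  (forall z, (f T z <= term z)%R) ->
  (at_hist (fun t => pos_part (t0 + t)%R) h)%:E <=
    stop h + \int[N k h]_z run tau rho (fun t => pos_part (t0 + t)%R) h z.
Proof.
move=> sub ft; have [mE' E'0] := nE.
have mp : measurable_fun setT (fun p : R * borel S => pos_part (t0 + p.1)%R p.2).
  by apply: measurable_maxr => //; exact: measurable_cst.
have C0 : (0 <= C)%R := dominated_ge0 H y (dg 0).
have pC t z : (`|pos_part t z| <= C * V0 z)%R.
  have := gC t z; rewrite /pos_part; case: (leP 0%R (g t z)) => // _ _.
  by rewrite normr0 mulr_ge0// ltW// (V0_gt0 H).
have p0 t z : (0 <= pos_part t z)%R by rewrite le_max lexx.
have run0 : 0 <= \int[N k h]_z run tau rho (fun t => pos_part (t0 + t)%R) h z.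
  by apply: integral_ge0 => -[q|]//= _; rewrite lee_fin mulr_ge0// weight_ge0.
rewrite /at_hist {1}/pos_part; have [g0|g0] := leP 0%R (g (t0 + hist_time h)%R (last_state h)); last exact: adde_ge0.
have := step_le (p1 := p1) (p2 := p2) mrho rho_le (lyapunov_V0 H) (h := h) (g := fun t => pos_part (t0 + t)%R) mp (fun t => pC (t0 + t)%R) (fun t => p0 (t0 + t)%R) L_ge0 acp phiM mE' E'0.
have -> : (f (s + 0)%R y)%R = g (t0 + hist_time h)%R (last_state h).
  by rewrite fg ?addr0//; have := in_T (u := 0%R); rewrite addr0 lexx L_ge0; exact.
rewrite -/L sL => key; apply: le_trans (key _) _; last first.
  rewrite leeD2r// lee_fin ler_wpM2r ?expR_ge0// ler_wpM2l ?expR_ge0//; exact: ft.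
move=> u Eu u0 uL; have [d1 d2] := derive_shift (dE Eu); split=> //; rewrite d2.
have := sub u Eu u0 uL; rewrite slope_off// lee_fin /s addrA => h1; apply: le_trans h1 _; rewrite lerD2l.
have dp : dominated V0 (pos_part (s + u)%R) C.
  by split=> [|z]; [apply: measurable_maxr => //; exact: (dg _).1|exact: pC].
(* [neg] is nonnegative, hence so is its [off]. By [off_mean] this is the difference of the two
   [off] terms to be compared. *)
pose neg z := (pos_part (s + u)%R z - g (s + u)%R z)%R.
have neg0 z : (0 <= neg z)%R by rewrite /neg subr_ge0 le_max lexx orbT.
have dn : dominated V0 neg (C + C)%R.
  split=> [|z]; first by apply: measurable_funB; [exact: dp.1|exact: (dg _).1].
  by rewrite mulrDl (le_trans (ler_normB _ _))// lerD.
have /andP[n0 _] := off_bound p1 p2 (lyapunov_V0 H) h u dn neg0.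
have [iV0 _] := mixE h u (lyapunov_V0 H).
have ip := integrable_dominated iV0 dp; have ig := integrable_dominated iV0 (dg (s + u)%R).
have Jn : fine (\int[m k h u]_z (neg z)%:E) =
    (fine (\int[m k h u]_z (pos_part (s + u)%R z)%:E) - fine (\int[m k h u]_z (g (s + u)%R z)%:E))%R.
  rewrite -fineB ?integrable_fin_num// -(integralB measurableT ip ig).
  by congr fine; apply: eq_integral => z _.
have o1 := off_mean p1 p2 (lyapunov_V0 H) h u dn; have o2 := off_mean p1 p2 (lyapunov_V0 H) h u dp.
have o3 := off_mean p1 p2 (lyapunov_V0 H) h u (dg (s + u)%R).
have ny : neg (last_state h) = (pos_part (s + u)%R (last_state h) - g (s + u)%R (last_state h))%R by [].
rewrite Jn ny in o1; rewrite -/s; move: o1 o2 o3 n0.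
move: (off H p1 p2 neg h u) (off H p1 p2 (pos_part (s + u)%R) h u) (off H p1 p2 (g (s + u)%R) h u) => a b d.
move: (leave _ _ _ _ _) (fine _) (fine _) (hist_clock h) (pos_part _ _) (g _ _) => l J1 J2 cc v1 v2 o1 o2 o3 a0.
have e : a = (b - d)%R.
  have : (a - l * (v1 - v2) = (b - l * v1) - (d - l * v2))%R by rewrite o1 o2 o3; ring.
  by rewrite mulrBr; move: (l * v1)%R (l * v2)%R => q1 q2; lra.
by rewrite e in a0; lra.
Qed.

End local.

Let start : P [set w | w.1 = x] = 1. Proof. by have [] := path_lawP H p1 p2 x. Qed.

Lemma super_sum : (forall k (h : hist R S k) u, (0 <= hist_time h <= tau)%R -> E (last_state h) (t0 + hist_time h + u)%R ->
    (0 < u)%R -> (u < tau - hist_time h)%R -> slope h u <= 0) ->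
  (forall t z, (0 <= g t z)%R) -> (forall z, (term z <= f T z)%R) ->
  \sum_(k <oo) stop_mean P live hst tau rho stop k <= (f t0 x)%:E.
Proof.
move=> sup g0 tf.
have hg : nneg_fun (fun t => g (t0 + t)%R).
  split=> [|t z]; last exact: g0.
  apply: (measurableT_comp mg (measurable_fun_pair _ measurable_snd)).
  by apply: measurable_funD => //; exact: measurable_fst.
have := sum_stop_le (P := P) (N := N) (@measurable_alive R S) (@measurable_hist_of R S) (alive0 R S) (@aliveS R S) (@hist_of_succ R S)
  (path_law_next H p1 p2 x) (measurable_singleton x (borelS G)) start tau0 mrho mstop stop_ge0 hg.
rewrite addr0 fg ?t00// => h; apply: h => k h hT; apply: super_step => // u Eu u0 uL; exact: sup.
Qed.

(** The term left after [n] jumps now has the unfavourable sign and must tend to 0; it is at most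
    [C] times the mean of [V0] at the [n]-th jump, so [remainder_cvg0] applies. *)
Lemma sub_sum : (forall k (h : hist R S k) u, (0 <= hist_time h <= tau)%R -> E (last_state h) (t0 + hist_time h + u)%R ->
    (0 < u)%R -> (u < tau - hist_time h)%R -> 0 <= slope h u) ->
  (forall z, (f T z <= term z)%R) ->
  (f t0 x)%:E <= \sum_(k <oo) stop_mean P live hst tau rho stop k.
Proof.
move=> sub ft; pose gp t z : R := Num.max 0%R (g (t0 + t)%R z).
have hg : nneg_fun gp.
  split=> [|t z]; last by rewrite le_max lexx.
  apply: measurable_maxr; first exact: measurable_cst.
  apply: (measurableT_comp mg (measurable_fun_pair _ measurable_snd)).
  by apply: measurable_funD => //; exact: measurable_fst.
have C0 : (0 <= C)%R := dominated_ge0 H x (dg 0).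
have hCV : nneg_fun (fun _ z => C * V0 z)%R.
  split=> [|t z]; last by rewrite mulr_ge0// ltW// (V0_gt0 H).
  by apply: measurable_funM => //; exact: nV0.1.
have gle t z : (gp t z <= C * V0 z)%R.
  rewrite /gp ge_max mulr_ge0 ?(ltW (V0_gt0 H z))//=; exact: le_trans (ler_norm _) (gC _ _).
have c1 : state_mean P live hst tau rho gp n @[n --> \oo] --> 0.
  have c2 : C%:E * state_mean P live hst tau rho (fun _ => V0) n @[n --> \oo] --> C%:E * 0.
    by apply: cvgeZl => //; exact: remainder_cvg0 mrho rho_le.
  rewrite mule0 in c2; apply: (squeeze_cvge _ (cvg_cst _) c2); apply: nearW => n.
  apply/andP; split; first exact: state_mean_ge0.
  rewrite -(@state_meanZ _ _ _ _ P live hst (@measurable_alive R S) (@measurable_hist_of R S) tau rho mrho (fun _ => V0) C n nV0 C0).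
  exact: (@state_mean_le _ _ _ _ P live hst (@measurable_alive R S) (@measurable_hist_of R S) tau rho mrho).
have := le_sum_stop (P := P) (N := N) (@measurable_alive R S) (@measurable_hist_of R S) (alive0 R S) (@aliveS R S) (@hist_of_succ R S)
  (path_law_next H p1 p2 x) (measurable_singleton x (borelS G)) start tau0 mrho mstop stop_ge0 hg.
move=> h; apply: le_trans (h _ c1); first by rewrite lee_fin /gp addr0 fg ?t00// le_max lexx orbT.
by move=> k h' hT; apply: sub_step => // u Eu u0 uL; exact: sub.
Qed.

End function.
End comparison.

(** * The game *)

Lemma saddle_point (X1 X2 : Type) (R : realType) (J : X1 -> X2 -> \bar R) (a : X1) (b : X2) v :
  (forall q, J q b <= v) -> (forall q, v <= J a q) ->
  [/\ ereal_sup [set ereal_inf [set J q1 q2 | q2 in [set: X2]] | q1 in [set: X1]] = v,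
    ereal_inf [set ereal_sup [set J q1 q2 | q1 in [set: X1]] | q2 in [set: X2]] = v,
    ereal_inf [set J a q2 | q2 in [set: X2]] = v,
    ereal_sup [set J q1 b | q1 in [set: X1]] = v & J a b = v].
Proof.
move=> up lo.
have ia : ereal_inf [set J a q2 | q2 in [set: X2]] = v.
  apply/le_anti/andP; split; first by apply: le_trans (up a); apply: ereal_inf_lbound; exists b.
  by apply: le_ereal_inf_tmp => _ [q _ <-].
have sb : ereal_sup [set J q1 b | q1 in [set: X1]] = v.
  apply/le_anti/andP; split; first by apply: ge_ereal_sup => _ [q _ <-].
  by apply: le_trans (lo b) _; apply: ereal_sup_ubound; exists a.
split=> //; last by apply/le_anti; rewrite up lo.
  apply/le_anti/andP; split; last by rewrite -{1}ia; apply: ereal_sup_ubound; exists a.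
  apply: ge_ereal_sup => _ [q _ <-]; apply: le_trans (up q); apply: ereal_inf_lbound; by exists b.
apply/le_anti/andP; split; first by rewrite -[leRHS]sb; apply: ereal_inf_lbound; exists b.
apply: le_ereal_inf_tmp => _ [q _ <-]; apply: le_trans (lo q) _; apply: ereal_sup_ubound; by exists a.
Qed.

Lemma lebesgue_set2 (R : realType) (a b : R) : lebesgue_measure ([set a; b] : set R) = 0.
Proof. exact (@countable_lebesgue_measure0 R [set a; b] (finite_set_countable (finite_set2 a b))). Qed.

Section solutions.
Context (R : realType) (S A B : ptopologicalType) (G : game R S A B)
  (V0 V1 : S -> R) (rho0 L0 M0 rho1 b1 M1 : R).
Hypothesis H : growth G V0 V1 rho0 L0 M0 rho1 b1 M1.
Notation T := (horizon G).

Let T0 : (0 <= T)%R. Proof. exact: ltW (horizon_gt0 G). Qed.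

(** The linearity lemmas [meanD] and [dblD] treat sums with a multiple; the opposite of a function
    is therefore written as itself plus -2 times itself. *)
Lemma hamiltonianN f C x (phi : probability (borel A) R) (psi : probability (borel B) R) :
  phi (actA G x) = 1 -> psi (actB G x) = 1 -> dominated V0 f C ->
  hamiltonian G (fun y => - f y)%R x phi psi = - hamiltonian G f x phi psi.
Proof.
move=> phiA psiB df; have dN : dominated V0 (fun y => - f y)%R C.
  by have [mf fC] := df; split=> [|y]; [exact: measurableT_comp mf|rewrite normrN].
rewrite (hamiltonianE H phiA psiB dN) (hamiltonianE H phiA psiB df) -EFinN; congr EFin.
have tg := tame_gain H x df.
have -> : (- dbl G x phi psi (gain H f x) = dbl G x phi psi (fun a b => gain H f x a b + (- 2) * gain H f x a b))%R.
  by rewrite (dblD phiA psiB _ tg tg); lra.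
apply: eq_Rintegral => -[a b] /set_mem[/= Aa Bb]; have mD := meanD H Aa Bb (- 2) df df.
have -> : (fun y => - f y)%R = (fun y => f y + (- 2) * f y)%R by apply/funext => y; lra.
by rewrite /gain mD; lra.
Qed.

(** * Verification of an arbitrary solution *)

Section candidate.
Variables (f : R -> S -> R) (E : S -> set R).
Hypotheses (hB : in_B1 T V0 V1 f E) (acf : forall x, absolutely_continuous 0 T (fun t => f t x)).
Hypothesis sol : shapley_solution G f E.

Let g t y := f (clamp T t) y.

Let fg t y : (0 <= t <= T)%R -> g t y = f t y.
Proof. by move=> tT; rewrite /g clamp_id. Qed.

Let gf t : (0 <= t <= T)%R -> f t = g t.
Proof. by move=> tT; apply/funext => y; rewrite fg. Qed.

Let mg : measurable_fun setT (fun p : R * borel S => g p.1 p.2).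
Proof.
have [mf _ _ _] := hB; have mK : measurable (`[0%R, T] `*` [set: borel S] : set (R * borel S)).
  by apply: measurableX.
have sub : (fun p : R * borel S => (clamp T p.1, p.2)) @` setT `<=` (`[0%R, T] `*` [set: borel S]).
  by move=> _ [p _ <-]; split=> //=; rewrite in_itv/= clamp_itv.
have mh : measurable_fun setT (fun p : R * borel S => (clamp T p.1, p.2)).
  apply: measurable_fun_pair => //.
  exact: (measurableT_comp (@measurable_clamp R T) measurable_fst).
exact: (measurable_comp mK sub mf mh).
Qed.

Let bounded : exists C, forall t y, (`|g t y| <= C * V0 y)%R.
Proof.
have [_ wb _ _] := hB; rewrite /weight_bounded in wb; set D := [set _ | _ in _] in wb.
have le t y : (`|g t y| / V0 y)%R%:E <= ereal_sup D.
  by apply: ereal_sup_ubound; exists (clamp T t, y) => //; split=> //=; rewrite in_itv/= clamp_itv.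
exists (fine (ereal_sup D)) => t y; rewrite -ler_pdivrMr ?(V0_gt0 H)// -lee_fin fineK ?le//.
rewrite ge0_fin_numE//; apply: le_trans (le t y).
by rewrite lee_fin divr_ge0// ltW// (V0_gt0 H).
Qed.

Let C := projT1 (cid bounded).
Let gC : forall t y, (`|g t y| <= C * V0 y)%R := projT2 (cid bounded).

Let dg t : dominated V0 (g t) C.
Proof. by split; [exact: (measurableT_comp mg (measurable_pair1 t))|exact: gC]. Qed.

Let mE y : measurable (E y). Proof. by have [_ _ /(_ y)[]] := hB. Qed.
Let E0 y : lebesgue_measure (`[0%R, T] `\` E y) = 0. Proof. by have [_ _ /(_ y)[]] := hB. Qed.
Let dE y t : E y t -> derivable (fun s => f s y) t 1%R.
Proof. by have [_ _ /(_ y)[_ _ _ h] _] := hB; exact: h. Qed.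
Let E_T y t : E y t -> (0 <= t <= T)%R.
Proof. by have [_ _ /(_ y)[_ sub _ _] _] := hB => /sub; rewrite /= in_itv. Qed.

Lemma saddle_policies : exists (v : borel S * R -> R) (p1 : markov_policy1 G) (p2 : markov_policy2 G),
  forall x t, saddle H (g t) x (v (x, t)) (kprob (markov_kernel p1) (x, t)) (kprob (markov_kernel p2) (x, t)).
Proof.
have mF : measurable_fun setT ((fun wy => g wy.1.2 wy.2) : (borel S * R) * borel S -> R).
  apply: (measurableT_comp mg (measurable_fun_pair _ measurable_snd)).
  exact: (measurableT_comp measurable_snd measurable_fst).
have [v [phi [psi [_ sp]]]] := saddle_exists H (W := (borel S * R)%type) (F := fun w => g w.2) (@measurable_fst _ _ _ _) mF (fun w => gC w.2).
have a1 (x : S) t : phi (x, t) (actA G x) = 1 by have [] := sp (x, t).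
have a2 (x : S) t : psi (x, t) (actB G x) = 1 by have [] := sp (x, t).
by exists v, (MarkovPolicy a1), (MarkovPolicy a2) => x t; exact: (sp (x, t)).
Qed.

Section policies.
Variables (v : borel S * R -> R) (p1 : markov_policy1 G) (p2 : markov_policy2 G).
Hypothesis sp : forall x t, saddle H (g t) x (v (x, t)) (kprob (markov_kernel p1) (x, t)) (kprob (markov_kernel p2) (x, t)).

Lemma derive_value x t : E x t -> derive1 (fun s => f s x) t = (- v (x, t))%R.
Proof.
move=> Et; have [_ /(_ x t Et)] := sol; rewrite (gf (E_T Et)) (saddle_sup_inf (dg t) (sp x t)).
by rewrite -EFinD => -[] /eqP; rewrite addr_eq0 => /eqP.
Qed.

Let in_T t0 k (h : hist R S k) u : (0 <= t0)%R -> (0 <= hist_time h <= T - t0)%R -> (0 < u)%R -> (u < T - t0 - hist_time h)%R ->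
  (0 <= t0 + hist_time h + u <= T)%R.
Proof. by move=> h1 /andP[h2 h3] h4 h5; apply/andP; split; lra. Qed.

(** Along the saddle pair the equation becomes linear, so [- f] is a subsolution with nonpositive
    terminal value. Its comparison with the zero terminal reward gives [- f <= 0]. *)
Lemma solution_ge0 t x : (0 <= t <= T)%R -> (0 <= f t x)%R.
Proof.
move=> /andP[t0 tT]; pose q1 := markov_from t p1; pose q2 := markov_from t p2.
have mN : measurable_fun setT (fun p : R * borel S => - g p.1 p.2)%R by exact: measurableT_comp mg.
have NC s y : (`|- g s y| <= C * V0 y)%R by rewrite normrN.
have Nfg s y : (0 <= s <= T)%R -> (- g s y = - f s y)%R by move=> /fg ->.
have acN y : absolutely_continuous 0 T (fun s => - f s y)%R.
  by apply: (ac_dominated (C := 1%R) (L := 0%R) (acf y)) => // s s' _ _ _; rewrite mul1r mul0r addr0 -opprD normrN.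
have dN y s : E y s -> derivable (fun r => - f r y)%R s 1%R by move=> /dE; exact: derivableN.
have := @sub_sum R S A B G V0 V1 rho0 L0 M0 rho1 b1 M1 H q1 q2 x t t0 tT (fun s y => - f s y)%R (fun s y => - g s y)%R C E
  mN NC Nfg acN mE E0 dN (fun=> 0%R) (measurable_cst _) (fun=> lexx _).
have -> : \sum_(k <oo) stop_mean (path_law q1 q2 x) (fun k => [set w : path_space R S | alive k w])
    (fun k w => hist_of k w) (T - t) (hist_rate q1 q2) (stop H q1 q2 t (fun=> 0%R)) k = 0.
  apply: eseries0 => k _ _; rewrite /stop_mean integral0_eq// => w _.
  by rewrite /stop mulr0 mul0r mule0.
rewrite lee_fin oppr_le0; apply; last by move=> z; rewrite oppr_le0 sol.1 expR_ge0.
move=> k h u hT Eu u0 uL; have iT := in_T t0 hT u0 uL; set s := (t + hist_time h + u)%R in Eu iT *.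
have -> : hamiltonian G (fun y => - f s y)%R (last_state h) (policy_kernel q1 k (h, u)) (policy_kernel q2 k (h, u)) = (- v (last_state h, s))%:E.
  have [phiA psiB _ _] := sp (last_state h) s.
  by rewrite (gf iT) [LHS](hamiltonianN phiA psiB (dg s)) (hamiltonian_saddle (dg s) (sp (last_state h) s)) EFinN.
have -> : derive1 (fun r => - f r (last_state h))%R s = v (last_state h, s).
  by rewrite derive1E deriveN; [rewrite -derive1E derive_value// opprK|exact: dE].
by rewrite -EFinD subrr.
Qed.

Let g_ge0 t y : (0 <= g t y)%R. Proof. by apply: solution_ge0; exact: clamp_itv. Qed.

Let term y : R := expR (theta G * terminal G y).
Let mterm : measurable_fun [set: borel S] term.
Proof.
apply: (measurableT_comp (@measurable_expR R)); apply: measurable_funM => //; exact: measurable_terminal.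
Qed.
Let term0 y : (0 <= term y)%R. Proof. exact: expR_ge0. Qed.

(** At almost every time the saddle policy of the second player makes the slope of [f] nonpositive
    whatever the first player mixes, so the history of [q] enters only as a parameter. *)
Lemma criterion_le (q : policy1 G) t x : (0 <= t <= T)%R ->
  criterion_upto q (markov_from t p2) (T - t) x <= (f t x)%:E.
Proof.
move=> /andP[t0 tT]; pose q2 := markov_from t p2; have tau0 : (0 <= T - t)%R by rewrite subr_ge0.
rewrite (criterion_sum H tau0 (nonexplosion H q q2 x t0 tT)).
apply: (@super_sum R S A B G V0 V1 rho0 L0 M0 rho1 b1 M1 H q q2 x t t0 tT f g C E
  mg gC fg acf mE E0 dE term mterm term0) => //; last by move=> z; rewrite sol.1.
move=> k h u hT Eu u0 uL; have iT := in_T t0 hT u0 uL; rewrite derive_value// (gf iT).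
rewrite EFinN addeC sube_le0.
exact: (@hamiltonian_le _ _ _ _ _ _ _ _ _ _ _ _ _ H _ _ (dg _) _ _ _ _ (sp (last_state h) _) (kprob (policy_kernel q k) (h, u)) (policy_adm q h u)).
Qed.

Lemma le_criterion (q : policy2 G) t x : (0 <= t <= T)%R ->
  (f t x)%:E <= criterion_upto (markov_from t p1) q (T - t) x.
Proof.
move=> /andP[t0 tT]; pose q1 := markov_from t p1; have tau0 : (0 <= T - t)%R by rewrite subr_ge0.
rewrite (criterion_sum H tau0 (nonexplosion H q1 q x t0 tT)).
apply: (@sub_sum R S A B G V0 V1 rho0 L0 M0 rho1 b1 M1 H q1 q x t t0 tT f g C E
  mg gC fg acf mE E0 dE term mterm term0) => //; last by move=> z; rewrite sol.1.
move=> k h u hT Eu u0 uL; have iT := in_T t0 hT u0 uL; rewrite derive_value// (gf iT).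
rewrite EFinN addeC sube_ge0//.
exact: (@hamiltonian_ge _ _ _ _ _ _ _ _ _ _ _ _ _ H _ _ (dg _) _ _ _ _ (sp (last_state h) _) (kprob (policy_kernel q k) (h, u)) (policy_adm q h u)).
Qed.

End policies.

Lemma solution_saddle : exists (p1 : markov_policy1 G) (p2 : markov_policy2 G),
  [/\ forall x t, E x t -> - (derive1 (fun s => f s x) t)%:E =
        hamiltonian G (f t) x (markov_kernel p1 (x, t)) (markov_kernel p2 (x, t)),
    forall t x, (0 <= t <= T)%R ->
      hamiltonian G (f t) x (markov_kernel p1 (x, t)) (markov_kernel p2 (x, t)) =
        ereal_sup [set hamiltonian G (f t) x phi (markov_kernel p2 (x, t)) | phi in prob_on R (actA G x)] /\
      hamiltonian G (f t) x (markov_kernel p1 (x, t)) (markov_kernel p2 (x, t)) =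
        ereal_inf [set hamiltonian G (f t) x (markov_kernel p1 (x, t)) psi | psi in prob_on R (actB G x)],
    forall (q : policy1 G) t x, (0 <= t <= T)%R -> criterion_upto q (markov_from t p2) (T - t) x <= (f t x)%:E
  & forall (q : policy2 G) t x, (0 <= t <= T)%R -> (f t x)%:E <= criterion_upto (markov_from t p1) q (T - t) x].
Proof.
have [v [p1 [p2 sp]]] := saddle_policies; exists p1, p2; split.
- move=> x t Et; rewrite (derive_value sp Et) EFinN oppeK (gf (E_T Et)).
  by rewrite -(hamiltonian_saddle (dg t) (sp x t)).
- by move=> t x tT; rewrite (gf tT); split; [exact: (saddle_sup (dg t) (sp x t))|exact: (saddle_inf (dg t) (sp x t))].
- by move=> q t x; exact: (criterion_le sp).
- by move=> q t x; exact: (le_criterion sp).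
Qed.

End candidate.

(** Cross the policies: [f'] is at most the criterion of the first policy for [f'] against the
    second policy for [f], which is at most [f]; then exchange the roles. *)
Lemma solution_unique f E f' E' : in_B1 T V0 V1 f E -> (forall x, absolutely_continuous 0 T (fun t => f t x)) ->
  shapley_solution G f E -> in_B1 T V0 V1 f' E' -> (forall x, absolutely_continuous 0 T (fun t => f' t x)) ->
  shapley_solution G f' E' -> forall t x, (0 <= t <= T)%R -> f' t x = f t x.
Proof.
move=> h1 h2 h3 h1' h2' h3' t x tT.
have [p1 [p2 [_ _ up lo]]] := solution_saddle h1 h2 h3.
have [p1' [p2' [_ _ up' lo']]] := solution_saddle h1' h2' h3'.
apply/le_anti/andP; split; rewrite -lee_fin.
  exact: le_trans (lo' (markov_from t p2) t x tT) (up (markov_from t p1') t x tT).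
exact: le_trans (lo (markov_from t p2') t x tT) (up' (markov_from t p1) t x tT).
Qed.

(** The bound on the gain is of order [V0 ^ 2], at most [M1 * V1]; this is why the time derivative
    is measured with [V1] in the function space. *)
Lemma gain_bound_V1 C : (0 <= C)%R -> exists K, forall x, (gain_bound G V0 rho0 L0 M0 C x <= K * V1 x)%R.
Proof.
move=> C0; exists (C * (theta G * (M0 + 1) + L0 *+ 2 + rho0) * M1)%R => x.
have V_1 := V0_ge1 H x; have m0 := M0_gt0 H; have th := theta_gt0 G; have L00 := L0_gt0 H; have r0 := rho0_gt0 H.
have pb : (payoff_bound V0 M0 x <= (M0 + 1) * V0 x)%R.
  have l0 : (0 <= ln (V0 x))%R by rewrite ln_ge0.
  have lV : (ln (V0 x) <= V0 x - 1)%R.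
    by have := expR_ge1Dx (ln (V0 x)); rewrite lnK ?posrE ?(V0_gt0 H)//; lra.
  have s1 : (Num.sqrt (ln (V0 x)) ^+ 2 = ln (V0 x))%R by rewrite sqr_sqrtr.
  have s0 : (0 <= Num.sqrt (ln (V0 x)))%R := sqrtr_ge0 _.
  have sV : (Num.sqrt (ln (V0 x)) <= V0 x)%R.
    by have := sqr_ge0 (Num.sqrt (ln (V0 x)) - 2^-1)%R; move: s1 lV; rewrite !expr2; set s := Num.sqrt _; nra.
  have q1 := sqrt2_half_le1 R.
  have q2 : (Num.sqrt 2 / 2 * Num.sqrt (ln (V0 x)) <= V0 x)%R.
    by apply: le_trans sV; rewrite ler_piMl.
  have q3 : (M0 <= M0 * V0 x)%R by rewrite ler_peMr// ltW.
  by rewrite /payoff_bound mulrDl mul1r lerD.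
have vM := A2_weight H x; rewrite /gain_bound -!mulrA ler_wpM2l//.
have V_0 : (0 <= V0 x)%R := ltW (V0_gt0 H x).
have h1 : (theta G * payoff_bound V0 M0 x + clock V0 L0 x *+ 2 + rho0 <= (theta G * (M0 + 1) + L0 *+ 2 + rho0) * V0 x)%R.
  rewrite !mulrDl; apply: lerD; first apply: lerD.
  - by rewrite -mulrA ler_wpM2l// ltW.
  - by rewrite mulr2n.
  - by rewrite ler_peMr// ltW.
apply: le_trans (ler_wpM2r V_0 h1) _; rewrite -mulrA ler_wpM2l//.
by rewrite !addr_ge0 ?mulr_ge0 ?addr_ge0 ?mulrn_wge0// ltW.
Qed.

(** Time is reversed in the constructed solution. The set [E x] is the open interval, whose
    complement in [[0, T]] consists of the two end points. *)
Lemma solution_exists : exists (f : R -> S -> R) (E : S -> set R),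
  [/\ in_B1 T V0 V1 f E, forall x, absolutely_continuous 0 T (fun t => f t x) & shapley_solution G f E].
Proof.
have [F [C [L [mF FC F0 FL dF]]]] := solution H.
pose f t x := F (T - t)%R x; pose E (_ : S) : set R := `]0%R, T[%classic.
have rev t : (0 <= t <= T)%R -> (0 <= T - t <= T)%R by move=> /andP[h1 h2]; apply/andP; split; lra.
have dFu u : dominated V0 (F u) C by split; [exact: (measurableT_comp mF (measurable_pair1 u))|exact: FC].
have C0 : (0 <= C)%R := dominated_ge0 H point (dFu 0%R).
have df t x : (0 < t < T)%R -> is_derive t (1%R : R) (fun s => f s x) (- value G (f t) x)%R.
  move=> /andP[h1 h2]; have iT : (0 < T - t < T)%R by apply/andP; split; lra.
  have d1 : is_derive t (1%R : R) (fun s : R => T - s)%R (- 1)%R.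
    by have := is_deriveB (is_derive_cst T t (1%R : R)) (is_derive_id t (1%R : R)); rewrite sub0r.
  have d2 := is_derive1_comp (f := F ^~ x) (g := fun s : R => (T - s)%R) (dF x _ iT) d1.
  by apply: (is_derive_eq d2); rewrite mulrN1.
have Et x t : E x t -> (0 < t < T)%R by rewrite /E/= in_itv.
have d1E x t : E x t -> derive1 (fun s => f s x) t = (- value G (f t) x)%R.
  by move=> /(Et x) h; rewrite derive1E; have d := df t x h; exact: derive_val.
exists f, E; split.
- split.
  + apply: measurable_funTS; apply: (measurableT_comp mF (measurable_fun_pair _ measurable_snd)).
    by apply: measurable_funB => //; exact: measurable_fst.
  + apply: (@le_lt_trans _ _ C%:E); last exact: ltry.
    by apply: ge_ereal_sup => _ [[t x] _ <-]; rewrite lee_fin ler_pdivrMr ?(V0_gt0 H)//; exact: FC.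
  + move=> x; split.
    * exact: measurable_itv.
    * by move=> t /(Et x)/andP[/ltW h1 /ltW h2] /=; rewrite ?in_itv/= h1.
    * have -> : (`[0%R, T] `\` E x)%classic = [set 0%R; T].
        apply/seteqP; split=> t /=; rewrite /E/= !in_itv/=.
          move=> [/andP[h1 h2] n]; move: h1; rewrite le_eqVlt => /orP[/eqP<-|h1]; first by left.
          by move: h2; rewrite le_eqVlt => /orP[/eqP->|h2]; [right|exfalso; apply: n; rewrite h1 h2].
        by move=> [->|->]; rewrite ?lexx ?ltxx ?andbF T0; split.
      exact (lebesgue_set2 0%R T).
    * by move=> t /(Et x) h; case: (df t x h).
  + have [K hK] := gain_bound_V1 C0; apply: (@le_lt_trans _ _ K%:E); last exact: ltry.
    apply: ge_ereal_sup => _ [[t x] /= Etx <-]; rewrite lee_fin ler_pdivrMr ?(V1_gt0 H)//.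
    by rewrite (d1E x t Etx) normrN; apply: le_trans (value_norm H x (dFu _)) (hK x).
- move=> x; have acc : absolutely_continuous 0%R T (cst (0%R : R)) := ac_cst _ _ _.
  have L0' : (0 <= `|L| * V0 x ^+ 2)%R by rewrite mulr_ge0// sqr_ge0.
  apply: (ac_dominated (C := 0%R) (L := (`|L| * V0 x ^+ 2)%R) acc) => // s t s0 st tT; rewrite mul0r add0r.
  have iS : (0 <= s <= T)%R by rewrite s0 (le_trans st).
  have iT : (0 <= t <= T)%R by rewrite (le_trans s0).
  apply: le_trans (FL x _ _ (rev _ iS) (rev _ iT)) _.
  rewrite (_ : T - t - (T - s) = - (t - s))%R; last by ring.
  rewrite normrN (ger0_norm (_ : 0 <= t - s)%R) ?subr_ge0// ler_wpM2r ?subr_ge0// ler_wpM2r ?sqr_ge0//.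
  exact: ler_norm.
- split=> [x|x t Etx]; first by rewrite /f subrr F0.
  have [phi [psi sv]] := value_saddle H x (dFu (T - t)%R).
  by rewrite (d1E x t Etx) (saddle_sup_inf (dFu _) sv) -EFinD addNr.
Qed.

End solutions.

Theorem theorem4p1 (R : realType) (S A B : ptopologicalType) (G : game R S A B)
    (V0 V1 : S -> R) (rho0 L0 M0 rho1 b1 M1 : R)
    (* (A1) *)
    (mV0 : measurable_fun [set: borel S] V0)
    (V0_ge1 : forall x, (1 <= V0 x)%R)
    (rho0_gt0 : (0 < rho0)%R) (L0_gt0 : (0 < L0)%R) (M0_gt0 : (0 < M0)%R)
    (A1_drift : forall x a b, actA G x a -> actB G x b ->
      signed_integral (rate G x a b) (fun y => (V0 y)%:E) <= (rho0 * V0 x)%:E)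
    (A1_rate : forall x, max_rate G x <= (L0 * V0 x)%:E)
    (A1_payoff : forall x a b, actA G x a -> actB G x b ->
      (`|payoff G x a b| <= M0 + Num.sqrt 2 / 2 * Num.sqrt (ln (V0 x)))%R)
    (A1_terminal : forall x,
      (`|terminal G x| <= M0 + Num.sqrt 2 / 2 * Num.sqrt (ln (V0 x)))%R)
    (* (A2) *)
    (mV1 : measurable_fun [set: borel S] V1)
    (V1_ge1 : forall x, (1 <= V1 x)%R)
    (rho1_gt0 : (0 < rho1)%R) (b1_gt0 : (0 < b1)%R) (M1_gt0 : (0 < M1)%R)
    (A2_drift : forall x a b, actA G x a -> actB G x b ->
      signed_integral (rate G x a b) (fun y => (V1 y ^+ 2)%:E) <=
        (rho1 * V1 x ^+ 2 + b1)%:E)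
    (A2_weight : forall x, (V0 x ^+ 2 <= M1 * V1 x)%R)
    (* (A3) *)
    (A3_compactA : forall x, compact (actA G x))
    (A3_compactB : forall x, compact (actB G x))
    (A3_rate : forall x (D : set (borel S)), measurable D ->
      {within actA G x `*` actB G x, continuous
        ((fun ab => rate G x ab.1 ab.2 D) : A * B -> \bar R)})
    (A3_payoff : forall x, {within actA G x `*` actB G x, continuous
        ((fun ab => payoff G x ab.1 ab.2) : A * B -> R)})
    (A3_drift : forall x, {within actA G x `*` actB G x, continuous
        ((fun ab => signed_integral (rate G x ab.1 ab.2) (fun y => (V0 y)%:E))
          : A * B -> \bar R)}) :
  let T := horizon G in
  exists (f : R -> S -> R) (E : S -> set R),
    (* (a) *)
    [/\ in_B1 T V0 V1 f E,
        forall x, absolutely_continuous 0 T (fun t => f t x),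
        shapley_solution G f E,
        forall (f' : R -> S -> R) (E' : S -> set R),
          in_B1 T V0 V1 f' E' ->
          (forall x, absolutely_continuous 0 T (fun t => f' t x)) ->
          shapley_solution G f' E' ->
          forall t x, t \in `[0%R, T] -> f' t x = f t x
      & exists (p1 : markov_policy1 G) (p2 : markov_policy2 G),
        let ph1 t x : set (borel A) -> \bar R := markov_kernel p1 (x, t) in
        let ph2 t x : set (borel B) -> \bar R := markov_kernel p2 (x, t) in
        [/\
        (* (b) *)
            (forall x t, E x t ->
              - (derive1 (fun s => f s x) t)%:E =
                hamiltonian G (f t) x (ph1 t x) (ph2 t x)) /\
            (forall t x, t \in `[0%R, T] ->
              hamiltonian G (f t) x (ph1 t x) (ph2 t x) =
                ereal_sup [set hamiltonian G (f t) x phi (ph2 t x)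
                          | phi in prob_on R (actA G x)] /\
              hamiltonian G (f t) x (ph1 t x) (ph2 t x) =
                ereal_inf [set hamiltonian G (f t) x (ph1 t x) psi
                          | psi in prob_on R (actB G x)]),
        (* (c) *)
            forall t x, t \in `[0%R, T] ->
              [/\ (f t x)%:E =
                    ereal_sup [set ereal_inf [set markov_criterion q1 q2 t x
                                             | q2 in [set: markov_policy2 G]]
                              | q1 in [set: markov_policy1 G]],
                  (f t x)%:E =
                    ereal_inf [set ereal_sup [set markov_criterion q1 q2 t x
                                             | q1 in [set: markov_policy1 G]]
                              | q2 in [set: markov_policy2 G]]
                & (f t x)%:E = markov_criterion p1 p2 t x]
        (* (d) *)
          & is_value G (fun x => (f 0%R x)%:E) /\
            nash_equilibrium (markov_from 0 p1) (markov_from 0 p2)]].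
Proof.
have H : growth G V0 V1 rho0 L0 M0 rho1 b1 M1 by split.
move=> T; have T0 : (0 <= T)%R := ltW (horizon_gt0 G).
have [f [E [hB acf sol]]] := solution_exists H.
have [p1 [p2 [dv ham up lo]]] := solution_saddle H hB acf sol.
exists f, E; split=> //.
  by move=> f' E' hB' acf' sol' t x; rewrite in_itv; exact: (solution_unique H hB acf sol hB' acf' sol').
exists p1, p2; split; first by split=> // t x; rewrite in_itv; exact: ham.
  move=> t x; rewrite in_itv => tT.
  (* [up] and [lo] hold against every policy, in particular against Markov policies restarted at
     [t]; the same pair thus serves the game over Markov policies and, at time 0, the game over all
     policies. *)
  have [h1 h2 _ _ h3] := saddle_point (J := fun q1 q2 => markov_criterion q1 q2 t x)
    (fun q => up (markov_from t q) t x tT) (fun q => lo (markov_from t q) t x tT).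
  by split; rewrite ?h1 ?h2 ?h3.
have sp x := saddle_point (J := fun q1 q2 => criterion q1 q2 x) (a := markov_from 0 p1) (b := markov_from 0 p2) (v := (f 0%R x)%:E).
have up0 x (q : policy1 G) : criterion q (markov_from 0 p2) x <= (f 0%R x)%:E.
  by have := up q 0%R x; rewrite lexx subr0; exact.
have lo0 x (q : policy2 G) : (f 0%R x)%:E <= criterion (markov_from 0 p1) q x.
  by have := lo q 0%R x; rewrite lexx subr0; exact.
have val : is_value G (fun x => (f 0%R x)%:E).
  by move=> x; have [h1 h2 _ _ _] := sp x (up0 x) (lo0 x).
split=> //; exists (fun x => (f 0%R x)%:E); split=> // x.
  by have [_ _ h _ _] := sp x (up0 x) (lo0 x).
by have [_ _ _ h _] := sp x (up0 x) (lo0 x).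
Qed.
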